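(* Let $X$ be an infinite compact metric space with $\dim(X)<\infty$, $\alpha:X\to X$ a minimal homeomorphism, and $\mathscr{V}=[V,p,X]$ a line bundle. Let $\mathcal{E}=\Gamma(\mathscr{V},\alpha)$. Suppose that $Y\subset X$ is a non-empty closed subset meeting each $\alpha$-orbit at most once and such that for every $N\in\mathbb{Z}_{\geq0}$ there exists an open set $W_N\supset Y$ for which $\mathscr{V}|_{\alpha^n(W_N)}$ is trivial whenever $-N\leq n\leq N$, and let $\mathcal{E}_Y:=C_0(X\setminus Y)\mathcal{E}$. Then $\mathcal{O}(\mathcal{E}_Y)$ has nuclear dimension at most one.
   Context: $\dim(X)$ is covering dimension; nuclear dimension is that of Winter and Zacharias. A homeomorphism $\alpha$ is minimal if every closed $E\subset X$ with $\alpha(E)\subset E$ is $\emptyset$ or $X$. A set $Y$ meets every $\alpha$-orbit at most once if $\alpha^n(Y)\cap Y=\emptyset$ for every $n\in\mathbb{Z}\setminus\{0\}$. A line bundle $\mathscr{V}=[V,p,X]$ over $X$ is a locally trivial complex vector bundle with one-dimensional fibres, equipped with a Hermitian structure (a continuous family of fibrewise inner products, linear in the second variable). $\Gamma(\mathscr{V})$ is the right Hilbert $C(X)$-module of continuous sections with $\langle\xi,\eta\rangle(x)=\langle\xi(x),\eta(x)\rangle$. $\Gamma(\mathscr{V},\alpha)$ is the $\mathrm{C}^*$-correspondence over $C(X)$ whose right Hilbert module is $\Gamma(\mathscr{V})$ and whose left action is $f\xi:=\xi\,(f\circ\alpha)$. $\mathcal{E}_Y=C_0(X\setminus Y)\mathcal{E}=\overline{\mathrm{span}}\{f\xi: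 f\in C_0(X\setminus Y),\xi\in\mathcal{E}\}$ is a sub-correspondence over $C(X)$, and $\mathcal{O}(\mathcal{E}_Y)$ is identified with the $\mathrm{C}^*$-subalgebra of $\mathcal{O}(\mathcal{E})$ generated by $C(X)$ and $\mathcal{E}_Y$. A $\mathrm{C}^*$-correspondence over a $\mathrm{C}^*$-algebra $A$ is a right Hilbert $A$-module $\mathcal{E}$ with a $^*$-homomorphism $\varphi$ from $A$ to the adjointable operators $\mathcal{L}(\mathcal{E})$. Let $\mathcal{K}(\mathcal{E})$ be the compact operators, generated by $\theta_{\xi,\eta}(\zeta)=\xi\langle\eta,\zeta\rangle$, and $J_{\mathcal{E}}=\varphi^{-1}(\mathcal{K}(\mathcal{E}))\cap(\ker\varphi)^\perp$, where $(\ker\varphi)^\perp=\{a: ab=0\ \forall b\in\ker\varphi\}$. A covariant representation $(\pi,\tau)$ of $\mathcal{E}$ on a $\mathrm{C}^*$-algebra $B$ is a $^*$-homomorphism $\pi:A\to B$ and a linear map $\tau:\mathcal{E}\to B$ with $\pi(\langle\xi,\eta\rangle)=\tau(\xi)^*\tau(\eta)$, $\pi(a)\tau(\xi)=\tau(\varphi(a)\xi)$, and $\pi(a)=\psi_\tau(\varphi(a))$ for $a\in J_{\mathcal{E}}$, where $\psi_\tau:\mathcal{K}(\mathcal{E})\to B$ is the $^*$-homomorphism with $\psi_\tau(\theta_{\xi,\eta})=\tau(\xi)\tau(\eta)^*$. The Cuntz--Pimsner algebra $\mathcal{O}(\mathcal{E})$ is the $\mathrm{C}^*$-algebra generated by the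 universal covariant representation of $\mathcal{E}$. *)

(* Defs.v *)
From HB Require Import structures.
From mathcomp Require Import all_boot all_order all_algebra.
From mathcomp Require Import complex.
From mathcomp Require Import all_classical all_reals.
From mathcomp Require Import topology normedtype realfun.
Set Implicit Arguments.
Unset Strict Implicit.
Unset Printing Implicit Defensive.
Import Order.TTheory GRing.Theory Num.Theory.
Import numFieldNormedType.Exports.
Local Open Scope classical_set_scope.
Local Open Scope ring_scope.
Local Open Scope complex_scope.

HB.instance Definition _ (R : realType) := NormedModule.copy R[i] R[i]^o.

Lemma continuous_distP (X : topologicalType) (K : numFieldType)
    (V : normedModType K) (f : X -> V) (x : X) :
  {for x, continuous f} <->
  forall e, 0 < e -> \forall t \near x, `|f x - f t| < e.
Proof. exact: cvgrPdist_lt. Qed.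

Section ComplexFacts.
Variable R : realType.
Implicit Types x y : R[i].

Lemma normcRe x : (complex.Re `|x|)%:C = `|x|.
Proof. by rewrite RRe_real// normr_real. Qed.

Lemma Re_norm_ge0 x : 0 <= complex.Re `|x|.
Proof. by rewrite -lecR normcRe normr_ge0. Qed.

Lemma Re_norm_le x : `|complex.Re x| <= complex.Re `|x|.
Proof. by rewrite -lecR normcRe; exact: normc_ge_Re. Qed.

Lemma Im_norm_le x : `|complex.Im x| <= complex.Re `|x|.
Proof.
rewrite -[complex.Im x]opprK -ReiNIm normrN (le_trans (Re_norm_le _))//.
by rewrite -lecR !normcRe normrM normCi mulr1.
Qed.

Lemma norm_le_ReIm x : complex.Re `|x| <= `|complex.Re x| + `|complex.Im x|.
Proof.
rewrite -lecR normcRe {1}[x]complexE (le_trans (ler_normD _ _))// rmorphD/=.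
by rewrite normrM normCi mul1r !normc_def /= !expr0n/= !addr0 !sqrtr_sqr.
Qed.

Lemma Re_ler x y : x <= y -> complex.Re x <= complex.Re y.
Proof. by rewrite lecE => /andP[]. Qed.

Lemma Re_continuous : continuous (@complex.Re R).
Proof.
move=> x; apply/continuous_distP => e e0.
have e0' : 0 < e%:C by rewrite ltcR.
have := nbhsx_ballx x _ e0'; apply: filterS => t.
rewrite -ball_normE /ball_/= -normcRe ltcR; apply: le_lt_trans.
by rewrite -raddfB; exact: Re_norm_le.
Qed.

Lemma Re_norm_continuous : continuous (fun x => complex.Re `|x|).
Proof.
move=> x; apply: (@continuous_comp _ _ _ (fun x : R[i] => `|x|) (@complex.Re R)).
  exact: norm_continuous.
exact: Re_continuous.
Qed.

Lemma real_complex_continuous : continuous (real_complex R).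
Proof.
move=> x; apply/continuous_distP => e e0.
have e0' : 0 < complex.Re e by move: e0; rewrite ltcE => /andP[].
have eE : (complex.Re e)%:C = e by rewrite RRe_real// ger0_real// ltW.
have := nbhsx_ballx x _ e0'; apply: filterS => t.
rewrite -ball_normE /ball_/= -rmorphB normc_def /= expr0n/= addr0 sqrtr_sqr.
by rewrite -eE ltcR.
Qed.

Lemma conjc_continuous : continuous (@conjc R).
Proof.
move=> x; apply/continuous_distP => e e0.
have := nbhsx_ballx x _ e0; apply: filterS => t.
by rewrite -ball_normE /ball_/= -rmorphB/= normcJ.
Qed.

Lemma complex_complete (F : set_system R[i]) :
  ProperFilter F -> cauchy F -> cvg F.
Proof.
move=> FF /cauchy_ballP cF.
have cauchy_part (p : R[i] -> R) :
    (forall x y, `|p x - p y| <= complex.Re `|x - y|) -> cvg (p @ F).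
  move=> pl; apply: cauchy_cvg; apply/cauchy_ballP => e e0.
  have := cF e%:C; rewrite ltcR => /(_ e0).
  move=> [[A B] [FA FB] AB].
  exists (p @` A, p @` B) => /=.
    split; [apply: filterS FA => x Ax | apply: filterS FB => x Bx]; by exists x.
  move=> [_ _] [/= [a Aa <-] [b Bb <-]].
  rewrite -ball_normE /ball_/= (le_lt_trans (pl _ _))//.
  have := AB (a, b) (conj Aa Bb); rewrite -ball_normE /ball_/= -normcRe ltcR.
  by [].
have cre : cvg (@complex.Re R @ F).
  by apply: cauchy_part => x y; rewrite -raddfB; exact: Re_norm_le.
have cim : cvg (@complex.Im R @ F).
  by apply: cauchy_part => x y; rewrite -raddfB; exact: Im_norm_le.
apply/cvg_ex; exists (lim (@complex.Re R @ F) +i* lim (@complex.Im R @ F)).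
apply/cvgrPdist_lt => e e0.
have e0' : 0 < complex.Re e by move: e0; rewrite ltcE => /andP[].
have eE : (complex.Re e)%:C = e by rewrite RRe_real// ger0_real// ltW.
have e2 : 0 < complex.Re e / 2 by rewrite divr_gt0.
near=> t; rewrite -eE -normcRe ltcR.
rewrite (le_lt_trans (norm_le_ReIm _))// [ltRHS]splitr ltrD//.
  rewrite [X in `|X|](_ : _ = lim (@complex.Re R @ F) - complex.Re t).
    by near: t; move/cvgrPdist_lt : cre; exact.
  by case: (t).
rewrite [X in `|X|](_ : _ = lim (@complex.Im R @ F) - complex.Im t).
  by near: t; move/cvgrPdist_lt : cim; exact.
by case: (t).
Unshelve. all: by end_near. Qed.

End ComplexFacts.

HB.instance Definition _ (R : realType) :=
  Uniform_isComplete.Build R[i] (@complex_complete R).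

(* C*-algebras, not necessarily unital.  Norms of a normed module over [R[i]]
   take their values in [R[i]], ordered by x <= y iff y - x is real and >= 0. *)
HB.mixin Record isCStarAlgebra (R : realType) A
    & CompleteNormedModule R[i] A := {
  cmul : A -> A -> A;
  cstar : A -> A;
  cmulA : associative cmul;
  cmulDl : left_distributive cmul +%R;
  cmulDr : right_distributive cmul +%R;
  cmulZl : forall (c : R[i]) x y, cmul (c *: x) y = c *: cmul x y;
  cmulZr : forall (c : R[i]) x y, cmul x (c *: y) = c *: cmul x y;
  cstarK : involutive cstar;
  cstarD : {morph cstar : x y / x + y};
  cstarZ : forall (c : R[i]) x, cstar (c *: x) = c^* *: cstar x;
  cstarM : forall x y, cstar (cmul x y) = cmul (cstar y) (cstar x);
  cnormM : forall x y, `|cmul x y| <= `|x| * `|y|;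
  cnorm_star : forall x, `|cmul (cstar x) x| = `|x| ^+ 2
}.

#[short(type="cstarAlgType")]
HB.structure Definition CStarAlgebra (R : realType) :=
  { A of CompleteNormedModule R[i] A & isCStarAlgebra R A }.

Section CStarNotions.
Variable R : realType.
Implicit Types A B : cstarAlgType R.

Definition is_linear (V W : lmodType R[i]) (f : V -> W) :=
  forall (c : R[i]) x y, f (c *: x + y) = c *: f x + f y.

Definition star_hom A B (f : A -> B) :=
  [/\ is_linear f, {morph f : x y / cmul x y} & {morph f : x / cstar x}].

Definition positive_elt A (a : A) := exists b, a = cmul (cstar b) b.

(* The matrix (a i j) in M_k(A) is positive, i.e. of the form b^* b. *)
Definition positive_mx A k (a : 'I_k -> 'I_k -> A) :=
  exists b : 'I_k -> 'I_k -> A,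
    forall i j, a i j = \sum_l cmul (cstar (b l i)) (b l j).

Definition completely_positive A B (f : A -> B) :=
  is_linear f /\
  forall k (a : 'I_k -> 'I_k -> A),
    positive_mx a -> positive_mx (fun i j => f (a i j)).

Definition contractive_on A B (I : set A) (f : A -> B) :=
  forall x, I x -> `|f x| <= `|x|.

Definition order_zero_on A B (I : set A) (f : A -> B) :=
  forall x y, I x -> I y -> positive_elt x -> positive_elt y ->
    cmul x y = 0 -> cmul (f x) (f y) = 0.

Definition finite_dimensional A :=
  exists (n : nat) (e : 'I_n -> A),
    forall x, exists c : 'I_n -> R[i], x = \sum_i c i *: e i.

Definition two_sided_ideal A (I : set A) :=
  [/\ I 0, (forall (c : R[i]) x y, I x -> I y -> I (c *: x + y)),
      (forall a x, I x -> I (cmul a x)) & (forall a x, I x -> I (cmul x a))].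

Definition direct_sum_of A n (I : 'I_n -> set A) :=
  forall x, exists! s : {ffun 'I_n -> A},
    (forall i, I i (s i)) /\ x = \sum_i s i.

(* Winter--Zacharias: [nuclear_dim_le A n] says that the nuclear dimension of A
   is at most n.  [Lam], directed by [le], indexes the net of approximations
   A --psi--> F --phi--> A.  Ideals of a finite-dimensional algebra are closed,
   and a positive element of an ideal of F is positive in the ideal. *)
Definition nuclear_dim_le A (n : nat) :=
  exists (Lam : Type) (le : Lam -> Lam -> Prop) (F : Lam -> cstarAlgType R)
         (psi : forall l, A -> F l) (phi : forall l, F l -> A)
         (I : forall l, 'I_n.+1 -> set (F l)),
  [/\ inhabited Lam,
      (forall l, le l l),
      (forall l1 l2 l3, le l1 l2 -> le l2 l3 -> le l1 l3) &
      (forall l1 l2, exists l3, le l1 l3 /\ le l2 l3)] /\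
  (forall l, [/\ finite_dimensional (F l),
      completely_positive (psi l), completely_positive (phi l),
      contractive_on setT (psi l) &
      [/\ (forall i, two_sided_ideal (I l i)), direct_sum_of (I l) &
          forall i, contractive_on (I l i) (phi l) /\
                    order_zero_on (I l i) (phi l)]]) /\
  (forall (s : seq A) (eps : R), 0 < eps ->
     exists l0, forall l, le l0 l -> forall a, a \in s ->
       `|phi l (psi l a) - a| < eps%:C).

(* S generates B as a C*-algebra. *)
Definition cstar_generates B (S : set B) :=
  forall T : set B, S `<=` T -> closed T ->
    (forall (c : R[i]) x y, T x -> T y -> T (c *: x + y)) ->
    (forall x y, T x -> T y -> T (cmul x y)) ->
    (forall x, T x -> T (cstar x)) ->
    T 0 -> T = setT.

End CStarNotions.

HB.mixin Record isHilbertModule (R : realType) (A : cstarAlgType R) E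
    & CompleteNormedModule R[i] E := {
  ract : E -> A -> E;
  hdot : E -> E -> A;
  ractDl : forall xi eta a, ract (xi + eta) a = ract xi a + ract eta a;
  ractDr : forall xi a b, ract xi (a + b) = ract xi a + ract xi b;
  ractZl : forall (c : R[i]) xi a, ract (c *: xi) a = c *: ract xi a;
  ractZr : forall (c : R[i]) xi a, ract xi (c *: a) = c *: ract xi a;
  ractM : forall xi a b, ract xi (cmul a b) = ract (ract xi a) b;
  hdot_linear : forall xi (c : R[i]) eta zeta,
    hdot xi (c *: eta + zeta) = c *: hdot xi eta + hdot xi zeta;
  hdot_ract : forall xi eta a, hdot xi (ract eta a) = cmul (hdot xi eta) a;
  hdotC : forall xi eta, cstar (hdot xi eta) = hdot eta xi;
  hdot_pos : forall xi, positive_elt (hdot xi xi);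
  hdot_norm : forall xi, `|xi| ^+ 2 = `|hdot xi xi|
}.

#[short(type="hilbertModType")]
HB.structure Definition HilbertModule (R : realType) (A : cstarAlgType R) :=
  { E of CompleteNormedModule R[i] E & isHilbertModule R A E }.

(* The last three fields say that [lact] is a *-homomorphism into the
   adjointable operators, the adjoint of [lact a] being [lact (cstar a)]. *)
Record correspondence (R : realType) (A : cstarAlgType R) := Correspondence {
  corr_module :> hilbertModType A;
  lact : A -> corr_module -> corr_module;
  lact_linear : forall (c : R[i]) a b xi,
    lact (c *: a + b) xi = c *: lact a xi + lact b xi;
  lactM : forall a b xi, lact (cmul a b) xi = lact a (lact b xi);
  lact_adjoint : forall a xi eta,
    hdot (lact a xi) eta = hdot xi (lact (cstar a) eta)
}.

Section CuntzPimsner.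
Variables (R : realType) (A : cstarAlgType R).

Definition theta (E : hilbertModType A) (xi eta : E) : E -> E :=
  fun zeta => ract xi (hdot eta zeta).

(* The closure, in operator norm, of the span of the [theta xi eta].  Operators
   T in this closure are automatically adjointable. *)
Definition compact_operator (E : hilbertModType A) : set (E -> E) :=
  [set T | forall eps : R, 0 < eps ->
     exists s : seq (E * E), forall zeta,
       `|T zeta - \sum_(p <- s) theta p.1 p.2 zeta| <= eps%:C * `|zeta|].

Definition adjoint_of (E : hilbertModType A) (T S : E -> E) :=
  forall xi eta, hdot (T xi) eta = hdot xi (S eta).

Variable E : correspondence A.

Definition lact_kernel : set A := [set a | forall xi : E, lact a xi = 0].

Definition annihilator (I : set A) : set A :=
  [set a | forall b, I b -> cmul a b = 0].

(* The ideal J_E. *)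
Definition katsura_ideal : set A :=
  [set a | compact_operator (@lact _ _ E a)] `&` annihilator lact_kernel.

Section Representations.
Variable B : cstarAlgType R.

(* [psi] restricts to the *-homomorphism psi_tau on the compact operators;
   its values elsewhere are irrelevant. *)
Definition is_psi (tau : E -> B) (psi : (E -> E) -> B) :=
  [/\ (forall (c : R[i]) T S, compact_operator T -> compact_operator S ->
         psi (fun z => c *: T z + S z) = c *: psi T + psi S),
      (forall T S, compact_operator T -> compact_operator S ->
         psi (T \o S) = cmul (psi T) (psi S)),
      (forall T S, compact_operator T -> compact_operator S ->
         adjoint_of T S -> psi S = cstar (psi T)) &
      forall xi eta, psi (theta xi eta) = cmul (tau xi) (cstar (tau eta))].

Record covariant_rep (pi : A -> B) (tau : E -> B) : Prop := CovariantRep {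
  rep_hom : star_hom pi;
  rep_linear : is_linear tau;
  rep_dot : forall xi eta, pi (hdot xi eta) = cmul (cstar (tau xi)) (tau eta);
  rep_lact : forall a xi, cmul (pi a) (tau xi) = tau (lact a xi);
  rep_cov : exists psi, is_psi tau psi /\
    forall a, katsura_ideal a -> pi a = psi (@lact _ _ E a)
}.

End Representations.

(* [O], with the representation [(pi, tau)], is the Cuntz--Pimsner algebra of E;
   this determines [O] up to a unique isomorphism. *)
Record is_cuntz_pimsner (O : cstarAlgType R) (pi : A -> O) (tau : E -> O)
    : Prop := IsCuntzPimsner {
  cp_rep : covariant_rep pi tau;
  cp_generated : cstar_generates (range pi `|` range tau);
  cp_universal : forall (B : cstarAlgType R) (pi' : A -> B) (tau' : E -> B),
    covariant_rep pi' tau' ->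
    exists rho : O -> B,
      [/\ star_hom rho, rho \o pi = pi' & rho \o tau = tau']
}.

End CuntzPimsner.

Section SupNorm.
Variables (R : realType) (X : topologicalType) (cX : compact [set: X]).
Implicit Types f g : X -> R.

(* On the empty space this is 0. *)
Definition supnorm f : R := sup (range f).

Lemma supnorm_ub f x : continuous f -> f x <= supnorm f.
Proof.
move=> cf; apply: sup_upper_bound; last by exists x.
apply: compact_has_sup; first by exists (f x), x.
by apply: continuous_compact => //; apply: continuous_subspaceT.
Qed.

Lemma supnorm_le f (M : R) : 0 <= M -> (forall x, f x <= M) -> supnorm f <= M.
Proof.
move=> M0 fM; have [[y ry]|/set0P/negP/negPn/eqP r0] := pselect (range f !=set0).
  by apply: ge_sup; [exists y|move=> _ [x _ <-]].
by rewrite /supnorm r0 sup0.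
Qed.

Lemma supnorm_ge0 f : continuous f -> (forall x, 0 <= f x) -> 0 <= supnorm f.
Proof.
move=> cf f0; have [[_ [x _ _]]|/set0P/negP/negPn/eqP r0] :=
  pselect (range f !=set0); last by rewrite /supnorm r0 sup0.
exact: le_trans (f0 x) (supnorm_ub x cf).
Qed.

Lemma supnorm_eq0 f : continuous f -> (forall x, 0 <= f x) ->
  supnorm f = 0 -> forall x, f x = 0.
Proof.
by move=> cf f0 s0 x; apply: le_anti; rewrite f0 -{1}s0 supnorm_ub.
Qed.

Lemma supnorm_scale f (c : R) : continuous f -> (forall x, 0 <= f x) ->
  0 <= c -> supnorm (fun x => c * f x) = c * supnorm f.
Proof.
move=> cf f0 c0; have cfc : continuous (fun x => c * f x).
  by move=> x; apply: cvgM; [exact: cvg_cst|exact: cf].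
have := c0; rewrite le_eqVlt => /predU1P[<-|cgt0].
  rewrite mul0r; apply: le_anti; apply/andP; split.
    by apply: supnorm_le => // x; rewrite mul0r.
  apply: supnorm_ge0 => [x|x]; last by rewrite mul0r.
  by apply: cvgM; [exact: cvg_cst|exact: cf].
apply: le_anti; apply/andP; split.
  apply: supnorm_le => [|x]; first by rewrite mulr_ge0// supnorm_ge0.
  by rewrite ler_wpM2l// supnorm_ub.
rewrite -ler_pdivlMl//; apply: supnorm_le => [|x].
  by rewrite mulr_ge0 ?invr_ge0// supnorm_ge0// => x; rewrite mulr_ge0.
by rewrite ler_pdivlMl//; exact: (@supnorm_ub (fun x => c * f x)).
Qed.

Lemma supnorm_sqr f : continuous f -> (forall x, 0 <= f x) ->
  supnorm (fun x => f x ^+ 2) = supnorm f ^+ 2.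
Proof.
move=> cf f0; have cf2 : continuous (fun x => f x ^+ 2).
  by move=> x; apply: cvgM; exact: cf.
apply: le_anti; apply/andP; split.
  apply: supnorm_le => [|x]; first by rewrite exprn_ge0// supnorm_ge0.
  by rewrite lerXn2r// ?nnegrE// ?supnorm_ge0// supnorm_ub.
have s0 : 0 <= supnorm (fun x => f x ^+ 2).
  by rewrite supnorm_ge0// => x; rewrite exprn_ge0.
rewrite -[leRHS]sqr_sqrtr// lerXn2r ?nnegrE ?supnorm_ge0 ?sqrtr_ge0//.
apply: supnorm_le => [|x]; first exact: sqrtr_ge0.
rewrite -[f x]ger0_norm// -sqrtr_sqr ler_sqrt ?exprn_ge0//.
exact: (@supnorm_ub (fun x => f x ^+ 2)).
Qed.

End SupNorm.

(* Completeness of a space of functions normed by the supremum of continuous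
   pointwise norms, given that Cauchy filters converge pointwise. *)
Lemma sup_normed_cvg (R : realType) (X : topologicalType)
    (cX : compact [set: X]) (V : normedModType R[i]) (p : V -> X -> R) :
  (forall v, continuous (p v)) -> (forall v w x, p (v + w) x <= p v x + p w x) ->
  (forall v, `|v| = (supnorm (p v))%:C) ->
  forall F : set_system V, ProperFilter F -> cauchy F ->
  forall m, (forall x (e : R), 0 < e -> \forall v \near F, p (m - v) x < e) ->
  F --> m.
Proof.
move=> pc pD normE F FF /cauchy_ballP cF m mF.
apply/cvgrPdist_le => e e0.
have e0' : 0 < complex.Re e by move: e0; rewrite ltcE => /andP[].
have eE : (complex.Re e)%:C = e by rewrite RRe_real// ger0_real// ltW.
have e2 : 0 < complex.Re e / 2 by rewrite divr_gt0.
have := cF (complex.Re e / 2)%:C; rewrite ltcR => /(_ e2)[[A B] [/= FA FB] AB].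
near=> v.
have Bv : B v by near: v.
rewrite normE -eE lecR; apply: supnorm_le; first exact: ltW.
move=> x.
have : \forall u \near F, p (m - u) x < complex.Re e / 2 by exact: mF.
move=> /(filterI FA) /filter_ex[u [Au mu]].
rewrite -(subrKA u) (le_trans (pD _ _ _))// [leRHS]splitr lerD ?(ltW mu)//.
have := AB (u, v) (conj Au Bv); rewrite -ball_normE /ball_/= normE ltcR => /ltW.
by apply: le_trans; exact: supnorm_ub.
Unshelve. all: by end_near. Qed.

Section ContinuousFunctions.
Variables (R : realType) (X : topologicalType) (cX : compact [set: X]).

(* The algebra C(X) of continuous complex functions on a compact space. *)
Record Cfun := MkCfun { cfun :> X -> R[i]; cfunP : continuous cfun }.

HB.instance Definition _ := gen_eqMixin Cfun.
HB.instance Definition _ := gen_choiceMixin Cfun.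

Lemma CfunP (f g : Cfun) : f =1 g -> f = g.
Proof.
case: f g => [f cf] [g cg] /= /funext fg; rewrite fg in cf *.
by rewrite (Prop_irrelevance cf cg).
Qed.

Lemma Cfun0_cont : continuous (fun _ : X => 0 : R[i]).
Proof. by move=> x; exact: cvg_cst. Qed.
Lemma CfunN_cont (f : Cfun) : continuous (fun x => - f x).
Proof. by move=> x; apply: cvgN; exact: cfunP. Qed.
Lemma CfunD_cont (f g : Cfun) : continuous (fun x => f x + g x).
Proof. by move=> x; apply: cvgD; exact: cfunP. Qed.
Lemma CfunM_cont (f g : Cfun) : continuous (fun x => f x * g x).
Proof. by move=> x; apply: cvgM; exact: cfunP. Qed.
Lemma CfunZ_cont (c : R[i]) (f : Cfun) : continuous (fun x => c * f x).
Proof. by move=> x; apply: cvgM; [exact: cvg_cst|exact: cfunP]. Qed.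
Lemma CfunJ_cont (f : Cfun) : continuous (fun x => (f x)^*).
Proof.
move=> x; apply: (@continuous_comp _ _ _ f (@conjc R)); first exact: cfunP.
exact: conjc_continuous.
Qed.
Lemma Cfun_norm_cont (f : Cfun) : continuous (fun x => complex.Re `|f x|).
Proof.
move=> x; apply: (@continuous_comp _ _ _ f (fun z : R[i] => complex.Re `|z|)).
  exact: cfunP.
exact: Re_norm_continuous.
Qed.

Definition Cfun0 := MkCfun Cfun0_cont.
Definition CfunN f := MkCfun (@CfunN_cont f).
Definition CfunD f g := MkCfun (@CfunD_cont f g).
Definition CfunM f g := MkCfun (@CfunM_cont f g).
Definition CfunZ c f := MkCfun (@CfunZ_cont c f).
Definition CfunJ f := MkCfun (@CfunJ_cont f).

Lemma CfunDA : associative CfunD.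
Proof. by move=> f g h; apply: CfunP => x /=; rewrite addrA. Qed.
Lemma CfunDC : commutative CfunD.
Proof. by move=> f g; apply: CfunP => x /=; rewrite addrC. Qed.
Lemma CfunD0 : left_id Cfun0 CfunD.
Proof. by move=> f; apply: CfunP => x /=; rewrite add0r. Qed.
Lemma CfunDN : left_inverse Cfun0 CfunN CfunD.
Proof. by move=> f; apply: CfunP => x /=; rewrite addNr. Qed.
HB.instance Definition _ := GRing.isZmodule.Build Cfun CfunDA CfunDC CfunD0 CfunDN.

Lemma CfunZA a b f : CfunZ a (CfunZ b f) = CfunZ (a * b) f.
Proof. by apply: CfunP => x /=; rewrite mulrA. Qed.
Lemma CfunZ1 : left_id 1 CfunZ.
Proof. by move=> f; apply: CfunP => x /=; rewrite mul1r. Qed.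
Lemma CfunZDr : right_distributive CfunZ +%R.
Proof. by move=> c f g; apply: CfunP => x /=; rewrite mulrDr. Qed.
Lemma CfunZDl f : {morph CfunZ^~ f : a b / a + b}.
Proof. by move=> a b; apply: CfunP => x /=; rewrite mulrDl. Qed.
HB.instance Definition _ :=
  GRing.Zmodule_isLmodule.Build R[i] Cfun CfunZA CfunZ1 CfunZDr CfunZDl.

End ContinuousFunctions.

(* The supremum norm requires compactness, which is kept in the type. *)
Definition CX (R : realType) (X : topologicalType) (cX : compact [set: X]) :=
  Cfun R X.

Section CXCStar.
Variables (R : realType) (X : topologicalType) (cX : compact [set: X]).
Local Notation T := (CX R cX).
HB.instance Definition _ := GRing.Lmodule.on T.
Implicit Types f g : T.

Definition CX_norm f : R[i] := (supnorm (fun x => complex.Re `|(f : Cfun R X) x|))%:C.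

Lemma CX_normD f g : CX_norm (f + g) <= CX_norm f + CX_norm g.
Proof.
rewrite /CX_norm -rmorphD lecR; apply: supnorm_le => [|x].
  by rewrite addr_ge0// supnorm_ge0// => [|x||x];
    rewrite ?Re_norm_ge0//; exact: Cfun_norm_cont.
apply: (@le_trans _ _ (complex.Re (`|(f : Cfun R X) x| + `|(g : Cfun R X) x|))).
  by apply: Re_ler; exact: ler_normD.
by rewrite raddfD; apply: lerD; apply: (supnorm_ub cX); exact: Cfun_norm_cont.
Qed.

Lemma CX_normZ (c : R[i]) f : CX_norm (c *: f) = `|c| * CX_norm f.
Proof.
rewrite /CX_norm -[`|c|]normcRe -rmorphM; congr _%:C.
rewrite -(supnorm_scale cX) ?Re_norm_ge0//; last 2 first.
- exact: Cfun_norm_cont.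
- by move=> x; exact: Re_norm_ge0.
congr supnorm; apply/funext => x /=.
by apply: (@complexI R); rewrite rmorphM/= !normcRe normrM.
Qed.

Lemma CX_norm_eq0 f : CX_norm f = 0 -> f = 0.
Proof.
move=> /(@complexI R) /supnorm_eq0 => /(_ cX) f0; apply: CfunP => x /=.
apply/eqP; rewrite -normr_eq0 -normcRe f0//; first exact: Cfun_norm_cont.
by move=> y; exact: Re_norm_ge0.
Qed.

HB.instance Definition _ :=
  Lmodule_isNormed.Build R[i] T CX_normD CX_normZ CX_norm_eq0.

End CXCStar.
Lemma split5 (K : numFieldType) (e : K) :
  e = (e / 5%:R + e / 5%:R) + (e / 5%:R + (e / 5%:R + e / 5%:R)).
Proof.
have {1}-> : e = (e / 5%:R) *+ 5 by rewrite -mulr_natr divfK ?pnatr_eq0.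
by move: (e / _) => d; rewrite !mulrS mulr0n addr0 !addrA.
Qed.

Section CXComplete.
Variables (R : realType) (X : topologicalType) (cX : compact [set: X]).
Local Notation T := (CX R cX).
Implicit Types f g : T.

Lemma CX_normE f :
  `|f| = (supnorm (fun x => complex.Re `|(f : Cfun R X) x|))%:C.
Proof. by []. Qed.

Lemma CX_norm_ub f x : `|(f : Cfun R X) x| <= `|f|.
Proof.
rewrite CX_normE -normcRe lecR.
by apply: (supnorm_ub cX x); exact: Cfun_norm_cont.
Qed.

Lemma CX_complete (F : set_system T) : ProperFilter F -> cauchy F -> cvg F.
Proof.
move=> FF cF; have /cauchy_ballP cF' := cF.
have evx x : exists l : R[i], (fun f : T => (f : Cfun R X) x) @ F --> l.
  apply/cvg_ex; apply: (@cauchy_cvg _ _ (fmap_proper_filter _ FF)).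
  apply/cauchy_ballP => e e0.
  have [[A B] [/= FA FB] AB] := cF' _ e0.
  exists ((fun f : T => (f : Cfun R X) x) @` A,
          (fun f : T => (f : Cfun R X) x) @` B) => /=.
    by split; [apply: filterS FA => f Af|apply: filterS FB => f Bf]; exists f.
  move=> [_ _] [/= [f Af <-] [g Bg <-]].
  have := AB (f, g) (conj Af Bg); rewrite -!ball_normE /ball_/=.
  by apply: le_lt_trans; exact: (CX_norm_ub (f - g)).
have [l lP] := choice evx.
have lnear x (e : R[i]) : 0 < e -> \forall f \near F, `|l x - (f : Cfun R X) x| < e.
  by move=> e0; move/cvgrPdist_lt : (lP x); exact.
have lc : continuous l.
  move=> x; apply/continuous_distP => e e0.
  have e5 : 0 < e / 5%:R by rewrite divr_gt0// ltr0n.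
  have [[A B] [/= FA FB] AB] := cF' _ e5.
  have [h Bh] := filter_ex FB.
  have hl y : `|l y - (h : Cfun R X) y| < e / 5%:R + e / 5%:R.
    have := lnear y _ e5; move=> /(filterI FA) /filter_ex[f [Af lf]].
    rewrite -(subrKA ((f : Cfun R X) y)) (le_lt_trans (ler_normD _ _))//.
    rewrite ltrD// (le_lt_trans (CX_norm_ub (f - h) y))//.
    by have := AB (f, h) (conj Af Bh); rewrite -ball_normE.
  have := @cfunP _ _ (h : Cfun R X) x.
  move=> /continuous_distP /(_ _ e5); apply: filterS => y hxy.
  rewrite -(subrKA ((h : Cfun R X) x)) (le_lt_trans (ler_normD _ _))//.
  rewrite -(subrKA ((h : Cfun R X) y) ((h : Cfun R X) x)) [ltRHS]split5.
  rewrite ltrD// (le_lt_trans (ler_normD _ _))// ltrD//.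
  by rewrite distrC.
pose m : T := MkCfun lc.
apply/cvg_ex; exists m.
apply: (@sup_normed_cvg R X cX T
         (fun f x => complex.Re `|(f : Cfun R X) x|)) => //.
- by move=> f; exact: Cfun_norm_cont.
- move=> f g x; rewrite -lecR rmorphD/= !normcRe; exact: ler_normD.
- move=> x e e0; have e0' : 0 < e%:C by rewrite ltcR.
  have := lnear x _ e0'; apply: filterS => f.
  by rewrite -normcRe ltcR.
Qed.

HB.instance Definition _ := Uniform_isComplete.Build T CX_complete.

Definition CX_mul f g : T := CfunM f g.
Definition CX_star f : T := CfunJ f.

Lemma CX_mulA : associative CX_mul.
Proof. by move=> f g h; apply: CfunP => x /=; rewrite mulrA. Qed.
Lemma CX_mulDl : left_distributive CX_mul +%R.
Proof. by move=> f g h; apply: CfunP => x /=; rewrite mulrDl. Qed.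
Lemma CX_mulDr : right_distributive CX_mul +%R.
Proof. by move=> f g h; apply: CfunP => x /=; rewrite mulrDr. Qed.
Lemma CX_mulZl (c : R[i]) f g : CX_mul (c *: f) g = c *: CX_mul f g.
Proof. by apply: CfunP => x /=; rewrite mulrA. Qed.
Lemma CX_mulZr (c : R[i]) f g : CX_mul f (c *: g) = c *: CX_mul f g.
Proof. by apply: CfunP => x /=; rewrite mulrCA. Qed.
Lemma CX_starK : involutive CX_star.
Proof. by move=> f; apply: CfunP => x /=; rewrite conjcK. Qed.
Lemma CX_starD : {morph CX_star : f g / f + g}.
Proof. by move=> f g; apply: CfunP => x /=; rewrite rmorphD. Qed.
Lemma CX_starZ (c : R[i]) f : CX_star (c *: f) = c^* *: CX_star f.
Proof. by apply: CfunP => x /=; rewrite rmorphM. Qed.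
Lemma CX_starM f g : CX_star (CX_mul f g) = CX_mul (CX_star g) (CX_star f).
Proof. by apply: CfunP => x /=; rewrite rmorphM mulrC. Qed.
Lemma CX_normM f g : `|CX_mul f g| <= `|f| * `|g|.
Proof.
rewrite 3!CX_normE -rmorphM lecR; apply: supnorm_le => [|x].
  by rewrite mulr_ge0// supnorm_ge0// => [|x||x];
    rewrite ?Re_norm_ge0//; exact: Cfun_norm_cont.
rewrite -lecR rmorphM/= normcRe normrM.
by apply: ler_pM => //; exact: CX_norm_ub.
Qed.
Lemma CX_norm_star f : `|CX_mul (CX_star f) f| = `|f| ^+ 2.
Proof.
rewrite 2!CX_normE -rmorphXn -(supnorm_sqr cX)/=; last 2 first.
- exact: Cfun_norm_cont.
- by move=> x; exact: Re_norm_ge0.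
congr (supnorm _)%:C; apply/funext => x /=.
by apply: (@complexI R); rewrite rmorphXn/= !normcRe normrM normcJ expr2.
Qed.

HB.instance Definition _ := isCStarAlgebra.Build R T CX_mulA CX_mulDl CX_mulDr
  CX_mulZl CX_mulZr CX_starK CX_starD CX_starZ CX_starM CX_normM CX_norm_star.

End CXComplete.
(* A family of complex vector spaces over X: a space over X together with a
   vector space structure on each fibre, [vpt x] being the bijection from the
   vector space [vfibre x] onto the fibre of [vproj] over x. *)
Record vfamily (R : realType) (X : topologicalType) := VFamily {
  vtotal :> topologicalType;
  vproj : vtotal -> X;
  vfibre : X -> lmodType R[i];
  vpt : forall x, vfibre x -> vtotal;
  vproj_continuous : continuous vproj;
  vproj_vpt : forall x (v : vfibre x), vproj (vpt v) = x;
  vpt_inj : forall x, injective (@vpt x);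
  vpt_surj : forall t, exists v : vfibre (vproj t), vpt v = t
}.

(* [t |-> (vproj t, ch t)] is a homeomorphism from the part of V over Z onto
   Z * C, with inverse [fr], and is linear on the fibres. *)
Definition trivialization (R : realType) (X : topologicalType)
    (V : vfamily R X) (Z : set X) (ch : V -> R[i]) (fr : X * R[i] -> V) :=
  [/\ {within @vproj _ _ V @^-1` Z, continuous ch},
      {within Z `*` setT, continuous fr},
      (forall t, Z (vproj t) -> fr (vproj t, ch t) = t),
      (forall x c, Z x -> vproj (fr (x, c)) = x /\ ch (fr (x, c)) = c) &
      (forall x (c : R[i]) (v w : vfibre V x), Z x ->
         ch (vpt (c *: v + w)) = c * ch (vpt v) + ch (vpt w))].

Definition trivial_over (R : realType) (X : topologicalType)
    (V : vfamily R X) (Z : set X) :=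
  exists ch fr, @trivialization R X V Z ch fr.

(* [herm_continuous] is continuity on the fibre product of V with itself. *)
Record line_bundle (R : realType) (X : topologicalType) := LineBundle {
  lb_family :> vfamily R X;
  lb_locally_trivial : forall x, exists U : set X,
    [/\ open U, U x & trivial_over lb_family U];
  herm : forall x, vfibre lb_family x -> vfibre lb_family x -> R[i];
  herm_linear : forall x (v : vfibre lb_family x) (c : R[i]) w1 w2,
    herm v (c *: w1 + w2) = c * herm v w1 + herm v w2;
  hermC : forall x (v w : vfibre lb_family x), herm w v = (herm v w)^*;
  herm_pos : forall x (v : vfibre lb_family x), v != 0 -> 0 < herm v v;
  herm_continuous : forall x (v w : vfibre lb_family x) (B : set R[i]),
    nbhs (herm v w) B ->
    \forall z \near (vpt v, vpt w), forall y (v' w' : vfibre lb_family y),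
      z = (vpt v', vpt w') -> B (herm v' w')
}.


Lemma near_continuous (Y Z : topologicalType) (f g : Y -> Z) (x : Y) :
  (\forall y \near x, f y = g y) -> {for x, continuous g} ->
  {for x, continuous f}.
Proof.
move=> fg cg B; rewrite (nbhs_singleton fg) => /cg; apply: filterS2 fg.
by move=> y /= ->.
Qed.

Section BundleFacts.
Variables (R : realType) (X : topologicalType) (V : line_bundle R X).
Implicit Types (x y : X) (U : set X).

Lemma chart_at x0 : exists U (ch : V -> R[i]) (fr : X * R[i] -> V),
  [/\ open U, U x0, trivialization U ch fr,
      (forall t, U (vproj t) -> {for t, continuous ch}) &
      (forall z, U z.1 -> {for z, continuous fr})].
Proof.
have [U [oU Ux0 [ch [fr tr]]]] := lb_locally_trivial V x0.
exists U, ch, fr; split => //.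
  move=> t Ut; have [+ _ _ _ _] := tr.
  rewrite continuous_open_subspace; last first.
    by apply: open_comp => // z _; exact: vproj_continuous.
  by apply; rewrite inE.
move=> z Uz; have [_ + _ _ _] := tr.
rewrite continuous_open_subspace; last first.
  have -> : U `*` setT = fst @^-1` U :> set (X * R[i]).
    by apply/seteqP; split => [w []|w] //.
  by apply: open_comp => // w _; exact: cvg_fst.
by apply; rewrite inE.
Qed.

Section Chart.
Variables (U : set X) (ch : V -> R[i]) (fr : X * R[i] -> V).
Hypothesis tr : trivialization U ch fr.

Lemma chD x (v w : vfibre V x) : U x -> ch (vpt (v + w)) = ch (vpt v) + ch (vpt w).
Proof.
by have [_ _ _ _ lin] := tr => Ux; rewrite -[v]scale1r lin// mul1r scale1r.
Qed.

Lemma ch0 x : U x -> ch (vpt (0 : vfibre V x)) = 0.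
Proof.
by move=> Ux; apply/(addrI (ch (vpt (0 : vfibre V x)))); rewrite -chD// !addr0.
Qed.

Lemma chZ x c (v : vfibre V x) : U x -> ch (vpt (c *: v)) = c * ch (vpt v).
Proof.
by have [_ _ _ _ lin] := tr => Ux; rewrite -[c *: v]addr0 lin// ch0// addr0.
Qed.

Lemma chB x (v w : vfibre V x) : U x -> ch (vpt (v - w)) = ch (vpt v) - ch (vpt w).
Proof. by move=> Ux; rewrite -scaleN1r chD// chZ// mulN1r. Qed.

Lemma ch_inj x (v w : vfibre V x) : U x -> ch (vpt v) = ch (vpt w) -> v = w.
Proof.
have [_ _ can _ _] := tr => Ux vw; apply: (@vpt_inj _ _ V).
have cv := can (vpt v); have cw := can (vpt w); rewrite !vproj_vpt in cv cw.
by rewrite -(cv Ux) vw; exact: cw.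
Qed.

Lemma frame x : U x -> exists e : vfibre V x, vpt e = fr (x, 1) /\ ch (vpt e) = 1.
Proof.
have [_ _ _ can _] := tr => Ux; have [pr1 ch1] := can x 1 Ux.
have [e] := @vpt_surj _ _ V (fr (x, 1)).
by move: e; rewrite pr1 => e eE; exists e; rewrite eE ch1.
Qed.

Lemma frameE x (e v : vfibre V x) : U x -> ch (vpt e) = 1 -> v = ch (vpt v) *: e.
Proof. by move=> Ux e1; apply: ch_inj => //; rewrite chZ// e1 mulr1. Qed.

End Chart.

Lemma line_basis x : exists (e : vfibre V x), e != 0 /\ forall v, exists c, v = c *: e.
Proof.
have [U [ch [fr [_ Ux tr _ _]]]] := chart_at x.
have [e [_ e1]] := frame tr Ux; exists e; split => [|v].
  by apply/eqP => e0; move: e1; rewrite e0 (ch0 tr)// => /esym/eqP; rewrite oner_eq0.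
by exists (ch (vpt v)); exact: (frameE tr).
Qed.

Lemma herm_scale x c d (e : vfibre V x) :
  herm (c *: e) (d *: e) = c^* * d * herm e e.
Proof.
have hZ (u w : vfibre V x) b : herm u (b *: w) = b * herm u w.
  have h0 : herm u (0 : vfibre V x) = 0.
    have := herm_linear u 1 0 0; rewrite scale1r addr0 mul1r => h.
    by apply/(addrI (herm u 0)); rewrite -h addr0.
  by rewrite -[b *: w]addr0 herm_linear h0 addr0.
by rewrite hZ hermC hZ rmorphM/= -hermC mulrA [d * _]mulrC.
Qed.

End BundleFacts.
Section FibreNorm.
Variables (R : realType) (X : topologicalType) (V : line_bundle R X).

Definition fnorm x (v : vfibre V x) : R := Num.sqrt (complex.Re (herm v v)).

Lemma herm_ge0 x (v : vfibre V x) : 0 <= herm v v.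
Proof.
have [->|v0] := eqVneq v 0; last exact/ltW/herm_pos.
have := herm_linear (0 : vfibre V x) 1 0 0.
rewrite scale1r addr0 mul1r => h.
suff -> : herm (0 : vfibre V x) 0 = 0 by [].
by apply/(addrI (herm (0 : vfibre V x) 0)); rewrite -h addr0.
Qed.

Lemma fnorm_ge0 x (v : vfibre V x) : 0 <= fnorm v.
Proof. exact: sqrtr_ge0. Qed.

Lemma fnorm_sqr x (v : vfibre V x) : (fnorm v ^+ 2)%:C = herm v v.
Proof.
have h0 := herm_ge0 v; have r0 : 0 <= complex.Re (herm v v) by exact: Re_ler h0.
by rewrite sqr_sqrtr// RRe_real// ger0_real.
Qed.

Lemma fnormZ x c (v : vfibre V x) : fnorm (c *: v) = complex.Re `|c| * fnorm v.
Proof.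
apply/eqP; rewrite -(@eqrXn2 _ 2)// ?fnorm_ge0 ?mulr_ge0 ?fnorm_ge0 ?Re_norm_ge0//.
apply/eqP/(@complexI R); rewrite fnorm_sqr herm_scale -fnorm_sqr exprMn.
rewrite [RHS]rmorphM; congr (_ * _); rewrite -(normCKC c) -normcRe.
by rewrite -rmorphXn.
Qed.

Lemma fnormD x (v w : vfibre V x) : fnorm (v + w) <= fnorm v + fnorm w.
Proof.
have [e [_ he]] := line_basis V x; have [a ->] := he v; have [b ->] := he w.
rewrite -scalerDl !fnormZ -mulrDl ler_wpM2r ?fnorm_ge0// -raddfD.
by apply: Re_ler; exact: ler_normD.
Qed.

Lemma fnorm_eq0 x (v : vfibre V x) : fnorm v = 0 -> v = 0.
Proof.
move=> v0; apply/eqP/negP => /negP /(@herm_pos _ _ V).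
by rewrite -fnorm_sqr v0 expr0n/= ltxx.
Qed.

(* Continuity at a point of (not necessarily continuous) sections. *)
Definition sec_at (s : forall x, vfibre V x) x0 :=
  {for x0, continuous (fun x => vpt (s x))}.

Lemma herm_sec_continuous (s t : forall x, vfibre V x) x0 :
  sec_at s x0 -> sec_at t x0 -> {for x0, continuous (fun x => herm (s x) (t x))}.
Proof.
move=> cs ct B /(@herm_continuous _ _ V) [[B1 B2] [/= /cs nB1 /ct nB2] sB].
suff : \forall x \near x0, B (herm (s x) (t x)) by [].
apply: (@filterS _ (nbhs x0) _ _ _ _ (@filterI _ (nbhs x0) _ _ _ nB1 nB2)).
by move=> x [B1x B2x]; exact: (sB (_, _) (conj B1x B2x)).
Qed.

Lemma fnorm_sec_continuous (s : forall x, vfibre V x) x0 :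
  sec_at s x0 -> {for x0, continuous (fun x => fnorm (s x))}.
Proof.
move=> cs; apply: (@continuous_comp _ _ _
  (fun x => complex.Re (herm (s x) (s x))) Num.sqrt).
  apply: (@continuous_comp _ _ _ (fun x => herm (s x) (s x)) (@complex.Re R)).
    exact: herm_sec_continuous.
  exact: Re_continuous.
exact: sqrt_continuous.
Qed.

Section Chart.
Variables (U : set X) (ch : V -> R[i]) (fr : X * R[i] -> V) (x0 : X).
Hypotheses (oU : open U) (Ux0 : U x0) (tr : trivialization U ch fr).
Hypothesis cch : forall t, U (vproj t) -> {for t, continuous ch}.
Hypothesis cfr : forall z, U z.1 -> {for z, continuous fr}.

Lemma nearU : \forall x \near x0, U x.
Proof. by apply: open_nbhs_nbhs; split. Qed.

Lemma sec_at_ch s : sec_at s x0 -> {for x0, continuous (fun x => ch (vpt (s x)))}.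
Proof.
move=> cs; apply: (@continuous_comp _ _ _ (fun x => vpt (s x)) ch) => //.
by apply: cch; rewrite vproj_vpt.
Qed.

Lemma ch_sec_at (s : forall x, vfibre V x) :
  {for x0, continuous (fun x => ch (vpt (s x)))} -> sec_at s x0.
Proof.
move=> cs; apply: (@near_continuous _ _ _ (fun x => fr (x, ch (vpt (s x))))).
  near=> x; have Ux : U x by near: x; exact: nearU.
  by have [_ _ + _ _] := tr => /(_ (vpt (s x))); rewrite vproj_vpt => ->.
apply: (@continuous_comp _ _ _ (fun x => (x, ch (vpt (s x)))) fr).
  exact: (@cvg_pair _ _ _ (nbhs x0) (nbhs x0) (nbhs (ch (vpt (s x0)))) _ _ _
    (fun x => x) (fun x => ch (vpt (s x))) (@cvg_id _ _) cs).
exact: cfr.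
Unshelve. all: by end_near. Qed.

End Chart.

Lemma sec0_at x0 : sec_at (fun x => 0) x0.
Proof.
have [U [ch [fr [oU Ux0 tr cch cfr]]]] := chart_at V x0.
apply: (ch_sec_at oU Ux0 tr cfr).
apply: (@near_continuous _ _ _ (fun=> 0)); last exact: cvg_cst.
by apply: filterS (nearU oU Ux0) => x Ux; rewrite (ch0 tr).
Qed.

Lemma sec_comb_at (f : X -> R[i]) s t x0 : {for x0, continuous f} ->
  sec_at s x0 -> sec_at t x0 -> sec_at (fun x => f x *: s x + t x) x0.
Proof.
move=> cf cs ct; have [U [ch [fr [oU Ux0 tr cch cfr]]]] := chart_at V x0.
apply: (ch_sec_at oU Ux0 tr cfr).
apply: (@near_continuous _ _ _
  (fun x => f x * ch (vpt (s x)) + ch (vpt (t x)))).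
  apply: filterS (nearU oU Ux0) => x Ux.
  by rewrite (chD tr)// (chZ tr).
apply: cvgD; last exact: (sec_at_ch Ux0 cch ct).
by apply: cvgM; [exact: cf|exact: (sec_at_ch Ux0 cch cs)].
Qed.

End FibreNorm.

Section Sections.
Variables (R : realType) (X : topologicalType) (V : line_bundle R X).

Record csection := CSection {
  csec :> forall x, vfibre V x;
  csecP : continuous (fun x => vpt (csec x))
}.

HB.instance Definition _ := gen_eqMixin csection.
HB.instance Definition _ := gen_choiceMixin csection.

Lemma csectionP (s t : csection) : (forall x, s x = t x) -> s = t.
Proof.
case: s t => [s cs] [t ct] /= st.
have {}st : s = t by apply: functional_extensionality_dep.
by rewrite st in cs *; rewrite (Prop_irrelevance cs ct).
Qed.

Lemma csec0_cont : continuous (fun x => vpt (0 : vfibre V x)).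
Proof. exact: sec0_at. Qed.
Definition csec0 := CSection csec0_cont.

Lemma csecD_cont (s t : csection) : continuous (fun x => vpt (s x + t x)).
Proof.
move=> x; have -> : (fun x => vpt (s x + t x)) = fun x => vpt (1 *: s x + t x).
  by apply/funext => y; rewrite scale1r.
by apply: (@sec_comb_at _ _ _ (fun=> 1)); [exact: cvg_cst|exact: csecP..].
Qed.
Definition csecD s t := CSection (@csecD_cont s t).

Lemma csecM_cont (f : Cfun R X) (s : csection) : continuous (fun x => vpt (f x *: s x)).
Proof.
move=> x; have -> : (fun x => vpt (f x *: s x)) = fun x => vpt (f x *: s x + 0).
  by apply/funext => y; rewrite addr0.
by apply: sec_comb_at; [exact: cfunP|exact: csecP|exact: sec0_at].
Qed.
Definition csecM f s := CSection (@csecM_cont f s).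

Lemma csecZ_cont (c : R[i]) (s : csection) : continuous (fun x => vpt (c *: s x)).
Proof. by apply: (@csecM_cont (MkCfun (fun x => @cvg_cst _ c _ _ _))). Qed.
Definition csecZ c s := CSection (@csecZ_cont c s).

Lemma csecN_cont (s : csection) : continuous (fun x => vpt (- s x)).
Proof.
have -> : (fun x => vpt (- s x)) = fun x => vpt (-1 *: s x).
  by apply/funext => y; rewrite scaleN1r.
exact: csecZ_cont.
Qed.
Definition csecN s := CSection (@csecN_cont s).

Lemma csecDA : associative csecD.
Proof. by move=> f g h; apply: csectionP => x /=; rewrite addrA. Qed.
Lemma csecDC : commutative csecD.
Proof. by move=> f g; apply: csectionP => x /=; rewrite addrC. Qed.
Lemma csecD0 : left_id csec0 csecD.
Proof. by move=> f; apply: csectionP => x /=; rewrite add0r. Qed.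
Lemma csecDN : left_inverse csec0 csecN csecD.
Proof. by move=> f; apply: csectionP => x /=; rewrite addNr. Qed.
HB.instance Definition _ :=
  GRing.isZmodule.Build csection csecDA csecDC csecD0 csecDN.

Lemma csecZA a b s : csecZ a (csecZ b s) = csecZ (a * b) s.
Proof. by apply: csectionP => x /=; rewrite scalerA. Qed.
Lemma csecZ1 : left_id 1 csecZ.
Proof. by move=> f; apply: csectionP => x /=; rewrite scale1r. Qed.
Lemma csecZDr : right_distributive csecZ +%R.
Proof. by move=> c f g; apply: csectionP => x /=; rewrite scalerDr. Qed.
Lemma csecZDl s : {morph csecZ^~ s : a b / a + b}.
Proof. by move=> a b; apply: csectionP => x /=; rewrite scalerDl. Qed.
HB.instance Definition _ :=
  GRing.Zmodule_isLmodule.Build R[i] csection csecZA csecZ1 csecZDr csecZDl.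

Lemma csec_fnorm_cont (s : csection) : continuous (fun x => fnorm (s x)).
Proof. by move=> x; apply: fnorm_sec_continuous; exact: csecP. Qed.

End Sections.

(* The Hilbert C(X)-module of continuous sections; as for [CX], the compactness
   proof is kept in the type because the norm depends on it. *)
Definition Gamma (R : realType) (X : topologicalType) (cX : compact [set: X])
  (V : line_bundle R X) := csection V.

Section GammaNorm.
Variables (R : realType) (X : topologicalType) (cX : compact [set: X]).
Variable V : line_bundle R X.
Local Notation T := (Gamma cX V).
HB.instance Definition _ := GRing.Lmodule.on T.
Implicit Types s t : T.

Definition Gamma_norm s : R[i] := (supnorm (fun x => fnorm ((s : csection V) x)))%:C.

Lemma Gamma_normD s t : Gamma_norm (s + t) <= Gamma_norm s + Gamma_norm t.
Proof.
rewrite /Gamma_norm -rmorphD lecR; apply: supnorm_le => [|x].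
  by apply: addr_ge0; apply: (supnorm_ge0 cX) => [|x];
    [exact: csec_fnorm_cont|exact: fnorm_ge0
    |exact: csec_fnorm_cont|exact: fnorm_ge0].
apply: (le_trans (fnormD _ _)).
by apply: lerD; apply: (supnorm_ub cX x); exact: csec_fnorm_cont.
Qed.

Lemma Gamma_normZ (c : R[i]) s : Gamma_norm (c *: s) = `|c| * Gamma_norm s.
Proof.
rewrite /Gamma_norm -[`|c|]normcRe -rmorphM; congr _%:C.
rewrite -(supnorm_scale cX) ?Re_norm_ge0//; last 2 first.
- exact: csec_fnorm_cont.
- by move=> x; exact: fnorm_ge0.
by congr supnorm; apply/funext => x /=; exact: fnormZ.
Qed.

Lemma Gamma_norm_eq0 s : Gamma_norm s = 0 -> s = 0.
Proof.
move=> /(@complexI R) /supnorm_eq0 => /(_ cX) s0; apply: csectionP => x /=.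
apply: fnorm_eq0; apply: s0; first exact: csec_fnorm_cont.
by move=> y; exact: fnorm_ge0.
Qed.

HB.instance Definition _ :=
  Lmodule_isNormed.Build R[i] T Gamma_normD Gamma_normZ Gamma_norm_eq0.

Lemma Gamma_normE s :
  `|s| = (supnorm (fun x => fnorm ((s : csection V) x)))%:C.
Proof. by []. Qed.

Lemma Gamma_norm_ub s x : (fnorm ((s : csection V) x))%:C <= `|s|.
Proof.
rewrite Gamma_normE lecR.
by apply: (supnorm_ub cX x); exact: csec_fnorm_cont.
Qed.

Lemma Gamma_pointwise (F : set_system T) : ProperFilter F -> cauchy F ->
  forall x, exists m : vfibre V x, forall e : R, 0 < e ->
    \forall s \near F, fnorm (m - (s : csection V) x) < e.
Proof.
move=> FF /cauchy_ballP cF x.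
have [U [ch [fr [oU Ux tr cch cfr]]]] := chart_at V x.
have [u [_ u1]] := frame tr Ux.
have u0 : 0 < fnorm u.
  rewrite lt_neqAle fnorm_ge0 andbT eq_sym; apply/eqP => /fnorm_eq0 u0.
  by move: u1; rewrite u0 (ch0 tr)// => /esym/eqP; rewrite oner_eq0.
have chE (v : vfibre V x) : complex.Re `|ch (vpt v)| * fnorm u = fnorm v.
  by rewrite -fnormZ -(frameE tr v Ux u1).
pose z (s : T) := ch (vpt ((s : csection V) x)).
have [l lP] : exists l : R[i], z @ F --> l.
  apply/cvg_ex; apply: (@cauchy_cvg _ _ (fmap_proper_filter _ FF)).
  apply/cauchy_ballP => e e0.
  have eu0 : 0 < e * (fnorm u)%:C by rewrite mulr_gt0// ltcR.
  have [[A B] [/= FA FB] AB] := cF _ eu0.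
  exists (z @` A, z @` B) => /=.
    by split; [apply: filterS FA => f Af|apply: filterS FB => f Bf]; exists f.
  move=> [_ _] [/= [f Af <-] [g Bg <-]].
  have := AB (f, g) (conj Af Bg); rewrite -!ball_normE /ball_/= => fg.
  have u0' : 0 < (fnorm u)%:C by rewrite ltcR.
  rewrite -(ltr_pM2r u0'); apply: le_lt_trans fg.
  rewrite -normcRe -rmorphM /z -(chB tr)// chE.
  exact: (Gamma_norm_ub (f - g)).
exists (l *: u) => e e0.
have eu0 : 0 < (e / fnorm u)%:C by rewrite ltcR divr_gt0.
move/cvgrPdist_lt : lP => /(_ _ eu0); apply: filterS => s.
rewrite -normcRe ltcR ltr_pdivlMr//; apply: le_lt_trans.
by rewrite -chE (chB tr)// (chZ tr)// u1 mulr1.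
Qed.

Lemma Gamma_limit_continuous (F : set_system T) (m : forall x, vfibre V x) :
  ProperFilter F -> cauchy F ->
  (forall x (e : R), 0 < e ->
    \forall s \near F, fnorm (m x - (s : csection V) x) < e) ->
  continuous (fun x => vpt (m x)).
Proof.
move=> FF /cauchy_ballP cF mF x0.
have [U [ch [fr [oU Ux0 tr cch cfr]]]] := chart_at V x0.
apply: (ch_sec_at oU Ux0 tr cfr); apply/continuous_distP => e e0.
pose u x : vfibre V x :=
  if pselect (U x) is left Ux then projT1 (cid (frame tr Ux)) else 0.
have uE x : U x -> vpt (u x) = fr (x, 1) /\ ch (vpt (u x)) = 1.
  rewrite /u; case: pselect => // Ux _.
  exact: (projT2 (cid (frame tr Ux))).
have uc : sec_at u x0.
  apply: (ch_sec_at oU Ux0 tr cfr).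
  apply: (@near_continuous _ _ _ (fun=> 1 : R[i])); last exact: cvg_cst.
  by apply: filterS (nearU oU Ux0) => x /uE[].
have u0 : 0 < fnorm (u x0).
  rewrite lt_neqAle fnorm_ge0 andbT eq_sym; apply/eqP => /fnorm_eq0 u0.
  by have [_] := uE _ Ux0; rewrite u0 (ch0 tr)// => /esym/eqP; rewrite oner_eq0.
pose k := fnorm (u x0) / 2.
have k0 : 0 < k by rewrite divr_gt0.
have kE : fnorm (u x0) - k = k by rewrite {1}[fnorm _]splitr addrK.
have nk : \forall x \near x0, k < fnorm (u x).
  have /continuous_distP /(_ _ k0) := fnorm_sec_continuous uc.
  apply: filterS => x; rewrite ltr_distl => /andP[_].
  by rewrite -ltrBlDr kE.
have chE x (v : vfibre V x) : U x ->
    complex.Re `|ch (vpt v)| * fnorm (u x) = fnorm v.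
  by move=> Ux; rewrite -fnormZ -(frameE tr v Ux (uE _ Ux).2).
pose e1 := complex.Re e.
have e10 : 0 < e1 by move: e0; rewrite ltcE => /andP[].
have eE : e = e1%:C by rewrite RRe_real// ger0_real// ltW.
have d0 : 0 < e1 / 5%:R * k by rewrite mulr_gt0// divr_gt0// ltr0n.
have d0' : 0 < (e1 / 5%:R * k)%:C by rewrite ltcR.
have [[A B] [/= FA FB] AB] := cF _ d0'.
have [h Bh] := filter_ex FB.
have hm x : fnorm (m x - (h : csection V) x) < (e1 / 5%:R + e1 / 5%:R) * k.
  have := mF x _ d0; move=> /(filterI FA) /filter_ex[f [Af mf]].
  rewrite -(subrKA ((f : csection V) x)) (le_lt_trans (fnormD _ _))// mulrDl.
  rewrite ltrD// -ltcR (le_lt_trans (Gamma_norm_ub (f - h) x))//.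
  by have := AB (f, h) (conj Af Bh); rewrite -ball_normE.
have hm' x : U x -> k < fnorm (u x) ->
    complex.Re `|ch (vpt (m x)) - ch (vpt ((h : csection V) x))|
    < e1 / 5%:R + e1 / 5%:R.
  move=> Ux kx; rewrite -(ltr_pM2r k0); apply: le_lt_trans (hm x).
  by rewrite -chE// (chB tr)// ler_wpM2l ?Re_norm_ge0// ltW.
have e5 : 0 < (e1 / 5%:R)%:C by rewrite ltcR divr_gt0// ltr0n.
have /continuous_distP /(_ _ e5) hc := sec_at_ch Ux0 cch (@csecP _ _ _ h x0).
near=> x.
have Ux : U x by near: x; exact: nearU.
have kx : k < fnorm (u x) by near: x.
have kx0 : k < fnorm (u x0) by rewrite -[ltRHS](subrK k) kE ltrDl.
rewrite -(subrKA (ch (vpt ((h : csection V) x0)))) (le_lt_trans (ler_normD _ _))//.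
rewrite -(subrKA (ch (vpt ((h : csection V) x))) (ch (vpt ((h : csection V) x0)))).
rewrite eE [e1]split5 rmorphD/= ltrD//; first by rewrite -normcRe ltcR hm'.
rewrite (le_lt_trans (ler_normD _ _))// rmorphD/= ltrD//.
  by near: x.
by rewrite distrC -normcRe ltcR hm'.
Unshelve. all: by end_near. Qed.

Lemma Gamma_complete (F : set_system T) : ProperFilter F -> cauchy F -> cvg F.
Proof.
move=> FF cF; pose mP x := cid (Gamma_pointwise FF cF x).
pose m x := projT1 (mP x).
have mF x : forall e : R, 0 < e ->
    \forall s \near F, fnorm (m x - (s : csection V) x) < e.
  exact: (projT2 (mP x)).
pose M : T := CSection (Gamma_limit_continuous FF cF mF).
apply/cvg_ex; exists M.
apply: (@sup_normed_cvg R X cX T (fun s x => fnorm ((s : csection V) x))) => //.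
- by move=> s; exact: csec_fnorm_cont.
- by move=> s t x; exact: fnormD.
Qed.

HB.instance Definition _ := Uniform_isComplete.Build T Gamma_complete.

End GammaNorm.

Record homeo (X : topologicalType) := Homeo {
  homeo_fun :> X -> X;
  homeo_inv : X -> X;
  homeo_continuous : continuous homeo_fun;
  homeo_inv_continuous : continuous homeo_inv;
  homeoK : cancel homeo_fun homeo_inv;
  homeoVK : cancel homeo_inv homeo_fun
}.

Definition homeo_pow (X : topologicalType) (alpha : homeo X) (n : int) : X -> X :=
  match n with
  | Posz k => iter k alpha
  | Negz k => iter k.+1 (homeo_inv alpha)
  end.

Definition minimal (X : topologicalType) (alpha : homeo X) :=
  forall E : set X, closed E -> alpha @` E `<=` E -> E = set0 \/ E = setT.

Definition meets_orbits_at_most_once (X : topologicalType) (alpha : homeo X)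
    (Y : set X) :=
  forall n : int, n != 0 -> (homeo_pow alpha n @` Y) `&` Y = set0.

(* Covering dimension: every finite open cover U has a finite open refinement V
   such that every point lies in at most n + 1 members of V. *)
Definition covering_dim_le (X : topologicalType) (n : nat) :=
  forall m (U : 'I_m -> set X), (forall i, open (U i)) ->
    \bigcup_i U i = setT ->
    exists k (V : 'I_k -> set X),
      [/\ (forall j, open (V j)), \bigcup_j V j = setT,
          (forall j, exists i, V j `<=` U i) &
          forall x, (#|[set j : 'I_k | `[< V j x >]]%SET| <= n.+1)%N].

Section GammaHilbert.
Variables (R : realType) (X : topologicalType) (cX : compact [set: X]).
Variable V : line_bundle R X.
Local Notation A := (CX R cX).
Local Notation T := (Gamma cX V).
Implicit Types (s t : T) (f g : A).

Lemma herm_cont (s t : csection V) : continuous (fun x => herm (s x) (t x)).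
Proof. by move=> x; apply: herm_sec_continuous; exact: csecP. Qed.

Definition Gamma_dot s t : A := MkCfun (@herm_cont s t).
Definition Gamma_ract s f : T := csecM f s.

Lemma Gamma_ractDl s t f : Gamma_ract (s + t) f = Gamma_ract s f + Gamma_ract t f.
Proof. by apply: csectionP => x /=; rewrite scalerDr. Qed.
Lemma Gamma_ractDr s f g : Gamma_ract s (f + g) = Gamma_ract s f + Gamma_ract s g.
Proof. by apply: csectionP => x /=; rewrite scalerDl. Qed.
Lemma Gamma_ractZl (c : R[i]) s f : Gamma_ract (c *: s) f = c *: Gamma_ract s f.
Proof. by apply: csectionP => x /=; rewrite !scalerA mulrC. Qed.
Lemma Gamma_ractZr (c : R[i]) s f : Gamma_ract s (c *: f) = c *: Gamma_ract s f.
Proof. by apply: csectionP => x /=; rewrite scalerA. Qed.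
Lemma Gamma_ractM s f g : Gamma_ract s (cmul f g) = Gamma_ract (Gamma_ract s f) g.
Proof. by apply: csectionP => x /=; rewrite scalerA mulrC. Qed.

Lemma herm0r x (v : vfibre V x) : herm v 0 = 0.
Proof.
have := herm_linear v 1 0 0; rewrite scale1r addr0 mul1r => h.
by apply/(addrI (herm v 0)); rewrite -h addr0.
Qed.
Lemma hermZr x (v w : vfibre V x) c : herm v (c *: w) = c * herm v w.
Proof. by rewrite -[c *: w]addr0 herm_linear herm0r addr0. Qed.

Lemma Gamma_dot_linear s (c : R[i]) t u :
  Gamma_dot s (c *: t + u) = c *: Gamma_dot s t + Gamma_dot s u.
Proof. by apply: CfunP => x /=; exact: herm_linear. Qed.
Lemma Gamma_dot_ract s t f : Gamma_dot s (Gamma_ract t f) = cmul (Gamma_dot s t) f.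
Proof. by apply: CfunP => x /=; rewrite hermZr mulrC. Qed.
Lemma Gamma_dotC s t : cstar (Gamma_dot s t) = Gamma_dot t s.
Proof. by apply: CfunP => x /=; rewrite -hermC. Qed.

Lemma fnormC_cont (s : csection V) : continuous (fun x => (fnorm (s x))%:C).
Proof.
move=> x; apply: (@continuous_comp _ _ _ (fun x => fnorm (s x)) (real_complex R)).
  exact: csec_fnorm_cont.
exact: real_complex_continuous.
Qed.

Lemma Gamma_dot_pos s : positive_elt (Gamma_dot s s).
Proof.
exists (MkCfun (@fnormC_cont s) : A); apply: CfunP => x.
transitivity ((fnorm ((s : csection V) x) ^+ 2)%:C); first by rewrite fnorm_sqr.
by rewrite expr2 rmorphM; congr (_ * _); rewrite -[LHS]conjc_real.
Qed.

Lemma Gamma_dot_norm s : `|s| ^+ 2 = `|Gamma_dot s s|.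
Proof.
rewrite Gamma_normE CX_normE -rmorphXn -(supnorm_sqr cX)/=; last 2 first.
- exact: csec_fnorm_cont.
- by move=> x; exact: fnorm_ge0.
congr (supnorm _)%:C; apply/funext => x /=.
by apply: (@complexI R); rewrite normcRe fnorm_sqr ger0_norm ?herm_ge0.
Qed.

HB.instance Definition _ := isHilbertModule.Build R A T
  Gamma_ractDl Gamma_ractDr Gamma_ractZl Gamma_ractZr Gamma_ractM
  Gamma_dot_linear Gamma_dot_ract Gamma_dotC Gamma_dot_pos Gamma_dot_norm.

Variable alpha : homeo X.

Lemma Cfun_comp_cont (f : Cfun R X) : continuous (f \o alpha).
Proof.
by move=> x; apply: continuous_comp; [exact: homeo_continuous|exact: cfunP].
Qed.

Definition Gamma_lact f s : T := Gamma_ract s (MkCfun (@Cfun_comp_cont f) : A).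

Lemma Gamma_lact_linear (c : R[i]) f g s :
  Gamma_lact (c *: f + g) s = c *: Gamma_lact f s + Gamma_lact g s.
Proof. by apply: csectionP => x /=; rewrite scalerDl scalerA. Qed.
Lemma Gamma_lactM f g s : Gamma_lact (cmul f g) s = Gamma_lact f (Gamma_lact g s).
Proof. by apply: csectionP => x /=; rewrite scalerA. Qed.
Lemma Gamma_lact_adjoint f s t :
  hdot (Gamma_lact f s) t = hdot s (Gamma_lact (cstar f) t) :> A.
Proof. by apply: CfunP => x /=; rewrite hermC !hermZr rmorphM/= -hermC. Qed.

(* The correspondence Gamma(V, alpha) over C(X), with f xi = xi (f \o alpha). *)
Definition Gamma_corr : correspondence A :=
  Correspondence Gamma_lact_linear Gamma_lactM Gamma_lact_adjoint.

End GammaHilbert.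

(* A closed subspace invariant under both actions; with the restricted
   operations it is again a correspondence, [sub_corr]. *)
Record subcorrespondence (R : realType) (A : cstarAlgType R)
    (E : correspondence A) := SubCorrespondence {
  sub_set : set E;
  sub_closed : closed sub_set;
  sub0 : sub_set 0;
  sub_comb : forall (c : R[i]) xi eta,
    sub_set xi -> sub_set eta -> sub_set (c *: xi + eta);
  sub_ract : forall xi a, sub_set xi -> sub_set (ract xi a);
  sub_lact : forall a xi, sub_set xi -> sub_set (lact a xi)
}.

Section SubCorr.
Variables (R : realType) (A : cstarAlgType R) (E : correspondence A).
Variable S : subcorrespondence E.

Record sub_elt := SubElt { sub_val :> E; sub_valP : sub_set S sub_val }.

HB.instance Definition _ := gen_eqMixin sub_elt.
HB.instance Definition _ := gen_choiceMixin sub_elt.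

Lemma sub_eltP (x y : sub_elt) : x = y :> E -> x = y.
Proof.
case: x y => [x Sx] [y Sy] /= xy; rewrite xy in Sx *.
by rewrite (Prop_irrelevance Sx Sy).
Qed.

Lemma subD_subproof (x y : sub_elt) : sub_set S ((x : E) + (y : E)).
Proof. by rewrite -[(x : E)]scale1r; apply: sub_comb; exact: sub_valP. Qed.
Lemma subZ_subproof (c : R[i]) (x : sub_elt) : sub_set S (c *: (x : E)).
Proof. by rewrite -[_ *: _]addr0; apply: sub_comb; [exact: sub_valP|exact: sub0]. Qed.
Lemma subN_subproof (x : sub_elt) : sub_set S (- (x : E)).
Proof. by rewrite -scaleN1r; exact: subZ_subproof. Qed.

Definition sub_zero := SubElt (sub0 S).
Definition sub_add x y := SubElt (subD_subproof x y).
Definition sub_opp x := SubElt (subN_subproof x).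
Definition sub_scale c x := SubElt (subZ_subproof c x).

Lemma sub_addA : associative sub_add.
Proof. by move=> x y z; apply: sub_eltP; rewrite /= addrA. Qed.
Lemma sub_addC : commutative sub_add.
Proof. by move=> x y; apply: sub_eltP; rewrite /= addrC. Qed.
Lemma sub_add0 : left_id sub_zero sub_add.
Proof. by move=> x; apply: sub_eltP; rewrite /= add0r. Qed.
Lemma sub_addN : left_inverse sub_zero sub_opp sub_add.
Proof. by move=> x; apply: sub_eltP; rewrite /= addNr. Qed.
HB.instance Definition _ :=
  GRing.isZmodule.Build sub_elt sub_addA sub_addC sub_add0 sub_addN.

Lemma sub_scaleA a b x : sub_scale a (sub_scale b x) = sub_scale (a * b) x.
Proof. by apply: sub_eltP; rewrite /= scalerA. Qed.
Lemma sub_scale1 : left_id 1 sub_scale.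
Proof. by move=> x; apply: sub_eltP; rewrite /= scale1r. Qed.
Lemma sub_scaleDr : right_distributive sub_scale +%R.
Proof. by move=> c x y; apply: sub_eltP; rewrite /= scalerDr. Qed.
Lemma sub_scaleDl x : {morph sub_scale^~ x : a b / a + b}.
Proof. by move=> a b; apply: sub_eltP; rewrite /= scalerDl. Qed.
HB.instance Definition _ := GRing.Zmodule_isLmodule.Build R[i] sub_elt
  sub_scaleA sub_scale1 sub_scaleDr sub_scaleDl.

Definition sub_norm (x : sub_elt) : R[i] := `|(x : E)|.
Lemma sub_normD x y : sub_norm (x + y) <= sub_norm x + sub_norm y.
Proof. exact: ler_normD. Qed.
Lemma sub_normZ (c : R[i]) x : sub_norm (c *: x) = `|c| * sub_norm x.
Proof. exact: normrZ. Qed.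
Lemma sub_norm_eq0 x : sub_norm x = 0 -> x = 0.
Proof. by move=> /normr0_eq0 x0; exact: sub_eltP. Qed.
HB.instance Definition _ :=
  Lmodule_isNormed.Build R[i] sub_elt sub_normD sub_normZ sub_norm_eq0.

Lemma sub_complete (F : set_system sub_elt) : ProperFilter F -> cauchy F -> cvg F.
Proof.
move=> FF /cauchy_ballP cF.
have : cvg (sub_val @ F).
  apply: (@cauchy_cvg _ _ (fmap_proper_filter _ FF)).
  apply/cauchy_ballP => e e0.
  have [[B1 B2] [/= FB1 FB2] BB] := cF _ e0.
  exists (sub_val @` B1, sub_val @` B2) => /=.
    by split; [apply: filterS FB1 => f Af|apply: filterS FB2 => f Bf]; exists f.
  move=> [_ _] [/= [f Af <-] [g Bg <-]].
  by have := BB (f, g) (conj Af Bg); rewrite -!ball_normE.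
move=> /cvg_ex[l lP].
have Sl : sub_set S l.
  apply: (@sub_closed _ _ _ S); move=> B nB.
  have /filter_ex[x Bx] : F (sub_val @^-1` B) by exact: lP.
  by exists (sub_val x); split; [exact: (sub_valP x)|exact: Bx].
apply/cvg_ex; exists (SubElt Sl); apply/cvgrPdist_lt => e e0.
by move/cvgrPdist_lt : lP => /(_ _ e0).
Qed.
HB.instance Definition _ := Uniform_isComplete.Build sub_elt sub_complete.

Definition sub_ract_op (x : sub_elt) a := SubElt (sub_ract a (sub_valP x)).
Definition sub_lact_op a (x : sub_elt) := SubElt (sub_lact a (sub_valP x)).
Definition sub_dot (x y : sub_elt) : A := hdot (x : E) (y : E).

Lemma sub_ractDl x y a : sub_ract_op (x + y) a = sub_ract_op x a + sub_ract_op y a.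
Proof. by apply: sub_eltP; exact: ractDl. Qed.
Lemma sub_ractDr x a b : sub_ract_op x (a + b) = sub_ract_op x a + sub_ract_op x b.
Proof. by apply: sub_eltP; exact: ractDr. Qed.
Lemma sub_ractZl (c : R[i]) x a : sub_ract_op (c *: x) a = c *: sub_ract_op x a.
Proof. by apply: sub_eltP; exact: ractZl. Qed.
Lemma sub_ractZr (c : R[i]) x a : sub_ract_op x (c *: a) = c *: sub_ract_op x a.
Proof. by apply: sub_eltP; exact: ractZr. Qed.
Lemma sub_ractM x a b : sub_ract_op x (cmul a b) = sub_ract_op (sub_ract_op x a) b.
Proof. by apply: sub_eltP; exact: ractM. Qed.
Lemma sub_dot_linear x (c : R[i]) y z :
  sub_dot x (c *: y + z) = c *: sub_dot x y + sub_dot x z.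
Proof. exact: hdot_linear. Qed.
Lemma sub_dot_ract x y a : sub_dot x (sub_ract_op y a) = cmul (sub_dot x y) a.
Proof. exact: hdot_ract. Qed.
Lemma sub_dotC x y : cstar (sub_dot x y) = sub_dot y x.
Proof. exact: hdotC. Qed.
Lemma sub_dot_pos x : positive_elt (sub_dot x x).
Proof. exact: hdot_pos. Qed.
Lemma sub_dot_norm x : `|x| ^+ 2 = `|sub_dot x x|.
Proof. exact: hdot_norm. Qed.
HB.instance Definition _ := isHilbertModule.Build R A sub_elt
  sub_ractDl sub_ractDr sub_ractZl sub_ractZr sub_ractM
  sub_dot_linear sub_dot_ract sub_dotC sub_dot_pos sub_dot_norm.

Lemma sub_lact_linear (c : R[i]) a b x :
  sub_lact_op (c *: a + b) x = c *: sub_lact_op a x + sub_lact_op b x.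
Proof. by apply: sub_eltP; exact: lact_linear. Qed.
Lemma sub_lactM a b x : sub_lact_op (cmul a b) x = sub_lact_op a (sub_lact_op b x).
Proof. by apply: sub_eltP; exact: lactM. Qed.
Lemma sub_lact_adjoint a x y :
  hdot (sub_lact_op a x) y = hdot x (sub_lact_op (cstar a) y) :> A.
Proof. exact: lact_adjoint. Qed.

Definition sub_corr : correspondence A :=
  Correspondence sub_lact_linear sub_lactM sub_lact_adjoint.

End SubCorr.

(* A map that is Lipschitz and preserves a set preserves its closure. *)
Lemma closure_lipschitz (K : numFieldType) (W : normedModType K) (S : set W)
    (T : W -> W) (M : K) :
  (forall x, S x -> S (T x)) -> (forall x y, `|T x - T y| <= M * `|x - y|) ->
  0 <= M -> forall x, closure S x -> closure S (T x).
Proof.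
move=> ST TM M0 x clx B /nbhs_ballP[e /= e0 eB].
have e0' : 0 < e / (M + 1) by rewrite divr_gt0// ltr_wpDl.
have [y [Sy]] := clx _ (nbhsx_ballx x _ e0').
rewrite -ball_normE /ball_/= ltr_pdivlMr ?ltr_wpDl// => xy.
exists (T y); split; first exact: ST.
apply: eB; rewrite -ball_normE /ball_/= (le_lt_trans (TM _ _))//.
by apply: le_lt_trans xy; rewrite mulrC ler_wpM2l// lerDl.
Qed.

Lemma closure_add (K : numFieldType) (W : normedModType K) (S : set W) :
  (forall x y, S x -> S y -> S (x + y)) ->
  forall x y, closure S x -> closure S y -> closure S (x + y).
Proof.
move=> SD x y clx cly B /nbhs_ballP[e /= e0 eB].
have e20 : 0 < e / 2%:R by rewrite divr_gt0// ltr0n.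
have [x' [Sx']] := clx _ (nbhsx_ballx x _ e20).
have [y' [Sy']] := cly _ (nbhsx_ballx y _ e20).
rewrite -!ball_normE /ball_/= => yy xx.
exists (x' + y'); split; first exact: SD.
apply: eB; rewrite -ball_normE /ball_/= opprD addrACA.
by rewrite (le_lt_trans (ler_normD _ _))// [e]splitr ltrD.
Qed.

Section EY.
Variables (R : realType) (X : topologicalType) (cX : compact [set: X]).
Variables (V : line_bundle R X) (alpha : homeo X) (Y : set X).
Local Notation A := (CX R cX).
Local Notation E := (Gamma_corr cX V alpha).

(* C_0(X \ Y), regarded as an ideal of C(X). *)
Definition C0_off : set A := [set f | forall y, Y y -> (f : Cfun R X) y = 0].

Definition EY_span : set E :=
  [set xi | exists s : seq (A * E),
     (forall p, p \in s -> C0_off p.1) /\ xi = \sum_(p <- s) lact p.1 p.2].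

Lemma EY_span_ind (T : E -> E) :
  T 0 = 0 -> (forall x y, T (x + y) = T x + T y) ->
  (forall f xi, C0_off f -> exists g eta, C0_off g /\ T (lact f xi) = lact g eta) ->
  forall x, EY_span x -> EY_span (T x).
Proof.
move=> T0 TD Tf _ [s [sY ->]]; elim: s sY => [|[f xi] s IH] sY.
  by rewrite big_nil T0; exists [::]; split => //; rewrite big_nil.
have [|t [tY tE]] := IH; first by move=> p ps; apply: sY; rewrite inE ps orbT.
have [|g [eta [gY gE]]] := Tf f xi; first by apply: (sY (f, xi)); rewrite inE eqxx.
exists ((g, eta) :: t); split.
  by move=> p; rewrite inE => /predU1P[->//|]; exact: tY.
by rewrite !big_cons TD gE tE.
Qed.

Lemma EY_span_add x y : EY_span x -> EY_span y -> EY_span (x + y).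
Proof.
move=> [s [sY ->]] [t [tY ->]]; exists (s ++ t); split; last by rewrite big_cat.
by move=> p; rewrite mem_cat => /orP[/sY|/tY].
Qed.

Lemma EY_span0 : EY_span 0.
Proof. by exists [::]; split => //; rewrite big_nil. Qed.

Lemma Gamma_mul_norm (f : Cfun R X) (s : Gamma cX V) (h : X -> X) :
  continuous (f \o h) ->
  forall t : Gamma cX V, (forall x, (t : csection V) x = f (h x) *: (s : csection V) x) ->
  `|t| <= `|(f : A)| * `|s|.
Proof.
move=> cfh t tE; rewrite 2!Gamma_normE CX_normE -rmorphM lecR.
have c1 : continuous (fun x => complex.Re `|f x|) by exact: Cfun_norm_cont.
have n1 : forall x, 0 <= complex.Re `|f x| by move=> x; exact: Re_norm_ge0.
have c2 : continuous (fun x => fnorm ((s : csection V) x)) by exact: csec_fnorm_cont.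
have n2 : forall x, 0 <= fnorm ((s : csection V) x) by move=> x; exact: fnorm_ge0.
apply: supnorm_le => [|x]; first by apply: mulr_ge0; exact: (supnorm_ge0 cX).
rewrite tE fnormZ; apply: ler_pM => //.
  exact: (supnorm_ub cX (h x) c1).
exact: (supnorm_ub cX x c2).
Qed.

Definition EY_set : set E := closure EY_span.

Lemma EY_scale (c : R[i]) x : EY_set x -> EY_set (c *: x).
Proof.
apply: (@closure_lipschitz _ _ _ (fun x : E => c *: x) `|c|) => //.
  apply: EY_span_ind => [|u w|f xi fY]; rewrite ?scaler0 ?scalerDr//.
  exists f, (c *: xi); split => //; apply: csectionP => y /=.
  by rewrite !scalerA mulrC.
by move=> u w; rewrite -scalerBr normrZ.
Qed.

Lemma EY_comb (c : R[i]) x y : EY_set x -> EY_set y -> EY_set (c *: x + y).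
Proof.
by move=> /(@EY_scale c) cx cy; apply: closure_add => //; exact: EY_span_add.
Qed.

Lemma EY_ract x (a : A) : EY_set x -> EY_set (ract x a).
Proof.
apply: (@closure_lipschitz _ _ _ (fun x : E => ract x a) `|a|) => //.
  apply: EY_span_ind => [|u w|f xi fY].
  - by apply: csectionP => y /=; rewrite scaler0.
  - by rewrite ractDl.
  exists f, (ract xi a); split => //; apply: csectionP => y /=.
  by rewrite !scalerA mulrC.
move=> u w; apply: (@Gamma_mul_norm a (u - w) id); first exact: cfunP.
by move=> y /=; rewrite scalerBr.
Qed.

Lemma EY_lact (a : A) x : EY_set x -> EY_set (lact a x).
Proof.
apply: (@closure_lipschitz _ _ _ (fun x : E => lact a x) `|a|) => //.
  apply: EY_span_ind => [|u w|f xi fY].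
  - by apply: csectionP => y /=; rewrite scaler0.
  - by apply: csectionP => y /=; rewrite scalerDr.
  exists (cmul a f), xi; split; last by rewrite lactM.
  by move=> y Yy /=; rewrite fY// mulr0.
move=> u w; apply: (@Gamma_mul_norm a (u - w) alpha); first exact: Cfun_comp_cont.
by move=> y /=; rewrite scalerBr.
Qed.

Lemma EY_set0 : EY_set 0.
Proof. by apply: subset_closure; exact: EY_span0. Qed.

(* E_Y = C_0(X \ Y) Gamma(V, alpha). *)
Definition EY_sub : subcorrespondence E :=
  @SubCorrespondence R A E EY_set (@closed_closure _ _)
    EY_set0 EY_comb EY_ract EY_lact.

Definition EY : correspondence A := sub_corr EY_sub.

End EY.

(* Main.v *)
Require Import Defs.
From HB Require Import structures.
From mathcomp Require Import all_boot all_order all_algebra.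
From mathcomp Require Import complex.
From mathcomp Require Import all_classical all_reals.
From mathcomp Require Import topology normedtype realfun.
From mathcomp Require Import zify ring lra.
From Stdlib Require List.
Set Implicit Arguments.
Unset Strict Implicit.
Unset Printing Implicit Defensive.
Import Order.TTheory GRing.Theory Num.Theory.
Import numFieldNormedType.Exports.
Local Open Scope classical_set_scope.
Local Open Scope ring_scope.
Local Open Scope complex_scope.

(** The algebra is generated by C(X) and by elements tau xi that move a point x to alpha x,
    and never across Y. Measured in unit vectors chosen fibrewise, every element is a limit of
    finite sums of homogeneous elements (Hom): moving x to alpha^n x with a coefficient that
    vanishes when the orbit segment crosses a neighbourhood of Y (Kel_dense). Hence on each orbit
    an element looks like a block matrix, one block for each piece of the orbit between two visits
    near Y. By minimality the blocks have bounded size, and the blocks compute the norm (krep_le),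
    detect positivity of sums of squares (positive_sums), and compress to finitely many orbit
    segments by completely positive contractions (compression_ex). The representation pi of
    C(X) is faithful, hence isometric, by minimality (pi_isometric).

    To approximate finitely many homogeneous elements up to eta, cut the orbits near Y by a
    continuous function q: a cut is made where q exceeds 1/2. Blocks of one length whose starting
    points are close to each other carry almost the same matrices, in coordinates given by local
    unimodular sections (good_base_ex). Towers over small bases, weighted by continuous functions,
    give order zero maps S (Smap) from a finite-dimensional algebra; composed with the compression
    they return a times the total weight of the towers (Smap_comp). The weight cannot be 1
    everywhere: where q, or a function deciding to which base a block belongs, is near 1/2, nothing
    can be decided. Since X has dimension d, these functions can be perturbed so that on long orbit
    segments a value near 1/2 is taken at most d times (rarely_half). The number of ambiguous points
    per orbit segment is thus bounded independently of the length of the segment.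

    The ambiguous remainder r is absorbed. Blocks meeting the ambiguous region are cut at random,
    with weights adding up to 1 (cut_sum), and divided into small pieces with boundedly many colours,
    two pieces of one colour being far apart on each orbit (sparse_colouring). For each type of
    block, each level i = 1, ..., k and each colour there is a small marker in the base, prepared in
    advance, and each piece is moved to its marker along the orbit, avoiding Y (castle_ex). The sums
    V_1, ..., V_k of these moves are isometric on the support of r, have orthogonal ranges inside
    the clear towers, and almost commute with the given elements, because a piece and its target
    carry almost the same matrices (row_comm). A second set of towers gets the weight i / k on the
    range of V_i. A product of Givens rotations in the planes spanned by 1 and the V_i, with angles
    depending on r, is a unitary U that shifts r into this chain of levels, so that conjugation by U
    turns the second weight s into s + r up to 3 / k (absorb_spec). Hence S_0 + U^* S_1 U composed
    with the compression is close to the identity, whatever d is: two colours suffice, and the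
    nuclear dimension is at most one. *)

(** * Real-valued norms and continuous real functions *)

Section Nrm.
Variable R : realType.

(** Norms of the framework take values in R[i]; [nrm] is the same norm read in R,
    where inequalities can be handled by linear arithmetic. *)
Definition nrm (V : normedModType R[i]) (v : V) : R := complex.Re `|v|.

Section NormedModule.
Variable V : normedModType R[i].
Implicit Types v w : V.

Lemma nrmE v : `|v| = (nrm v)%:C.
Proof. by rewrite RRe_real// normr_real. Qed.

Lemma nrm_ge0 v : 0 <= nrm v.
Proof. by rewrite -lecR -nrmE normr_ge0. Qed.

Lemma nrm0 : nrm (0 : V) = 0.
Proof. by rewrite /nrm normr0. Qed.

Lemma nrm_eq0 v : nrm v = 0 -> v = 0.
Proof. by move=> v0; apply: normr0_eq0; rewrite nrmE v0. Qed.

Lemma nrm_le0 v : nrm v <= 0 -> v = 0.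
Proof. by move=> v0; apply: nrm_eq0; apply/le_anti; rewrite v0 nrm_ge0. Qed.

Lemma nrmD v w : nrm (v + w) <= nrm v + nrm w.
Proof. by rewrite -lecR rmorphD/= -!nrmE ler_normD. Qed.

Lemma nrmN v : nrm (- v) = nrm v.
Proof. by rewrite /nrm normrN. Qed.

Lemma nrmB v w : nrm (v - w) <= nrm v + nrm w.
Proof. by rewrite -(nrmN w) nrmD. Qed.

Lemma nrm_distC v w : nrm (v - w) = nrm (w - v).
Proof. by rewrite /nrm distrC. Qed.

Lemma nrm_triangle u v w : nrm (v - w) <= nrm (v - u) + nrm (u - w).
Proof. by apply: le_trans (nrmD _ _); rewrite addrA subrK. Qed.

Lemma nrm_sum I (s : seq I) (P : pred I) (F : I -> V) :
  nrm (\sum_(i <- s | P i) F i) <= \sum_(i <- s | P i) nrm (F i).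
Proof.
elim/big_rec2: _ => [|i x y _ xy]; first by rewrite nrm0.
by apply: le_trans (nrmD _ _) _; rewrite lerD2l.
Qed.

Lemma nrm_small v : (forall e : R, 0 < e -> nrm v <= e) -> v = 0.
Proof.
move=> h; apply: nrm_le0; apply/ler_addgt0Pl => e e0.
by rewrite addr0; exact: h.
Qed.

End NormedModule.

Lemma nrmZ (V : normedModType R[i]) (c : R[i]) (v : V) : nrm (c *: v) = nrm c * nrm v.
Proof. by apply: (@complexI R); rewrite rmorphM/= -!nrmE normrZ. Qed.

Lemma nrmCM (c d : R[i]) : nrm (c * d) = nrm c * nrm d.
Proof. by apply: (@complexI R); rewrite rmorphM/= -!nrmE normrM. Qed.

Lemma nrmCX (c : R[i]) n : nrm (c ^+ n) = nrm c ^+ n.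
Proof. by apply: (@complexI R); rewrite rmorphXn/= -!nrmE normrX. Qed.

Lemma nrmC1 : nrm (1 : R[i]) = 1.
Proof. by rewrite /nrm normr1. Qed.

Lemma nrmCJ (c : R[i]) : nrm c^* = nrm c.
Proof. by rewrite /nrm normcJ. Qed.

Lemma nrmCR (x : R) : nrm (x%:C : R[i]) = `|x|.
Proof. by rewrite /nrm normc_def /= expr0n/= addr0 sqrtr_sqr. Qed.

Lemma conjM_nrm (c : R[i]) : c^* * c = ((nrm c) ^+ 2)%:C.
Proof. by rewrite mulrC -normCK nrmE -rmorphXn. Qed.

Lemma conjC_real (x : R) : (x%:C : R[i])^* = x%:C.
Proof. exact: conjc_real. Qed.

Section CStar.
Variable A : cstarAlgType R.
Implicit Types a b : A.

Lemma nrm_mul a b : nrm (cmul a b) <= nrm a * nrm b.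
Proof. by rewrite -lecR rmorphM/= -!nrmE cnormM. Qed.

Lemma nrm_sq a : nrm (cmul (cstar a) a) = nrm a ^+ 2.
Proof. by apply: (@complexI R); rewrite rmorphXn/= -!nrmE cnorm_star. Qed.

Lemma cmul0l a : cmul 0 a = 0.
Proof. by rewrite -{1}(scale0r (0 : A)) cmulZl scale0r. Qed.

Lemma cmul0r a : cmul a 0 = 0.
Proof. by rewrite -{1}(scale0r (0 : A)) cmulZr scale0r. Qed.

Lemma cmulNl a b : cmul (- a) b = - cmul a b.
Proof. by rewrite -scaleN1r cmulZl scaleN1r. Qed.

Lemma cmulNr a b : cmul a (- b) = - cmul a b.
Proof. by rewrite -scaleN1r cmulZr scaleN1r. Qed.

Lemma cmulBl a b c : cmul (a - b) c = cmul a c - cmul b c.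
Proof. by rewrite cmulDl cmulNl. Qed.

Lemma cmulBr a b c : cmul a (b - c) = cmul a b - cmul a c.
Proof. by rewrite cmulDr cmulNr. Qed.

Lemma cmul_suml I (s : seq I) (P : pred I) (F : I -> A) a :
  cmul (\sum_(i <- s | P i) F i) a = \sum_(i <- s | P i) cmul (F i) a.
Proof. by elim/big_rec2: _ => [|i x y _ <-]; rewrite ?cmul0l ?cmulDl. Qed.

Lemma cmul_sumr I (s : seq I) (P : pred I) (F : I -> A) a :
  cmul a (\sum_(i <- s | P i) F i) = \sum_(i <- s | P i) cmul a (F i).
Proof. by elim/big_rec2: _ => [|i x y _ <-]; rewrite ?cmul0r ?cmulDr. Qed.

Lemma cstar0 : cstar (0 : A) = 0.
Proof. by rewrite -{1}(scale0r (0 : A)) cstarZ rmorph0 scale0r. Qed.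

Lemma cstarN a : cstar (- a) = - cstar a.
Proof. by rewrite -scaleN1r cstarZ rmorphN rmorph1 scaleN1r. Qed.

Lemma cstarB a b : cstar (a - b) = cstar a - cstar b.
Proof. by rewrite cstarD cstarN. Qed.

Lemma cstar_sum I (s : seq I) (P : pred I) (F : I -> A) :
  cstar (\sum_(i <- s | P i) F i) = \sum_(i <- s | P i) cstar (F i).
Proof. by elim/big_rec2: _ => [|i x y _ <-]; rewrite ?cstar0 ?cstarD. Qed.

Lemma nrm_star a : nrm (cstar a) = nrm a.
Proof.
have h b : nrm b <= nrm (cstar b).
  have [->|/eqP b0] := eqVneq (nrm b) 0; first exact: nrm_ge0.
  have bp : 0 < nrm b by rewrite lt_neqAle eq_sym nrm_ge0 andbT; apply/eqP.
  by rewrite -(ler_pM2r bp) -expr2 -nrm_sq nrm_mul.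
by apply/le_anti; rewrite h -{2}(cstarK a) h.
Qed.

End CStar.

Lemma is_linear0 (V W : lmodType R[i]) (f : V -> W) : is_linear f -> f 0 = 0.
Proof. by move=> h; have := h (-1) 0 0; rewrite scaleN1r addNr scaleN1r addNr. Qed.

Lemma is_linearZ (V W : lmodType R[i]) (f : V -> W) c x :
  is_linear f -> f (c *: x) = c *: f x.
Proof. by move=> h; rewrite -[c *: x]addr0 h (is_linear0 h) addr0. Qed.

Lemma is_linearD (V W : lmodType R[i]) (f : V -> W) x y :
  is_linear f -> f (x + y) = f x + f y.
Proof. by move=> h; rewrite -{1}[x]scale1r h scale1r. Qed.

Lemma is_linear_sum (V W : lmodType R[i]) (f : V -> W) I (s : seq I) (P : pred I) F :
  is_linear f -> f (\sum_(i <- s | P i) F i) = \sum_(i <- s | P i) f (F i).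
Proof.
move=> h; elim/big_rec2: _ => [|i x y _ <-]; first exact: is_linear0.
by rewrite (is_linearD _ _ h).
Qed.

(** A quantity whose powers of order 2^n exceed those of c by at most a fixed factor
    does not exceed c: this replaces the spectral radius formula. *)
Lemma le_of_powers (x c K : R) : 0 <= x -> 0 <= c ->
  (forall n, x ^+ (2 ^ n) <= K * c ^+ (2 ^ n)) -> x <= c.
Proof.
move=> x0 c0 h; rewrite leNgt; apply/negP => cx.
have xp : 0 < x by exact: le_lt_trans cx.
have [c00|cn0] := eqVneq c 0.
  by have := h 0%N; rewrite expn0 !expr1 c00 mulr0 leNgt xp.
have cp : 0 < c by rewrite lt_neqAle eq_sym cn0.
pose q := x / c.
have q1 : 1 < q by rewrite ltr_pdivlMr// mul1r.
have hq n : q ^+ (2 ^ n) <= K.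
  by rewrite expr_div_n ler_pdivrMr ?exprn_gt0.
have q10 : 0 < q - 1 by rewrite subr_gt0.
have bern n : 1 + n%:R * (q - 1) <= q ^+ n.
  elim: n => [|n IH]; first by rewrite mul0r addr0 expr0.
  rewrite exprS; apply: (@le_trans _ _ (q * (1 + n%:R * (q - 1)))).
    rewrite -[n.+1]addn1 natrD.
    rewrite -subr_ge0 [leRHS](_ : _ = n%:R * (q - 1) ^+ 2); last by ring.
    by rewrite mulr_ge0// sqr_ge0.
  by rewrite ler_wpM2l// ltW// (lt_trans ltr01).
have [n nP] : exists n : nat, K / (q - 1) < n%:R.
  exists (Num.trunc (K / (q - 1))).+1; exact: Num.Theory.truncnS_gt.
have := hq n; apply/negP; rewrite -ltNge.
apply: lt_le_trans (bern _).
rewrite ltr_pdivrMr// in nP; apply: (lt_le_trans nP).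
apply: (@le_trans _ _ ((2 ^ n)%:R * (q - 1))).
  by rewrite ler_pM2r// ler_nat ltnW// ltn_expl.
by rewrite lerDr.
Qed.

End Nrm.

Section RealContinuity.
Variables (R : realType) (T : topologicalType).
Implicit Types f g : T -> R.

Lemma contMax f g : continuous f -> continuous g -> continuous (fun x => Num.max (f x) (g x)).
Proof.
move=> cf cg; have -> : (fun x => Num.max (f x) (g x)) =
    fun x => (f x + g x + `|f x - g x|) / 2 by apply/funext => x; rewrite maxr_absE.
move=> x; apply: cvgM; last exact: cvg_cst.
apply: cvgD; first by apply: cvgD; [exact: cf|exact: cg].
by apply: cvg_norm; apply: cvgB; [exact: cf|exact: cg].
Qed.

Lemma contMin f g : continuous f -> continuous g -> continuous (fun x => Num.min (f x) (g x)).
Proof.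
move=> cf cg; have -> : (fun x => Num.min (f x) (g x)) =
    fun x => (f x + g x - `|f x - g x|) / 2 by apply/funext => x; rewrite minr_absE.
move=> x; apply: cvgM; last exact: cvg_cst.
apply: cvgB; first by apply: cvgD; [exact: cf|exact: cg].
by apply: cvg_norm; apply: cvgB; [exact: cf|exact: cg].
Qed.

Lemma contCst (c : R) : continuous (fun _ : T => c).
Proof. by move=> x; exact: cvg_cst. Qed.
Lemma contD f g : continuous f -> continuous g -> continuous (fun x => f x + g x).
Proof. by move=> cf cg x; apply: cvgD; [exact: cf|exact: cg]. Qed.
Lemma contB f g : continuous f -> continuous g -> continuous (fun x => f x - g x).
Proof. by move=> cf cg x; apply: cvgB; [exact: cf|exact: cg]. Qed.
Lemma contM f g : continuous f -> continuous g -> continuous (fun x => f x * g x).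
Proof. by move=> cf cg x; apply: cvgM; [exact: cf|exact: cg]. Qed.
Lemma contAbs f : continuous f -> continuous (fun x => `|f x|).
Proof. by move=> cf x; apply: cvg_norm; exact: cf. Qed.
Lemma contSqrt f : continuous f -> continuous (fun x => Num.sqrt (f x)).
Proof.
move=> cf x; apply: (@continuous_comp _ _ _ f Num.sqrt); first exact: cf.
exact: sqrt_continuous.
Qed.
Lemma contSum (I : Type) (s : seq I) (P : pred I) (F : I -> T -> R) :
  (forall i, P i -> continuous (F i)) -> continuous (fun x => \sum_(i <- s | P i) F i x).
Proof.
move=> cF; elim: s => [|i s IH].
  by rewrite (_ : (fun x => _) = fun=> 0); [exact: contCst|apply/funext => x; rewrite big_nil].
case Pi : (P i); last first.
  by rewrite (_ : (fun x => _) = fun x => \sum_(j <- s | P j) F j x)//;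
    apply/funext => x; rewrite big_cons Pi.
rewrite (_ : (fun x => _) = fun x => F i x + \sum_(j <- s | P j) F j x); last first.
  by apply/funext => x; rewrite big_cons Pi.
by apply: contD => //; exact: cF.
Qed.
Lemma contProd (I : Type) (s : seq I) (P : pred I) (F : I -> T -> R) :
  (forall i, P i -> continuous (F i)) -> continuous (fun x => \prod_(i <- s | P i) F i x).
Proof.
move=> cF; elim: s => [|i s IH].
  by rewrite (_ : (fun x => _) = fun=> 1); [exact: contCst|apply/funext => x; rewrite big_nil].
case Pi : (P i); last first.
  by rewrite (_ : (fun x => _) = fun x => \prod_(j <- s | P j) F j x)//;
    apply/funext => x; rewrite big_cons Pi.
rewrite (_ : (fun x => _) = fun x => F i x * \prod_(j <- s | P j) F j x); last first.
  by apply/funext => x; rewrite big_cons Pi.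
by apply: contM => //; exact: cF.
Qed.

End RealContinuity.

(** * Finite-dimensional algebras of block matrices *)

Record blockrel (I : finType) := BlockRel {
  brel :> rel I;
  brel_refl : reflexive brel;
  brel_sym : symmetric brel;
  brel_trans : transitive brel
}.

Section BlockMatrices.
Variables (R : realType) (I : finType) (e : blockrel I).

(** Matrices indexed by I whose entries vanish outside the relation e: the finite
    direct sum of full matrix algebras, one for each class of e. *)
Record bmx := BMx { bent :> I -> I -> R[i]; bentP : forall i j, ~~ e i j -> bent i j = 0 }.

HB.instance Definition _ := gen_eqMixin bmx.
HB.instance Definition _ := gen_choiceMixin bmx.

Lemma bmxP (a b : bmx) : (forall i j, a i j = b i j) -> a = b.
Proof.
case: a b => [a aP] [b bP] /= ab.
have {}ab : a = b by apply/funext => i; apply/funext => j; exact: ab.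
by rewrite ab in aP *; rewrite (Prop_irrelevance aP bP).
Qed.

Definition bmx0 := @BMx (fun _ _ => 0) (fun _ _ _ => erefl).
Lemma bmxD_subproof (a b : bmx) i j : ~~ e i j -> a i j + b i j = 0.
Proof. by move=> h; rewrite !bentP// addr0. Qed.
Definition bmxD a b := BMx (@bmxD_subproof a b).
Lemma bmxN_subproof (a : bmx) i j : ~~ e i j -> - a i j = 0.
Proof. by move=> h; rewrite bentP// oppr0. Qed.
Definition bmxN a := BMx (@bmxN_subproof a).
Lemma bmxZ_subproof c (a : bmx) i j : ~~ e i j -> c * a i j = 0.
Proof. by move=> h; rewrite bentP// mulr0. Qed.
Definition bmxZ c a := BMx (@bmxZ_subproof c a).
Lemma bmxM_subproof (a b : bmx) i j : ~~ e i j -> \sum_l a i l * b l j = 0.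
Proof.
move=> h; apply: big1 => l _; have [il|il] := boolP (e i l); last by rewrite bentP ?mul0r.
by rewrite (@bentP b) ?mulr0//; apply: contra h; exact: brel_trans.
Qed.
Definition bmxM a b := BMx (@bmxM_subproof a b).
Lemma bmxS_subproof (a : bmx) i j : ~~ e i j -> (a j i)^* = 0.
Proof. by move=> h; rewrite bentP ?rmorph0// brel_sym. Qed.
Definition bmxS a := BMx (@bmxS_subproof a).

Lemma bmxDA : associative bmxD.
Proof. by move=> a b c; apply: bmxP => i j; rewrite /= addrA. Qed.
Lemma bmxDC : commutative bmxD.
Proof. by move=> a b; apply: bmxP => i j; rewrite /= addrC. Qed.
Lemma bmxD0 : left_id bmx0 bmxD.
Proof. by move=> a; apply: bmxP => i j; rewrite /= add0r. Qed.
Lemma bmxDN : left_inverse bmx0 bmxN bmxD.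
Proof. by move=> a; apply: bmxP => i j; rewrite /= addNr. Qed.
HB.instance Definition _ := GRing.isZmodule.Build bmx bmxDA bmxDC bmxD0 bmxDN.

Lemma bmxZA c d a : bmxZ c (bmxZ d a) = bmxZ (c * d) a.
Proof. by apply: bmxP => i j; rewrite /= mulrA. Qed.
Lemma bmxZ1 : left_id 1 bmxZ.
Proof. by move=> a; apply: bmxP => i j; rewrite /= mul1r. Qed.
Lemma bmxZDr : right_distributive bmxZ +%R.
Proof. by move=> c a b; apply: bmxP => i j; rewrite /= mulrDr. Qed.
Lemma bmxZDl a : {morph bmxZ^~ a : c d / c + d}.
Proof. by move=> c d; apply: bmxP => i j; rewrite /= mulrDl. Qed.
HB.instance Definition _ :=
  GRing.Zmodule_isLmodule.Build R[i] bmx bmxZA bmxZ1 bmxZDr bmxZDl.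

Implicit Types (a b m : I -> I -> R[i]) (x y : I -> R[i]).

Definition vsq x : R := \sum_i nrm (x i) ^+ 2.
Definition bil m x y : R[i] := \sum_i \sum_j (x i)^* * m i j * y j.
Definition mxv m y : I -> R[i] := fun i => \sum_j m i j * y j.

Lemma vsq_ge0 x : 0 <= vsq x.
Proof. by apply: sumr_ge0 => i _; rewrite sqr_ge0. Qed.

Lemma vsq_le x i : nrm (x i) ^+ 2 <= vsq x.
Proof.
rewrite /vsq (bigD1 i)//= lerDl; apply: sumr_ge0 => j _; exact: sqr_ge0.
Qed.

Lemma vsq_eq0 x : vsq x = 0 -> forall i, x i = 0.
Proof.
move=> x0 i; apply: nrm_le0; have := vsq_le x i; rewrite x0.
by rewrite -sqrf_eq0'' || (move=> h; rewrite -(@ler_pXn2r _ 2%N)// ?nnegrE ?nrm_ge0// expr0n).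
Qed.

Lemma vsqZ c x : vsq (fun i => c * x i) = nrm c ^+ 2 * vsq x.
Proof. by rewrite /vsq mulr_sumr; apply: eq_bigr => i _; rewrite nrmCM exprMn. Qed.

Lemma bilE m x y : bil m x y = \sum_i (x i)^* * mxv m y i.
Proof.
by apply: eq_bigr => i _; rewrite mulr_sumr; apply: eq_bigr => j _; rewrite mulrA.
Qed.

Lemma bilZl m c x y : bil m (fun i => c * x i) y = c^* * bil m x y.
Proof.
rewrite !bilE mulr_sumr; apply: eq_bigr => i _.
by rewrite rmorphM/= mulrA.
Qed.

Lemma bilZr m c x y : bil m x (fun i => c * y i) = c * bil m x y.
Proof.
rewrite /bil mulr_sumr; apply: eq_bigr => i _; rewrite mulr_sumr.
by apply: eq_bigr => j _; rewrite mulrCA.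
Qed.

Lemma ball_coord x i : vsq x <= 1 -> nrm (x i) <= 1.
Proof.
move=> x1; rewrite -(@ler_pXn2r _ 2%N)// ?nnegrE ?nrm_ge0// expr1n.
exact: le_trans (vsq_le x i) x1.
Qed.

Lemma bil_le m x y : vsq x <= 1 -> vsq y <= 1 ->
  nrm (bil m x y) <= \sum_i \sum_j nrm (m i j).
Proof.
move=> x1 y1; apply: le_trans (nrm_sum _ _ _) _; apply: ler_sum => i _.
apply: le_trans (nrm_sum _ _ _) _; apply: ler_sum => j _.
rewrite !nrmCM nrmCJ -[leRHS]mulr1; apply: ler_pM; rewrite ?mulr_ge0 ?nrm_ge0//.
  by rewrite -[leRHS]mul1r ler_pM ?nrm_ge0// ball_coord.
exact: ball_coord.
Qed.

(** The operator norm, as the supremum of the sesquilinear form on unit balls. *)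
Definition opn m : R :=
  sup [set nrm (bil m p.1 p.2) | p in [set p : (I -> R[i]) * (I -> R[i]) |
    vsq p.1 <= 1 /\ vsq p.2 <= 1]].

Lemma vsq0 : vsq (fun=> 0) = 0.
Proof. by apply: big1 => i _; rewrite nrm0 expr0n. Qed.

Lemma opn_has_sup m : has_sup [set nrm (bil m p.1 p.2) | p in
  [set p : (I -> R[i]) * (I -> R[i]) | vsq p.1 <= 1 /\ vsq p.2 <= 1]].
Proof.
split; first by exists (nrm (bil m (fun=> 0) (fun=> 0))), (fun=> 0, fun=> 0) => //=; rewrite vsq0.
by exists (\sum_i \sum_j nrm (m i j)) => _ [[x y] /= [x1 y1] <-]; exact: bil_le.
Qed.

Lemma opn_ub m x y : vsq x <= 1 -> vsq y <= 1 -> nrm (bil m x y) <= opn m.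
Proof.
by move=> x1 y1; apply: sup_upper_bound; [exact: opn_has_sup|exists (x, y)].
Qed.

Lemma opn_le m c : (forall x y, vsq x <= 1 -> vsq y <= 1 -> nrm (bil m x y) <= c) ->
  opn m <= c.
Proof.
move=> h; apply: ge_sup; first by have [] := opn_has_sup m.
by move=> _ [[x y] /= [x1 y1] <-]; exact: h.
Qed.

Lemma opn_ge0 m : 0 <= opn m.
Proof. by apply: le_trans (nrm_ge0 _) (@opn_ub m (fun=> 0) (fun=> 0) _ _); rewrite vsq0. Qed.

Lemma opn_sum m : opn m <= \sum_i \sum_j nrm (m i j).
Proof. by apply: opn_le => x y; exact: bil_le. Qed.

Definition basis_vec i : I -> R[i] := fun j => (j == i)%:R.

Lemma vsq_basis i : vsq (basis_vec i) = 1.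
Proof.
rewrite /vsq (bigD1 i)//= big1 ?addr0; first by rewrite /basis_vec eqxx nrmC1 expr1n.
by move=> j /negbTE ji; rewrite /basis_vec ji nrm0 expr0n.
Qed.

Lemma mxv_basis m i j : mxv m (basis_vec j) i = m i j.
Proof.
rewrite /mxv (bigD1 j)//= big1 ?addr0; first by rewrite /basis_vec eqxx mulr1.
by move=> l /negbTE lj; rewrite /basis_vec lj mulr0.
Qed.

Lemma bil_basis m i j : bil m (basis_vec i) (basis_vec j) = m i j.
Proof.
rewrite bilE (bigD1 i)//= big1 ?addr0 => [|l /negbTE li].
  by rewrite mxv_basis /basis_vec eqxx rmorph1 mul1r.
by rewrite /basis_vec li rmorph0 mul0r.
Qed.

Lemma opn_entry m i j : nrm (m i j) <= opn m.
Proof. by rewrite -(bil_basis m) opn_ub// vsq_basis. Qed.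

(** Boundedness of the form extends from unit vectors by homogeneity. *)
Lemma bil_bound m x y : nrm (bil m x y) <= opn m * (Num.sqrt (vsq x) * Num.sqrt (vsq y)).
Proof.
have unit z : vsq z != 0 -> vsq (fun i => ((Num.sqrt (vsq z))^-1)%:C * z i) <= 1.
  move=> z0; rewrite vsqZ nrmCR ger0_norm ?invr_ge0 ?sqrtr_ge0// exprVn sqr_sqrtr ?vsq_ge0//.
  by rewrite mulVf.
have zero z : vsq z = 0 -> z = fun=> 0 by move=> z0; apply/funext => i; exact: vsq_eq0.
have scal z : vsq z != 0 ->
    z = fun i => (Num.sqrt (vsq z))%:C * (((Num.sqrt (vsq z))^-1)%:C * z i).
  move=> z0; apply/funext => i; rewrite mulrA -rmorphM/= divff ?mul1r//.
  by rewrite sqrtr_eq0 -ltNge lt_neqAle eq_sym z0 vsq_ge0.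
have [x0|x0] := eqVneq (vsq x) 0.
  rewrite (zero _ x0) bilE big1 ?nrm0 => [|i _]; last by rewrite rmorph0 mul0r.
  by rewrite !mulr_ge0 ?opn_ge0 ?sqrtr_ge0.
have [y0|y0] := eqVneq (vsq y) 0.
  rewrite (zero _ y0) /bil big1 ?nrm0 => [|i _]; last by apply: big1 => j _; rewrite mulr0.
  by rewrite !mulr_ge0 ?opn_ge0 ?sqrtr_ge0.
rewrite {1}(scal _ x0) {1}(scal _ y0) bilZl bilZr !nrmCM nrmCJ !nrmCR.
rewrite !ger0_norm ?sqrtr_ge0// mulrA mulrC ler_wpM2r ?mulr_ge0 ?sqrtr_ge0//.
by rewrite opn_ub ?unit.
Qed.

Lemma bil_mul a b x y : bil (fun i j => \sum_l a i l * b l j) x y = bil a x (mxv b y).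
Proof.
rewrite !bilE; apply: eq_bigr => i _; congr (_ * _).
rewrite /mxv; under eq_bigr do rewrite mulr_suml.
rewrite exchange_big; apply: eq_bigr => l _; rewrite mulr_sumr.
by apply: eq_bigr => j _; rewrite mulrA.
Qed.

Lemma bil_self m y : bil m (mxv m y) y = (vsq (mxv m y))%:C.
Proof.
by rewrite bilE /vsq rmorph_sum; apply: eq_bigr => i _; rewrite conjM_nrm.
Qed.

Lemma mxv_bound m y : Num.sqrt (vsq (mxv m y)) <= opn m * Num.sqrt (vsq y).
Proof.
set t := Num.sqrt _; have t0 : 0 <= t by exact: sqrtr_ge0.
have [->|tn0] := eqVneq t 0; first by rewrite mulr_ge0 ?opn_ge0 ?sqrtr_ge0.
have tp : 0 < t by rewrite lt_neqAle eq_sym tn0.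
rewrite -(ler_pM2r tp) -{2}/t; have := bil_bound m (mxv m y) y.
rewrite bil_self nrmCR ger0_norm ?vsq_ge0// -/t.
have -> : vsq (mxv m y) = t * t by rewrite -expr2 sqr_sqrtr ?vsq_ge0.
by rewrite [t * Num.sqrt _]mulrC mulrA.
Qed.

Lemma opn_mul a b : opn (fun i j => \sum_l a i l * b l j) <= opn a * opn b.
Proof.
apply: opn_le => x y x1 y1; rewrite bil_mul; apply: le_trans (bil_bound _ _ _) _.
rewrite ler_wpM2l ?opn_ge0// -[leRHS]mul1r; apply: ler_pM; rewrite ?sqrtr_ge0//.
  by rewrite -sqrtr1 ler_sqrt.
apply: le_trans (mxv_bound _ _) _; rewrite -[leRHS]mulr1 ler_wpM2l ?opn_ge0//.
by rewrite -sqrtr1 ler_sqrt.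
Qed.

Lemma bil_star m x y : bil (fun i j => (m j i)^*) x y = (bil m y x)^*.
Proof.
rewrite /bil rmorph_sum exchange_big; apply: eq_bigr => j _.
rewrite rmorph_sum; apply: eq_bigr => i _.
rewrite !rmorphM/= conjcK; ring.
Qed.

Lemma opn_star m : opn (fun i j => (m j i)^*) = opn m.
Proof.
have h k : opn (fun i j => (k j i)^*) <= opn k.
  by apply: opn_le => x y x1 y1; rewrite bil_star nrmCJ opn_ub.
apply/le_anti; rewrite h /= -{1}(_ : (fun i j => ((fun i j => (m j i)^*) j i)^*) = m) ?h//.
by apply/funext => i; apply/funext => j /=; rewrite conjcK.
Qed.

Lemma dot_le x y : nrm (\sum_i (x i)^* * y i) <= Num.sqrt (vsq x) * Num.sqrt (vsq y).
Proof.
pose id1 (i j : I) : R[i] := (i == j)%:R.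
have idE z i : mxv id1 z i = z i.
  rewrite /mxv (bigD1 i)//= big1 ?addr0 => [|j /negbTE ji].
    by rewrite /id1 eqxx mul1r.
  by rewrite /id1 eq_sym ji mul0r.
have bilid u v : bil id1 u v = \sum_i (u i)^* * v i.
  by rewrite bilE; apply: eq_bigr => i _; rewrite idE.
rewrite -bilid; apply: le_trans (bil_bound _ _ _) _.
rewrite -[leRHS]mul1r ler_wpM2r ?mulr_ge0 ?sqrtr_ge0//.
apply: opn_le => u v u1 v1; rewrite bilid; apply: le_trans (nrm_sum _ _ _) _.
apply: (@le_trans _ _ ((vsq u + vsq v) / 2)); last by lra.
rewrite /vsq -big_split /= mulr_suml; apply: ler_sum => i _.
rewrite nrmCM nrmCJ; have := sqr_ge0 (nrm (u i) - nrm (v i)); nra.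
Qed.

Lemma opn_C m : opn (fun i j => \sum_l (m l i)^* * m l j) = opn m ^+ 2.
Proof.
apply/le_anti/andP; split.
  apply: le_trans (@opn_mul (fun i j => (m j i)^*) m) _.
  by rewrite opn_star expr2.
set c := (X in _ <= X); have c0 : 0 <= c by exact: opn_ge0.
rewrite -[c]sqr_sqrtr// ler_pXn2r// ?nnegrE ?opn_ge0 ?sqrtr_ge0//.
apply: opn_le => x y x1 y1; rewrite bilE; set w := mxv m y.
have wc : vsq w <= c.
  rewrite -[vsq w]ger0_norm ?vsq_ge0// -nrmCR -bil_self -/w.
  have -> : bil m w y = (bil (fun i j => \sum_l (m l i)^* * m l j) y y)^*.
    by rewrite (@bil_mul (fun i j => (m j i)^*) m) -/w bil_star conjcK.
  by rewrite nrmCJ opn_ub.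
apply: le_trans (dot_le _ _) _; rewrite -[leRHS]mul1r.
apply: ler_pM; rewrite ?sqrtr_ge0// ?ler_wsqrtr//.
by rewrite -sqrtr1 ler_wsqrtr.
Qed.

Definition bmx_norm (a : bmx) : R[i] := (opn a)%:C.

Lemma bilD a b x y : bil (fun i j => a i j + b i j) x y = bil a x y + bil b x y.
Proof.
rewrite /bil -big_split; apply: eq_bigr => i _ /=.
rewrite -big_split; apply: eq_bigr => j _ /=; ring.
Qed.

Lemma bilZ c a x y : bil (fun i j => c * a i j) x y = c * bil a x y.
Proof.
rewrite /bil mulr_sumr; apply: eq_bigr => i _; rewrite mulr_sumr.
apply: eq_bigr => j _ /=; ring.
Qed.

Lemma opnD a b : opn (fun i j => a i j + b i j) <= opn a + opn b.
Proof.
apply: opn_le => x y x1 y1; rewrite bilD; apply: le_trans (nrmD _ _) _.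
by apply: lerD; exact: opn_ub.
Qed.

Lemma opnZ c a : opn (fun i j => c * a i j) = nrm c * opn a.
Proof.
apply/le_anti/andP; split.
  apply: opn_le => x y x1 y1; rewrite bilZ nrmCM ler_wpM2l ?nrm_ge0//; exact: opn_ub.
have [->|c0] := eqVneq c 0; first by rewrite nrm0 mul0r opn_ge0.
have cp : 0 < nrm c.
  by rewrite lt_neqAle nrm_ge0 andbT eq_sym; apply: contra_neq c0; exact: nrm_eq0.
rewrite mulrC -ler_pdivlMr//; apply: opn_le => x y x1 y1.
by rewrite ler_pdivlMr// mulrC -nrmCM -bilZ opn_ub.
Qed.

Lemma bmx_normD (a b : bmx) : bmx_norm (a + b) <= bmx_norm a + bmx_norm b.
Proof. by rewrite /bmx_norm -rmorphD lecR; exact: opnD. Qed.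

Lemma bmx_normZ (c : R[i]) (a : bmx) : bmx_norm (c *: a) = `|c| * bmx_norm a.
Proof. by rewrite /bmx_norm nrmE -rmorphM; congr _%:C; exact: opnZ. Qed.

Lemma bmx_norm_eq0 (a : bmx) : bmx_norm a = 0 -> a = 0.
Proof.
move=> /(@complexI R) a0; apply: bmxP => i j; apply: nrm_le0.
by rewrite -a0; exact: opn_entry.
Qed.

HB.instance Definition _ :=
  Lmodule_isNormed.Build R[i] bmx bmx_normD bmx_normZ bmx_norm_eq0.

Lemma bmx_nrmE (a : bmx) : nrm a = opn a.
Proof. by []. Qed.

Lemma bmx_complete (F : set_system bmx) : ProperFilter F -> cauchy F -> cvg F.
Proof.
move=> FF cF; have /cauchy_ballP cF' := cF.
have ev i j : exists l : R[i], (fun a : bmx => a i j) @ F --> l.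
  apply/cvg_ex; apply: (@cauchy_cvg _ _ (fmap_proper_filter _ FF)).
  apply/cauchy_ballP => r r0.
  have [[A B] [/= FA FB] AB] := cF' _ r0.
  exists ((fun a : bmx => a i j) @` A, (fun a : bmx => a i j) @` B) => /=.
    by split; [apply: filterS FA => f Af|apply: filterS FB => f Bf]; exists f.
  move=> [_ _] [/= [f Af <-] [g Bg <-]].
  have := AB (f, g) (conj Af Bg); rewrite -!ball_normE /ball_/=.
  apply: le_lt_trans; rewrite !nrmE lecR; exact: (opn_entry (f - g) i j).
have [l0 l0P] := choice (fun p : I * I => ev p.1 p.2).
have lP i j : ~~ e i j -> l0 (i, j) = 0.
  move=> ij; have := l0P (i, j) => /=.
  rewrite (_ : (fun a : bmx => a i j) = fun=> 0); last by apply/funext => a; rewrite bentP.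
  by move=> h; apply/esym; apply: (cvg_unique _ (cvg_cst _)) h.
apply/cvg_ex; exists (@BMx (fun i j => l0 (i, j)) lP); apply/cvgrPdist_lt => r r0.
have r0' : 0 < complex.Re r by move: r0; rewrite ltcE => /andP[].
have rE : (complex.Re r)%:C = r by rewrite RRe_real// ger0_real// ltW.
pose k := #|{: I * I}|.+1.
have rk : 0 < (complex.Re r / k%:R)%:C by rewrite ltcR divr_gt0// ltr0n.
have : F [set f : bmx | forall p : I * I, `|l0 p - f p.1 p.2| < (complex.Re r / k%:R)%:C].
  apply: filter_forall => p; move/cvgrPdist_lt : (l0P p); exact.
apply: filterS => a ha; rewrite nrmE -rE ltcR bmx_nrmE.
apply: le_lt_trans (opn_sum _) _; rewrite pair_big /=.
apply: (@le_lt_trans _ _ (\sum_(p : I * I) complex.Re r / k%:R)).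
  apply: ler_sum => -[i j] _ /=; rewrite -lecR -nrmE ltW//; exact: (ha (i, j)).
rewrite sumr_const -[_ *+ _]mulr_natl mulrCA gtr_pMr// ltr_pdivrMr ?ltr0n// mul1r ltr_nat.
by [].
Qed.
HB.instance Definition _ := Uniform_isComplete.Build bmx bmx_complete.

Lemma bmxMA : associative bmxM.
Proof.
move=> a b c; apply: bmxP => i j /=.
under eq_bigr do rewrite mulr_sumr; rewrite exchange_big /=; apply: eq_bigr => k _.
by rewrite mulr_suml; apply: eq_bigr => l _; rewrite mulrA.
Qed.
Lemma bmxMDl : left_distributive bmxM +%R.
Proof.
move=> a b c; apply: bmxP => i j /=; rewrite -big_split; apply: eq_bigr => l _.
by rewrite mulrDl.
Qed.
Lemma bmxMDr : right_distributive bmxM +%R.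
Proof.
move=> a b c; apply: bmxP => i j /=; rewrite -big_split; apply: eq_bigr => l _.
by rewrite mulrDr.
Qed.
Lemma bmxMZl (c : R[i]) (a b : bmx) : bmxM (c *: a) b = c *: bmxM a b.
Proof.
by apply: bmxP => i j /=; rewrite mulr_sumr; apply: eq_bigr => l _; rewrite mulrA.
Qed.
Lemma bmxMZr (c : R[i]) (a b : bmx) : bmxM a (c *: b) = c *: bmxM a b.
Proof.
by apply: bmxP => i j /=; rewrite mulr_sumr; apply: eq_bigr => l _; rewrite mulrCA.
Qed.
Lemma bmxSK : involutive bmxS.
Proof. by move=> a; apply: bmxP => i j /=; rewrite conjcK. Qed.
Lemma bmxSD : {morph bmxS : a b / a + b}.
Proof. by move=> a b; apply: bmxP => i j /=; rewrite rmorphD. Qed.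
Lemma bmxSZ (c : R[i]) (a : bmx) : bmxS (c *: a) = c^* *: bmxS a.
Proof. by apply: bmxP => i j /=; rewrite rmorphM. Qed.
Lemma bmxSM (a b : bmx) : bmxS (bmxM a b) = bmxM (bmxS b) (bmxS a).
Proof.
apply: bmxP => i j /=; rewrite rmorph_sum; apply: eq_bigr => l _.
by rewrite rmorphM mulrC.
Qed.
Lemma bmx_normM (a b : bmx) : `|bmxM a b| <= `|a| * `|b|.
Proof. by rewrite !nrmE -rmorphM lecR; exact: opn_mul. Qed.
Lemma bmx_normS (a : bmx) : `|bmxM (bmxS a) a| = `|a| ^+ 2.
Proof. by rewrite !nrmE -rmorphXn; congr _%:C; exact: opn_C. Qed.

HB.instance Definition _ := isCStarAlgebra.Build R bmx bmxMA bmxMDl bmxMDr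
  bmxMZl bmxMZr bmxSK bmxSD bmxSZ bmxSM bmx_normM bmx_normS.

Lemma bmx_finite_dimensional : finite_dimensional bmx.
Proof.
pose n := #|{: I * I}|.
have dP (p : I * I) i j : ~~ e i j -> ((e p.1 p.2) && ((i, j) == p))%:R = 0 :> R[i].
  by move=> ij; case: eqP => [<-|_]; rewrite ?andbF //= (negbTE ij).
exists n, (fun k => BMx (dP (enum_val k))) => a.
exists (fun k => a (enum_val k).1 (enum_val k).2).
apply: bmxP => i j.
have ev (s : seq 'I_n) (f : 'I_n -> bmx) : (\sum_(k <- s) f k) i j = \sum_(k <- s) f k i j.
  by elim: s => [|k s IH]; rewrite ?big_nil ?big_cons //= IH.
rewrite ev (bigD1 (enum_rank (i, j)))//= enum_rankK /= eqxx andbT big1 ?addr0.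
  by have [ij|ij] := boolP (e i j); rewrite ?mulr1// bentP ?mul0r.
move=> k; rewrite -(inj_eq enum_val_inj) enum_rankK eq_sym => /negbTE ->.
by rewrite andbF mulr0.
Qed.

End BlockMatrices.

(** * Functions on X, and matrices of functions carried by partial isometries *)

Section CXfacts.
Variables (R : realType) (X : topologicalType) (cX : compact [set: X]).
Local Notation A := (CX R cX).

Definition cev (f : A) : X -> R[i] := (f : Cfun R X).
Definition mkC (f : X -> R[i]) (cf : continuous f) : A := MkCfun cf.

Lemma mkCE f (cf : continuous f) : cev (mkC cf) = f. Proof. by []. Qed.
Lemma CXP (f g : A) : (forall x, cev f x = cev g x) -> f = g.
Proof. exact: CfunP. Qed.
Lemma cev_cont (f : A) : continuous (cev f). Proof. exact: cfunP. Qed.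
Lemma cevD (f g : A) x : cev (f + g) x = cev f x + cev g x. Proof. by []. Qed.
Lemma cevB (f g : A) x : cev (f - g) x = cev f x - cev g x. Proof. by []. Qed.
Lemma cevN (f : A) x : cev (- f) x = - cev f x. Proof. by []. Qed.
Lemma cevM (f g : A) x : cev (cmul f g) x = cev f x * cev g x. Proof. by []. Qed.
Lemma cevZ c (f : A) x : cev (c *: f) x = c * cev f x. Proof. by []. Qed.
Lemma cevS (f : A) x : cev (cstar f) x = (cev f x)^*. Proof. by []. Qed.
Lemma cev0 x : cev (0 : A) x = 0. Proof. by []. Qed.
Lemma cev_sum I (s : seq I) (P : pred I) (F : I -> A) x :
  cev (\sum_(i <- s | P i) F i) x = \sum_(i <- s | P i) cev (F i) x.
Proof. by elim/big_rec2: _ => [|i u v _ <-]. Qed.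

Lemma nrm_cev (f : A) x : nrm (cev f x) <= nrm f.
Proof. by rewrite -lecR -!nrmE; exact: CX_norm_ub. Qed.

Lemma nrm_CX_le (f : A) (c : R) : 0 <= c -> (forall x, nrm (cev f x) <= c) -> nrm f <= c.
Proof. by move=> c0 h; exact: supnorm_le. Qed.

Lemma cst_cont (c : R[i]) : continuous (fun _ : X => c).
Proof. by move=> x; exact: cvg_cst. Qed.
Definition cstC c : A := mkC (@cst_cont c).
Definition CX1 : A := cstC 1.

Lemma cont_real (f : X -> R) : continuous f -> continuous (fun x => (f x)%:C).
Proof.
move=> cf x; apply: (@continuous_comp _ _ _ f (real_complex R)); first exact: cf.
exact: real_complex_continuous.
Qed.
Definition rC (f : X -> R) (cf : continuous f) : A := mkC (@cont_real f cf).

Lemma cont_nrm (f : A) : continuous (fun x => nrm (cev f x)).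
Proof. exact: Cfun_norm_cont. Qed.

End CXfacts.

Section MatrixUnits.
Variables (R : realType) (X : topologicalType) (cX : compact [set: X]).
Local Notation A := (CX R cX).
Variables (O : cstarAlgType R) (pi : A -> O).
Hypotheses (pi_hom : star_hom pi) (pi_le : forall f, nrm (pi f) <= nrm f).
Variables (I : finType) (v : I -> O) (D : I -> set X).

Definition vanish_off (B : set X) (f : A) := forall x, ~ B x -> cev f x = 0.

Hypothesis v_orth : forall i j f g, vanish_off (D i) f -> vanish_off (D j) g ->
  cmul (cmul (pi f) (cstar (v i))) (cmul (v j) (pi g)) =
  if i == j then pi (cmul f g) else 0.

Definition adapted (m : I -> I -> A) :=
  forall i j, vanish_off (D i) (m i j) /\ vanish_off (D j) (m i j).

(** Matrices of functions carried into O by the partial isometries v i. *)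
Definition Jmap (m : I -> I -> A) : O :=
  \sum_i \sum_j cmul (cmul (v i) (pi (m i j))) (cstar (v j)).

Definition mmul (m k : I -> I -> A) : I -> I -> A := fun i j => \sum_l cmul (m i l) (k l j).
Definition mstar (m : I -> I -> A) : I -> I -> A := fun i j => cstar (m j i).

Lemma pi_lin : is_linear pi. Proof. by have [] := pi_hom. Qed.
Lemma piM f g : pi (cmul f g) = cmul (pi f) (pi g). Proof. by have [_ + _] := pi_hom; exact. Qed.
Lemma piS f : pi (cstar f) = cstar (pi f). Proof. by have [_ _] := pi_hom; exact. Qed.

Lemma adapted_mmul m k : adapted m -> adapted k -> adapted (mmul m k).
Proof.
move=> am ak i j; split => x xD; rewrite /mmul cev_sum big1// => l _; rewrite cevM.
  by rewrite (am i l).1// mul0r.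
by rewrite (ak l j).2// mulr0.
Qed.

Lemma adapted_mstar m : adapted m -> adapted (mstar m).
Proof.
move=> am i j; split => x xD; rewrite /mstar cevS.
  by rewrite (am j i).2// rmorph0.
by rewrite (am j i).1// rmorph0.
Qed.

Lemma v_orth_left a i j f g : vanish_off (D i) f -> vanish_off (D j) g ->
  cmul (cmul (cmul (cmul a (pi f)) (cstar (v i))) (v j)) (pi g) =
  if i == j then cmul a (pi (cmul f g)) else 0.
Proof.
move=> fD gD; rewrite -!cmulA [cmul (pi f) _]cmulA v_orth//.
by case: eqP; rewrite ?cmul0r.
Qed.

(** The v i are orthogonal partial isometries on D i, so that inner factors contract. *)
Lemma Jmul m k : adapted m -> adapted k -> cmul (Jmap m) (Jmap k) = Jmap (mmul m k).
Proof.
move=> am ak; rewrite /Jmap cmul_suml; apply: eq_bigr => i _.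
transitivity (\sum_j \sum_l cmul (cmul (v i) (pi (cmul (m i l) (k l j)))) (cstar (v j))).
  rewrite [RHS]exchange_big cmul_suml /=; apply: eq_bigr => l _.
  rewrite cmul_sumr (bigD1 l)//= [X in _ + X]big1 ?addr0.
    rewrite cmul_sumr; apply: eq_bigr => j _.
    by rewrite !cmulA (v_orth_left _ (am i l).2 (ak l j).1) eqxx.
  move=> l' /negbTE ll'; rewrite cmul_sumr big1// => j _.
  by rewrite !cmulA (v_orth_left _ (am i l).2 (ak l' j).1) eq_sym ll' cmul0l.
apply: eq_bigr => j _; rewrite /mmul (is_linear_sum _ _ _ pi_lin) cmul_sumr cmul_suml.
by [].
Qed.

Lemma Jstar m : cstar (Jmap m) = Jmap (mstar m).
Proof.
rewrite /Jmap cstar_sum exchange_big /=; apply: eq_bigr => j _.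
rewrite cstar_sum; apply: eq_bigr => i _.
by rewrite !cstarM cstarK /mstar piS cmulA.
Qed.

Lemma nrm_Jmap_crude : exists2 K : R, 0 <= K & forall m (c : R), 0 <= c ->
  (forall i j, nrm (m i j) <= c) -> nrm (Jmap m) <= K * c.
Proof.
exists (\sum_i \sum_j nrm (v i) * nrm (v j)).
  by apply: sumr_ge0 => i _; apply: sumr_ge0 => j _; rewrite mulr_ge0 ?nrm_ge0.
move=> m c c0 mc; rewrite mulr_suml; apply: le_trans (nrm_sum _ _ _) _.
apply: ler_sum => i _; rewrite mulr_suml; apply: le_trans (nrm_sum _ _ _) _.
apply: ler_sum => j _; apply: le_trans (nrm_mul _ _) _; rewrite nrm_star mulrAC.
rewrite ler_wpM2r ?nrm_ge0//; apply: le_trans (nrm_mul _ _) _.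
by rewrite ler_wpM2l ?nrm_ge0// (le_trans (pi_le _)).
Qed.

(** The pointwise operator norm bounds the norm of [Jmap m]: for self-adjoint m the
    powers of order 2^n are bounded up to a constant independent of n. *)
Lemma nrm_Jmap m (c : R) : adapted m -> 0 <= c ->
  (forall x, opn (fun i j => cev (m i j) x) <= c) -> nrm (Jmap m) <= c.
Proof.
move=> am c0 mc; have [K K0 KP] := nrm_Jmap_crude.
pose h := mmul (mstar m) m.
have ah : adapted h by apply: adapted_mmul => //; exact: adapted_mstar.
have hh : mstar h = h.
  apply/funext => i; apply/funext => j; rewrite /mstar /h /mmul cstar_sum.
  by apply: eq_bigr => l _; rewrite cstarM cstarK.
pose p := fix p n := if n is n'.+1 then mmul (p n') (p n') else h.
have pP n : [/\ adapted (p n), mstar (p n) = p n,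
    nrm (Jmap (p n)) = nrm (Jmap h) ^+ (2 ^ n) &
    forall x, opn (fun i j => cev (p n i j) x) <= (c ^+ 2) ^+ (2 ^ n)].
  elim: n => [|n [an sn nn on]].
    split; rewrite ?expn0 ?expr1// => x /=.
    rewrite (_ : (fun i j => _) =
      fun i j => \sum_l (cev (m l i) x)^* * cev (m l j) x); last first.
      by apply/funext => i; apply/funext => j; rewrite cev_sum.
    by rewrite opn_C lerXn2r ?nnegrE ?opn_ge0.
  split => /=.
  - exact: adapted_mmul.
  - rewrite -{3}sn; apply/funext => i; apply/funext => j; rewrite /mstar /mmul cstar_sum.
    apply: eq_bigr => l _; rewrite cstarM; congr cmul.
    by rewrite -{1}sn /mstar cstarK.
  - rewrite -Jmul// -{1}sn -Jstar nrm_sq nn -exprM expnSr.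
    by [].
  - move=> x; rewrite (_ : (fun i j => _) =
      fun i j => \sum_l cev (p n i l) x * cev (p n l j) x); last first.
      by apply/funext => i; apply/funext => j; rewrite cev_sum.
    apply: le_trans (opn_mul _ _) _.
    by rewrite expnS mul2n -addnn exprD ler_pM ?opn_ge0.
have hc : nrm (Jmap h) <= c ^+ 2.
  apply: (@le_of_powers _ _ _ K); rewrite ?nrm_ge0 ?sqr_ge0// => n.
  have [_ _ <- on] := pP n; apply: KP; first by rewrite exprn_ge0 ?sqr_ge0.
  move=> i j; apply: nrm_CX_le => [|x]; first by rewrite exprn_ge0 ?sqr_ge0.
  by apply: le_trans (on x); exact: (opn_entry (fun i j => cev (p n i j) x)).
rewrite -(@ler_pXn2r _ 2%N)// ?nnegrE ?nrm_ge0//.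
by rewrite -nrm_sq Jstar Jmul//; exact: adapted_mstar.
Qed.

End MatrixUnits.

(** * Rotating a small remainder into a chain of levels *)

Section Rotation.
Variables (R : realType) (k : nat).
Hypothesis k0 : (0 < k)%N.
Implicit Types (l : R) (m j : nat).

Definition lvl m l : R := Num.max 0 (Num.min 1 (k%:R * l - m%:R + 1)).
Definition sg m l := Num.sqrt (lvl m l).
Definition cg m l := Num.sqrt (1 - lvl m l).

Lemma lvl01 m l : 0 <= lvl m l <= 1.
Proof. by rewrite /lvl le_max lexx /= ge_max ler01 ge_min lexx. Qed.

Lemma sg2 m l : sg m l ^+ 2 = lvl m l.
Proof. by rewrite sqr_sqrtr//; have /andP[] := lvl01 m l. Qed.
Lemma cg2 m l : cg m l ^+ 2 = 1 - lvl m l.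
Proof. by rewrite sqr_sqrtr//; have /andP[] := lvl01 m l; rewrite subr_ge0. Qed.
Lemma sg_ge0 m l : 0 <= sg m l. Proof. exact: sqrtr_ge0. Qed.
Lemma cg_ge0 m l : 0 <= cg m l. Proof. exact: sqrtr_ge0. Qed.
Lemma sg_le1 m l : sg m l <= 1.
Proof. by rewrite /sg -sqrtr1 ler_wsqrtr//; have /andP[] := lvl01 m l. Qed.

Lemma sg0 l : 0 <= l -> sg 0 l = 1.
Proof.
move=> l0; rewrite /sg /lvl subr0 min_l ?lerDr ?mulr_ge0//.
by rewrite max_r ?ler01// sqrtr1.
Qed.

Lemma sg_last l : l <= 1 -> sg k.+1 l = 0.
Proof.
move=> l1; rewrite /sg /lvl max_l ?sqrtr0//.
rewrite ge_min; apply/orP; right; rewrite -natr1 opprD addrA subrK subr_le0.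
by rewrite -[leRHS]mulr1 ler_wpM2l.
Qed.

Lemma cs0 m n l : (m < n)%N -> cg m l * sg n l = 0.
Proof.
move=> mn; have [h|h] := leP (k%:R * l - n%:R + 1) 0.
  by rewrite /sg /lvl max_l ?sqrtr0 ?mulr0// ge_min h orbT.
rewrite /cg /lvl min_l; first by rewrite max_r ?ler01// subrr sqrtr0 mul0r.
have : (m.+1%:R : R) <= n%:R by rewrite ler_nat.
rewrite -natr1; lra.
Qed.

Lemma s_eq m l : sg m l ^+ 2 * sg m.+1 l ^+ 2 = sg m.+1 l ^+ 2.
Proof.
have := cs0 l (ltnSn m) => h.
have : (cg m l * sg m.+1 l) ^+ 2 = 0 by rewrite h expr0n.
by rewrite exprMn cg2 -sg2 mulrBl mul1r => /eqP; rewrite subr_eq0 => /eqP.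
Qed.

Lemma c_next m l : cg m l * cg m.+1 l = cg m l.
Proof.
have /eqP := cs0 l (ltnSn m); rewrite mulf_eq0 => /orP[/eqP->|/eqP h]; first by rewrite mul0r.
by rewrite {2}/cg -sg2 h expr0n subr0 sqrtr1 mulr1.
Qed.

Lemma s_prev m l : sg m l * sg m.+1 l = sg m.+1 l.
Proof.
have /eqP := cs0 l (ltnSn m); rewrite mulf_eq0 => /orP[/eqP h|/eqP->]; last by rewrite mulr0.
suff -> : sg m l = 1 by rewrite mul1r.
have /eqP := cg2 m l; rewrite h expr0n eq_sym subr_eq0 => /eqP lv.
by rewrite /sg -lv sqrtr1.
Qed.

Lemma sum_lvl l : 0 <= l -> l <= 1 -> \sum_(m < k) lvl m.+1 l = k%:R * l.
Proof.
move=> l0 l1.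
suff h n : \sum_(m < n) lvl m.+1 l = Num.min n%:R (k%:R * l).
  by rewrite h min_r// -[leRHS]mulr1 ler_wpM2l.
elim: n => [|n IH]; first by rewrite big_ord0 min_l ?mulr_ge0.
rewrite big_ord_recr /= IH /lvl -natr1.
have kl : 0 <= k%:R * l by rewrite mulr_ge0.
have n0 : 0 <= n%:R :> R by [].
move: (k%:R * l) kl => z z0.
rewrite opprD addrA subrK.
by case: (leP n%:R z) => h1; case: (leP 1 (z - n%:R)) => h2;
  case: (leP (n%:R + 1) z) => h3; rewrite /Num.max; case: ifP => h4; lra.
Qed.

(** The product of the Givens rotations in the planes (0, m), m = 1, ..., k, by the
    angles with cosine [cg m l] and sine [sg m l], multiplied out. *)
Definition rot l (m j : nat) : R :=
  if j == 0%N then sg m l * cg m.+1 l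
  else if m == j then cg j l else if m.+1 == j then - (sg j l * sg m l) else 0.

Lemma rot_col l j (g : nat -> R) : (0 < j <= k)%N ->
  \sum_(m < k.+1) g m * rot l m j = g j * cg j l - g j.-1 * sg j l.
Proof.
case: j => // j /= jk.
have jk1 : (j.+1 < k.+1)%N by rewrite ltnS.
have jk0 : (j < k.+1)%N by rewrite ltnW.
rewrite (bigD1 (Ordinal jk1))//= (bigD1 (Ordinal jk0))/=; last first.
  by rewrite -val_eqE /= neq_ltn ltnSn.
rewrite big1 ?addr0 => [|m /andP[m1 m2]].
  rewrite /rot /= eqxx (_ : (j == j.+1) = false) ?eqxx; last by rewrite eqn_leq ltnn andbF.
  by rewrite mulrN [sg j.+1 l * _]mulrC s_prev.
rewrite /rot /= ifN; last by move: m1; rewrite -val_eqE.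
rewrite ifN ?mulr0//; apply: contra m2; rewrite eqSS => /eqP mj.
Qed.

Lemma rot_sum0 l (g : nat -> R) : \sum_(m < k.+1) g m * rot l m 0 * rot l m 0 =
  \sum_(m < k.+1) g m * (sg m l ^+ 2 - sg m.+1 l ^+ 2).
Proof.
apply: eq_bigr => m _; rewrite -mulrA; congr (_ * _).
by rewrite /rot eqxx -expr2 exprMn cg2 -sg2 mulrBr mulr1 s_eq.
Qed.

Lemma rot_gram l (g : nat -> R) j j' : (0 < j' <= k)%N -> (j <= j')%N ->
  \sum_(m < k.+1) g m * rot l m j * rot l m j' =
  if j == 0%N then (g j' - g j'.-1) * (cg j' l * sg j' l)
  else if j == j' then g j' * cg j' l ^+ 2 + g j'.-1 * sg j' l ^+ 2 else 0.
Proof.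
move=> j'0 jj; rewrite (@rot_col l j' (fun m => g m * rot l m j))//.
case: j' j'0 jj => // j' _ jj /=.
have [->|j0] := eqVneq j 0%N.
  rewrite /rot /=; transitivity (g j'.+1 * sg j'.+1 l * (cg j'.+1 l * cg j'.+2 l) -
    g j' * cg j'.+1 l * (sg j' l * sg j'.+1 l)); first by ring.
  by rewrite c_next s_prev; ring.
rewrite /rot (negbTE j0).
have [->|jn] := eqVneq j j'.+1.
  rewrite ?eqxx (_ : (j' == j'.+1) = false); last by rewrite eqn_leq ltnn andbF.
  by rewrite mulrN mulNr opprK [sg j'.+1 l * sg j' l]mulrC s_prev -!mulrA -!expr2.
have jlt : (j < j'.+1)%N by rewrite ltn_neqAle jn.
rewrite [j'.+2 == j]gtn_eqF ?(ltnW jlt)// mulr0 mul0r sub0r.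
have [->|_] := eqVneq j' j; last by rewrite mulr0 mul0r oppr0.
by rewrite -mulrA cs0 ?ltnSn// mulr0 oppr0.
Qed.

Lemma rot_orth l j j' : 0 <= l -> l <= 1 -> (j <= k)%N -> (j' <= k)%N ->
  \sum_(m < k.+1) rot l m j * rot l m j' = (j == j')%:R.
Proof.
move=> l0 l1.
have main i i' : (i <= i')%N -> (i' <= k)%N ->
    \sum_(m < k.+1) rot l m i * rot l m i' = (i == i')%:R.
  have g1 : \sum_(m < k.+1) rot l m i * rot l m i' =
      \sum_(m < k.+1) 1 * rot l m i * rot l m i'.
    by apply: eq_bigr => m _; rewrite mul1r.
  rewrite {}g1; case: (posnP i') => [->|i'0] ii' i'k.
    move: ii'; rewrite leqn0 => /eqP ->; rewrite eqxx (rot_sum0 l (fun=> 1)).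
    under eq_bigr do rewrite mul1r -opprB.
    rewrite sumrN -(big_mkord predT (fun m => sg m.+1 l ^+ 2 - sg m l ^+ 2)).
    rewrite (telescope_sumr (fun m => sg m l ^+ 2))// sg0// sg_last//.
    by rewrite expr0n expr1n sub0r opprK.
  rewrite (@rot_gram l (fun=> 1))// ?i'0// subrr mul0r !mul1r cg2 sg2 subrK.
  have [i0|_] := eqVneq i 0%N; last by case: eqP.
  by move: i'0; rewrite i0; case: i' {ii' i'k}.
move=> jk j'k; have [jj|/ltnW jj] := leqP j j'; first exact: main.
by rewrite eq_sym -main//; apply: eq_bigr => m _; rewrite mulrC.
Qed.

(** Conjugating the levels 0, 1/k, ..., 1 by the rotation produces l, 1/k, ..., 1 up to
    1/k; the defect is diagonal up to one off-diagonal entry. *)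
Definition defect l (j j' : nat) : R :=
  \sum_(m < k.+1) m%:R / k%:R * rot l m j * rot l m j' -
  (if j == j' then (if j == 0%N then l else j%:R / k%:R) else 0).

Lemma defectE l j j' : 0 <= l -> l <= 1 -> (j <= k)%N -> (j' <= k)%N ->
  defect l j j' =
  k%:R^-1 * (if j == j' then (if j == 0%N then 0 else - sg j l ^+ 2)
             else if j == 0%N then cg j' l * sg j' l
             else if j' == 0%N then cg j l * sg j l else 0).
Proof.
move=> l0 l1.
have kn0 : k%:R != 0 :> R by rewrite pnatr_eq0 -lt0n.
have main i i' : (i <= i')%N -> (i' <= k)%N -> defect l i i' =
    k%:R^-1 * (if i == i' then (if i == 0%N then 0 else - sg i l ^+ 2)
             else if i == 0%N then cg i' l * sg i' l
             else if i' == 0%N then cg i l * sg i l else 0).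
  case: (posnP i') => [->|i'0] ii' i'k.
    move: ii'; rewrite leqn0 => /eqP ->; rewrite /defect eqxx mulr0.
    rewrite (rot_sum0 l (fun m => m%:R / k%:R)).
    have tel n : \sum_(m < n.+1) m%:R / k%:R * (sg m l ^+ 2 - sg m.+1 l ^+ 2) =
        k%:R^-1 * (\sum_(m < n) lvl m.+1 l - n%:R * sg n.+1 l ^+ 2).
      elim: n => [|n IH]; first by rewrite big_ord_recr !big_ord0 /= !mul0r addr0 subr0 mulr0.
      rewrite big_ord_recr /= IH [in RHS]big_ord_recr /= -sg2 -natr1; ring.
    by rewrite tel sum_lvl// sg_last// expr0n mulr0 subr0 mulKf// subrr.
  rewrite /defect (@rot_gram l (fun m => m%:R / k%:R)) ?i'0//.
  have i'E : i'%:R = i'.-1%:R + 1 :> R by rewrite natr1 prednK.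
  have [->|i0] := eqVneq i 0%N.
    by rewrite (ltn_eqF i'0) subr0 -mulrBl i'E addrAC subrr add0r mul1r.
  have [->|ne] := eqVneq i i'.
    by rewrite cg2 -sg2 i'E; ring.
  by rewrite ?mulr0 ?subr0.
move=> jk j'k; have [jj|/ltnW jj] := leqP j j'; first exact: main.
have -> : defect l j j' = defect l j' j.
  rewrite /defect eq_sym; congr (_ - _); last by case: eqP => // ->.
  by apply: eq_bigr => m _; rewrite mulrAC.
rewrite main// [j == j']eq_sym; case: (eqVneq j' j) => [->//|ne].
by case: (eqVneq j' 0%N) ne => [->|_]; case: (eqVneq j 0%N) => [->|_].
Qed.

Lemma defect_bound l : 0 <= l -> l <= 1 ->
  opn (fun i j : 'I_k.+1 => (defect l i j)%:C) <= 3 / k%:R.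
Proof.
move=> l0 l1; apply: opn_le => x y x1 y1.
have kp : 0 < k%:R :> R by rewrite ltr0n.
pose t (j : 'I_k.+1) : R[i] := (if j == ord0 then 0 else cg j l * sg j l)%:C.
pose d (j : 'I_k.+1) : R[i] := (if j == ord0 then 0 else - sg j l ^+ 2)%:C.
have -> : bil (fun i j : 'I_k.+1 => (defect l i j)%:C) x y =
    (k%:R^-1)%:C * (\sum_i (x i)^* * (d i * y i) + (x ord0)^* * (\sum_j (t j)^* * y j)
      + (\sum_j (x j)^* * t j) * y ord0).
  transitivity (bil (fun i j : 'I_k.+1 => (k%:R^-1)%:C * (((i == j)%:R * d j +
      (i == ord0)%:R * (t j)^*) + t i * (j == ord0)%:R)) x y).
    congr bil; apply/funext => i; apply/funext => j.
    rewrite defectE ?leq_ord// rmorphM; congr (_ * _).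
    rewrite (_ : Num.conj (t j) = t j); last exact: conjC_real.
    rewrite /t /d -!val_eqE /=.
    case: (eqVneq (i : nat) j) => [ij|ne].
      by rewrite -ij; case: eqP; rewrite ?mul1r ?mulr0 ?mul0r ?mulr1 ?addr0 ?add0r.
    rewrite mul0r add0r; case: (eqVneq (i : nat) 0%N) ne => [->|i0] ne.
      by rewrite mul1r eq_sym (negbTE ne) mulr0 addr0.
    by rewrite mul0r add0r; case: eqP; rewrite ?mulr1 ?mulr0.
  rewrite bilZ !bilD; congr (_ * (_ + _ + _)).
  - rewrite bilE; apply: eq_bigr => i _; congr (_ * _); rewrite /mxv (bigD1 i)//= eqxx mul1r.
    by rewrite big1 ?addr0// => j /negbTE ji; rewrite eq_sym ji !mul0r.
  - rewrite bilE (bigD1 ord0)//= [X in _ + X]big1 ?addr0 => [|i /negbTE i0].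
      by congr (_ * _); apply: eq_bigr => j _; rewrite mul1r.
    by rewrite /mxv big1 ?mulr0// => j _; rewrite i0 !mul0r.
  - rewrite bilE mulr_suml; apply: eq_bigr => i _; rewrite -mulrA; congr (_ * _).
    rewrite /mxv (bigD1 ord0)//= ?eqxx mulr1 big1 ?addr0// => j /negbTE j0.
    by rewrite j0 mulr0 mul0r.
rewrite nrmCM nrmCR ger0_norm ?invr_ge0// mulrC ler_wpM2r ?invr_ge0//.
have c_le1 m : cg m l <= 1.
  rewrite -(@ler_pXn2r _ 2%N)// ?nnegrE ?cg_ge0// cg2 expr1n gerBl.
  by have /andP[] := lvl01 m l.
have t1 : vsq t <= 1.
  have <- : \sum_(m < k.+1) rot l m 0 * rot l m 0 = 1 by rewrite rot_orth.
  apply: ler_sum => j _; rewrite /t nrmCR -expr2 real_normK ?num_real//.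
  case: eqP => _; first by rewrite expr0n sqr_ge0.
  rewrite /rot eqxx mulrC lerXn2r ?nnegrE ?mulr_ge0 ?sg_ge0 ?cg_ge0//.
  by rewrite ler_wpM2l ?sg_ge0// -(c_next j) -[leRHS]mul1r ler_wpM2r ?cg_ge0.
have d1 : vsq (fun i => d i * y i) <= 1.
  apply: le_trans y1; apply: ler_sum => j _; rewrite nrmCM exprMn -[leRHS]mul1r.
  rewrite ler_wpM2r ?sqr_ge0// /d nrmCR exprn_ile1//; case: eqP => _; first by rewrite normr0.
  by rewrite normrN ger0_norm ?sqr_ge0// exprn_ile1 ?sg_ge0 ?sg_le1.
have cs u v : vsq u <= 1 -> vsq v <= 1 -> nrm (\sum_(i < k.+1) (u i)^* * v i) <= 1.
  move=> u1 v1; apply: le_trans (dot_le _ _) _; rewrite -[leRHS]mul1r.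
  by apply: ler_pM; rewrite ?sqrtr_ge0// -sqrtr1 ler_wsqrtr.
have -> : (3 : R) = 1 + 1 * 1 + 1 * 1 by ring.
apply: le_trans (nrmD _ _) _; apply: lerD; last first.
  by rewrite nrmCM; apply: ler_pM; rewrite ?nrm_ge0 ?cs ?ball_coord.
apply: le_trans (nrmD _ _) _; apply: lerD; first exact: cs.
by rewrite nrmCM nrmCJ; apply: ler_pM; rewrite ?nrm_ge0 ?cs ?ball_coord.
Qed.

Lemma cont_lvl m : continuous (lvl m).
Proof.
apply: contMax; first exact: contCst.
apply: contMin; first exact: contCst.
apply: contD; last exact: contCst.
apply: contB; last exact: contCst.
by apply: contM; [exact: contCst|move=> x; exact: cvg_id].
Qed.

Lemma cont_rot m j : continuous (fun l => rot l m j).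
Proof.
have cs n : continuous (sg n).
  move=> l; apply: (@continuous_comp _ _ _ (lvl n) Num.sqrt); first exact: cont_lvl.
  exact: sqrt_continuous.
have cc n : continuous (cg n).
  move=> l; apply: (@continuous_comp _ _ _ (fun l => 1 - lvl n l) Num.sqrt).
    by apply: cvgB; [exact: cvg_cst|exact: cont_lvl].
  exact: sqrt_continuous.
move=> l; rewrite /rot; case: eqP => _; first by apply: cvgM; [exact: cs|exact: cc].
case: eqP => _; first exact: cc.
case: eqP => _; last exact: cvg_cst.
by apply: cvgN; apply: cvgM; exact: cs.
Qed.

Lemma rot_at0 m j : (m <= k)%N -> (j <= k)%N -> rot 0 m j = (m == j)%:R.
Proof.
move=> mk jk.
have sz n : sg n.+1 0 = 0.
  by rewrite /sg /lvl mulr0 sub0r -natr1 opprD subrK max_l ?sqrtr0// ge_min oppr_le0 ler0n orbT.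
have cz n : cg n.+1 0 = 1 by rewrite /cg -sg2 sz expr0n subr0 sqrtr1.
rewrite /rot; case: (posnP j) => [->|]; first by case: m mk => [|m] _; rewrite cz ?sg0 ?sz ?mulr1.
case: j jk => // j _ _; rewrite cz sz mul0r oppr0.
by case: eqP => // _; case: eqP.
Qed.

End Rotation.

Section Absorption.
Variables (R : realType) (X : topologicalType) (cX : compact [set: X]).
Local Notation A := (CX R cX).
Variables (O : cstarAlgType R) (pi : A -> O).
Hypotheses (pi_hom : star_hom pi) (pi_le : forall f, nrm (pi f) <= nrm f).
Let e1 := pi (CX1 R cX).
Hypotheses (mul1O : forall a, cmul e1 a = a) (mulO1 : forall a, cmul a e1 = a).
Variables (k : nat) (k0 : (0 < k)%N) (r : X -> R) (cr : continuous r).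
Hypotheses (r0 : forall x, 0 <= r x) (r1 : forall x, r x <= 1).
Variables (s : A) (v : 'I_k.+1 -> O).
Hypothesis s_real : cstar s = s.
Local Notation D := [set x : X | r x != 0].
Hypothesis v0 : v ord0 = e1.
Hypothesis v_orth : forall i j f g, vanish_off D f -> vanish_off D g ->
  cmul (cmul (pi f) (cstar (v i))) (cmul (v j) (pi g)) =
  if i == j then pi (cmul f g) else 0.
Hypothesis s_v : forall i f, vanish_off D f ->
  cmul (pi s) (cmul (v i) (pi f)) = (i%:R / k%:R)%:C *: cmul (v i) (pi f).

Lemma cont_rotr m j : continuous (fun x => rot k (r x) m j - (m == j)%:R).
Proof.
apply: contB; last exact: contCst.
move=> x; apply: (@continuous_comp _ _ _ r (fun l => rot k l m j)); first exact: cr.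
exact: cont_rot.
Qed.

Definition absorb_mx (i j : 'I_k.+1) : A := rC cX (@cont_rotr i j).

(** The unitary that shifts the remainder r along the chain of levels. *)
Definition absorb : O := e1 + Jmap pi v absorb_mx.

Lemma absorb_adapted : adapted (fun=> D) absorb_mx.
Proof.
have h i j : vanish_off D (absorb_mx i j).
  move=> x /negP; rewrite negbK => /eqP rx; rewrite /absorb_mx /rC mkCE /= rx.
  by rewrite rot_at0 ?leq_ord// val_eqE subrr.
by move=> i j; split; exact: h.
Qed.

Lemma JmapD (m n : 'I_k.+1 -> 'I_k.+1 -> A) :
  Jmap pi v m + Jmap pi v n = Jmap pi v (fun i j => m i j + n i j).
Proof.
rewrite /Jmap -big_split; apply: eq_bigr => i _; rewrite -big_split; apply: eq_bigr => j _ /=.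
by rewrite (is_linearD _ _ (pi_lin pi_hom)) cmulDr cmulDl.
Qed.

Lemma Jmap_eq0 (m : 'I_k.+1 -> 'I_k.+1 -> A) :
  (forall i j x, cev (m i j) x = 0) -> Jmap pi v m = 0.
Proof.
move=> m0; rewrite /Jmap big1// => i _; rewrite big1// => j _.
rewrite (_ : m i j = 0); last by apply: CXP => x; rewrite m0.
by rewrite (is_linear0 (pi_lin pi_hom)) cmul0r cmul0l.
Qed.

Lemma s_Jmap (m : 'I_k.+1 -> 'I_k.+1 -> A) : adapted (fun=> D) m ->
  cmul (pi s) (Jmap pi v m) = Jmap pi v (fun i j => (i%:R / k%:R)%:C *: m i j).
Proof.
move=> am; rewrite /Jmap cmul_sumr; apply: eq_bigr => i _; rewrite cmul_sumr.
apply: eq_bigr => j _; rewrite cmulA s_v; last exact: (am i j).1.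
by rewrite (is_linearZ _ _ (pi_lin pi_hom)) cmulZl cmulZr cmulZl.
Qed.

Let w := absorb_mx.
Let aw := absorb_adapted.
Let J := Jmap pi v.

Lemma cev_absorb i j x : cev (absorb_mx i j) x = (rot k (r x) i j - (i == j)%:R)%:C.
Proof. by rewrite /absorb_mx /rC mkCE val_eqE. Qed.

Lemma e1_star : cstar e1 = e1.
Proof.
rewrite /e1 -(piS pi_hom); congr pi; apply: CXP => x.
by rewrite cevS /CX1 /cstC mkCE rmorph1.
Qed.

Lemma rot_row (l : R) (i j : 'I_k.+1) : 0 <= l -> l <= 1 ->
  \sum_(m < k.+1) rot k l i m * rot k l j m = (i == j)%:R.
Proof.
move=> l0 l1; pose M : 'M[R]_k.+1 := \matrix_(a, b) rot k l a b.
have MM : M^T *m M = 1%:M.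
  apply/matrixP => a b; rewrite !mxE -val_eqE -(rot_orth l0 l1 (leq_ord a) (leq_ord b)).
  by apply: eq_bigr => m _; rewrite !mxE.
have := mulmx1C MM => /matrixP /(_ i j); rewrite !mxE => <-.
by apply: eq_bigr => m _; rewrite !mxE.
Qed.

Lemma cev_rr (f : 'I_k.+1 -> R) x (m n : 'I_k.+1 -> A) :
  (forall l, cev (m l) x * cev (n l) x = (f l)%:C) ->
  cev (\sum_l cmul (m l) (n l)) x = (\sum_l f l)%:C.
Proof. by move=> h; rewrite cev_sum rmorph_sum; apply: eq_bigr => l _; rewrite cevM h. Qed.

Lemma sum_delta_rot (a b : 'I_k.+1 -> R) (i j : 'I_k.+1) (g : 'I_k.+1 -> R) :
  \sum_l g l * (a l - (l == i)%:R) * (b l - (l == j)%:R) =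
  \sum_l g l * a l * b l - g j * a j - g i * b i + g i * (i == j)%:R.
Proof.
have pick (h : 'I_k.+1 -> R) c : \sum_l h l * (l == c)%:R = h c.
  rewrite (bigD1 c)//= eqxx mulr1 big1 ?addr0// => l /negbTE ->.
  by rewrite mulr0.
have -> : \sum_l g l * (a l - (l == i)%:R) * (b l - (l == j)%:R) =
    \sum_l g l * a l * b l - \sum_l (g l * a l) * (l == j)%:R
    - \sum_l (g l * b l) * (l == i)%:R + \sum_l (g l * (l == j)%:R) * (l == i)%:R.
  by rewrite -!sumrB -big_split /=; apply: eq_bigr => l _; ring.
by rewrite !pick.
Qed.

Lemma absorb_unitary_l : cmul (cstar absorb) absorb = e1.
Proof.
rewrite /absorb cstarD e1_star cmulDl !cmulDr !mul1O mulO1 (Jstar pi_hom).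
rewrite (Jmul pi_hom v_orth (adapted_mstar aw) aw) addrA -addrA -[RHS]addr0.
rewrite -!addrA; congr (_ + _); rewrite !JmapD; apply: Jmap_eq0 => i j x.
rewrite !cevD /mmul (cev_rr (f := fun l => (rot k (r x) l i - (l == i)%:R) *
  (rot k (r x) l j - (l == j)%:R))); last first.
  by move=> l; rewrite /mstar cevS !cev_absorb conjC_real -rmorphM.
rewrite /mstar cevS !cev_absorb conjC_real -!rmorphD.
have -> : \sum_(l < k.+1) (rot k (r x) l i - (l == i)%:R) * (rot k (r x) l j - (l == j)%:R) =
    \sum_(l < k.+1) 1 * (rot k (r x) l i - (l == i)%:R) * (rot k (r x) l j - (l == j)%:R).
  by apply: eq_bigr => l _; rewrite mul1r.
rewrite (sum_delta_rot _ _ i j (fun=> 1)).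
have -> : \sum_(l < k.+1) 1 * rot k (r x) l i * rot k (r x) l j = (i == j)%:R.
  under eq_bigr do rewrite mul1r.
  by rewrite rot_orth ?leq_ord.
rewrite [j == i]eq_sym (_ : _ + _ = 0) ?rmorph0//; ring.
Qed.

Lemma absorb_unitary_r : cmul absorb (cstar absorb) = e1.
Proof.
rewrite /absorb cstarD e1_star cmulDl !cmulDr !mul1O mulO1 (Jstar pi_hom).
rewrite (Jmul pi_hom v_orth aw (adapted_mstar aw)) addrA -addrA -[RHS]addr0.
rewrite -!addrA; congr (_ + _); rewrite !JmapD; apply: Jmap_eq0 => i j x.
rewrite !cevD /mmul (cev_rr (f := fun l => (rot k (r x) i l - (l == i)%:R) *
  (rot k (r x) j l - (l == j)%:R))); last first.
  move=> l; rewrite /mstar cevS !cev_absorb conjC_real -rmorphM.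
  by rewrite [i == l]eq_sym [j == l]eq_sym.
rewrite /mstar cevS !cev_absorb conjC_real -!rmorphD.
have -> : \sum_(l < k.+1) (rot k (r x) i l - (l == i)%:R) * (rot k (r x) j l - (l == j)%:R) =
    \sum_(l < k.+1) 1 * (rot k (r x) i l - (l == i)%:R) * (rot k (r x) j l - (l == j)%:R).
  by apply: eq_bigr => l _; rewrite mul1r.
rewrite (sum_delta_rot (fun l => rot k (r x) i l) (fun l => rot k (r x) j l) i j (fun=> 1)).
have -> : \sum_(l < k.+1) 1 * rot k (r x) i l * rot k (r x) j l = (i == j)%:R.
  under eq_bigr do rewrite mul1r.
  by rewrite rot_row.
rewrite [j == i]eq_sym (_ : _ + _ = 0) ?rmorph0//; ring.
Qed.

(** Functions of r commute with the matrix units spanned by the v i, so that the estimate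
    reduces to the defect matrix at each point. *)
Lemma absorb_spec :
  nrm (cmul (cstar absorb) (cmul (pi s) absorb) - (pi s + pi (rC cX cr))) <= 3 / k%:R.
Proof.
pose L (m : 'I_k.+1 -> 'I_k.+1 -> A) := fun i j : 'I_k.+1 => (i%:R / k%:R)%:C *: m i j : A.
have aL m : adapted (fun=> D) m -> adapted (fun=> D) (L m).
  by move=> am i j; split => x xD; rewrite cevZ ?(am i j).1// mulr0.
have sJ : cmul (pi s) (J w) = J (L w) by rewrite s_Jmap.
have Js : cmul (J (mstar w)) (pi s) = J (mstar (L w)).
  transitivity (cmul (cstar (J w)) (cstar (pi s))).
    by rewrite /J (Jstar pi_hom) -(piS pi_hom) s_real.
  by rewrite -cstarM sJ /J (Jstar pi_hom).
pose q : 'I_k.+1 -> 'I_k.+1 -> A := fun i j => if (i == ord0) && (j == ord0) then - rC cX cr else 0.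
have Jq : J q = - pi (rC cX cr).
  rewrite /J /Jmap (bigD1 ord0)//= (bigD1 ord0)//= [X in _ + X + _]big1 ?addr0; last first.
    move=> j /negbTE j0; rewrite /q j0 andbF.
    by rewrite (is_linear0 (pi_lin pi_hom)) cmul0r cmul0l.
  rewrite big1 ?addr0 => [|i /negbTE i0]; last first.
    rewrite big1// => j _; rewrite /q i0.
    by rewrite (is_linear0 (pi_lin pi_hom)) cmul0r cmul0l.
  rewrite /q eqxx /= v0 e1_star mulO1 mul1O -scaleN1r (is_linearZ _ _ (pi_lin pi_hom)).
  by rewrite scaleN1r.
have -> : cmul (cstar absorb) (cmul (pi s) absorb) - (pi s + pi (rC cX cr)) =
    J (fun i j : 'I_k.+1 => L w i j + (mstar (L w) i j + (mmul (mstar w) (L w) i j + q i j))).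
  transitivity (J (L w) + (J (mstar (L w)) + (cmul (J (mstar w)) (J (L w)) + J q))); last first.
    by rewrite /J (Jmul pi_hom v_orth (adapted_mstar aw) (aL _ aw)) !JmapD.
  have aE : absorb = e1 + J w by [].
  have sE : cstar absorb = e1 + J (mstar w) by rewrite aE cstarD e1_star /J (Jstar pi_hom).
  rewrite Jq -Js -sJ sE aE !cmulDl !cmulDr !mul1O !mulO1.
  move: (cmul (pi s) (J w)) (cmul (J (mstar w)) (pi s)) => a b.
  move: (cmul (J (mstar w)) a) (pi s) (pi (rC cX cr)) => c d e.
  rewrite [d + a]addrC -!addrA opprD; congr (_ + _); rewrite addrCA; congr (_ + _).
  by rewrite addrCA; congr (_ + _); rewrite addrA subrr add0r.
rewrite /J; apply: (@nrm_Jmap _ _ _ _ _ pi_hom pi_le _ _ (fun=> D) v_orth).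
- move=> i j; split => x /[dup] xD /negP; rewrite negbK => /eqP rx; rewrite !cevD.
    rewrite (aL _ aw i j).1// (adapted_mstar (aL _ aw) i j).1//.
    rewrite (adapted_mmul (adapted_mstar aw) (aL _ aw) i j).1// /q.
    by case: ifP => _; rewrite ?cevN /rC ?mkCE ?rx ?cev0 ?rmorph0 ?oppr0 !addr0.
  rewrite (aL _ aw i j).1// (adapted_mstar (aL _ aw) i j).1//.
  rewrite (adapted_mmul (adapted_mstar aw) (aL _ aw) i j).1// /q.
  by case: ifP => _; rewrite ?cevN /rC ?mkCE ?rx ?cev0 ?rmorph0 ?oppr0 !addr0.
- by rewrite divr_ge0.
move=> x; have -> : (fun i j : 'I_k.+1 => cev (L w i j + (mstar (L w) i j +
    (mmul (mstar w) (L w) i j + q i j))) x) = fun i j : 'I_k.+1 => (defect k (r x) i j)%:C.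
  apply/funext => i; apply/funext => j; rewrite !cevD /mmul.
  rewrite (cev_rr (f := fun l : 'I_k.+1 => l%:R / k%:R * (rot k (r x) l i - (l == i)%:R) *
    (rot k (r x) l j - (l == j)%:R))); last first.
    move=> l; rewrite /mstar cevS /L cevZ !cev_absorb conjC_real -!rmorphM; congr _%:C; ring.
  rewrite (sum_delta_rot _ _ i j (fun l : 'I_k.+1 => l%:R / k%:R)) /mstar cevS /L !cevZ !cev_absorb.
  rewrite -!rmorphM conjC_real.
  have -> : cev (q i j) x = (- (if (i == ord0) && (j == ord0) then r x else 0))%:C.
    by rewrite /q; case: ifP => _; rewrite ?cevN /rC ?mkCE ?cev0 ?oppr0 ?rmorphN.
  rewrite -!rmorphD; congr _%:C; rewrite /defect val_eqE.
  have -> : (i == 0%N :> nat) = (i == ord0) by rewrite -val_eqE.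
  case: (eqVneq i j) => [<-|ne].
    by case: (eqVneq i ord0) => [->|i0] /=; rewrite ?mul0r ?eqxx /=; ring.
  rewrite (_ : (i == ord0) && (j == ord0) = false); last first.
    by apply/negP => /andP[/eqP i0 /eqP j0]; move: ne; rewrite i0 j0 eqxx.
  have -> : false%:R = 0 :> R by []. ring.
exact: defect_bound.
Qed.

End Absorption.

Section Conj.
Variable R : realType.
Implicit Types a b : R[i].
(* Conjugation may be displayed by either of two convertible constants. *)
Lemma cj_conj a : Num.conj a = conjc a. Proof. by []. Qed.
Lemma cjD a b : conjc (a + b) = conjc a + conjc b. Proof. exact: rmorphD. Qed.
Lemma cjM a b : conjc (a * b) = conjc a * conjc b. Proof. exact: rmorphM. Qed.
Lemma cjN a : conjc (- a) = - conjc a. Proof. exact: rmorphN. Qed.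
Lemma cjB a b : conjc (a - b) = conjc a - conjc b. Proof. exact: rmorphB. Qed.
Lemma cj0 : conjc (0 : R[i]) = 0. Proof. exact: rmorph0. Qed.
Lemma cj1 : conjc (1 : R[i]) = 1. Proof. exact: rmorph1. Qed.
Lemma cjK a : conjc (conjc a) = a. Proof. exact: conjcK. Qed.
Lemma cj_real (x : R) : conjc (x%:C : R[i]) = x%:C. Proof. exact: conjc_real. Qed.
Lemma cj_nat n : conjc (n%:R : R[i]) = n%:R. Proof. exact: rmorph_nat. Qed.
Lemma cj_i : conjc ('i : R[i]) = - 'i. Proof. exact: conjCi. Qed.

Lemma cj_mul_nrm a : conjc a * a = ((nrm a) ^+ 2)%:C. Proof. exact: conjM_nrm. Qed.
End Conj.
Definition cjE := (cj_conj, cjD, cjM, cjB, cjN, cj0, cj1, cjK, cj_real, cj_nat, cj_i).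

(** * Representations of C(X) are contractive *)

Section PiContractive.
Variables (R : realType) (X : topologicalType) (cX : compact [set: X]).
Local Notation A := (CX R cX).
Variables (O : cstarAlgType R) (pi : A -> O) (pi_hom : star_hom pi).

(** A real function bounded by 1 is the mean of a unitary and its adjoint. *)
Lemma pi_le_real (f : X -> R) (cf : continuous f) : (forall x, `|f x| <= 1) ->
  nrm (pi (rC cX cf)) <= 1.
Proof.
move=> f1; have [lin mul star] := pi_hom.
have cs : continuous (fun x => Num.sqrt (1 - f x * f x)).
  by apply: contSqrt; apply: contB; [exact: contCst|exact: contM].
pose v : A := rC cX cf + 'i *: rC cX cs.
have vE : rC cX cf + rC cX cf = v + cstar v.
  apply: CXP => x; rewrite !cevD cevS /v cevD cevZ /rC !mkCE.
  by rewrite !cjE; ring.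
have vv : cmul (cstar v) v = CX1 R cX.
  apply: CXP => x; rewrite cevM cevS /v cevD cevZ /rC !mkCE /CX1 /cstC ?mkCE.
  rewrite !cjE.
  have h : 0 <= 1 - f x * f x.
    by rewrite subr_ge0 -expr2 -real_normK ?num_real// exprn_ile1.
  have -> (a b : R[i]) : (a + - 'i * b) * (a + 'i * b) = a ^+ 2 - 'i ^+ 2 * b ^+ 2 by ring.
  by rewrite sqrCi mulN1r opprK -!rmorphXn/= sqr_sqrtr// -rmorphD expr2 addrC subrK.
have p1 : nrm (pi (CX1 R cX)) <= 1.
  have : nrm (pi (CX1 R cX)) = nrm (pi (CX1 R cX)) ^+ 2.
    rewrite -nrm_sq -star -mul; congr (nrm (pi _)); apply: CXP => x.
    by rewrite cevM cevS /CX1 /cstC ?mkCE rmorph1 mulr1.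
  have := nrm_ge0 (pi (CX1 R cX)); move: (nrm _) => t t0 tt.
  rewrite leNgt; apply/negP => t1; have : t < t ^+ 2 by rewrite expr2 ltr_pMr// (lt_trans ltr01).
  by rewrite -tt ltxx.
have v1 : nrm (pi v) <= 1.
  by rewrite -(@ler_pXn2r _ 2%N)// ?nnegrE ?nrm_ge0// -nrm_sq -star -mul vv expr1n.
have twice : nrm (pi (rC cX cf) + pi (rC cX cf)) = nrm (pi (rC cX cf)) + nrm (pi (rC cX cf)).
  apply: (@complexI R); rewrite rmorphD/= -!nrmE -!mulr2n -normrMn.
  by [].
have := nrmD (pi v) (cstar (pi v)); rewrite nrm_star -star -(is_linearD _ _ lin) -vE.
rewrite (is_linearD _ _ lin) twice; lra.
Qed.

Lemma pi_le f : nrm (pi f) <= nrm f.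
Proof.
have [lin mul star] := pi_hom.
have [f0|f0] := eqVneq (nrm f) 0.
  by rewrite (nrm_eq0 f0) (is_linear0 lin) !nrm0.
have fp : 0 < nrm f by rewrite lt_neqAle eq_sym f0 nrm_ge0.
rewrite -(@ler_pXn2r _ 2%N)// ?nnegrE ?nrm_ge0// -nrm_sq -star -mul.
pose g x := nrm (cev f x) ^+ 2 / nrm f ^+ 2.
have cg : continuous g.
  apply: contM; last exact: contCst.
  by under eq_fun do rewrite expr2; apply: contM; exact: cont_nrm.
have -> : cmul (cstar f) f = ((nrm f ^+ 2)%:C) *: rC cX cg.
  apply: CXP => x; rewrite cevZ cevM cevS conjM_nrm /rC mkCE -rmorphM; congr _%:C.
  by rewrite /g mulrC divfK// expf_neq0.
rewrite (is_linearZ _ _ lin) nrmZ nrmCR ger0_norm ?sqr_ge0// -[leRHS]mulr1.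
rewrite ler_wpM2l ?sqr_ge0//; apply: pi_le_real => x.
rewrite /g ger0_norm ?divr_ge0 ?sqr_ge0// ler_pdivrMr ?exprn_gt0// mul1r.
by rewrite lerXn2r ?nnegrE ?nrm_ge0// nrm_cev.
Qed.

End PiContractive.

(** * Powers of a homeomorphism *)

Section Powers.
Variables (X : topologicalType) (alpha : homeo X).
Local Notation "x '^^' n" := (homeo_pow alpha n x) (at level 30, format "x ^^ n").

Lemma apow0 x : x^^0 = x. Proof. by []. Qed.
Lemma apow1 x : x^^1 = alpha x. Proof. by []. Qed.

Lemma apowS x (n : int) : x^^(n + 1) = alpha (x^^n).
Proof.
case: n => [n|[|n]].
- by rewrite (_ : Posz n + 1 = n.+1) //= -PoszD addn1.
- by rewrite /= homeoVK.
rewrite (_ : Negz n.+1 + 1 = Negz n); first by rewrite /= homeoVK.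
by rewrite !NegzE -[n.+2]addn1 PoszD opprD subrK.
Qed.

Lemma apowP x (n : int) : x^^(n - 1) = homeo_inv alpha (x^^n).
Proof. by rewrite -{2}[n](subrK 1) apowS homeoK. Qed.

Lemma apowD x (m n : int) : x^^(m + n) = (x^^n)^^m.
Proof.
elim/int_rect: m => [|m IH|m IH]; first by rewrite add0r.
  by rewrite -addn1 PoszD addrAC !apowS IH.
by rewrite -addn1 PoszD opprD addrAC !apowP IH.
Qed.

Lemma apowK x (n : int) : (x^^n)^^(- n) = x.
Proof. by rewrite -apowD addNr. Qed.

Lemma apowNK x (n : int) : (x^^(- n))^^n = x.
Proof. by rewrite -apowD addrN. Qed.

Lemma apow_inj n : injective (homeo_pow alpha n).
Proof. by move=> x y xy; rewrite -(apowK x n) xy apowK. Qed.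

Lemma apow_cont n : continuous (homeo_pow alpha n).
Proof.
elim/int_rect: n => [|n IH|n IH] x.
- exact: cvg_id.
- rewrite (_ : homeo_pow alpha n.+1 = alpha \o homeo_pow alpha n).
    by apply: continuous_comp; [exact: IH|exact: homeo_continuous].
  by apply/funext => y; rewrite -addn1 PoszD apowS.
rewrite (_ : homeo_pow alpha (- n.+1%:Z) = homeo_inv alpha \o homeo_pow alpha (- n%:Z)).
  by apply: continuous_comp; [exact: IH|exact: homeo_inv_continuous].
by apply/funext => y; rewrite -addn1 PoszD opprD apowP.
Qed.

End Powers.

(** * Unit frames and the relations of the generators *)

Section Frames.
Variables (R : realType) (X : topologicalType) (V : line_bundle R X).

Lemma unit_vector_ex x : exists e : vfibre V x, herm e e = 1 /\ forall w, exists c, w = c *: e.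
Proof.
have [e [e0 he]] := line_basis V x.
have p := herm_pos e0; have fp : 0 < fnorm e.
  rewrite lt_neqAle fnorm_ge0 andbT eq_sym; apply/eqP => /fnorm_eq0 ee.
  by move: e0; rewrite ee eqxx.
have i0 : ((fnorm e)^-1%:C : R[i]) * (fnorm e)%:C = 1.
  by rewrite -rmorphM mulVf ?gt_eqF.
exists (((fnorm e)^-1)%:C *: e); split.
  rewrite herm_scale -fnorm_sqr !cjE rmorphXn /=.
  have -> (a b : R[i]) : a * a * b ^+ 2 = (a * b) ^+ 2 by ring.
  by rewrite i0 expr1n.
move=> w; have [c ->] := he w; exists (c * (fnorm e)%:C).
by rewrite scalerA -mulrA [_%:C * _%:C]mulrC i0 mulr1.
Qed.

(** A unit vector in each fibre, chosen without any continuity. *)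
Definition frame_vec x : vfibre V x := projT1 (cid (unit_vector_ex x)).

Lemma frame_unit x : herm (frame_vec x) (frame_vec x) = 1.
Proof. by have [] := projT2 (cid (unit_vector_ex x)). Qed.

Definition coord (s : csection V) x : R[i] := herm (frame_vec x) (s x).

Lemma coordE (s : csection V) x : s x = coord s x *: frame_vec x.
Proof.
have [_ h] := projT2 (cid (unit_vector_ex x)); have [c cE] := h (s x).
by rewrite /coord cE hermZr frame_unit mulr1.
Qed.

Lemma herm_coord (s t : csection V) x : herm (s x) (t x) = conjc (coord s x) * coord t x.
Proof. by rewrite {1}coordE {1}[t x]coordE herm_scale frame_unit mulr1. Qed.

Lemma coord_inj (s t : csection V) : (forall x, coord s x = coord t x) -> s = t.
Proof. by move=> h; apply: csectionP => x; rewrite coordE [t x]coordE h. Qed.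

Lemma fnorm_coord (s : csection V) x : fnorm (s x) = nrm (coord s x).
Proof.
apply/eqP; rewrite -(@eqrXn2 _ 2%N) ?fnorm_ge0 ?nrm_ge0//; apply/eqP/(@complexI R).
by rewrite fnorm_sqr herm_coord cj_mul_nrm.
Qed.

End Frames.

Section Relations.
Variables (R : realType) (X : topologicalType) (cX : compact [set: X]).
Variables (V : line_bundle R X) (alpha : homeo X) (Y : set X).
Local Notation A := (CX R cX).
Local Notation EV := (EY cX V alpha Y).
Variables (O : cstarAlgType R) (pi : A -> O) (tau : EV -> O).
Hypothesis cov : covariant_rep pi tau.
Local Notation "x '^^' n" := (homeo_pow alpha n x) (at level 30, format "x ^^ n").

Definition ecoord (xi : EV) : X -> R[i] := coord (sub_val xi : csection V).

Let pi_hom : star_hom pi := rep_hom cov.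
Let lin_pi : is_linear pi. Proof. by have [] := pi_hom. Qed.

Lemma comp_homeo_cont (f : A) n : continuous (fun x => cev f (x^^n)).
Proof.
move=> x; apply: (@continuous_comp _ _ _ (homeo_pow alpha n) (cev f)); first exact: apow_cont.
exact: cev_cont.
Qed.

Lemma ecoord_dot xi eta x : cev (hdot xi eta) x = conjc (ecoord xi x) * ecoord eta x.
Proof. exact: herm_coord. Qed.

Lemma ecoord_lact f xi x : ecoord (lact f xi) x = cev f (alpha x) * ecoord xi x.
Proof. exact: hermZr. Qed.

Lemma ecoord_ract f xi x : ecoord (ract xi f) x = cev f x * ecoord xi x.
Proof. exact: hermZr. Qed.

Lemma ecoord_inj (xi eta : EV) : (forall x, ecoord xi x = ecoord eta x) -> xi = eta.
Proof. by move=> h; apply: sub_eltP; exact: coord_inj. Qed.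

Lemma ecoord_Y (xi : EV) x : Y (alpha x) -> ecoord xi x = 0.
Proof.
move=> Yx; apply: nrm_small => e e0.
have cl : closure (@EY_span R X cX V alpha Y) (sub_val xi) := sub_valP xi.
have e0' : 0 < (e%:C : R[i]) by rewrite ltcR.
have [z [[s [sY zE]]]] := cl _ (nbhsx_ballx (sub_val xi) _ e0').
rewrite -ball_normE /ball_ /= => d.
have z0 : coord (z : csection V) x = 0.
  rewrite zE; elim: (s) sY => [|[f eta] t IH] tY.
    by rewrite big_nil; exact: herm0r.
  rewrite big_cons; transitivity (coord (lact f eta : csection V) x +
      coord ((\sum_(p <- t) lact p.1 p.2 : Gamma_corr cX V alpha) : csection V) x).
    rewrite /coord -[herm _ _ in RHS]mul1r -herm_linear scale1r.
    by [].
  rewrite IH ?addr0 => [|p pt]; last by apply: tY; rewrite inE pt orbT.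
  have := tY (f, eta); rewrite inE eqxx => /(_ isT) /(_ _ Yx) /= fY.
  by rewrite /coord hermZr /= fY mul0r.
have -> : ecoord xi x = coord ((sub_val xi - z : Gamma_corr cX V alpha) : csection V) x.
  rewrite -[LHS]subr0 -z0 /ecoord /coord.
  transitivity (herm (frame_vec V x) ((-1) *: (z : csection V) x + (sub_val xi : csection V) x)).
    by rewrite herm_linear mulN1r addrC.
  by congr herm; rewrite scaleN1r addrC.
rewrite -fnorm_coord -lecR; apply: le_trans (ltW d).
exact: (@Gamma_norm_ub _ _ cX V (sub_val xi - z)).
Qed.

Lemma tau_dot xi eta : cmul (cstar (tau xi)) (tau eta) = pi (hdot xi eta).
Proof. by rewrite (rep_dot cov). Qed.

Lemma pi_tau f xi : cmul (pi f) (tau xi) = tau (lact f xi).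
Proof. exact: (rep_lact cov). Qed.

Lemma tau_pi xi f : cmul (tau xi) (pi f) = tau (ract xi f).
Proof.
apply/eqP; rewrite -subr_eq0; apply/eqP; apply: nrm_eq0; apply/eqP.
rewrite -(@eqrXn2 _ 2%N) ?nrm_ge0// expr0n -nrm_sq; apply/eqP.
pose P := pi (cmul (cmul (cstar f) (hdot xi xi)) f).
have e1 : cmul (cstar (cmul (tau xi) (pi f))) (cmul (tau xi) (pi f)) = P.
  by rewrite cstarM -cmulA [cmul (cstar (tau xi)) _]cmulA tau_dot /P !(piM pi_hom) (piS pi_hom) !cmulA.
have e2 : cmul (cstar (cmul (tau xi) (pi f))) (tau (ract xi f)) = P.
  rewrite cstarM -cmulA tau_dot -(piS pi_hom) -(piM pi_hom); congr pi; apply: CXP => x.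
  by rewrite !cevM !ecoord_dot ecoord_ract; ring.
have e3 : cmul (cstar (tau (ract xi f))) (cmul (tau xi) (pi f)) = P.
  rewrite cmulA tau_dot -(piM pi_hom); congr pi; apply: CXP => x.
  by rewrite !cevM !ecoord_dot ecoord_ract cevS !cjE; ring.
have e4 : cmul (cstar (tau (ract xi f))) (tau (ract xi f)) = P.
  rewrite tau_dot; congr pi; apply: CXP => x.
  by rewrite !cevM !ecoord_dot ecoord_ract cevS !cjE; ring.
by rewrite cstarB cmulBl !cmulBr e1 e2 e3 e4 !subrr nrm0.
Qed.

Lemma dot_back_cont (xi eta : EV) :
  continuous (fun x => conjc (ecoord eta (x^^(-1))) * ecoord xi (x^^(-1))).
Proof.
move=> x; have h := @comp_homeo_cont (hdot eta xi : A) (-1) x.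
rewrite (_ : (fun x => _) = fun x => cev (hdot eta xi : A) (x^^(-1))); first exact: h.
by apply/funext => y; rewrite ecoord_dot.
Qed.

(** Covariance on the ideal of functions vanishing on Y: rank-one operators of a line
    bundle act by such functions. *)
Lemma tau_tau xi eta : cmul (tau xi) (cstar (tau eta)) = pi (mkC cX (@dot_back_cont xi eta)).
Proof.
set g := mkC cX _.
have gact : @lact _ _ EV g = theta xi eta.
  apply/funext => zeta; apply: ecoord_inj => x.
  rewrite ecoord_lact /theta ecoord_ract ecoord_dot /g mkCE.
  rewrite -apow1 (apowK alpha x 1); ring.
have [psi [[_ _ _ psiT] psiJ]] := rep_cov cov.
rewrite -psiT -gact psiJ//; split.
  move=> e e0; exists [:: (xi, eta)] => zeta.
  by rewrite gact big_seq1 /= subrr normr0 mulr_ge0// lecR ltW.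
move=> b bker; apply: CXP => x; rewrite cevM cev0 /g mkCE.
have := bker xi => /(congr1 (fun z => ecoord z (x^^(-1)))).
rewrite ecoord_lact -apow1 apowNK => h.
have z0 : ecoord (0 : EV) (x^^(-1)) = 0 by exact: herm0r.
by rewrite -mulrA [_ * cev b x]mulrC h z0 mulr0.
Qed.

End Relations.

(** * Homogeneous elements and their symbols *)

Section Homogeneous.
Variables (R : realType) (X : topologicalType) (cX : compact [set: X]).
Variables (V : line_bundle R X) (alpha : homeo X) (Y : set X).
Local Notation A := (CX R cX).
Local Notation EV := (EY cX V alpha Y).
Variables (O : cstarAlgType R) (pi : A -> O) (tau : EV -> O).
Hypothesis cov : covariant_rep pi tau.
Local Notation "x '^^' n" := (homeo_pow alpha n x) (at level 30, format "x ^^ n").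
Implicit Types (s t : X -> R[i]) (a b : O) (f g : A) (xi eta : EV).

Let pi_hom : star_hom pi := rep_hom cov.
Let lin_pi : is_linear pi. Proof. by have [] := pi_hom. Qed.

Inductive Pos : nat -> (X -> R[i]) -> O -> Prop :=
| Pos0 f : Pos 0 (cev f) (pi f)
| PosS n s a xi : Pos n s a ->
    Pos n.+1 (fun x => ecoord xi (x^^n) * s x) (cmul (tau xi) a)
| PosD n s t a b : Pos n s a -> Pos n t b -> Pos n (fun x => s x + t x) (a + b).

Lemma PosE n m s t a b : Pos n s a -> n = m -> (forall x, s x = t x) -> a = b -> Pos m t b.
Proof. by move=> h <- /funext <- <-. Qed.

Lemma Pos0E s a : Pos 0 s a -> exists f, (forall x, s x = cev f x) /\ a = pi f.
Proof.
move E : 0%N => n h; elim: h E => {n s a} [f _|//|n s t a b _ IHs _ IHt E].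
  by exists f.
have [f [fs ->]] := IHs E; have [g [gt ->]] := IHt E.
exists (f + g); split; last by rewrite (is_linearD _ _ lin_pi).
by move=> x; rewrite cevD fs gt.
Qed.

Lemma nat_apowS x (n : nat) : x^^n.+1 = alpha (x^^n).
Proof. by []. Qed.

Lemma Pos_pil n s a f : Pos n s a -> Pos n (fun x => cev f (x^^n) * s x) (cmul (pi f) a).
Proof.
elim => {n s a} [g|n s a xi h IH|n s t a b _ IHs _ IHt].
- apply: (PosE (Pos0 (cmul f g))) => //; by rewrite (piM pi_hom).
- apply: (PosE (PosS (lact f xi) h)) => //; last by rewrite cmulA (pi_tau cov).
  by move=> x; rewrite ecoord_lact mulrA.
- apply: (PosE (PosD IHs IHt)) => // [x|]; first by rewrite mulrDr.
  by rewrite cmulDr.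
Qed.

Lemma Pos_pir n s a f : Pos n s a -> Pos n (fun x => s x * cev f x) (cmul a (pi f)).
Proof.
elim => {n s a} [g|n s a xi _ IH|n s t a b _ IHs _ IHt].
- apply: (PosE (Pos0 (cmul g f))) => //; by rewrite (piM pi_hom).
- apply: (PosE (PosS xi IH)) => // [x|]; first by rewrite mulrA.
  by rewrite cmulA.
- apply: (PosE (PosD IHs IHt)) => // [x|]; first by rewrite mulrDl.
  by rewrite cmulDl.
Qed.

Lemma PosZ n s a (c : R[i]) : Pos n s a -> Pos n (fun x => c * s x) (c *: a).
Proof.
elim => {n s a} [g|n s a xi _ IH|n s t a b _ IHs _ IHt].
- apply: (PosE (Pos0 (c *: g))) => //; by rewrite (is_linearZ _ _ lin_pi).
- apply: (PosE (PosS xi IH)) => // [x|]; first by rewrite mulrCA.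
  by rewrite cmulZr.
- apply: (PosE (PosD IHs IHt)) => // [x|]; first by rewrite mulrDr.
  by rewrite scalerDr.
Qed.

Lemma nat_apowD x (n m : nat) : x^^(n + m)%N = (x^^m)^^n.
Proof. by rewrite PoszD apowD. Qed.

Lemma Pos_mul n m s t a b : Pos n s a -> Pos m t b ->
  Pos (n + m) (fun x => s (x^^m) * t x) (cmul a b).
Proof.
move=> h hb; elim: h => {n s a} [f|n s a xi h IH|n s s' a a' _ IHs _ IHt].
- exact: Pos_pil.
- apply: (PosE (PosS xi IH)) => // [x|]; last by rewrite cmulA.
  by rewrite nat_apowD mulrA.
- apply: (PosE (PosD IHs IHt)) => // [x|]; first by rewrite mulrDl.
  by rewrite cmulDl.
Qed.

Lemma Pos_tau_star n s a xi : Pos n.+1 s a ->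
  Pos n (fun x => conjc (ecoord xi (x^^n)) * s x) (cmul (cstar (tau xi)) a).
Proof.
move E : n.+1 => m h; elim: h n E => {m s a} [//|m s a eta h _ n [->]|m s t a b _ IHs _ IHt n E].
- apply: (PosE (Pos_pil (hdot xi eta) h)) => // [x|].
    by rewrite ecoord_dot mulrA.
  by rewrite cmulA (tau_dot cov).
- apply: (PosE (PosD (IHs _ E) (IHt _ E))) => // [x|]; first by rewrite mulrDr.
  by rewrite cmulDr.
Qed.

Lemma Pos_starl n m s t a b : Pos n s a -> Pos (n + m) t b ->
  Pos m (fun x => conjc (s (x^^m)) * t x) (cmul (cstar a) b).
Proof.
move=> h; elim: h m t b => {n s a} [f|n s a xi h IH|n s s' a a' _ IHs _ IHt] m t b hb.
- by apply: (PosE (Pos_pil (cstar f) hb)) => //; rewrite (piS pi_hom).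
- have h1 : Pos (n + m) (fun x => conjc (ecoord xi (x^^(n + m)%N)) * t x)
    (cmul (cstar (tau xi)) b) by apply: Pos_tau_star; rewrite -addSn.
  apply: (PosE (IH _ _ _ h1)) => // [x|]; last by rewrite cstarM cmulA.
  by rewrite nat_apowD cjM mulrA [conjc (s _) * _]mulrC.
- apply: (PosE (PosD (IHs _ _ _ hb) (IHt _ _ _ hb))) => // [x|].
    by rewrite cjD mulrDl.
  by rewrite cstarD cmulDl.
Qed.

Inductive PosR (n : nat) : (X -> R[i]) -> O -> Prop :=
| PosR1 s a xi : Pos n s a -> PosR n (fun x => s (alpha x) * ecoord xi x) (cmul a (tau xi))
| PosRD s t a b : PosR n s a -> PosR n t b -> PosR n (fun x => s x + t x) (a + b).

Lemma PosRE n s t a b : PosR n s a -> (forall x, s x = t x) -> a = b -> PosR n t b.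
Proof. by move=> h /funext <- <-. Qed.

Lemma PosR_tau n s a eta : PosR n s a ->
  PosR n.+1 (fun x => ecoord eta (x^^n.+1) * s x) (cmul (tau eta) a).
Proof.
elim => {s a} [s a xi h|s t a b _ IHs _ IHt].
- apply: (PosRE (PosR1 xi (PosS eta h))) => [x|]; last by rewrite cmulA.
  by rewrite -addn1 nat_apowD apow1 mulrA.
- by apply: (PosRE (PosRD IHs IHt)) => [x|]; rewrite ?mulrDr ?cmulDr.
Qed.

Lemma PosR_of n s a : Pos n.+1 s a -> PosR n s a.
Proof.
move E : n.+1 => m h; elim: h n E => {m s a} [//|m s a eta h IH n [->]|m s t a b _ IHs _ IHt n E].
- case: m h IH => [|m] h IH; last by apply: PosR_tau; exact: IH.
  have [f [fs ->]] := Pos0E h.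
  apply: (PosRE (PosR1 (ract eta f) (Pos0 (CX1 R cX)))) => [x|].
    by rewrite ecoord_ract /CX1 /cstC mkCE mul1r fs mulrC.
  rewrite (pi_tau cov) (tau_pi cov); congr tau; apply: ecoord_inj => x.
  by rewrite ecoord_lact /CX1 /cstC mkCE mul1r.
- exact: (PosRD (IHs _ E) (IHt _ E)).
Qed.

Lemma Pos_starr n m s t a b : Pos (m + n) s a -> Pos n t b ->
  Pos m (fun x => s (x^^(- n%:Z)) * conjc (t (x^^(- n%:Z)))) (cmul a (cstar b)).
Proof.
elim: n m s t a b => [|n IH] m s t a b.
  rewrite addn0 => ha /Pos0E[f [fs ->]].
  apply: (PosE (Pos_pir (cstar f) ha)) => // [x|]; last by rewrite (piS pi_hom).
  by rewrite fs.
rewrite addnS => /PosR_of ha /PosR_of hb.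
elim: hb => {t b} [t b eta hb|t t' b b' _ IH1 _ IH2]; last first.
  by apply: (PosE (PosD IH1 IH2)) => // [x|]; rewrite ?cjD ?mulrDr// cstarD cmulDr.
elim: ha => {s a} [s a xi ha|s s' a a' _ IH1 _ IH2]; last first.
  by apply: (PosE (PosD IH1 IH2)) => // [x|]; rewrite ?mulrDl// cmulDl.
have h1 := Pos_pir (mkC cX (@dot_back_cont _ _ _ _ _ _ xi eta)) ha.
apply: (PosE (IH _ _ _ _ _ h1 hb)) => // [x|]; last first.
  by rewrite cstarM -(tau_tau cov) !cmulA.
rewrite mkCE -!apowD -[n.+1]addn1 PoszD !opprD [- 1 + - _]addrC -!apow1 -!apowD !cjM.
rewrite [1 + _]addrC subrK; ring.
Qed.

(** [Hom n s a]: the element a moves each point x to alpha^n x with coefficient s x,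
    measured in the chosen unit frames. *)
Definition Hom (n : int) s a : Prop :=
  match n with
  | Posz m => Pos m s a
  | Negz m => Pos m.+1 (fun x => conjc (s (x^^m.+1))) (cstar a)
  end.

Lemma HomE n m s t a b : Hom n s a -> n = m -> (forall x, s x = t x) -> a = b -> Hom m t b.
Proof. by move=> h <- /funext <- <-. Qed.

Lemma Hom_pi f : Hom 0 (cev f) (pi f). Proof. exact: Pos0. Qed.

Lemma Hom_pi0 (c : A) s : (forall x, s x = cev c x) -> Hom 0 s (pi c).
Proof. by move=> h; apply: (HomE (Hom_pi c)). Qed.

Lemma Hom0E s a : Hom 0 s a -> exists f, (forall x, s x = cev f x) /\ a = pi f.
Proof. exact: Pos0E. Qed.

Lemma Hom_tau xi : Hom 1 (ecoord xi) (tau xi).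
Proof.
apply: (PosE (PosS xi (Pos0 (CX1 R cX)))) => // [x|].
  by rewrite /CX1 /cstC mkCE mulr1.
rewrite (tau_pi cov); congr tau; apply: ecoord_inj => x.
by rewrite ecoord_ract /CX1 /cstC mkCE mul1r.
Qed.

Lemma Hom_add n s t a b : Hom n s a -> Hom n t b -> Hom n (fun x => s x + t x) (a + b).
Proof.
case: n => n ha hb; first exact: (PosD ha hb).
by apply: (PosE (PosD ha hb)) => // [x|]; rewrite ?cjD ?cstarD.
Qed.

Lemma Hom_scale n s a (c : R[i]) : Hom n s a -> Hom n (fun x => c * s x) (c *: a).
Proof.
case: n => n ha; first exact: PosZ.
by apply: (PosE (PosZ (conjc c) ha)) => // [x|]; rewrite ?cjM ?cstarZ.
Qed.

Lemma Hom_star n s a : Hom n s a -> Hom (- n) (fun x => conjc (s (x^^(- n)))) (cstar a).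
Proof.
case: n => [[|n]|n] ha.
- have [f [fs ->]] := Pos0E ha; rewrite -(piS pi_hom); apply: Hom_pi0 => x.
  by rewrite fs.
- rewrite -NegzE; apply: (PosE ha) => // [x|]; last by rewrite cstarK.
  by rewrite NegzE apowK cjK.
- rewrite NegzE opprK; exact: ha.
Qed.

Lemma Hom_mul n m s t a b : Hom n s a -> Hom m t b ->
  Hom (n + m) (fun x => s (x^^m) * t x) (cmul a b).
Proof.
have negpos p q u v c d : Pos p u c -> Pos q v d ->
    Hom (q%:Z - p%:Z) (fun x => conjc (u (x^^(q%:Z - p%:Z))) * v x) (cmul (cstar c) d).
  move=> hc hd; have [pq|/ltnW qp] := leqP p q.
    have hd' : Pos (p + (q - p)) v d by rewrite subnKC.
    by apply: (HomE (Pos_starl hc hd' : Hom (Posz (q - p)) _ _)) => //; rewrite ?subzn// => x; rewrite subzn.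
  have hc' : Pos (q + (p - q)) u c by rewrite subnKC.
  have h : Hom (Posz (p - q)) _ _ := Pos_starl hd hc'.
  apply: (HomE (Hom_star h)) => // [|x|]; rewrite -?subzn ?opprB//.
    by rewrite cjM cjK -apowD -[p%:Z - q%:Z]opprB addNr mulrC.
  by rewrite cstarM cstarK.
have posneg p q u v c d : Pos p u c -> Pos q v d ->
    Hom (p%:Z - q%:Z) (fun x => u (x^^(- q%:Z)) * conjc (v (x^^(- q%:Z)))) (cmul c (cstar d)).
  move=> hc hd; have [pq|/ltnW qp] := leqP q p.
    have hc' : Pos ((p - q) + q) u c by rewrite subnK.
    by apply: (HomE (Pos_starr hc' hd : Hom (Posz (p - q)) _ _)) => //; rewrite ?subzn.
  have hd' : Pos ((q - p) + p) v d by rewrite subnK.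
  have h : Hom (Posz (q - p)) _ _ := Pos_starr hd' hc.
  apply: (HomE (Hom_star h)) => // [|x|]; rewrite -?subzn ?opprB//.
    by rewrite cjM cjK -!apowD addrA addNr sub0r mulrC.
  by rewrite cstarM cstarK.
case: n => n; case: m => m ha hb.
- exact: Pos_mul.
- apply: (HomE (posneg _ _ _ _ _ _ ha hb)) => // [x|]; last by rewrite cstarK.
  by rewrite NegzE cjK apowNK.
- apply: (HomE (negpos _ _ _ _ _ _ ha hb)) => // [x|]; last by rewrite cstarK.
  by rewrite cjK -apowD addrC subrK.
- have h : Hom (Posz (m.+1 + n.+1)) _ _ := Pos_mul hb ha.
  have h2 := Hom_star h; apply: (HomE h2) => [|x|].
  + by rewrite !NegzE PoszD opprD addrC.
  + rewrite cjM !cjK -!apowD mulrC PoszD.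
    have -> : n.+1%:Z - (m.+1%:Z + n.+1%:Z) = Negz m by rewrite NegzE; lia.
    by rewrite subrr.
  + by rewrite cstarM !cstarK.
Qed.

Lemma Hom_opp n s a : Hom n s a -> Hom n (fun x => - s x) (- a).
Proof. by move=> h; apply: (HomE (Hom_scale (-1) h)) => // [x|]; rewrite ?mulN1r ?scaleN1r. Qed.

Lemma Hom_sub n s t a b : Hom n s a -> Hom n t b -> Hom n (fun x => s x - t x) (a - b).
Proof. by move=> ha hb; exact: (Hom_add ha (Hom_opp hb)). Qed.

Lemma Hom_sq n s a : Hom n s a -> exists f, (forall x, cev f x = (nrm (s x) ^+ 2)%:C) /\
  cmul (cstar a) a = pi f.
Proof.
move=> h; have h2 := Hom_mul (Hom_star h) h.
have [f [fs ->]] : exists f, (forall x, conjc (s ((x^^n)^^(- n))) * s x = cev f x) /\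
    cmul (cstar a) a = pi f by apply: Hom0E; rewrite addNr in h2.
by exists f; split => // x; rewrite -fs apowK cj_mul_nrm.
Qed.

Lemma Hom_le n s a (c : R) : Hom n s a -> 0 <= c -> (forall x, nrm (s x) <= c) -> nrm a <= c.
Proof.
move=> h c0 sc; have [f [fs aE]] := Hom_sq h.
rewrite -(@ler_pXn2r _ 2%N)// ?nnegrE ?nrm_ge0// -nrm_sq aE.
apply: le_trans (pi_le pi_hom f) _; apply: nrm_CX_le => [|x]; first exact: sqr_ge0.
by rewrite fs nrmCR ger0_norm ?sqr_ge0// lerXn2r ?nnegrE ?nrm_ge0.
Qed.

Lemma Hom_zero n s a : Hom n s a -> (forall x, s x = 0) -> a = 0.
Proof.
by move=> h s0; apply: nrm_le0; apply: (Hom_le h) => // x; rewrite s0 nrm0.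
Qed.

Lemma Hom_eq n s t a b : Hom n s a -> Hom n t b -> (forall x, s x = t x) -> a = b.
Proof.
move=> ha hb st; apply/eqP; rewrite -subr_eq0; apply/eqP.
by apply: (Hom_zero (Hom_sub ha hb)) => x; rewrite st subrr.
Qed.

Lemma Hom_nrm_cont n s a : Hom n s a -> continuous (fun x => nrm (s x)).
Proof.
move=> /Hom_sq[f [fs _]].
rewrite (_ : (fun x => _) = fun x => Num.sqrt (nrm (cev f x))).
  by apply: contSqrt; exact: cont_nrm.
apply/funext => x; rewrite fs nrmCR [`|_|]ger0_norm ?sqr_ge0// sqrtr_sqr ger0_norm//.
exact: nrm_ge0.
Qed.

Lemma Hom0 n : Hom n (fun=> 0) 0.
Proof.
have h0 (m : nat) : Pos m (fun=> 0) 0.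
  elim: m => [|m IH]; first by apply: (PosE (Pos0 0)) => //; exact: is_linear0.
  by apply: (PosE (PosS 0 IH)) => // [x|]; rewrite ?mulr0 ?cmul0r.
case: n => n; first exact: h0.
by apply: (PosE (h0 n.+1)) => // [x|]; rewrite ?cj0 ?cstar0.
Qed.

Lemma Hom_sum n I (r : seq I) (P : pred I) (s : I -> X -> R[i]) (a : I -> O) :
  (forall i, P i -> Hom n (s i) (a i)) ->
  Hom n (fun x => \sum_(i <- r | P i) s i x) (\sum_(i <- r | P i) a i).
Proof.
move=> h; elim: r => [|i r IH].
  by apply: (HomE (Hom0 n)) => // [x|]; rewrite big_nil.
case Pi : (P i).
  by apply: (HomE (Hom_add (h i Pi) IH)) => // [x|]; rewrite big_cons Pi.
by apply: (HomE IH) => // [x|]; rewrite big_cons Pi.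
Qed.

(** The orbit segment from x to alpha^n x, without the starting point of each step,
    avoids B. *)
Definition nocross (B : set X) (n : int) x :=
  forall l : int, (0 < l <= n) || (n < l <= 0) -> ~ B (x^^l).

Lemma nocross0 B x : nocross B 0 x.
Proof. by move=> l /orP[]; lia. Qed.

Lemma nocrossD B n m x : nocross B m x -> nocross B n (x^^m) -> nocross B (n + m) x.
Proof.
move=> hm hn l hl.
have [h|h] := boolP ((0 < l <= m) || (m < l <= 0)); first exact: hm.
by rewrite -[l](subrK m) apowD; apply: hn; move: hl h; lia.
Qed.

Lemma nocrossN B n x : nocross B n x -> nocross B (- n) (x^^n).
Proof. by move=> h l hl; rewrite -apowD; apply: h; move: hl; lia. Qed.

End Homogeneous.

(** * Partitions of unity and covering dimension *)

Section Topology.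
Variables (R : realType) (X : topologicalType).
Hypotheses (cX : compact [set: X]) (hX : hausdorff_space X).

Lemma ord0_false (j : 'I_0) : False. Proof. by case: j. Qed.

Lemma fin_cover (K : set X) (I : Type) (Q : I -> set X) : closed K ->
  (forall x, K x -> exists i, open (Q i) /\ Q i x) ->
  exists m (u : 'I_m -> I), (forall j, open (Q (u j))) /\
    forall x, K x -> exists j, Q (u j) x.
Proof.
move=> clK KQ; have cK : compact K := subclosed_compact clK cX (@subsetT _ K).
pose F := filter_from [set: seq I] (fun s0 => [set s : seq I | List.incl s0 s]).
have FF : Filter F.
  apply: filter_from_filter; first by exists [::].
  move=> s0 s1 _ _; exists (s0 ++ s1) => // s /= h.
  by split => i hi; apply: h; apply/List.in_app_iff; [left|right].
have [|s0 _ h] := (proj1 (compact_near_coveringP K) cK) (seq I) F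
    (fun s x => exists i, [/\ List.In i s, open (Q i) & Q i x]) FF.
  move=> x /KQ[i [oi Qi]]; exists (Q i, [set s | List.incl [:: i] s]) => /=.
    by split; [exact: open_nbhs_nbhs|exists [:: i]].
  by move=> [y s] /= [Qy si]; exists i; split => //; apply: si; left.
have {h} h : K `<=` (fun x => exists i, [/\ List.In i s0, open (Q i) & Q i x]).
  by apply: h => i.
(* keep the members that are open *)
have [m [u [ou uP]]] : exists m (u : 'I_m -> I), (forall j, open (Q (u j))) /\
    forall i, List.In i s0 -> open (Q i) -> exists j, u j = i.
  elim: s0 {h} => [|i s [m [u [ou uP]]]]; first by have u0 : 'I_0 -> I := (fun j => False_rect I (ord0_false j)); exists 0%N, u0; split => [[]|].
  have [oi|noi] := pselect (open (Q i)); last first.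
    by exists m, u; split => // i' [<-//|]; exact: uP.
  exists m.+1, (fun j => if unlift ord0 j is Some j' then u j' else i); split.
    by move=> j; case: unliftP.
  move=> i' [<- _|si oi']; first by exists ord0; rewrite unlift_none.
  by have [j jE] := uP i' si oi'; exists (lift ord0 j); rewrite liftK.
exists m, u; split => // x /h[i [si oi Qi]]; have [j jE] := uP i si oi.
by exists j; rewrite jE.
Qed.

Lemma normalX : normal_space X. Proof. exact: compact_normal. Qed.

Lemma urysohn01 (A C : set X) : closed A -> closed C -> (forall x, A x -> ~ C x) ->
  exists f : X -> R, [/\ continuous f, forall x, 0 <= f x <= 1,
    forall x, A x -> f x = 1 & forall x, C x -> f x = 0].
Proof.
move=> clA clC AC.
have : uniform_separator C A.
  apply: (proj1 (@normal_separatorP R X) normalX) => //.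
  by apply/seteqP; split => // x [Cx Ax]; exact: (AC x).
move=> /(@uniform_separatorP _ R)[f [cf f01 fC fA]]; exists f; split => //.
- by move=> x; have := f01 (f x); rewrite /= in_itv /=; apply; exists x.
- by move=> x Ax; apply: fA; exists x.
- by move=> x Cx; apply: fC; exists x.
Qed.

Lemma closed_ge (f : X -> R) (c : R) : continuous f -> closed [set x | c <= f x].
Proof. by move=> cf; apply: closed_comp (@closed_ge _ c) => x _; exact: cf. Qed.

Lemma closed_le (f : X -> R) (c : R) : continuous f -> closed [set x | f x <= c].
Proof. by move=> cf; apply: closed_comp (@closed_le _ c) => x _; exact: cf. Qed.

Lemma open_gt (f : X -> R) (c : R) : continuous f -> open [set x | c < f x].
Proof. by move=> cf; apply: open_comp (@open_gt _ c) => x _; exact: cf. Qed.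

Lemma open_lt (f : X -> R) (c : R) : continuous f -> open [set x | f x < c].
Proof. by move=> cf; apply: open_comp (@open_lt _ c) => x _; exact: cf. Qed.

Lemma closed_forall (I : Type) (F : I -> set X) :
  (forall i, closed (F i)) -> closed [set x | forall i, F i x].
Proof.
move=> h; have : closed (\bigcap_(i in [set: I]) F i) by apply: closed_bigI => i _; exact: h.
by congr closed; apply/seteqP; split => x /= hx i; [exact: hx|move=> _; exact: hx].
Qed.

Lemma closed_imp (P : Prop) (F : set X) : closed F -> closed [set x | P -> F x].
Proof. by move=> h; apply: (@closed_forall P (fun=> F)). Qed.

Lemma closed_existsI (I : finType) (F : I -> set X) :
  (forall i, closed (F i)) -> closed [set x | exists i, F i x].
Proof.
move=> h; have : closed (\bigcup_(i in [set: I]) F i).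
  by apply: closed_bigcup => [|i _]; [exact: finite_finset|exact: h].
by congr closed; apply/seteqP; split => x; case=> i; by exists i.
Qed.

Lemma open_existsI (I : Type) (F : I -> set X) :
  (forall i, open (F i)) -> open [set x | exists i, F i x].
Proof.
move=> h; have : open (\bigcup_(i in [set: I]) F i) by apply: bigcup_open => i _; exact: h.
by congr open; apply/seteqP; split => x; case=> i; by exists i.
Qed.

Lemma open_forallI (I : finType) (F : I -> set X) :
  (forall i, open (F i)) -> open [set x | forall i, F i x].
Proof.
move=> h; rewrite (_ : [set x | _] = ~` [set x | exists i, (~` F i) x]).
  by apply: closed_openC; apply: closed_existsI => i; apply: open_closedC.
apply/seteqP; split => x /= hx; first by move=> [ i ]; apply; exact: hx.
by move=> i; apply: contrapT => Fi; apply: hx; exists i.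
Qed.

(** The closed support S matters: a product of f with a function defined only on U
    extends continuously by zero. *)
Lemma bump (K U : set X) : closed K -> open U -> K `<=` U ->
  exists (f : X -> R) (S : set X), [/\ continuous f, forall x, 0 <= f x <= 1,
    forall x, K x -> f x = 1, closed S /\ S `<=` U & forall x, ~ S x -> f x = 0].
Proof.
move=> clK oU KU.
have [|f [cf f01 fK fU]] := urysohn01 clK (open_closedC oU).
  by move=> x /KU Ux.
exists (fun x => Num.max 0 (2 * f x - 1)), [set x | 2^-1 <= f x]; split.
- apply: contMax; first exact: contCst.
  by apply: contB; [apply: contM; [exact: contCst|exact: cf]|exact: contCst].
- move=> x; have /andP[f0 f1] := f01 x.
  by rewrite le_max lexx /= ge_max ler01 /=; lra.
- by move=> x /fK ->; rewrite mulr1 (_ : 2 - 1 = 1 :> R); [rewrite max_r|lra].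
- split; first exact: closed_ge.
  by move=> x /= fx; apply: contrapT => /fU f0; move: fx; rewrite f0; lra.
- by move=> x /= /negP; rewrite -ltNge => h; rewrite max_l//; lra.
Qed.

Lemma closed_pt (x : X) : closed [set x].
Proof. by apply: accessible_closed_set1; exact: hausdorff_accessible. Qed.

Lemma shrink (K U : set X) : closed K -> open U -> K `<=` U ->
  exists W S : set X, [/\ open W, closed S, K `<=` W, W `<=` S & S `<=` U].
Proof.
move=> clK oU KU; have [f [S [cf f01 fK [clS SU] fS]]] := bump clK oU KU.
exists [set x | 2^-1 < f x], S; split => //; first exact: open_gt.
  by move=> x /fK /= ->; lra.
by move=> x /= fx; apply: contrapT => /fS f0; move: fx; rewrite f0; lra.
Qed.

Definition part_unity (K : set X) (I : finType) (U : I -> set X)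
    (f : I -> X -> R) (S : I -> set X) :=
  [/\ forall j, continuous (f j), forall j x, 0 <= f j x,
      forall j, closed (S j) /\ S j `<=` U j, forall j x, ~ S j x -> f j x = 0 &
      (forall x, \sum_j f j x <= 1) /\ forall x, K x -> \sum_j f j x = 1].

Lemma part_unity_ex (K : set X) (I : finType) (U : I -> set X) : closed K ->
  (forall i, open (U i)) -> (forall x, K x -> exists i, U i x) ->
  exists f S, part_unity K U f S.
Proof.
move=> clK oU KU.
pose T := ((X -> R) * set X * I)%type.
pose good (t : T) := [/\ continuous t.1.1, forall x, 0 <= t.1.1 x,
  closed t.1.2, t.1.2 `<=` U t.2 & forall x, ~ t.1.2 x -> t.1.1 x = 0].
have [|m [u [ou uK]]] := @fin_cover K T (fun t => [set x | good t /\ 2^-1 < t.1.1 x]) clK.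
  move=> x Kx; have [i Ux] := KU x Kx.
  have [|f [S [cf f01 fK [clS SU] fS]]] := bump (@closed_pt x) (oU i); first by move=> _ ->.
  have g : good (f, S, i) by split => //= y; have /andP[] := f01 y.
  exists (f, S, i); split; last by split => //=; rewrite fK//; lra.
  rewrite (_ : [set x | _] = [set x | 2^-1 < f x]); first exact: open_gt.
  by apply/seteqP; split => y /= => [[]|].
pose ok e := `[< good (u e) >].
have okP e : ok e -> good (u e) by move=> /asboolP.
pose g x := \sum_(e | ok e) (u e).1.1 x.
have cg : continuous g by apply: contSum => e /okP[].
have g0 x : 0 <= g x by apply: sumr_ge0 => e /okP[].
pose f i x := (\sum_(e | ok e && ((u e).2 == i)) (u e).1.1 x) / Num.max 2^-1 (g x).
have mp x : 0 < Num.max 2^-1 (g x) by rewrite lt_max invr_gt0 ltr0n.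
have fsum x : \sum_i f i x = g x / Num.max 2^-1 (g x).
  rewrite -mulr_suml; congr (_ / _); rewrite [RHS](partition_big (fun e => (u e).2) predT)//=.
exists f, (fun i => [set x | exists e : {e | ok e && ((u e).2 == i)}, (u (val e)).1.2 x]); split.
- move=> i; apply: contM; first by apply: contSum => e /andP[/okP[]].
  move=> x; apply: (@continuous_comp _ _ _ (fun x => Num.max 2^-1 (g x)) (fun y => y^-1)).
    by apply: contMax; [exact: contCst|exact: cg].
  by apply: inv_continuous; rewrite gt_eqF.
- move=> i x; rewrite divr_ge0 ?(ltW (mp x))//.
  by apply: sumr_ge0 => e /andP[/okP[]].
- move=> i; split; first by apply: closed_existsI => -[e /= /andP[/okP[]]].
  by move=> x [[e /= /andP[/okP[_ _ _ sU _] /eqP ei]]]; rewrite -ei; exact: sU.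
- move=> i x nS; rewrite /f big1 ?mul0r// => e he; have [/okP[_ _ _ _ h] _] := andP he.
  by apply: h => Sx; apply: nS; exists (exist _ e he).
- split=> x => [|Kx]; rewrite fsum.
    by rewrite ler_pdivrMr// mul1r le_max lexx orbT.
  rewrite max_r ?divff//; last first.
    have [j [gj jx]] := uK x Kx; apply: le_trans (ltW jx) _.
    rewrite /g (bigD1 j)/=; last by apply/asboolP.
    by rewrite lerDl; apply: sumr_ge0 => e /andP[/okP[]].
  have [j [gj jx]] := uK x Kx; rewrite gt_eqF// (lt_le_trans _ (_ : (u j).1.1 x <= _))//.
    by rewrite (lt_trans _ jx)// invr_gt0 ltr0n.
  rewrite /g (bigD1 j)/=; last by apply/asboolP.
  by rewrite lerDl; apply: sumr_ge0 => e /andP[/okP[]].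
Qed.

Variable d : nat.
Hypothesis dimX : covering_dim_le X d.

Definition cnt (I : finType) (P : I -> Prop) : nat := #|[set i | `[< P i >]]%SET|.

Lemma cnt_le (I J : finType) (P : I -> Prop) (Q : J -> Prop) (f : I -> J) :
  (forall i, P i -> Q (f i)) -> (forall i i', P i -> P i' -> f i = f i' -> i = i') ->
  (cnt P <= cnt Q)%N.
Proof.
move=> fPQ inj; rewrite /cnt -(card_in_imset (f := f)).
  apply/subset_leq_card/fintype.subsetP => _ /imsetP[i + ->].
  by rewrite !finset.in_set => /asboolP h; apply/asboolP; exact: fPQ.
by move=> i i'; rewrite !finset.in_set => /asboolP ? /asboolP ?; exact: inj.
Qed.

Lemma part_unity_dim (I : finType) (U : I -> set X) :
  (forall i, open (U i)) -> (forall x, exists i, U i x) ->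
  exists f S, part_unity setT U f S /\ forall x, (cnt (fun i => S i x) <= d.+1)%N.
Proof.
move=> oU cU.
have [||k [V [oV cV VU Vd]]] := dimX (U := fun i : 'I_#|I| => U (enum_val i)).
- by move=> i; exact: oU.
- apply/seteqP; split => // x _; have [i Ui] := cU x.
  by exists (enum_rank i) => //; rewrite enum_rankK.
have [j jP] : exists j : 'I_k -> I, forall e, V e `<=` U (j e).
  suff [j jP] : {j : 'I_k -> 'I_#|I| & forall e, V e `<=` U (enum_val (j e))}.
    by exists (fun e => enum_val (j e)).
  by apply: (@choice _ _ (fun e i => V e `<=` U (enum_val i))) => e; have [ i ] := VU e; exists i.
have [|f [S [cf f0 SV fS [fle f1]]]] := part_unity_ex (closedT : closed [set: X]) oV.
  move=> x _; have : (\bigcup_i V i) x by rewrite cV.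
  by move=> [i _ Vi]; exists i.
exists (fun i x => \sum_(e | j e == i) f e x),
       (fun i => [set x | exists e : {e | j e == i}, S (val e) x]).
have sumE x : \sum_i \sum_(e | j e == i) f e x = \sum_e f e x.
  by rewrite [RHS](partition_big j predT).
split; first split.
- by move=> i; apply: contSum => e _; exact: cf.
- by move=> i x; apply: sumr_ge0.
- move=> i; split; first by apply: closed_existsI => e; have [] := SV (val e).
  by move=> x [[e /= /eqP <-]] Se; apply: jP; have [_] := SV e; exact.
- move=> i x nS; apply: big1 => e je; apply: fS => Se.
  by apply: nS; exists (exist _ e je).
- by split=> x => [|_]; rewrite sumE; [exact: fle|exact: f1].
move=> x; apply: leq_trans (Vd x).
(* each active index i is witnessed by an active member of the refinement *)
have [h hP] : {h : I -> option 'I_k & forall i, match h i with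
    | Some e => j e = i /\ S e x | None => ~ exists e : {e | j e == i}, S (val e) x end}.
  apply: (@choice _ _ (fun i o => match o with
    | Some e => j e = i /\ S e x | None => ~ exists e : {e | j e == i}, S (val e) x end)) => i.
  have [[[e /= /eqP je] Se]|h] := pselect (exists e : {e | j e == i}, S (val e) x).
    by exists (Some e).
  by exists None.
apply: leq_trans (_ : cnt (fun e => V e x) <= _)%N; last by [].
rewrite /cnt -(card_in_imset (f := h)); last first.
  move=> i i'; rewrite !finset.in_set => /asboolP hi /asboolP hi'.
  have := hP i; have := hP i'; case: (h i) => [e|//]; case: (h i') => [e'|//].
  by move=> [<- _] [<- _] [->].
have sI : injective (@Some 'I_k) by move=> ? ? [].
rewrite -(card_imset _ sI); apply/subset_leq_card/fintype.subsetP => _ /imsetP[i + ->].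
rewrite finset.in_set => /asboolP hi; have := hP i; case: (h i) => [e [_ Se]|//].
by apply: imset_f; rewrite finset.in_set; apply/asboolP; have [_ SVe] := SV e; exact: SVe.
Qed.

(** A finite cover refines to one by closed pieces in d+1 colours, pieces of one colour
    being disjoint: a point where exactly the members of s dominate a partition of unity
    belongs to the piece labelled s, coloured by the number of its elements. *)
Lemma colour_classes (I : finType) (U : I -> set X) :
  (forall i, open (U i)) -> (forall x, exists i, U i x) ->
  exists (E : finType) (K : E -> set X) (col : E -> 'I_d.+1),
  [/\ forall e, closed (K e), forall e, exists i, forall x, K e x -> U i x,
      forall x, exists e, K e x &
      forall e e' x, col e = col e' -> K e x -> K e' x -> e = e'].
Proof.
move=> oU cU; have [i0|noI] := pselect (inhabited I); last first.
  exists void, (fun=> set0), (fun=> ord0); split => [[]|[]|x|[]]. by have [i _] := cU x; case: noI; exists; exact: i.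
have [f [S [[cf f0 SU fS [_ f1]] Sd]]] := part_unity_dim oU cU.
pose D : R := d.+1%:R; have D1 : 1 <= D by rewrite ler1n.
pose dl : R := (D * (D + 1))^-1.
have dl0 : 0 < dl by rewrite invr_gt0 mulr_gt0//; lra.
pose K (s : {set I}) := [set x | [/\ (0 < #|s| <= d.+1)%N, forall e, e \in s -> dl <= f e x &
   forall p : I * I, p.1 \in s -> p.2 \notin s -> dl <= f p.1 x - f p.2 x]].
exists ({set I} : finType), K, (fun s : {set I} => inord #|s|.-1); split.
- move=> s; rewrite (_ : K s = [set x | (0 < #|s| <= d.+1)%N] `&`
      ([set x | forall e, e \in s -> dl <= f e x] `&`
      [set x | forall p : I * I, p.1 \in s -> p.2 \notin s -> dl <= f p.1 x - f p.2 x])).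
    apply: closedI.
      have [h|h] := boolP (0 < #|s| <= d.+1)%N.
        rewrite (_ : [set x | _] = setT); [exact: closedT|by apply/seteqP; split].
      rewrite (_ : [set x | _] = set0); [exact: closed0|by apply/seteqP; split => // x /=; rewrite (negbTE h)].
    apply: closedI; apply: closed_forall.
      by move=> e; apply: closed_imp; exact: closed_ge.
    move=> p; do 2 apply: closed_imp; apply: closed_ge.
    by apply: contB; exact: cf.
  by apply/seteqP; split => [x [h1 h2 h3]|x [h1 [h2 h3]]].
- move=> s; have [i0'] := i0.
  have [->|[i si]] := set_0Vmem s; first by exists i0' => x []; rewrite cards0.
  exists i => x [_ h _]; have [_] := SU i; apply; apply: contrapT => /fS fx.
  by have := h _ si; rewrite fx leNgt dl0.
- move=> x.
  (* among d+2 disjoint intervals of length dl one contains no value *)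
  have [i hi] : exists i : 'I_d.+2, forall e, ~ (i%:R * dl < f e x < i.+1%:R * dl).
    apply: contrapT => /forallNP h.
    have [g gP] : {g : 'I_d.+2 -> I & forall i : 'I_d.+2, i%:R * dl < f (g i) x < i.+1%:R * dl}.
      apply: (@choice _ _ (fun (i : 'I_d.+2) e => i%:R * dl < f e x < i.+1%:R * dl)) => i.
      by have := h i => /existsNP[e /contrapT]; exists e.
    have := Sd x; rewrite leqNgt => /negP; apply.
    rewrite -[X in (X <= _)%N](card_ord d.+2) -[#|'I_d.+2|](_ : cnt (fun _ : 'I_d.+2 => True) = _); last first.
      by rewrite /cnt; apply: eq_card => i; rewrite finset.in_set; apply/asboolP.
    apply: (cnt_le (f := g)) => [i _|i i' _ _ gi].
      apply: contrapT => /fS gx; have /andP[+ _] := gP i.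
      by rewrite gx; apply/negP; rewrite -leNgt mulr_ge0 ?ler0n// ltW.
    have /andP[a1 a2] := gP i; have /andP[b1 b2] := gP i'; rewrite -gi in b1 b2.
    have := lt_trans a1 b2; have := lt_trans b1 a2.
    by rewrite !ltr_pM2r// !ltr_nat !ltnS => ? ?; apply/val_inj/eqP; rewrite eqn_leq; apply/andP.
  have hi' e : f e x <= i%:R * dl \/ i.+1%:R * dl <= f e x.
    have [|h] := leP (f e x) (i%:R * dl); first by left.
    by right; rewrite leNgt; apply/negP => h2; apply: (hi e); rewrite h h2.
  pose s := [set e : I | i.+1%:R * dl <= f e x]%SET.
  have sE e : (e \in s) = (i.+1%:R * dl <= f e x) by rewrite finset.in_set.
  have dli : dl <= i.+1%:R * dl by rewrite ler_peMl ?ler1n// ltW.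
  have sS e : e \in s -> S e x.
    rewrite sE => h; apply: contrapT => /fS fx; move: h; rewrite fx leNgt.
    by rewrite (lt_le_trans dl0 dli).
  exists s; split.
  + apply/andP; split; last first.
      apply: leq_trans (Sd x); rewrite /cnt; apply/subset_leq_card/fintype.subsetP => e /sS Se.
      by rewrite finset.in_set; apply/asboolP.
    rewrite card_gt0; apply/eqP => s0.
    have := f1 x Logic.I => /eqP; rewrite lt_eqF//.
    apply: le_lt_trans (_ : \sum_e (if `[< S e x >] then i%:R * dl else 0) < 1).
      apply: ler_sum => e _; case: asboolP => [_|/fS ->//].
      have [//|h] := hi' e; have : e \in s by rewrite sE.
      by rewrite s0 inE.
    rewrite -big_mkcond sumr_const -[_ *+ #|_|]mulr_natl.
    have c1 : (#|[pred e | `[< S e x >]]|%:R : R) <= D.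
      rewrite ler_nat; apply: leq_trans (Sd x); rewrite /cnt.
      by apply/subset_leq_card/fintype.subsetP => e; rewrite finset.in_set.
    have c2 : (i%:R : R) <= D by rewrite ler_nat -ltnS.
    apply: le_lt_trans (_ : D * (D * dl) < 1).
      apply: ler_pM => //; [by rewrite mulr_ge0 ?ler0n// ltW|].
      by rewrite ler_wpM2r// ltW.
    rewrite mulrA /dl ltr_pdivrMr ?mul1r ?mulr_gt0 ?ltr_pM2l//; lra.
  + by move=> e; rewrite sE; apply: le_trans.
  + move=> [e e'] /=; rewrite !sE => h /negP h'; have [h2|//] := hi' e'.
    by move: h h2; rewrite -natr1 mulrDl mul1r; lra.
- move=> s s' x /(congr1 val); rewrite /= => cE [hs _ h] [hs' _ h'].
  have {cE} cE : #|s| = #|s'| by move: cE; rewrite !inordK; lia.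
  apply/eqP; rewrite eqEcard cE leqnn andbT; apply/fintype.subsetP => e es.
  apply: contrapT => /negP es'.
  have [e' e's' e's] : exists2 e', e' \in s' & e' \notin s.
    have /subsetPn[e' ? ?] : ~~ (s' \subset s); last by exists e'.
    apply: contraNN es' => ss; rewrite (_ : s' = s)//.
    by apply/eqP; rewrite eqEcard ss cE /=.
  by have := h (e, e') es e's; have := h' (e', e) e's' es'; rewrite /=; lra.
Qed.

End Topology.

(** * Minimal homeomorphisms *)

Section Minimal.
Variables (R : realType) (X : topologicalType).
Hypotheses (cX : compact [set: X]) (hX : hausdorff_space X).
Variable alpha : homeo X.
Hypotheses (minX : minimal alpha) (infX : infinite_set [set: X]).
Local Notation "x '^^' n" := (homeo_pow alpha n x) (at level 30, format "x ^^ n").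

Lemma open_pre (U : set X) n : open U -> open [set x | U (x^^n)].
Proof. by move=> oU; apply: open_comp oU => x _; exact: apow_cont. Qed.

Lemma closed_pre (U : set X) n : closed U -> closed [set x | U (x^^n)].
Proof. by move=> oU; apply: closed_comp oU => x _; exact: apow_cont. Qed.

Lemma finite_range (I : finType) (f : I -> X) : ~ (forall x, exists i, x = f i).
Proof.
move=> h; apply: infX; apply: (@sub_finite_set _ _ (f @` [set: I])).
  by move=> x _; have [i ->] := h x; exists i.
by apply: finite_image; exact: finite_finset.
Qed.

(** A periodic orbit is a finite invariant closed set, hence would be the whole infinite
    space. *)
Lemma aperiodic x n : n != 0 -> x^^n <> x.
Proof.
have pos (m : nat) : x^^m.+1 <> x.
  move=> xm; pose E := [set y | exists i : 'I_m.+1, y = x^^i].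
  have clE : closed E by apply: (@closed_existsI _ _ (fun i : 'I_m.+1 => [set x^^i])) => i; exact: closed_pt.
  have aE : alpha @` E `<=` E.
    move=> _ [_ [i ->] <-]; rewrite -[alpha _]/(x^^i.+1).
    have [im|im] := ltnP i.+1 m.+1; first by exists (Ordinal im).
    have -> : nat_of_ord i = m by apply/eqP; rewrite eqn_leq -ltnS ltn_ord -ltnS.
    by exists ord0; rewrite xm.
  have [E0|ET] := minX clE aE.
    have : E x by exists ord0.
    by rewrite E0.
  apply: (@finite_range _ (fun i : 'I_m.+1 => x^^i)) => y.
  by have : E y by rewrite ET.
case: n => [[//|n] _|n _]; first exact: pos.
by move=> h; apply: (pos n); rewrite -{1}h NegzE apowNK.
Qed.

(** The points whose forward orbits never enter W form a closed set mapped into itself;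
    compactness then makes the entrance time uniform. *)
Lemma syndetic (W : set X) : open W -> W !=set0 ->
  exists T : nat, forall x, exists t : nat, (t <= T)%N /\ W (x^^t).
Proof.
move=> oW [w Ww]; pose E := [set x | forall t : nat, ~ W (x^^t)].
have clE : closed E.
  by apply: closed_forall => t; apply: open_closedC; exact: open_pre.
have aE : alpha @` E `<=` E.
  move=> _ [x Ex <-] t; have := Ex t.+1.
  by rewrite -addn1 PoszD apowD apow1.
have [E0|ET] := minX clE aE; last first.
  by have Ew : E w; [rewrite ET|case: (Ew 0%N)].
have [|m [u [ou uP]]] := @fin_cover _ cX setT nat (fun t => [set x | W (x^^t)]) closedT.
  move=> x _; have : ~ E x by rewrite E0.
  by move=> /existsNP[t /contrapT Wt]; exists t; split => //; exact: open_pre.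
exists (\max_(j < m) u j)%N => x; have [j Wj] := uP x Logic.I.
by exists (u j); split => //; exact: (leq_bigmax j).
Qed.

Lemma syndetic_back (W : set X) T : (forall x, exists t : nat, (t <= T)%N /\ W (x^^t)) ->
  forall x, exists t : nat, (t <= T)%N /\ W (x^^(- t%:Z)).
Proof.
move=> h x; have [t [tT Wt]] := h (x^^(- T%:Z)); exists (T - t)%N.
by rewrite leq_subr; split => //; rewrite -subzn// opprB apowD.
Qed.

Lemma avoid_points (W : set X) (s : seq X) : open W -> W !=set0 ->
  exists x, W x /\ x \notin s.
Proof.
move=> oW W0; have [T hT] := syndetic oW W0; apply: contrapT => no.
have sW x : W x -> exists j : 'I_(size s), x = tnth (in_tuple s) j.
  move=> Wx; apply/tnthP; rewrite /=; apply: contrapT => /negP xs.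
  by apply: no; exists x.
apply: (@finite_range _ (fun p : 'I_T.+1 * 'I_(size s) => (tnth (in_tuple s) p.2)^^(- p.1%:Z))).
move=> x; have [t [tT /sW[j jE]]] := hT x; rewrite -ltnS in tT.
by exists (Ordinal tT, j); rewrite /= -jE apowK.
Qed.

Lemma separate (x y : X) : x <> y -> exists A B : set X,
  [/\ open A, open B, A x, B y & forall z, A z -> ~ B z].
Proof.
move=> /eqP xy; have := hX; rewrite open_hausdorff => /(_ _ _ xy)[[A B] [Ax By] [oA oB AB]].
exists A, B; split => //; [exact/set_mem|exact/set_mem|].
move/eqP : AB => /= AB z Az Bz; suff : @set0 X z by [].
by rewrite -[set0]AB.
Qed.

Definition free_upto (M : nat) (W : set X) :=
  forall x (m : int), (absz m <= M)%N -> W x -> W (x^^m) -> m = 0.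

Lemma free_nbhd x M : exists W, [/\ open W, W x & free_upto M W].
Proof.
have [F FP] : {F : 'I_M -> set X & forall m, open (F m) /\ F m x /\
    forall y, F m y -> ~ F m (y^^m.+1)}.
  apply: (@choice _ _ (fun (m : 'I_M) F => open F /\ F x /\ forall y, F y -> ~ F (y^^m.+1))) => m.
  have [|A [B [oA oB Ax By AB]]] := @separate x (x^^m.+1).
    by move=> h; apply: (@aperiodic x m.+1).
  exists (A `&` [set y | B (y^^m.+1)]); split; first by apply: openI => //; exact: open_pre.
  by split => // y [_ /= By1] [Ay1 _]; exact: (AB _ Ay1).
exists [set y | forall m, F m y]; split => [|m|y m].
- by apply: open_forallI => m; have [] := FP m.
- by have [_ []] := FP m.
have pos (k : nat) z : (k <= M)%N -> (forall m, F m z) -> (forall m, F m (z^^k)) -> k = 0%N.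
  case: k => // k kM hz hzk; have [_ [_ h]] := FP (Ordinal kM).
  by case: (h z (hz _) (hzk _)).
case: m => k kM hy hyk; first by rewrite (pos k y).
have := pos k.+1 (y^^(Negz k)) kM hyk; rewrite NegzE apowNK => /(_ hy).
by [].
Qed.

Lemma free_cover M : exists n (K : 'I_n -> set X), [/\ forall i, closed (K i),
  forall i, free_upto M (K i) & forall x, exists i, K i x].
Proof.
have [|m [u [ou uP]]] := @fin_cover _ cX setT (set X * set X) (fun p =>
    [set x | [/\ p.1 x, open p.1, closed p.2 & p.1 `<=` p.2 /\ free_upto M p.2]]) closedT.
  move=> x _; have [W [oW Wx fW]] := free_nbhd x M.
  have [|W' [S [oW' clS xW WS SW]]] := shrink R cX hX (@closed_pt X hX x) oW.
    by move=> _ ->.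
  exists (W', S) => /=.
  have fS : free_upto M S by move=> z k kM /SW Wz /SW; exact: fW.
  split; last by split => //; exact: xW.
  rewrite (_ : [set x | _] = W') //; apply/seteqP; split => [y []//|y Wy].
  by split.
exists m, (fun i => [set x | (exists y, [/\ (u i).1 y, open (u i).1, closed (u i).2 &
  (u i).1 `<=` (u i).2 /\ free_upto M (u i).2]) /\ (u i).2 x]); split.
- move=> i; have [[y [h1 h2 h3 h4]]|h] := pselect (exists y, [/\ (u i).1 y, open (u i).1, closed (u i).2 &
    (u i).1 `<=` (u i).2 /\ free_upto M (u i).2]).
    rewrite (_ : [set x | _] = (u i).2)//; apply/seteqP; split => [z []//|z uz].
    by split => //; exists y.
  rewrite (_ : [set x | _] = set0); first exact: closed0.
  by apply/seteqP; split => [z []|].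
- by move=> i z k kM [[y [_ _ _ [_ f]]] uz] [_ uz']; exact: (f z).
- move=> x; have [i [h1 h2 h3 [h4 h5]]] := uP x Logic.I; exists i; split; last exact: h4.
  by exists x.
Qed.

(** * Functions taking the value 1/2 rarely along orbits *)

Variable d : nat.
Hypothesis dimX : covering_dim_le X d.

Let oscillation (g : X -> R) (n : nat) (t : 'I_n -> nat) (dl : R) : continuous g -> 0 < dl ->
  exists (m : nat) (U : 'I_m -> set X), [/\ forall i, open (U i), forall x, exists i, U i x &
    forall i x y c, U i x -> U i y -> `|g (x^^(t c)) - g (y^^(t c))| < dl].
Proof.
move=> cg dl0; have dl2 : 0 < dl / 2 by rewrite divr_gt0.
pose N x := [set y | forall c, `|g (y^^(t c)) - g (x^^(t c))| < dl / 2].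
have [|m [u [ou uP]]] := @fin_cover _ cX setT X N closedT.
  move=> x _; exists x; split; last by move=> c; rewrite subrr normr0.
  apply: (@open_forallI _ _ (fun c y => `|g (y^^(t c)) - g (x^^(t c))| < dl / 2)) => c.
  apply: open_lt; apply: contAbs; apply: contB; last exact: contCst.
  move=> y; apply: (@continuous_comp _ _ _ (homeo_pow alpha (t c)) g); first exact: apow_cont.
  exact: cg.
exists m, (fun i => N (u i)); split => // [x|i x y c Nx Ny]; first exact: uP.
have hx := Nx c; have hy := Ny c; rewrite distrC in hy.
apply: le_lt_trans (ler_distD (g ((u i)^^(t c))) _ _) _; lra.
Qed.

(** On a closed set K whose translates by t are disjoint, any d+1 of the numbers
    [g (x^^t)] are prevented from being all close to 1/2: cut K into small pieces in d+1
    colours and lift g on the translate by t c of those pieces of colour c where it comes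
    close to 1/2. *)
Let perturb (A C : set X) (g : X -> R) (dl : R) (K : set X) (M : nat) (t : 'I_d.+1 -> 'I_M) :
  closed A -> closed C -> continuous g ->
  (forall x, A x -> g x = 1) -> (forall x, C x -> g x = 0) ->
  closed K -> free_upto M K -> injective t -> 0 < dl -> dl <= 16%:R^-1 ->
  exists h : X -> R, [/\ continuous h, forall x, 0 <= h x <= 4 * dl,
    forall x, A x \/ C x -> h x = 0 &
    forall x, K x -> exists c, dl <= `|g (x^^(t c)) + h (x^^(t c)) - 2^-1|].
Proof.
move=> clA clC cg gA gC clK fK tinj dl0 dl1.
have [m [U [oU cU osc]]] := oscillation (fun c => val (t c)) cg dl0.
have [E [P [col [clP PU cP dP]]]] := colour_classes R cX hX dimX oU cU.
pose tc e : int := (t (col e))%:Z.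
pose Q e := [set z | K (z^^(- tc e)) /\ P e (z^^(- tc e))].
have QE e z : Q e z -> exists x, [/\ z = x^^(tc e), K x & P e x].
  by move=> [Kz Pz]; exists (z^^(- tc e)); rewrite apowNK.
have clQ e : closed (Q e) by apply: closedI; exact: closed_pre.
have disj e e' z : Q e z -> Q e' z -> e = e'.
  move=> /QE[x [-> Kx Px]] /QE[x' [zE Kx' Px']].
  have xx : x' = x^^(tc e - tc e').
    by rewrite addrC apowD zE apowK.
  have eqc : col e = col e'.
    have h := fK x (tc e - tc e') _ Kx; rewrite -xx in h.
    have := h _ Kx'; rewrite /tc => {}h; apply: tinj; apply: val_inj => /=.
    have : (t (col e))%:Z - (t (col e'))%:Z = 0 by apply: h; have := ltn_ord (t (col e)); have := ltn_ord (t (col e')); lia.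
    lia.
  apply: (dP _ _ x) => //; suff <- : x' = x by [].
  by rewrite xx /tc eqc subrr.
pose near_half e := exists2 z, Q e z & `|g z - 2^-1| < dl.
pose A' := [set z | exists e, near_half e /\ Q e z].
pose C' := [set z | exists e, ~ near_half e /\ Q e z] `|` (A `|` C).
have clcond e (p : Prop) : closed [set z | p /\ Q e z].
  have [hp|hp] := pselect p.
    by rewrite (_ : [set z | _] = Q e)//; apply/seteqP; split => [z []|].
  by rewrite (_ : [set z | _] = set0); [exact: closed0|apply/seteqP; split => [z []|]].
have nh z e : near_half e -> Q e z -> `|g z - 2^-1| < 2 * dl.
  move=> [z' Qz' gz'] Qz; have [x [zE _ Px]] := QE _ _ Qz; have [x' [zE' _ Px']] := QE _ _ Qz'.
  have [i PUi] := PU e; have := osc i x x' (col e) (PUi _ Px) (PUi _ Px').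
  rewrite -/(tc e) -zE -zE' => h; apply: le_lt_trans (ler_distD (g z') _ _) _; lra.
have [|||h [ch h01 hA hC]] := @urysohn01 R X cX hX A' C'.
- by apply: closed_existsI => e; exact: clcond.
- by apply: closedU; [apply: closed_existsI => e; exact: clcond|exact: closedU].
- move=> z [e [ne Qz]] [[e' [ne' Qz']]|[Az|Cz]].
  + by have ee := disj _ _ _ Qz Qz'; rewrite ee in ne.
  + by have := nh _ _ ne Qz; rewrite gA// => /ltr_normlP[]; lra.
  + by have := nh _ _ ne Qz; rewrite gC// => /ltr_normlP[]; lra.
exists (fun x => 4 * dl * h x); split.
- by apply: contM => //; exact: contCst.
- move=> x; have /andP[h0 h1] := h01 x; apply/andP; split; first by rewrite !mulr_ge0// ltW.
  by rewrite ler_piMr// mulr_ge0// ltW.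
- by move=> x ACx; rewrite hC ?mulr0//; right.
move=> x Kx; have [e Pe] := cP x; exists (col e); set z := x^^_.
have Qz : Q e z by rewrite /Q /= /z /tc apowK.
have [ne|ne] := pselect (near_half e).
  rewrite hA; last by exists e.
  have /ltr_normlP[h1 h2] := nh _ _ ne Qz; rewrite ger0_norm; lra.
rewrite hC; last by left; exists e.
rewrite mulr0 addr0 leNgt; apply/negP => lt; apply: ne.
by exists z.
Qed.

(** Finitely many closed sets with disjoint translates cover the space. Starting from any
    function separating A and C, each of them is treated in turn by a perturbation so small
    that the property already obtained on the previous ones persists. *)
Lemma rarely_half (A C : set X) (M : nat) : closed A -> closed C -> (forall x, A x -> ~ C x) ->
  exists (g : X -> R) (eta : R), [/\ continuous g, 0 < eta,
    forall x, A x -> g x = 1, forall x, C x -> g x = 0 &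
    forall x, (cnt (fun t : 'I_M => `|g (x^^t) - 2^-1| <= eta)%R <= d)%N].
Proof.
move=> clA clC AC; have [n [K [clK fK cK]]] := free_cover M.
pose good (g : X -> R) eta (p : 'I_n * {ffun 'I_d.+1 -> 'I_M}) := injective p.2 ->
  forall x, K p.1 x -> exists c, eta <= `|g (x^^(p.2 c)) - 2^-1|.
have [g [eta [cg eta0 gA gC gP]]] : exists (g : X -> R) (eta : R), [/\ continuous g, 0 < eta,
    forall x, A x -> g x = 1, forall x, C x -> g x = 0 &
    forall p, p \in enum {: 'I_n * {ffun 'I_d.+1 -> 'I_M}} -> good g eta p].
  elim: (enum _) => [|p s [g [eta [cg eta0 gA gC gP]]]].
    have [g [cg _ gA gC]] := urysohn01 R cX hX clA clC AC.
    by exists g, 1; split.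
  have [pinj|ninj] := pselect (injective p.2); last first.
    exists g, eta; split => // q; rewrite inE => /predU1P[->//|]; exact: gP.
  pose dl := Num.min (eta / 8%:R) 16%:R^-1.
  have dl0 : 0 < dl by rewrite lt_min !divr_gt0 ?invr_gt0 ?ltr0n.
  have [dle dl16] : dl <= eta / 8%:R /\ dl <= 16%:R^-1.
    by rewrite /dl !ge_min !lexx orbT.
  have [h [ch h01 hAC hK]] := perturb clA clC cg gA gC (clK p.1) (fK p.1) pinj dl0 dl16.
  exists (fun x => g x + h x), dl; split => //.
  - exact: contD.
  - by move=> x Ax; rewrite gA// hAC ?addr0//; left.
  - by move=> x Cx; rewrite gC// hAC ?addr0//; right.
  move=> q; rewrite inE => /predU1P[-> _ x|qs qinj x Kx]; first exact: hK.
  have [c hc] := gP q qs qinj x Kx; exists c.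
  have /andP[h0 h1] := h01 (x^^(q.2 c)).
  have tri := ler_normD (g (x^^(q.2 c)) + h (x^^(q.2 c)) - 2^-1) (- h (x^^(q.2 c))).
  have e1 (a b c' : R) : a + b - c' + - b = a - c' by ring.
  rewrite e1 normrN [`|h _|]ger0_norm// in tri; lra.
exists g, (eta / 2); split => //; first by rewrite divr_gt0.
move=> x; rewrite leqNgt; apply/negP => big.
pose B := [set t : 'I_M | `[< `|g (x^^t) - 2^-1| <= eta / 2 >]]%SET.
have hB t : t \in B -> `|g (x^^t) - 2^-1| <= eta / 2 by rewrite finset.in_set => /asboolP.
pose t := [ffun c : 'I_d.+1 => enum_val (widen_ord big c : 'I_#|B|)].
have [i Ki] := cK x.
have tin : injective t.
  by move=> c c'; rewrite !ffunE => /enum_val_inj /(congr1 val) /= /val_inj.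
have [c hc] := gP (i, t) (mem_enum _ _) tin x Ki.
have := hB (t c); rewrite {1}ffunE enum_valP => /(_ isT); move: hc => /=; lra.
Qed.

End Minimal.

(** * Colouring a sparse set *)

Section Counting.

Lemma cnt_sub (I : finType) (P Q : I -> Prop) : (forall i, P i -> Q i) -> (cnt P <= cnt Q)%N.
Proof. by move=> PQ; apply: (cnt_le (f := id)). Qed.

Lemma cnt_ex (I J : finType) (P : I -> Prop) (Q : I -> J -> Prop) a b :
  (cnt P <= a)%N -> (forall i, P i -> (cnt (Q i) <= b)%N) ->
  (cnt (fun j => exists i, P i /\ Q i j) <= a * b)%N.
Proof.
move=> Pa Qb; pose B i := [set j | `[< Q i j >]]%SET.
have BE i j : (j \in B i) = `[< Q i j >] by rewrite finset.in_set.
pose PP := [set i | `[< P i >]]%SET.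
have PE i : (i \in PP) = `[< P i >] by rewrite finset.in_set.
apply: leq_trans (_ : #|(\bigcup_(i in PP) B i)%SET| <= _)%N.
  apply/subset_leq_card/fintype.subsetP => j; rewrite finset.in_set => /asboolP[i [Pi Qj]].
  apply/finset.bigcupP; exists i; first by rewrite PE; apply/asboolP.
  by rewrite BE; apply/asboolP.
apply: leq_trans (_ : \sum_(i in PP) #|B i| <= _)%N.
  elim/big_ind2 : _ => [|S n S' n' h h'|//]; first by rewrite cards0.
  by apply: leq_trans (leq_card_setU _ _) _; exact: leq_add.
apply: leq_trans (_ : \sum_(i in PP) b <= _)%N.
  by apply: leq_sum => i; rewrite PE => /asboolP; exact: Qb.
by rewrite sum_nat_const leq_mul2r Pa orbT.
Qed.

End Counting.

Section Colouring.
Variables (R : realType) (X : topologicalType).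
Hypotheses (cX : compact [set: X]) (hX : hausdorff_space X).
Variable alpha : homeo X.
Hypotheses (minX : minimal alpha) (infX : infinite_set [set: X]).
Local Notation "x '^^' n" := (homeo_pow alpha n x) (at level 30, format "x ^^ n").
Variable d : nat.
Hypothesis dimX : covering_dim_le X d.
Variables (M : nat) (L Lp : set X) (D : nat).
Hypotheses (clL : closed L) (oLp : open Lp) (LLp : L `<=` Lp).

Let shift (j : 'I_(M + M).+1) : int := j%:Z - M%:Z.

Let shift_ex m : (absz m <= M)%N -> exists j, shift j = m.
Proof.
move=> mM; have h : (absz (m + M%:Z)%R < (M + M).+1)%N by lia.
exists (Ordinal h); rewrite /shift /=; lia.
Qed.

Hypothesis LpD : forall x, (cnt (fun j => Lp (x^^(shift j))) <= D)%N.

Let m0 := (D * (d.+1 * d.+1)).+1.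

(* One step: distribute f, supported in S, over m0 colours, avoiding the colours already
   used at points of the same orbit. *)
Let distribute (f : X -> R) (S : set X) (n : nat) (Z : 'I_n -> 'I_m0 -> set X) :
  continuous f -> (forall x, 0 <= f x) -> closed S -> (forall x, ~ S x -> f x = 0) -> S `<=` Lp ->
  (forall e p, closed (Z e p)) -> (forall e p, Z e p `<=` Lp) ->
  (forall x, (cnt (fun e => exists p, Z e p x) <= d.+1)%N) ->
  (forall e x, (cnt (fun p => Z e p x) <= d.+1)%N) ->
  exists (t : 'I_m0 -> X -> R) (S' : 'I_m0 -> set X),
  [/\ forall p, continuous (t p), forall p x, 0 <= t p x, 
      forall p, closed (S' p) /\ S' p `<=` S, forall p x, ~ S' p x -> t p x = 0 &
      [/\ forall x, \sum_p t p x = f x, forall x, (cnt (fun p => S' p x) <= d.+1)%N &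
       forall p e x m, (absz m <= M)%N -> S' p x -> ~ Z e p (x^^m)]].
Proof.
move=> cf f0 clS fS SLp clZ ZLp Ze Zp.
pose conf p := [set x | exists ej : 'I_n * 'I_(M + M).+1, Z ej.1 p (x^^(shift ej.2))].
have clconf p : closed (conf p) by apply: closed_existsI => ej; exact: closed_pre.
pose U (o : option 'I_m0) := if o is Some p then ~` conf p else ~` S.
have [||h [H [[ch h0 HU hH [_ h1]] Hd]]] := @part_unity_dim R X cX hX d dimX (option 'I_m0) U.
- by case=> [p|]; apply: closed_openC.
- move=> x; apply: contrapT => no.
  have Sx : S x by apply: contrapT => nS; apply: no; exists None.
  have cx p : conf p x by apply: contrapT => nc; apply: no; exists (Some p).
  have : (cnt (fun p => exists j, Lp (x^^(shift j)) /\ exists e, (exists p, Z e p (x^^(shift j)))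
      /\ Z e p (x^^(shift j))) <= D * (d.+1 * d.+1))%N.
    apply: cnt_ex; first exact: LpD.
    by move=> j _; apply: cnt_ex; [exact: Ze|move=> e _; exact: Zp].
  rewrite leqNgt => /negP; apply.
  apply: leq_trans (_ : #|'I_m0| <= _)%N; first by rewrite card_ord.
  apply/subset_leq_card/fintype.subsetP => p _; rewrite finset.in_set; apply/asboolP.
  by have [[e j] Z1] := cx p; exists j; split; [exact: ZLp Z1|exists e; split => //; exists p].
exists (fun p x => f x * h (Some p) x), (fun p => S `&` H (Some p)); split.
- by move=> p; apply: contM.
- by move=> p x; rewrite mulr_ge0.
- move=> p; split; last by move=> x [].
  by apply: closedI => //; have [] := HU (Some p).
- by move=> p x nS; have [Sx|/fS ->] := pselect (S x); rewrite ?mul0r// hH ?mulr0// => Hx; apply: nS.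
split.
- move=> x; rewrite -mulr_sumr; have [Sx|/fS ->] := pselect (S x); last by rewrite mul0r.
  have := h1 x Logic.I; rewrite (bigD1 None)//= hH; last first.
    by move=> Hx; have [_ hU] := HU None; case: (hU _ Hx).
  rewrite add0r (reindex_omap Some id)/=; last by case.
  by under eq_bigl do rewrite eqxx; move=> ->; rewrite mulr1.
- move=> x; apply: leq_trans (Hd x); apply: (cnt_le (f := Some)) => [p []//|p p' _ _ []//].
- move=> p e x m /shift_ex[j <-] [_ Hx] Zx; have [_ hU] := HU (Some p).
  by apply: (hU _ Hx); exists (e, j).
Qed.

(** A sequence of functions with small supports is distributed over the colours one after
    the other; since an orbit segment of length 2M+1 meets Lp at most D times, and each
    point carries few functions and few colours, a free colour always remains. *)
Lemma sparse_colouring (I : finType) (U : I -> set X) :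
  (forall i, open (U i)) -> (forall x, exists i, U i x) ->
  exists (E : finType) (t : E -> X -> R) (S : E -> set X) (col : E -> 'I_m0),
  [/\ forall e, continuous (t e), forall e x, 0 <= t e x,
      forall e, closed (S e) /\ (S e !=set0 -> exists i, S e `<=` U i),
      forall e x, ~ S e x -> t e x = 0 &
      (forall x, L x -> \sum_e t e x = 1) /\
      forall e e' x m, col e = col e' -> (absz m <= M)%N -> S e x -> S e' (x^^m) ->
        e = e' /\ m = 0].
Proof.
move=> oU cU.
pose ok (W : set X) := [/\ exists i, W `<=` U i, free_upto alpha M W & W `<=` Lp \/ forall x, W x -> ~ L x].
have [|n [W [oW cW]]] := @fin_cover _ cX setT (set X) (fun W => [set x | W x /\ ok W]) closedT.
  move=> x _; have [i Ux] := cU x; have [F [oF Fx fF]] := free_nbhd hX minX infX x M.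
  have [G [oG Gx hG]] : exists G, [/\ open G, G x & G `<=` Lp \/ forall x, G x -> ~ L x].
    have [Lpx|Lpx] := pselect (Lp x); first by exists Lp; split => //; left.
    exists (~` L); split; [exact: closed_openC|by move=> /LLp|by right].
  exists (U i `&` F `&` G).
  have okW : ok (U i `&` F `&` G).
    split; first by exists i => y [[]].
    - by move=> y m mM [[_ Fy] _] [[_ Fy'] _]; exact: (fF y).
    - by case: hG => h; [left=> y [_ Gy]; exact: h|right=> y [_ Gy]; exact: h].
  split; last by [].
  rewrite (_ : [set x | _] = U i `&` F `&` G); first by apply: openI => //; exact: openI.
  by apply/seteqP; split => [y []//|y Wy].
have [|f [S [[cf f0 SW fS [_ f1]] Sd]]] := @part_unity_dim R X cX hX d dimX 'I_n _ oW.
  by move=> x; exact: cW.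
have Wok j x : S j x -> W j x /\ ok (W j) by have [_ h] := SW j => /h.
pose good j := S j `<=` Lp.
have bad j x : ~ good j -> L x -> f j x = 0.
  move=> ng Lx; apply: fS => Sx; apply: ng => y Sy; have [Wy [_ _ [h|h]]] := Wok _ _ Sy; first exact: h.
  by have [Wx _] := Wok _ _ Sx; have := h _ Wx.
(* the construction, for the functions with index below k *)
pose constr k := exists (t : 'I_n -> 'I_m0 -> X -> R) (Z : 'I_n -> 'I_m0 -> set X),
  [/\ forall e p, continuous (t e p), forall e p x, 0 <= t e p x,
      forall e p, closed (Z e p) /\ forall x, Z e p x -> S e x /\ good e,
      forall e p x, ~ Z e p x -> t e p x = 0 &
      [/\ forall e x, good e -> (e < k)%N -> \sum_p t e p x = f e x,
          forall e x, (cnt (fun p => Z e p x) <= d.+1)%N &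
          forall e e' p x m, (absz m <= M)%N -> Z e p x -> Z e' p (x^^m) -> e = e' /\ m = 0]].
have [t [Z [ct t0 ZS tZ [tsum Zc Zconf]]]] : constr n.
  have : (n <= n)%N by []. elim: {1 3}n => [_|k IH kn].
    exists (fun _ _ _ => 0), (fun _ _ => set0); split => //.
    + by move=> e p; exact: contCst.
    + by move=> e p; split; first exact: closed0.
    split => // e x; rewrite /cnt (_ : [set p | _]%SET = finset.set0) ?cards0//.
    by apply/finset.setP => p; rewrite finset.in_set inE; apply/asboolP.
  have [t [Z [ct t0 ZS tZ [tsum Zc Zconf]]]] := IH (ltnW kn).
  pose K := Ordinal kn.
  have [gK|ngK] := pselect (good K); last first.
    exists t, Z; split => //; split => // e x ge; rewrite ltnS leq_eqVlt => /predU1P[ek|]; last exact: tsum.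
    by have eK : e = K by [exact: val_inj]; rewrite eK in ge.
  (* pieces of the new index are not used before *)
  pose Z0 e p := if e == K then set0 else Z e p.
  have Z0Z e p x : Z0 e p x -> Z e p x by rewrite /Z0; case: ifP.
  have [||||tK [ZK [ctK tK0 ZKS tKZ [tKsum ZKc ZKconf]]]] := @distribute (f K) (S K) n Z0 (cf K) (f0 K) (proj1 (SW K)) (fS K) gK.
  - by move=> e p; rewrite /Z0; case: ifP => _; [exact: closed0|have [] := ZS e p].
  - by move=> e p x /Z0Z Zx; have [_ /(_ _ Zx)[Sx g]] := ZS e p; exact: g.
  - move=> x; apply: leq_trans (Sd x); apply: cnt_sub => e [p /Z0Z Zx].
    by have [_ /(_ _ Zx)[]] := ZS e p.
  - by move=> e x; apply: leq_trans (Zc e x); apply: cnt_sub => p /Z0Z.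
  exists (fun e p => if e == K then tK p else t e p), (fun e p => if e == K then ZK p else Z e p); split.
  - by move=> e p; case: ifP.
  - by move=> e p x; case: ifP.
  - move=> e p; case: eqP => [->|_]; last exact: ZS.
    by have [h1 h2] := ZKS p; split => // x /h2.
  - by move=> e p x; case: eqP => [_|_]; [exact: tKZ|exact: tZ].
  split.
  - move=> e x ge; rewrite ltnS leq_eqVlt; have [-> _|ne] := eqVneq e K; first exact: tKsum.
    by move=> /predU1P[ek|ek]; [case/eqP : ne; exact: val_inj|exact: tsum].
  - by move=> e x; case: eqP => [_|_]; [exact: ZKc|exact: Zc].
  move=> e e' p x m mM; have [->|ne] := eqVneq e K; have [->|ne'] := eqVneq e' K.
  - move=> /(proj2 (ZKS p)) Sx /(proj2 (ZKS p)) Sx'; split => //.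
    have [Wx [_ fr _]] := Wok _ _ Sx; have [Wx' _] := Wok _ _ Sx'; exact: (fr x).
  - by move=> Zx Zx'; case: (ZKconf p e' x m mM Zx); rewrite /Z0 (negbTE ne').
  - move=> Zx Zx'; case: (ZKconf p e (x^^m) (- m) _ Zx'); first by rewrite abszN.
    by rewrite /Z0 (negbTE ne) apowK.
  - exact: Zconf.
exists ('I_n * 'I_m0)%type, (fun e => t e.1 e.2), (fun e => Z e.1 e.2), (fun e => e.2); split.
- by move=> e; exact: ct.
- by move=> e x; exact: t0.
- move=> [e p] /=; split; first by have [] := ZS e p.
  move=> [y Zy]; have [_ hZ] := ZS e p; have [Sy _] := hZ _ Zy.
  have [_ [[i WU] _ _]] := Wok _ _ Sy; exists i => z /hZ[Sz _]; apply: WU.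
  by have [] := Wok _ _ Sz.
- by move=> e x; exact: tZ.
split=> [x Lx|[e p] [e' p'] x m /= -> mM Zx Zx'].
  rewrite -[RHS](f1 x Logic.I) -(pair_bigA _ (fun e p => t e p x))/=; apply: eq_bigr => e _.
  have [ge|nge] := pselect (good e); first by rewrite tsum.
  rewrite bad// big1// => p _; apply: tZ => Zx; have [_ /(_ _ Zx)[_]] := ZS e p; exact: nge.
by have [-> ->] := Zconf e e' p' x m mM Zx Zx'.
Qed.

End Colouring.

(** * Local units, the unit, and faithfulness on functions *)

Section NonvanishingSections.
Variables (R : realType) (X : topologicalType) (cX : compact [set: X]).
Hypothesis hX : hausdorff_space X.
Variables (V : line_bundle R X) (alpha : homeo X) (Y : set X).
Hypothesis clY : closed Y.
Local Notation EV := (EY cX V alpha Y).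

Lemma section_at x0 : exists s : csection V, coord s x0 != 0.
Proof.
have [U [ch [fr [oU Ux0 tr cch cfr]]]] := chart_at V x0.
have [|b [S [cb b01 b1 [clS SU] bS]]] := @bump R X cX hX [set x0] U (@closed_pt X hX x0) oU.
  by move=> _ ->.
pose e x : vfibre V x := if pselect (U x) is left Ux then projT1 (cid (frame tr Ux)) else 0.
have eU x : U x -> ch (vpt (e x)) = 1.
  by move=> Ux; rewrite /e; case: pselect => // Ux'; have [] := projT2 (cid (frame tr Ux')).
pose s x : vfibre V x := (b x)%:C *: e x.
have cs : continuous (fun x => vpt (s x)).
  move=> x; have [Ux|nUx] := pselect (U x).
    apply: (ch_sec_at oU Ux tr cfr).
    apply: (@near_continuous _ _ _ (fun x => (b x)%:C)); last exact: cont_real.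
    by apply: filterS (nearU oU Ux) => y Uy; rewrite (chZ tr)// eU// mulr1.
  have nSx : ~ S x by move=> /SU.
  apply: (@near_continuous _ _ _ (fun x => vpt (0 : vfibre V x))); last exact: sec0_at.
  have : \forall y \near x, (~` S) y by apply: open_nbhs_nbhs; split => //; exact: closed_openC.
  by apply: filterS => y nSy; rewrite /s bS// scale0r.
exists (CSection cs); apply/eqP => c0.
have : ch (vpt (CSection cs x0)) = 0 by rewrite coordE c0 scale0r (ch0 tr).
rewrite /= /s b1// scale1r eU// => /eqP; by rewrite oner_eq0.
Qed.

Lemma EY_at x0 : ~ Y (alpha x0) -> exists xi : EV, ecoord xi x0 != 0.
Proof.
move=> nY; have [s s0] := section_at x0.
have [|b [S [cb b01 b1 [clS SU] bS]]] := @bump R X cX hX [set (alpha x0)] (~` Y)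
    (@closed_pt X hX _) (closed_openC clY); first by move=> _ ->.
pose f := rC cX cb.
have mem : @EY_set R X cX V alpha Y (@lact _ _ (Gamma_corr cX V alpha) f s).
  apply: subset_closure; exists [:: (f, s)]; split; last by rewrite big_seq1.
  move=> p; rewrite inE => /eqP -> y Yy /=; rewrite bS// => /SU; exact.
exists (@SubElt _ _ _ (EY_sub cX V alpha Y) _ mem).
rewrite /ecoord /coord /= hermZr /= b1// mul1r; exact: s0.
Qed.

End NonvanishingSections.

Section LocalUnits.
Variables (R : realType) (X : topologicalType) (cX : compact [set: X]).
Hypothesis hX : hausdorff_space X.
Variables (V : line_bundle R X) (alpha : homeo X) (Y : set X).
Hypothesis clY : closed Y.
Local Notation A := (CX R cX).
Local Notation EV := (EY cX V alpha Y).
Variables (O : cstarAlgType R) (pi : A -> O) (tau : EV -> O).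
Hypothesis cov : covariant_rep pi tau.
Local Notation "x '^^' n" := (homeo_pow alpha n x) (at level 30, format "x ^^ n").
Let pi_hom : star_hom pi := rep_hom cov.
Let lin_pi : is_linear pi. Proof. by have [] := pi_hom. Qed.

Lemma Hom_nonzero n x0 : nocross alpha Y n x0 -> exists s a, Hom pi tau n s a /\ s x0 != 0.
Proof.
have pos (m : nat) x : nocross alpha Y m x -> exists s a, Hom pi tau m s a /\ s x != 0.
  elim: m => [|m IH] h.
    exists (cev (CX1 R cX)), (pi (CX1 R cX)); split; first exact: Hom_pi.
    by rewrite /CX1 /cstC mkCE oner_eq0.
  have [|s [a [ha sx]]] := IH; first by move=> l hl; apply: h; move: hl; lia.
  have [|xi xi0] := @EY_at R X cX hX V alpha Y clY (x^^m).
    by rewrite -nat_apowS; apply: h; lia.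
  exists (fun y => ecoord xi (y^^m) * s y), (cmul (tau xi) a); split; last by rewrite mulf_neq0.
  by apply: (HomE (Hom_mul cov (Hom_tau cov xi) ha)) => //; rewrite -addn1 PoszD addrC.
case: n => n h; first exact: pos.
have h2 : nocross alpha Y n.+1 (x0^^(Negz n)).
  by have := nocrossN h; rewrite NegzE opprK.
have [s [a [ha sx]]] := pos _ _ h2.
exists (fun x => conjc (s (x^^(Negz n)))), (cstar a); split.
  by apply: (HomE (Hom_star cov ha)) => // [|x]; rewrite ?NegzE.
by apply: contra_neq sx => /(congr1 conjc); rewrite cjK cj0.
Qed.

(** Where the orbit segment avoids Y, sections in E_Y can be chosen nonzero at each of its
    points; the product of the corresponding generators is nonzero at x0, and dividing by
    the modulus of its symbol makes the coefficient unimodular nearby. *)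
Lemma local_unit n x0 : nocross alpha Y n x0 -> exists (N : set X) (nu : X -> R[i]),
  [/\ open N, N x0, nu x0 = 1, forall x, N x -> nrm (nu x) = 1 &
      forall f : A, vanish_off N f -> exists a, Hom pi tau n (fun x => cev f x * nu x) a].
Proof.
move=> /Hom_nonzero[s [a [ha s0]]].
have p0 : 0 < nrm (s x0).
  rewrite lt_neqAle nrm_ge0 andbT eq_sym; apply/eqP => h; move: s0.
  by rewrite (nrm_eq0 h) eqxx.
pose c := nrm (s x0) / 2; have c0 : 0 < c by rewrite divr_gt0.
have cs : continuous (fun x => nrm (s x)) := @Hom_nrm_cont _ _ _ _ _ _ _ _ _ cov n s a ha.
have pos x : c < nrm (s x) -> nrm (s x) != 0 by move=> h; rewrite gt_eqF// (lt_trans c0).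
have nz x : c < nrm (s x) -> ((nrm (s x))%:C : R[i]) != 0.
  by move=> /pos h; apply: contra_neq h => /(@complexI R).
have cx0 : c < nrm (s x0) by rewrite /c; lra.
pose u : R[i] := (nrm (s x0))%:C / s x0.
have nu1 : nrm u = 1.
  have : nrm (u * s x0) = nrm (s x0) by rewrite divfK// nrmCR ger0_norm// ltW.
  by rewrite nrmCM => /(canRL (mulfK (pos _ cx0))) ->; rewrite divff ?gt_eqF.
exists [set x | c < nrm (s x)], (fun x => u * (s x / (nrm (s x))%:C)); split => //.
- exact: open_gt.
- by rewrite mulrA /u divfK// divff// nz.
- move=> x /= cx; rewrite nrmCM nu1 mul1r.
  have : nrm (s x / (nrm (s x))%:C * (nrm (s x))%:C) = nrm (s x) by rewrite divfK// nz.
  rewrite nrmCM nrmCR [`|_|]ger0_norm ?nrm_ge0// => /(canRL (mulfK (pos _ cx))) ->.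
  by rewrite divff// pos.
move=> f fN.
have cg : continuous (fun x => (Num.max (nrm (s x)) c)^-1).
  move=> x; apply: (@continuous_comp _ _ _ (fun x => Num.max (nrm (s x)) c) (fun y => y^-1)).
    by apply: contMax; [exact: cs|exact: contCst].
  by apply: inv_continuous; rewrite gt_eqF// lt_max c0 orbT.
have h := Hom_scale cov u (Hom_mul cov ha (Hom_pi pi tau (cmul f (rC cX cg)))).
eexists; apply: (HomE h) => [|x|]; [by rewrite addr0| |reflexivity].
rewrite cevM /rC mkCE /=.
have [Nx|nNx] := pselect (c < nrm (s x)); last by rewrite fN// !mul0r !mulr0.
rewrite max_l ?(ltW Nx)// fmorphV; ring.
Qed.

(** Summands whose symbols have disjoint targets have orthogonal ranges, so that the square
    of the sum is the sum of the squares. *)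
Lemma Hom_row_orth (I : finType) (n : I -> int) (s : I -> X -> R[i]) (a : I -> O) (c : R) :
  (forall i, Hom pi tau (n i) (s i) (a i)) -> 0 <= c ->
  (forall i j x y, s i x != 0 -> s j y != 0 -> x^^(n i) = y^^(n j) -> i = j) ->
  (forall x, \sum_i nrm (s i x) ^+ 2 <= c ^+ 2) -> nrm (\sum_i a i) <= c.
Proof.
move=> ha c0 orth sc.
have [f fP] : {f : I -> A & forall i, (forall x, cev (f i) x = (nrm (s i x) ^+ 2)%:C) /\
    cmul (cstar (a i)) (a i) = pi (f i)}.
  apply: (@choice _ _ (fun i f => (forall x, cev f x = (nrm (s i x) ^+ 2)%:C) /\
    cmul (cstar (a i)) (a i) = pi f)) => i; have [f [f1 f2]] := Hom_sq cov (ha i).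
  by exists f.
have cross i j : i != j -> cmul (cstar (a i)) (a j) = 0.
  move=> ij; apply: (Hom_zero cov (Hom_mul cov (Hom_star cov (ha i)) (ha j))) => x.
  have [->|sj] := eqVneq (s j x) 0; first by rewrite mulr0.
  have [->|si] := eqVneq (s i ((x^^(n j))^^(- n i))) 0; first by rewrite cj0 mul0r.
  by case/eqP: ij; apply: (orth _ _ _ _ si sj); rewrite apowNK.
rewrite -(@ler_pXn2r _ 2%N)// ?nnegrE ?nrm_ge0// -nrm_sq cstar_sum.
rewrite cmul_suml (eq_bigr (fun i => pi (f i))) => [|i _]; last first.
  rewrite cmul_sumr (bigD1 i)//= (proj2 (fP i)) big1 ?addr0// => j ji.
  by apply: cross; rewrite eq_sym.
rewrite -(is_linear_sum _ _ _ lin_pi); apply: le_trans (pi_le pi_hom _) _.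
apply: nrm_CX_le => [|x]; first exact: sqr_ge0.
rewrite cev_sum (eq_bigr (fun i => (nrm (s i x) ^+ 2)%:C)) => [|i _]; last exact: (proj1 (fP i)).
by rewrite -rmorph_sum /= nrmCR ger0_norm// sumr_ge0// => i _; exact: sqr_ge0.
Qed.

End LocalUnits.

Lemma closed_lip (R : realType) (V W : normedModType R[i]) (F : V -> W) (K : R) :
  (forall a b, nrm (F a - F b) <= K * nrm (a - b)) -> closed [set a | F a = 0].
Proof.
move=> lip a cla /=; apply: nrm_small => e e0.
have e0' : 0 < ((e / (`|K| + 1))%:C : R[i]) by rewrite ltcR divr_gt0// ltr_wpDl.
have [b [/= Fb]] := cla _ (nbhsx_ballx a _ e0').
rewrite -ball_normE /ball_/= nrmE ltcR ltr_pdivlMr ?ltr_wpDl// => ab.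
rewrite -[F a]subr0 -Fb; apply: le_trans (lip _ _) _; apply: le_trans _ (ltW ab).
by rewrite mulrC ler_wpM2l ?nrm_ge0// (le_trans (ler_norm _))// lerDl.
Qed.

Section UnitAndFaithful.
Variables (R : realType) (X : topologicalType) (cX : compact [set: X]).
Hypothesis hX : hausdorff_space X.
Variables (V : line_bundle R X) (alpha : homeo X) (Y : set X).
Hypothesis clY : closed Y.
Local Notation A := (CX R cX).
Local Notation EV := (EY cX V alpha Y).
Variables (O : cstarAlgType R) (pi : A -> O) (tau : EV -> O).
Hypothesis cov : covariant_rep pi tau.
Hypothesis gen : cstar_generates (range pi `|` range tau).
Local Notation "x '^^' n" := (homeo_pow alpha n x) (at level 30, format "x ^^ n").
Let pi_hom : star_hom pi := rep_hom cov.
Let lin_pi : is_linear pi. Proof. by have [] := pi_hom. Qed.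
Local Notation e1 := (pi (CX1 R cX)).

Lemma e1_le : nrm e1 <= 1.
Proof.
apply: le_trans (pi_le pi_hom _) _; apply: nrm_CX_le => // x.
by rewrite /CX1 /cstC mkCE nrmC1.
Qed.

(** The elements fixed by pi 1 on both sides form a closed *-algebra containing the
    generators. *)
Lemma unit_O a : cmul e1 a = a /\ cmul a e1 = a.
Proof.
pose T1 := [set a : O | cmul e1 a - a = 0]; pose T2 := [set a : O | cmul a e1 - a = 0].
have lip1 : closed T1.
  apply: (@closed_lip _ _ _ _ 2) => x y.
  rewrite [X in nrm X](_ : _ = cmul e1 (x - y) - (x - y)); last first.
    by rewrite cmulBr !opprB addrACA [RHS]addrACA; congr (_ + _); rewrite addrC.
  apply: le_trans (nrmB _ _) _; rewrite mulr2n mulrDl mul1r lerD2r.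
  by apply: le_trans (nrm_mul _ _) _; rewrite ler_piMl ?nrm_ge0 ?e1_le.
have lip2 : closed T2.
  apply: (@closed_lip _ _ _ _ 2) => x y.
  rewrite [X in nrm X](_ : _ = cmul (x - y) e1 - (x - y)); last first.
    by rewrite cmulBl !opprB addrACA [RHS]addrACA; congr (_ + _); rewrite addrC.
  apply: le_trans (nrmB _ _) _; rewrite mulr2n mulrDl mul1r lerD2r.
  by apply: le_trans (nrm_mul _ _) _; rewrite ler_piMr ?nrm_ge0 ?e1_le.
have e1s : cstar e1 = e1.
  by rewrite -(piS pi_hom); congr pi; apply: CXP => x; rewrite cevS /CX1 /cstC mkCE rmorph1.
have TP x : (T1 `&` T2) x <-> cmul e1 x = x /\ cmul x e1 = x.
  split=> [[/eqP h1 /eqP h2]|[h1 h2]]; last by split; rewrite /T1 /T2 /= ?h1 ?h2 subrr.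
  by move: h1 h2; rewrite !subr_eq0 => /eqP -> /eqP ->.
suff : (T1 `&` T2) a by move=> /TP.
rewrite (gen (T := T1 `&` T2))//.
- move=> _ [[f _ <-]|[xi _ <-]]; apply/TP; split.
  + by rewrite -(piM pi_hom); congr pi; apply: CXP => x; rewrite cevM /CX1 /cstC mkCE mul1r.
  + by rewrite -(piM pi_hom); congr pi; apply: CXP => x; rewrite cevM /CX1 /cstC mkCE mulr1.
  + rewrite (pi_tau cov); congr tau; apply: ecoord_inj => x.
    by rewrite ecoord_lact /CX1 /cstC mkCE mul1r.
  + rewrite (tau_pi cov); congr tau; apply: ecoord_inj => x.
    by rewrite ecoord_ract /CX1 /cstC mkCE mul1r.
- exact: closedI.
- move=> c x y /TP[x1 x2] /TP[y1 y2]; apply/TP.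
  by rewrite cmulDr cmulDl cmulZr cmulZl x1 x2 y1 y2.
- move=> x y /TP[x1 x2] /TP[y1 y2]; apply/TP.
  by rewrite cmulA x1 -cmulA y2.
- by move=> x /TP[x1 x2]; apply/TP; split; rewrite -{1}e1s -cstarM ?x1 ?x2.
- by apply/TP; rewrite cmul0l cmul0r.
Qed.

Hypotheses (minX : minimal alpha) (infX : infinite_set [set: X]).
Hypothesis orbY : meets_orbits_at_most_once alpha Y.
Hypothesis O0 : exists a : O, a != 0.

Let K := [set x | forall f, pi f = 0 -> cev f x = 0].

Let K_fwd x : K x -> ~ Y (alpha x) -> K (alpha x).
Proof.
move=> Kx nY f pf; have [xi xi0] := @EY_at R X cX hX V alpha Y clY x nY.
have : pi (hdot xi (lact f xi)) = 0 by rewrite -(tau_dot cov) -(pi_tau cov) pf cmul0l cmul0r.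
move=> /Kx; rewrite ecoord_dot ecoord_lact => /eqP; rewrite !mulf_eq0 (negbTE xi0) orbF.
case/orP => /eqP // h; move: xi0; by rewrite -[ecoord _ _]cjK h cj0 eqxx.
Qed.

Let K_bwd x : K x -> ~ Y x -> K (x^^(-1)).
Proof.
move=> Kx nY f pf; have [|xi xi0] := @EY_at R X cX hX V alpha Y clY (x^^(-1)).
  by rewrite -apow1 apowNK.
have : pi (mkC cX (@dot_back_cont _ _ _ _ _ _ (ract xi f) xi)) = 0.
  by rewrite -(tau_tau cov) -(tau_pi cov) pf cmul0r cmul0l.
move=> /Kx; rewrite mkCE ecoord_ract => /eqP; rewrite !mulf_eq0 (negbTE xi0) orbF.
case/orP => /eqP // h; move: xi0; by rewrite -[ecoord _ _]cjK h cj0 eqxx.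
Qed.

Let K_nonempty : K !=set0.
Proof.
apply: contrapT => K0.
have [|m [u [ou uP]]] := @fin_cover X cX setT A (fun f => [set x | pi f = 0 /\ 0 < nrm (cev f x)]) closedT.
  move=> x _; have : ~ K x by move=> Kx; apply: K0; exists x.
  move=> /existsNP[f /not_implyP[pf fx]]; exists f.
  have fp : 0 < nrm (cev f x).
    by rewrite lt_neqAle nrm_ge0 andbT eq_sym; apply/eqP => /nrm_eq0.
  split => //; rewrite (_ : [set x | _] = [set x | 0 < nrm (cev f x)]).
    by apply: open_gt; exact: cont_nrm.
  by apply/seteqP; split => y /= => [[]|].
pose ok j := `[< pi (u j) = 0 >].
pose g x := \sum_(j | ok j) nrm (cev (u j) x) ^+ 2.
have cg : continuous g.
  by apply: contSum => j _; under eq_fun do rewrite expr2; apply: contM; exact: cont_nrm.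
have gp x : 0 < g x.
  have [j [pj jx]] := uP x Logic.I; rewrite /g (bigD1 j)/=; last exact/asboolP.
  by rewrite ltr_wpDr// ?exprn_gt0// sumr_ge0// => i _; exact: sqr_ge0.
have ci : continuous (fun x => (g x)^-1).
  move=> x; apply: (@continuous_comp _ _ _ g (fun y => y^-1)); first exact: cg.
  by apply: inv_continuous; rewrite gt_eqF.
have e10 : e1 = 0.
  have -> : CX1 R cX = cmul (rC cX ci) (\sum_(j | ok j) cmul (cstar (u j)) (u j)).
    apply: CXP => x; rewrite cevM cev_sum /rC mkCE /CX1 /cstC mkCE.
    rewrite (eq_bigr (fun j => ((nrm (cev (u j) x)) ^+ 2)%:C)) => [|j _]; last first.
      by rewrite cevM cevS conjM_nrm.
    by rewrite -rmorph_sum -rmorphM mulVf ?gt_eqF.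
  rewrite (piM pi_hom) (is_linear_sum _ _ _ lin_pi) big1 ?cmul0r// => j /asboolP pj.
  by rewrite (piM pi_hom) pj cmul0r.
have [a a0] := O0; have [ea _] := unit_O a.
by move: a0; rewrite -ea e10 cmul0l eqxx.
Qed.

Let K_all x : K x.
Proof.
apply: contrapT => nK; pose W := ~` K.
have oW : open W.
  apply: closed_openC; apply: closed_forall => f; apply: closed_imp.
  have : closed [set x | nrm (cev f x) <= 0] by apply: closed_le; exact: cont_nrm.
  by congr closed; apply/seteqP; split => y /= => [/nrm_le0//|->]; rewrite nrm0.
have [T hT] : exists T : nat, forall x, exists t : nat, (t <= T)%N /\ W (x^^t).
  by apply: (syndetic cX minX oW); exists x.
have [z Kz] := K_nonempty.
have [[n [n0 Yn]]|noY] := pselect (exists n : nat, (0 < n)%N /\ Y (z^^n)).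
  have [t [_]] := @syndetic_back _ alpha W T hT z; apply.
  elim: t => [//|t IH]; rewrite -addn1 PoszD opprD addrC apowD; apply: K_bwd => // Yt.
  have nz : n%:Z + t%:Z != 0 by lia.
  have : ((homeo_pow alpha (n%:Z + t%:Z) @` Y) `&` Y) (z^^n).
    by split => //; exists (z^^(- t%:Z)) => //; rewrite -apowD addrK.
  by rewrite orbY.
have [t [_]] := hT z; apply; elim: t => [//|t IH]; rewrite nat_apowS; apply: K_fwd => // Yt.
by apply: noY; exists t.+1.
Qed.

(** If pi lost norm at some point, it would kill the functions supported in a nonempty open
    set. Homogeneous elements along orbit segments avoiding Y spread this to a cover of X,
    by minimality, since one of the two half orbits of each point avoids Y; then pi would
    kill the unit. *)
Lemma pi_isometric f x : nrm (cev f x) <= nrm (pi f).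
Proof.
rewrite leNgt; apply/negP => lt.
pose b := (nrm (cev f x) + nrm (pi f)) / 2.
have [b1 b2] : nrm (pi f) < b /\ b < nrm (cev f x) by rewrite /b; lra.
have b0 : 0 < b := le_lt_trans (nrm_ge0 _) b1.
have cf := @cont_nrm _ _ _ f.
have [|h [S [ch h01 h1 [clS SU] hS]]] := @bump R X cX hX [set x] [set y | b < nrm (cev f y)]
  (@closed_pt X hX x) (@open_gt R X _ b cf); first by move=> _ ->.
have cm2 : continuous (fun y => Num.max (nrm (cev f y)) b ^+ 2).
  have cmx : continuous (fun y => Num.max (nrm (cev f y)) b).
    by apply: contMax; [exact: cf|exact: contCst].
  by under eq_fun do rewrite expr2; exact: contM.
have cm : continuous (fun y => b / Num.max (nrm (cev f y)) b ^+ 2).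
  apply: contM; first exact: contCst.
  move=> y; apply: (@continuous_comp _ _ _ (fun y => Num.max (nrm (cev f y)) b ^+ 2) (fun y => y^-1)).
    exact: cm2.
  by apply: inv_continuous; rewrite expf_neq0// gt_eqF// lt_max b0 orbT.
pose u := cmul (cstar f) (rC cX cm).
have mp y : 0 < Num.max (nrm (cev f y)) b by rewrite lt_max b0 orbT.
have uf y : S y -> cev u y * cev f y = b%:C.
  move=> /SU; rewrite -[X in X -> _]/(is_true (b < nrm (cev f y))) => by1; rewrite cevM cevS /rC mkCE mulrAC conjM_nrm -rmorphM.
  by rewrite max_l ?(ltW by1)// mulrCA divff ?mulr1// expf_neq0// gt_eqF// (lt_trans b0).
have u1 y : nrm (cev u y) <= 1.
  rewrite cevM cevS /rC mkCE nrmCM nrmCJ nrmCR ger0_norm; last by rewrite divr_ge0 ?sqr_ge0 ?ltW.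
  rewrite mulrA ler_pdivrMr ?exprn_gt0// mul1r expr2 ler_pM ?nrm_ge0 ?(ltW b0)//.
    by rewrite le_max lexx.
  by rewrite le_max lexx orbT.
pose pw (g : A) n : A := iter n (cmul g) (CX1 R cX).
have pwE g n y : cev (pw g n) y = cev g y ^+ n.
  elim: n => [|n IH]; first by rewrite expr0.
  by rewrite exprS -IH.
have piw n : nrm (pi (pw f n)) <= nrm (pi f) ^+ n.
  elim: n => [|n IH]; first exact: e1_le.
  rewrite exprS /= (piM pi_hom); apply: le_trans (nrm_mul _ _) _.
  by rewrite ler_wpM2l ?nrm_ge0.
have ph0 : nrm (pi (rC cX ch)) != 0.
  apply/eqP => /nrm_eq0 /(K_all x); rewrite /rC mkCE h1// => /eqP; by rewrite oner_eq0.
have php : 0 < nrm (pi (rC cX ch)) by rewrite lt_neqAle eq_sym ph0 nrm_ge0.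
have : b <= nrm (pi f); last by rewrite leNgt b1.
apply: (@le_of_powers _ _ _ (nrm (pi (rC cX ch)))^-1) => [||n]; rewrite ?nrm_ge0 ?(ltW b0)//.
set N := (2 ^ n)%N; rewrite mulrC -ler_pdivrMr ?invr_gt0// invrK.
have e : (b ^+ N)%:C *: rC cX ch = cmul (cmul (rC cX ch) (pw u N)) (pw f N).
  apply: CXP => y; rewrite cevZ !cevM !pwE /rC mkCE -mulrA -exprMn.
  have [Sy|/hS ->] := pselect (S y); last by rewrite mulr0 mul0r.
  by rewrite uf// mulrC rmorphXn.
have : nrm (pi ((b ^+ N)%:C *: rC cX ch)) = b ^+ N * nrm (pi (rC cX ch)).
  by rewrite (is_linearZ _ _ lin_pi) nrmZ nrmCR ger0_norm// exprn_ge0// ltW.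
move=> <-; rewrite e (piM pi_hom); apply: le_trans (nrm_mul _ _) _.
rewrite -[leRHS]mul1r ler_pM ?nrm_ge0//; apply: le_trans (pi_le pi_hom _) _.
apply: nrm_CX_le => // y; rewrite cevM pwE nrmCM nrmCX /rC mkCE nrmCR.
have /andP[hy0 hy1] := h01 y; rewrite ger0_norm//.
by rewrite mulr_ile1 ?exprn_ge0 ?nrm_ge0 ?exprn_ile1 ?nrm_ge0.
Qed.

End UnitAndFaithful.

(** * Square roots of matrices over a C*-algebra *)

Section Limits.
Variable R : realType.

Lemma seq_limit (V : completeNormedModType R[i]) (a : nat -> V) :
  (forall e : R, 0 < e -> exists N, forall n, (N <= n)%N -> nrm (a n - a N) <= e) ->
  exists l, forall e : R, 0 < e -> exists N, forall n, (N <= n)%N -> nrm (a n - l) <= e.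
Proof.
move=> h.
have : cvg (a @ \oo).
  apply: cauchy_cvg; apply/cauchy_ballP => e e0.
  have e0' : 0 < complex.Re e by move: e0; rewrite ltcE => /andP[].
  have eE : (complex.Re e)%:C = e by rewrite RRe_real// ger0_real// ltW.
  have [|N hN] := h (complex.Re e / 3); first by rewrite divr_gt0.
  pose S := a @` [set n | (N <= n)%N].
  have FS : (a @ \oo) S by exists N => // n Nn; exists n.
  exists (S, S) => //= -[_ _] [/= [m Nm <-] [n Nn <-]].
  rewrite -ball_normE /ball_/= nrmE -eE ltcR.
  apply: le_lt_trans (nrm_triangle (a N) _ _) _; rewrite [nrm (a N - _)]nrm_distC.
  have := hN _ Nm; have := hN _ Nn; lra.
move=> /cvg_ex[l hl]; exists l => e e0.
have e0' : 0 < (e%:C : R[i]) by rewrite ltcR.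
move/cvgrPdist_lt : hl => /(_ _ e0')[N _ hN]; exists N => n Nn.
by have := hN n Nn; rewrite /= nrmE ltcR nrm_distC => /ltW.
Qed.

Lemma bounded_increasing (t : nat -> R) (b : R) : (forall n, t n <= t n.+1) ->
  (forall n, t n <= b) -> forall e : R, 0 < e -> exists N, forall n, (N <= n)%N -> t n - t N <= e.
Proof.
move=> tS tb e e0; pose S := range t.
have hs : has_sup S by split; [exists (t 0%N), 0%N|exists b => _ [n _ <-]].
have [_ [N _ <-] hN] := sup_adherent e0 hs.
exists N => n Nn; have : t n <= sup S by apply: sup_upper_bound => //; exists n.
lra.
Qed.

End Limits.

Section SquareRoot.
Variables (R : realType) (A : cstarAlgType R) (e : A) (k : nat).
Hypotheses (e1 : forall a, cmul e a = a) (e2 : forall a, cmul a e = a).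
Local Notation mat := ('I_k -> 'I_k -> A).
Implicit Types y w : mat.

Let es : cstar e = e. Proof. by rewrite -[LHS]e1 -[X in cmul X _]cstarK -cstarM e1 cstarK. Qed.

Definition mid : mat := fun p q => if p == q then e else 0.
Definition mprod y w : mat := fun p q => \sum_r cmul (y p r) (w r q).
Fixpoint mpow y n : mat := if n is n'.+1 then mprod y (mpow y n') else mid.

Lemma mprodA y w z p q : mprod y (mprod w z) p q = mprod (mprod y w) z p q.
Proof.
rewrite /mprod; under eq_bigr do rewrite cmul_sumr.
rewrite exchange_big; apply: eq_bigr => r _ /=; rewrite cmul_suml.
by apply: eq_bigr => s _; rewrite cmulA.
Qed.

Lemma mid_l y p q : mprod mid y p q = y p q.
Proof.
rewrite /mprod (bigD1 p)//= /mid eqxx e1 big1 ?addr0// => r /negbTE rp.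
by rewrite eq_sym rp cmul0l.
Qed.

Lemma mid_r y p q : mprod y mid p q = y p q.
Proof.
rewrite /mprod (bigD1 q)//= /mid eqxx e2 big1 ?addr0// => r /negbTE rq.
by rewrite rq cmul0r.
Qed.

Variables (y : mat) (C : R).
Hypotheses (yC : forall n p q, nrm (mpow y n p q) <= C) (ys : forall p q, cstar (y p q) = y q p).

(* the cone generated by the powers of y, with the sum of the coefficients *)
Inductive cone : R -> mat -> Prop :=
| cone_pow n : cone 1 (mpow y n)
| cone_0 : cone 0 (fun _ _ => 0)
| cone_add t u a b : cone t a -> cone u b -> cone (t + u) (fun p q => a p q + b p q)
| cone_scale t c a : cone t a -> 0 <= c -> cone (c * t) (fun p q => c%:C *: a p q).

Let coneE t u a b : cone t a -> t = u -> (forall p q, a p q = b p q) -> cone u b.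
Proof.
move=> h <- ab; suff <- : a = b by [].
by apply/funext => p; apply/funext => q.
Qed.

Let cone_nrm t a : cone t a -> forall p q, nrm (a p q) <= C * t.
Proof.
elim => {t a} [n|| t u a b _ ha _ hb|t c a _ ha c0] p q.
- by rewrite mulr1.
- by rewrite nrm0 mulr0.
- by rewrite mulrDr; apply: le_trans (nrmD _ _) _; exact: lerD.
by rewrite nrmZ nrmCR ger0_norm// mulrCA ler_wpM2l.
Qed.

Let mpowD m n p q : mprod (mpow y m) (mpow y n) p q = mpow y (m + n) p q.
Proof.
elim: m p q => [|m IH] p q; first exact: mid_l.
rewrite /= -mprodA; apply: eq_bigr => r _; by rewrite IH.
Qed.

Let cone_mul t u a b : cone t a -> cone u b -> cone (t * u) (mprod a b).
Proof.
move=> ha hb; elim: ha => {t a} [m||t t' a a' _ h1 _ h2|t c a _ h c0].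
- elim: hb => {u b} [n||u u' b b' _ h1 _ h2|u c b _ h c0].
  + by apply: (coneE (cone_pow (m + n))) => [|p q]; rewrite ?mulr1// mpowD.
  + apply: (coneE cone_0) => [|p q]; rewrite ?mulr0// /mprod big1// => r _.
    by rewrite cmul0r.
  + apply: (coneE (cone_add h1 h2)) => [|p q]; rewrite ?mulrDr// -big_split.
    by apply: eq_bigr => r _; rewrite cmulDr.
  + apply: (coneE (cone_scale h c0)) => [|p q]; first by rewrite mulrCA.
    by rewrite scaler_sumr; apply: eq_bigr => r _; rewrite cmulZr.
- apply: (coneE cone_0) => [|p q]; rewrite ?mul0r// /mprod big1// => r _.
  by rewrite cmul0l.
- apply: (coneE (cone_add h1 h2)) => [|p q]; rewrite ?mulrDl// -big_split.
  by apply: eq_bigr => r _; rewrite cmulDl.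
apply: (coneE (cone_scale h c0)) => [|p q]; first by rewrite mulrA.
by rewrite scaler_sumr; apply: eq_bigr => r _; rewrite cmulZl.
Qed.

Let half : R := 2^-1.

(* the solution of w = (y + w^2) / 2 by iteration *)
Fixpoint sqrt_iter n : mat := if n is n'.+1 then
  fun p q => half%:C *: (y p q + mprod (sqrt_iter n') (sqrt_iter n') p q) else fun _ _ => 0.
Fixpoint sqrt_mass n : R := if n is n'.+1 then half * (1 + sqrt_mass n' ^+ 2) else 0.

Let half0 : 0 <= half. Proof. by rewrite /half; lra. Qed.

Let mass01 n : 0 <= sqrt_mass n <= 1.
Proof.
elim: n => [|n /andP[h0 h1]] /=; first by rewrite lexx ler01.
by have := exprn_ile1 2 h0 h1; have := sqr_ge0 (sqrt_mass n); rewrite /half; lra.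
Qed.

Let cone_y : cone 1 y.
Proof. by apply: (coneE (cone_pow 1)) => //= p q; exact: mid_r. Qed.

Let cone_iter n : cone (sqrt_mass n) (sqrt_iter n).
Proof.
elim: n => [|n IH] /=; first exact: cone_0.
by rewrite expr2; exact: (cone_scale (cone_add cone_y (cone_mul IH IH)) half0).
Qed.

Let cone_step n : cone (sqrt_mass n.+1 - sqrt_mass n) (fun p q => sqrt_iter n.+1 p q - sqrt_iter n p q).
Proof.
elim: n => [|n IH].
  apply: (coneE (cone_scale cone_y half0)) => [|p q] /=; first by rewrite expr0n /= addr0 subr0.
  rewrite subr0 /mprod big1 ?addr0// => r _; exact: cmul0l.
have h := cone_add (cone_mul (cone_iter n.+1) IH) (cone_mul IH (cone_iter n)).
apply: (coneE (cone_scale h half0)) => [|p q].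
  transitivity (half * (1 + sqrt_mass n.+1 ^+ 2) - half * (1 + sqrt_mass n ^+ 2)) => //; ring.
rewrite [in RHS]/= -scalerBr opprD addrACA subrr add0r; congr (_ *: _).
rewrite /mprod -sumrB -big_split; apply: eq_bigr => r _ /=.
by rewrite cmulBr cmulBl addrA subrK.
Qed.

Let cone_diff m n p q : (n <= m)%N ->
  nrm (sqrt_iter m p q - sqrt_iter n p q) <= C * (sqrt_mass m - sqrt_mass n).
Proof.
elim: m => [|m IH]; first by rewrite leqn0 => /eqP ->; rewrite !subrr nrm0 mulr0.
rewrite leq_eqVlt => /predU1P[->|nm]; first by rewrite !subrr nrm0 mulr0.
apply: le_trans (nrm_triangle (sqrt_iter m p q) _ _) _.
have -> : C * (sqrt_mass m.+1 - sqrt_mass n) =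
  C * (sqrt_mass m.+1 - sqrt_mass m) + C * (sqrt_mass m - sqrt_mass n) by ring.
by apply: lerD; [exact: (cone_nrm (cone_step m))|exact: IH].
Qed.

Let iter_star n p q : cstar (sqrt_iter n p q) = sqrt_iter n q p.
Proof.
elim: n p q => [|n IH] p q; first exact: cstar0.
rewrite -[sqrt_iter n.+1 p q]/(half%:C *: (y p q + mprod (sqrt_iter n) (sqrt_iter n) p q)) cstarZ !cjE cstarD ys cstar_sum; congr (_ *: (_ + _)).
by apply: eq_bigr => r _; rewrite cstarM !IH.
Qed.

(** The iterates of w = (y + w^2) / 2 are combinations of powers of y with nonnegative
    coefficients of total mass below 1, so that they converge as soon as the powers are
    bounded; the root is then 1 - w. *)
Lemma sqrt_of_power_bounded : exists z : mat,
  (forall p q, cstar (z p q) = z q p) /\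
  forall p q, mprod z z p q = mid p q - y p q.
Proof.
have massS n : sqrt_mass n <= sqrt_mass n.+1.
  have /andP[h0 h1] := mass01 n; rewrite /= /half.
  have := sqr_ge0 (sqrt_mass n - 1); rewrite sqrrB1; lra.
have [k0|[p0]] : (k = 0)%N \/ inhabited 'I_k.
  by case: (k) => [|k']; [left|right; exists; exact: ord0].
  exists (fun _ _ => 0); split=> p; have := ltn_ord p; by rewrite {2}k0.
have C0 : 0 <= C := le_trans (nrm_ge0 _) (yC 0 p0 p0).
have lim p q : exists l, forall e : R, 0 < e ->
    exists N, forall n, (N <= n)%N -> nrm (sqrt_iter n p q - l) <= e.
  apply: seq_limit => ep ep0.
  have [|N hN] := @bounded_increasing R sqrt_mass 1 massS (fun n => proj2 (andP (mass01 n))) (ep / (C + 1)).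
    by rewrite divr_gt0// ltr_wpDl.
  exists N => n Nn; apply: le_trans (cone_diff p q Nn) _.
  have := hN n Nn; rewrite ler_pdivlMr ?ltr_wpDl// => h; apply: le_trans h.
  rewrite mulrC ler_wpM2l ?lerDl//; rewrite subr_ge0.
  elim: n Nn => [|n IH]; first by rewrite leqn0 => /eqP ->.
  by rewrite leq_eqVlt => /predU1P[->//|/IH h]; exact: le_trans h _.
have [w wP] : {w : mat & forall p q (e : R), 0 < e ->
    exists N, forall n, (N <= n)%N -> nrm (sqrt_iter n p q - w p q) <= e}.
  have [f fP] : {f : 'I_k * 'I_k -> A & forall pq (e : R), 0 < e ->
    exists N, forall n, (N <= n)%N -> nrm (sqrt_iter n pq.1 pq.2 - f pq) <= e}.
    apply: (@choice _ _ (fun pq l => forall e : R, 0 < e ->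
      exists N, forall n, (N <= n)%N -> nrm (sqrt_iter n pq.1 pq.2 - l) <= e)).
    by move=> [p q]; exact: lim.
  by exists (fun p q => f (p, q)) => p q; exact: (fP (p, q)).
(* uniform choice of N for the finitely many entries *)
have unif (ep : R) : 0 < ep -> exists n, forall p q, nrm (sqrt_iter n p q - w p q) <= ep /\
    nrm (sqrt_iter n.+1 p q - w p q) <= ep.
  move=> ep0.
  have [N hN] : {N : 'I_k * 'I_k -> nat & forall pq n, (N pq <= n)%N ->
      nrm (sqrt_iter n pq.1 pq.2 - w pq.1 pq.2) <= ep}.
    apply: (@choice _ _ (fun pq N => forall n, (N <= n)%N ->
      nrm (sqrt_iter n pq.1 pq.2 - w pq.1 pq.2) <= ep)) => -[p q].
    exact: wP.
  exists (\max_pq N pq)%N => p q.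
  have h : (N (p, q) <= \max_pq N pq)%N by exact: leq_bigmax.
  by split; apply: (hN (p, q)) => //; exact: leqW.
have iterC n p q : nrm (sqrt_iter n p q) <= C.
  apply: le_trans (cone_nrm (cone_iter n) p q) _.
  by have /andP[_ h] := mass01 n; rewrite ler_piMr.
have wC p q : nrm (w p q) <= C + 1.
  have [n hn] := unif 1 ltr01; have [h _] := hn p q; rewrite -[w p q]subr0.
  apply: le_trans (nrm_triangle (sqrt_iter n p q) _ _) _.
  by rewrite subr0 nrm_distC addrC lerD.
have wE p q : w p q = half%:C *: (y p q + mprod w w p q).
  apply/eqP; rewrite -subr_eq0; apply/eqP; apply: nrm_small => ep ep0.
  pose D : R := 1 + k%:R * (C + C + 1).
  have k0 : 0 <= k%:R :> R by rewrite ler0n.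
  have D0 : 0 < D by rewrite /D ltr_wpDr// mulr_ge0// !addr_ge0.
  have [|n hn] := unif (ep / D); first by rewrite divr_gt0.
  have [h0 h1] : 0 <= ep / D /\ forall p q, nrm (sqrt_iter n p q - w p q) <= ep / D.
    by split=> [|p' q']; [rewrite divr_ge0 ?ltW|have [] := hn p' q'].
  apply: le_trans (nrm_triangle (sqrt_iter n.+1 p q) _ _) _.
  rewrite nrm_distC; have -> : ep = ep / D + ep / D * (k%:R * (C + C + 1)).
    by rewrite -[LHS](@divfK _ D) ?gt_eqF// {2}/D mulrDr mulr1.
  apply: lerD; first by have [] := hn p q.
  rewrite /= -scalerBr nrmZ nrmCR ger0_norm// opprD addrACA subrr add0r /mprod -sumrB.
  apply: le_trans (_ : nrm (\sum_r (cmul (sqrt_iter n p r) (sqrt_iter n r q) - cmul (w p r) (w r q))) <= _).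
    by rewrite ler_piMl ?nrm_ge0// /half; lra.
  apply: le_trans (nrm_sum _ _ _) _.
  apply: le_trans (_ : \sum_(r < k) ep / D * (C + C + 1) <= _); last first.
    by rewrite sumr_const card_ord -[_ *+ k]mulr_natl mulrCA.
  apply: ler_sum => r _.
  have -> : cmul (sqrt_iter n p r) (sqrt_iter n r q) - cmul (w p r) (w r q) =
     cmul (sqrt_iter n p r) (sqrt_iter n r q - w r q) + cmul (sqrt_iter n p r - w p r) (w r q).
    by rewrite cmulBr cmulBl addrA subrK.
  apply: le_trans (nrmD _ _) _; rewrite -addrA mulrDr; apply: lerD.
    by apply: le_trans (nrm_mul _ _) _; rewrite mulrC ler_pM ?nrm_ge0.
  by apply: le_trans (nrm_mul _ _) _; rewrite ler_pM ?nrm_ge0.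
exists (fun p q => mid p q - w p q); split => p q.
  rewrite cstarB; congr (_ - _); first by rewrite /mid eq_sym; case: eqP => _; rewrite ?es ?cstar0.
  apply/eqP; rewrite -subr_eq0; apply/eqP; apply: nrm_small => ep ep0.
  have [|n hn] := unif (ep / 2); first by rewrite divr_gt0.
  apply: le_trans (nrm_triangle (sqrt_iter n q p) _ _) _; rewrite -iter_star -cstarB nrm_star nrm_distC.
  rewrite iter_star; have [h1 _] := hn p q; have [h2 _] := hn q p; lra.
rewrite /mprod; under eq_bigr do rewrite cmulBl !cmulBr.
rewrite !sumrB; have := mid_l mid p q; have := mid_l w p q; have := mid_r w p q.
rewrite /mprod => -> -> ->; rewrite -/(mprod w w p q).
have w2 : w p q + w p q = y p q + mprod w w p q.
  have twice : (half%:C : R[i]) + half%:C = 1 by rewrite -rmorphD /= /half; congr _%:C; lra.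
  by rewrite {1 2}wE -scalerDl twice scale1r.
by rewrite opprB [mprod w w p q - _]addrC addrA -[_ - _ - _]addrA -opprD w2 opprD addrA subrK.
Qed.

End SquareRoot.

(** * Positivity through bounded powers *)

Section BoundedPowers.
Variables (R : realType) (A : cstarAlgType R) (e : A) (k : nat).
Hypotheses (e1 : forall a, cmul e a = a) (e2 : forall a, cmul a e = a).
Local Notation mat := ('I_k -> 'I_k -> A).
Implicit Types h y : mat.

Definition defect_mx (c : R) h : mat := fun p q => mid e p q - (c^-1)%:C *: h p q.

Definition pbound (c : R) h := forall n p q, nrm (mpow e (defect_mx c h) n p q) <= 1.

(** The square root of h is obtained from the bounded powers of 1 - h / c, and being
    self-adjoint it is the Gram factor of h. *)
Lemma pbound_positive c h : 0 < c -> (forall p q, cstar (h p q) = h q p) ->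
  pbound c h -> positive_mx h.
Proof.
move=> c0 hs hb.
have es : cstar e = e by rewrite -[LHS]e1 -[X in cmul X _]cstarK -cstarM e1 cstarK.
have ys p q : cstar (defect_mx c h p q) = defect_mx c h q p.
  rewrite /defect_mx cstarB cstarZ !cjE hs; congr (_ - _).
  by rewrite /mid eq_sym; case: eqP => _; rewrite ?es ?cstar0.
have [z [zs zz]] := sqrt_of_power_bounded e1 e2 hb ys.
exists (fun l p => (Num.sqrt c)%:C *: z l p) => p q.
transitivity (c%:C *: mprod z z p q).
  rewrite zz /defect_mx opprB addrC subrK scalerA -rmorphM mulfV ?gt_eqF//.
  by rewrite scale1r.
rewrite /mprod scaler_sumr; apply: eq_bigr => l _.
rewrite cstarZ !cjE zs cmulZl cmulZr scalerA -rmorphM -expr2 sqr_sqrtr// ltW//.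
Qed.

Lemma pbound_limit c h : 0 < c ->
  (forall ep : R, 0 < ep -> exists h', pbound c h' /\ forall p q, nrm (h p q - h' p q) <= ep) ->
  pbound c h.
Proof.
move=> c0 lim.
have [B [B0 hB]] : exists B : R, 0 <= B /\ forall p q, nrm (defect_mx c h p q) <= B.
  exists (\sum_p \sum_q nrm (defect_mx c h p q)).
  have s0 p : 0 <= \sum_q nrm (defect_mx c h p q) by apply: sumr_ge0 => q _; exact: nrm_ge0.
  split=> [|p q]; first exact: sumr_ge0.
  rewrite (bigD1 p)//= (bigD1 q)//= -addrA lerDl addr_ge0//; apply: sumr_ge0 => // q' _; exact: nrm_ge0.
have cont n : exists K : R, 0 <= K /\ forall (dl : R) h', 0 <= dl -> pbound c h' ->
    (forall p q, nrm (h p q - h' p q) <= dl) ->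
    forall p q, nrm (mpow e (defect_mx c h) n p q - mpow e (defect_mx c h') n p q) <= K * dl.
  elim: n => [|n [K [K0 IH]]].
    by exists 0; split=> // dl h' d0 _ _ p q; rewrite subrr nrm0 mul0r.
  have ci0 : 0 <= c^-1 by rewrite invr_ge0 ltW.
  have kn : 0 <= k%:R :> R by rewrite ler0n.
  exists (k%:R * (B * K + c^-1)); split; first by rewrite mulr_ge0// addr_ge0// mulr_ge0.
  move=> dl h' d0 ph' hh p q; rewrite /= /mprod -sumrB; apply: le_trans (nrm_sum _ _ _) _.
  apply: le_trans (_ : \sum_(r < k) (B * K + c^-1) * dl <= _); last first.
    by rewrite sumr_const card_ord -[_ *+ k]mulr_natl mulrA.
  apply: ler_sum => r _.
  set y := defect_mx c h p r; set y' := defect_mx c h' p r.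
  set w := mpow _ _ _ _ _; set w' := mpow _ _ _ _ _.
  have -> : cmul y w - cmul y' w' = cmul y (w - w') + cmul (y - y') w'.
    by rewrite cmulBr cmulBl addrA subrK.
  apply: le_trans (nrmD _ _) _; rewrite mulrDl; apply: lerD.
    apply: le_trans (nrm_mul _ _) _; by rewrite -mulrA ler_pM ?nrm_ge0//; [exact: hB|exact: IH].
  apply: le_trans (nrm_mul _ _) _; rewrite -[leRHS]mulr1 ler_pM ?nrm_ge0//; last exact: ph'.
  have -> : y - y' = - ((c^-1)%:C *: (h p r - h' p r)).
    by rewrite /y /y' /defect_mx scalerBr !opprB addrC addrA subrK.
  by rewrite nrmN nrmZ nrmCR ger0_norm// ler_wpM2l.
move=> n p q; apply/ler_addgt0Pr => ep ep0.
have [K [K0 hK]] := cont n.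
have d0 : 0 < ep / (K + 1) by rewrite divr_gt0// ltr_wpDl.
have [h' [ph' hh]] := lim _ d0.
rewrite -[mpow _ _ _ _ _]subr0; apply: le_trans (nrm_triangle (mpow e (defect_mx c h') n p q) _ _) _.
rewrite subr0 addrC; apply: lerD; first exact: ph'.
apply: le_trans (hK _ _ (ltW d0) ph' hh p q) _.
by rewrite mulrCA ler_piMr ?(ltW ep0)// ler_pdivrMr ?ltr_wpDl// mul1r lerDl.
Qed.

End BoundedPowers.

Section Contractions.
Variable R : realType.

Lemma sum_pair (W : nmodType) (P Q : finType) (F : P * Q -> W) :
  \sum_x F x = \sum_p \sum_q F (p, q).
Proof. by rewrite pair_bigA; apply: eq_bigr => -[]. Qed.

Lemma sum_sq_le (I : finType) (a : I -> R[i]) :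
  nrm (\sum_i a i) ^+ 2 <= #|I|%:R * \sum_i nrm (a i) ^+ 2.
Proof.
have cs := @dot_le R I (fun=> 1) a.
have e1 : \sum_i conjc 1 * a i = \sum_i a i by apply: eq_bigr => i _; rewrite cj1 mul1r.
have e2 : vsq (fun _ : I => 1 : R[i]) = #|I|%:R.
  by rewrite /vsq; under eq_bigr do rewrite nrmC1 expr1n; rewrite sumr_const.
rewrite e1 e2 in cs.
have s0 := vsq_ge0 a; have n0 : 0 <= #|I|%:R :> R by rewrite ler0n.
apply: le_trans (_ : (Num.sqrt #|I|%:R * Num.sqrt (vsq a)) ^+ 2 <= _).
  by rewrite ler_pXn2r// nnegrE ?nrm_ge0// mulr_ge0// sqrtr_ge0.
by rewrite exprMn !sqr_sqrtr.
Qed.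

Lemma parallelogram_le (a b : R[i]) : nrm (a + b) ^+ 2 <= 2 * nrm a ^+ 2 + 2 * nrm b ^+ 2.
Proof.
apply: le_trans (_ : (nrm a + nrm b) ^+ 2 <= _).
  by rewrite ler_pXn2r// ?nnegrE ?addr_ge0 ?nrm_ge0// nrmD.
by have := sqr_ge0 (nrm a - nrm b); rewrite sqrrB sqrrD; lra.
Qed.

Definition psd_le (J : finType) (H : J -> J -> R[i]) (c : R) :=
  (forall i j, conjc (H j i) = H i j) /\
  forall w, 0 <= complex.Re (bil H w w) <= c * vsq w.

Lemma bilDl (J : finType) (M : J -> J -> R[i]) x x' y :
  bil M (fun j => x j + x' j) y = bil M x y + bil M x' y.
Proof. by rewrite !bilE -big_split; apply: eq_bigr => j _; rewrite ?cj_conj cjD mulrDl. Qed.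

Lemma bilDr (J : finType) (M : J -> J -> R[i]) x y y' :
  bil M x (fun j => y j + y' j) = bil M x y + bil M x y'.
Proof.
rewrite /bil -big_split; apply: eq_bigr => i _; rewrite -big_split; apply: eq_bigr => j _.
by rewrite mulrDr.
Qed.

Lemma bil_id (J : finType) (x y : J -> R[i]) :
  bil (fun i j => (i == j)%:R) x y = \sum_j conjc (x j) * y j.
Proof.
rewrite /bil; apply: eq_bigr => i _; rewrite (bigD1 i)//= eqxx mulr1 big1 ?addr0 ?cj_conj// => j /negbTE ji.
by rewrite eq_sym ji mulr0n mulr0 mul0r.
Qed.

Lemma bil_gram (T J : finType) (M : T -> J -> R[i]) w :
  bil (fun i j => \sum_t conjc (M t i) * M t j) w w = (\sum_t nrm (\sum_j M t j * w j) ^+ 2)%:C.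
Proof.
transitivity (\sum_i \sum_j \sum_t conjc (w i) * (conjc (M t i) * M t j) * w j).
  by apply: eq_bigr => i _; apply: eq_bigr => j _; rewrite ?cj_conj mulr_sumr mulr_suml.
under eq_bigr do rewrite exchange_big /=; rewrite exchange_big rmorph_sum.
apply: eq_bigr => t _ /=; rewrite -[RHS]cj_mul_nrm [X in X * _]rmorph_sum mulr_suml.
apply: eq_bigr => i _; rewrite mulr_sumr; apply: eq_bigr => j _.
transitivity (conjc (M t i * w i) * (M t j * w j)) => //; rewrite cjM; ring.
Qed.

(** By polarization the form of 1 - H / c is controlled by its values on the diagonal,
    which lie between 0 and 1. *)
Lemma psd_defect (J : finType) (H : J -> J -> R[i]) (c : R) : 0 < c -> psd_le H c ->
  opn (fun i j => (i == j)%:R - (c^-1)%:C * H i j) <= 1.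
Proof.
move=> c0 [Hh Hc]; set M := fun i j => _.
have Mh i j : conjc (M j i) = M i j.
  by rewrite /M cjB cjM cj_real Hh cj_nat eq_sym.
have ReZ (r : R) (w : R[i]) : complex.Re (r%:C * w) = r * complex.Re w.
  by case: w => a b /=; rewrite mul0r subr0.
have ReB (w w' : R[i]) : complex.Re (w - w') = complex.Re w - complex.Re w' by case: w; case: w'.
have ReD (w w' : R[i]) : complex.Re (w + w') = complex.Re w + complex.Re w' by case: w; case: w'.
have ReN (w : R[i]) : complex.Re (- w) = - complex.Re w by case: w.
have bilM x y : bil M x y = \sum_j conjc (x j) * y j - (c^-1)%:C * bil H x y.
  rewrite -bil_id -bilZ /bil -sumrB; apply: eq_bigr => i _; rewrite -sumrB; apply: eq_bigr => j _.
  by rewrite /M mulrBr mulrBl.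
have Mw w : 0 <= complex.Re (bil M w w) <= vsq w.
  have -> : complex.Re (bil M w w) = vsq w - c^-1 * complex.Re (bil H w w).
    rewrite bilM ReB ReZ; congr (_ - _).
    rewrite (eq_bigr (fun j => (nrm (w j) ^+ 2)%:C)) => [|j _]; last by rewrite cj_mul_nrm.
    by rewrite -rmorph_sum.
  have /andP[h1 h2] := Hc w; have ci : 0 <= c^-1 by rewrite invr_ge0 ltW.
  rewrite subr_ge0 gerBl mulr_ge0// andbT.
  by rewrite mulrC ler_pdivrMr// mulrC.
have MR x y : complex.Re (bil M y x) = complex.Re (bil M x y).
  rewrite (_ : bil M y x = conjc (bil M x y)); first by case: (bil M x y).
  rewrite -[conjc _]bil_star; congr bil; apply/funext => i; apply/funext => j.
  by rewrite ?cj_conj Mh.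
have re_le x y : vsq x <= 1 -> vsq y <= 1 -> complex.Re (bil M x y) <= 1.
  move=> x1 y1; pose y' j := (-1) * y j.
  have e4 : 4 * complex.Re (bil M x y) = complex.Re (bil M (fun j => x j + y j) (fun j => x j + y j)) -
      complex.Re (bil M (fun j => x j + y' j) (fun j => x j + y' j)).
    rewrite !bilDl !bilDr /y' !bilZr !bilZl ?cj_conj cjN cj1 !mulN1r opprK !ReD !ReN MR.
    lra.
  have /andP[_ h1] := Mw (fun j => x j + y j).
  have /andP[h2 _] := Mw (fun j => x j + y' j).
  have h3 : vsq (fun j => x j + y j) <= 4.
    apply: le_trans (_ : \sum_j (2 * nrm (x j) ^+ 2 + 2 * nrm (y j) ^+ 2) <= _).
      by apply: ler_sum => j _; exact: parallelogram_le.
    rewrite big_split /= -!mulr_sumr -/(vsq x) -/(vsq y); lra.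
  lra.
apply: opn_le => x y x1 y1.
have [->|q0] := eqVneq (bil M x y) 0; first by rewrite nrm0.
set q := bil M x y in q0 *.
have p0 : nrm q != 0 by apply: contra_neq q0 => /nrm_eq0.
pose u : R[i] := q / (nrm q)%:C.
have nq : (nrm q)%:C != 0 :> R[i] by apply: contra_neq p0 => /(@complexI R).
have u1 : nrm u = 1.
  have : nrm (u * (nrm q)%:C) = nrm q by rewrite divfK.
  by rewrite nrmCM nrmCR ger0_norm ?nrm_ge0// => /(canRL (mulfK p0)) ->; rewrite divff.
have := re_le (fun j => u * x j) y _ y1; rewrite vsqZ u1 expr1n mul1r => /(_ x1).
rewrite bilZl -/q; suff -> : conjc u * q = (nrm q)%:C by [].
have uq : u * (nrm q)%:C = q by rewrite divfK.
by rewrite -{1}uq mulrA cj_mul_nrm u1 expr1n mul1r.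
Qed.

End Contractions.

(** A family of matrix representations that computes the norm gives positivity of sums. *)
Section Models.
Variables (R : realType) (A : cstarAlgType R) (e : A) (Z : Type) (I : Z -> finType).
Local Notation model := (forall z, I z -> I z -> R[i]).
Variable rep : A -> model -> Prop.
Hypotheses (repD : forall a b M N, rep a M -> rep b N -> rep (a + b) (fun z i j => M z i j + N z i j))
  (repZ : forall c a M, rep a M -> rep (c *: a) (fun z i j => c * M z i j))
  (repM : forall a b M N, rep a M -> rep b N -> rep (cmul a b) (fun z i j => \sum_l M z i l * N z l j))
  (repS : forall a M, rep a M -> rep (cstar a) (fun z i j => conjc (M z j i)))
  (rep1 : rep e (fun z i j => (i == j)%:R))
  (rep_le : forall a M (c : R), rep a M -> 0 <= c -> (forall z, opn (M z) <= c) -> nrm a <= c)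
  (rep_ge : forall a M z, rep a M -> opn (M z) <= nrm a).

Lemma opn_block (I1 P : finType) (M : P * I1 -> P * I1 -> R[i]) p q :
  opn (fun i j => M (p, i) (q, j)) <= opn M.
Proof.
apply: opn_le => x y x1 y1.
pose ext r (w : I1 -> R[i]) (ri : P * I1) := if ri.1 == r then w ri.2 else 0.
have pick r (F : P * I1 -> R[i]) : (forall ri, ri.1 != r -> F ri = 0) -> \sum_ri F ri = \sum_i F (r, i).
  move=> F0; rewrite sum_pair/= (bigD1 r)//= [X in _ + X]big1 ?addr0// => r' rr.
  by apply: big1 => i _; apply: F0.
have vext r w : vsq (ext r w) = vsq w.
  apply: (@complexI R); rewrite /vsq !rmorph_sum (pick r) /ext.
    by apply: eq_bigr => i _ /=; rewrite eqxx.
  by move=> ri /negbTE ->; rewrite nrm0 expr0n.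
have -> : bil (fun i j => M (p, i) (q, j)) x y = bil M (ext p x) (ext q y).
  rewrite /bil [RHS](pick p) => [|ri /negbTE rip].
    apply: eq_bigr => i _; rewrite [RHS](pick q) => [|ri /negbTE riq].
      by apply: eq_bigr => j _; rewrite /ext /= !eqxx.
    by rewrite /ext riq mulr0.
  by apply: big1 => j _; rewrite /ext rip rmorph0 !mul0r.
by apply: opn_ub; rewrite vext.
Qed.

Lemma rep_sum (L : finType) (a : L -> A) (N : L -> model) : (forall l, rep (a l) (N l)) ->
  rep (\sum_l a l) (fun z i j => \sum_l N l z i j).
Proof.
move=> ha.
have r0 : rep 0 (fun z i j => 0).
  have := repZ 0 rep1; rewrite scale0r; congr rep.
  by do 3 apply: functional_extensionality_dep => ?; rewrite mul0r.
have eqm (s : seq L) : (fun z i j => \sum_(l <- s) N l z i j) =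
    foldr (fun l (T : model) z i j => N l z i j + T z i j) (fun z i j => 0) s.
  elim: s => [|l s IH] /=; do 3 apply: functional_extensionality_dep => ?; first by rewrite big_nil.
  by rewrite big_cons -IH.
rewrite eqm; elim: (index_enum L) => [|l s IH] /=; first by rewrite big_nil.
by rewrite big_cons; exact: repD.
Qed.

Lemma repE a N N' : rep a N -> (forall z i j, N z i j = N' z i j) -> rep a N'.
Proof.
move=> hN NN; suff <- : N = N' by [].
by do 3 apply: functional_extensionality_dep => ?.
Qed.

Section PositiveMatrices.
Variables (k : nat) (h : 'I_k -> 'I_k -> A) (H : 'I_k -> 'I_k -> model) (c : R).
Let J z := ('I_k * I z)%type.
Let HH z (i j : J z) := H i.1 j.1 i.2 j.2.
Hypotheses (hH : forall p q, rep (h p q) (H p q)) (c0 : 0 < c) (Hc : forall z, psd_le (@HH z) c).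
Let D z (i j : J z) := (i == j)%:R - (c^-1)%:C * HH i j.
Let Dn z n : J z -> J z -> R[i] := iter n (fun N => fun i j => \sum_l D i l * N l j) (fun i j => (i == j)%:R).

Lemma psd_pbound : pbound e c h.
Proof.
move=> n p q.
have r0 : rep 0 (fun z i j => 0).
  by have := repZ 0 rep1; rewrite scale0r => h0; apply: (repE h0) => z i j; rewrite mul0r.
have rD p' q' : rep (defect_mx e c h p' q') (fun z i j => D (p', i) (q', j)).
  have rm : rep (mid e p' q') (fun z i j => (p' == q')%:R * (i == j)%:R).
    rewrite /mid; case: eqP => _; first by apply: (repE rep1) => z i j; rewrite mul1r.
    by apply: (repE r0) => z i j; rewrite mul0r.
  rewrite /defect_mx -[- (_ *: _)]scaleN1r.
  apply: (repE (repD rm (repZ (-1) (repZ (c^-1)%:C (hH p' q'))))) => z i j.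
  rewrite /D /HH mulN1r; congr (_ - _ * _).
  by rewrite xpair_eqE; case: eqP; rewrite ?mul1r ?mul0r.
have {}rD : rep (mpow e (defect_mx e c h) n p q) (fun z i j => Dn n (p, i) (q, j)).
  elim: n p q => [|n IH] p q.
    rewrite /= /mid /Dn /=; case: eqP => [->|/eqP/negbTE pq].
      by apply: (repE rep1) => z i j; rewrite xpair_eqE eqxx.
    by apply: (repE r0) => z i j; rewrite xpair_eqE pq.
  apply: (repE (rep_sum (fun r => repM (rD p r) (IH r q)))) => z i j.
  by rewrite /Dn /= sum_pair.
apply: (rep_le rD) => // z; apply: le_trans (opn_block _ p q) _.
elim: n {rD} => [|n IH].
  apply: opn_le => x y x1 y1; rewrite bil_id.
  apply: le_trans (dot_le _ _) _; rewrite mulr_ile1 ?sqrtr_ge0//.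
    by rewrite -sqrtr1 ler_sqrt.
  by rewrite -sqrtr1 ler_sqrt.
apply: le_trans (opn_mul _ _) _; rewrite mulr_ile1 ?opn_ge0//.
exact: (psd_defect c0 (Hc z)).
Qed.

End PositiveMatrices.

Section SumsOfSquares.
Variables (m k : nat) (X : 'I_m -> 'I_k -> A) (M : 'I_m -> 'I_k -> model) (b : R).
Hypotheses (XM : forall l p, rep (X l p) (M l p)) (Xb : forall l p, nrm (X l p) <= b).
Arguments M : clear implicits.

Let h p q := \sum_l cmul (cstar (X l p)) (X l q).
Let c : R := m%:R * (k%:R * b ^+ 2) + 1.
Let J z := ('I_k * I z)%type.

Lemma gram_pbound : pbound e (m%:R * (k%:R * b ^+ 2) + 1) h.
Proof.
have c0 : 0 < c by rewrite /c ltr_wpDl// mulr_ge0 ?ler0n// mulr_ge0 ?ler0n// sqr_ge0.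
pose H p q z i j := \sum_l \sum_r conjc (M l p z r i) * M l q z r j.
have hH p q : rep (h p q) (H p q).
  by apply: rep_sum => l; apply: repM => //; exact: repS.
apply: (psd_pbound hH c0) => z.
pose N (lr : 'I_m * I z) (pi : J z) := M lr.1 pi.1 z lr.2 pi.2.
have HE : (fun i j : J z => H i.1 j.1 z i.2 j.2) = fun i j => \sum_t conjc (N t i) * N t j.
  by apply/funext => i; apply/funext => j; rewrite sum_pair.
rewrite HE; split=> [i j|w].
  rewrite [conjc _]rmorph_sum; apply: eq_bigr => t _.
  by rewrite -[LHS]/(conjc (conjc (N t j) * N t i)) cjM cjK mulrC.
rewrite bil_gram; apply/andP; split; first by apply: sumr_ge0 => t _; exact: sqr_ge0.
have vw : vsq w = \sum_(p < k) vsq (fun i => w (p, i)) by rewrite /vsq sum_pair.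
apply: le_trans (_ : m%:R * (k%:R * b ^+ 2) * vsq w <= _); last first.
  by rewrite /c mulrDl mul1r lerDl vsq_ge0.
rewrite [leLHS]sum_pair.
apply: le_trans (_ : \sum_(l < m) (k%:R * b ^+ 2) * vsq w <= _); last first.
  by rewrite sumr_const card_ord -[_ *+ m]mulr_natl mulrA.
apply: ler_sum => l _.
have b0 (p : 'I_k) : 0 <= b := le_trans (nrm_ge0 (X l p)) (Xb l p).
apply: le_trans (_ : \sum_i k%:R * (\sum_p nrm (mxv (M l p z) (fun i => w (p, i)) i) ^+ 2) <= _).
  apply: ler_sum => i _; rewrite sum_pair.
  by have := sum_sq_le (fun p => mxv (M l p z) (fun i => w (p, i)) i); rewrite card_ord.
rewrite -mulr_sumr -mulrA ler_wpM2l ?ler0n// exchange_big vw mulr_sumr /=.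
apply: ler_sum => p _; have h1 := mxv_bound (M l p z) (fun i => w (p, i)).
rewrite -/(vsq _) -[leLHS](@sqr_sqrtr R) ?vsq_ge0// -[vsq (fun i => w (p, i))](@sqr_sqrtr R) ?vsq_ge0//.
rewrite -exprMn ler_pXn2r// ?nnegrE ?mulr_ge0 ?sqrtr_ge0 ?(b0 p)//.
apply: le_trans h1 _; rewrite ler_wpM2r ?sqrtr_ge0//.
exact: le_trans (rep_ge z (XM l p)) (Xb l p).
Qed.

End SumsOfSquares.
End Models.

(** * Kernels *)

Section Kernels.
Variables (R : realType) (X : topologicalType) (cX : compact [set: X]).
Variables (V : line_bundle R X) (alpha : homeo X) (Y : set X).
Local Notation A := (CX R cX).
Local Notation EV := (EY cX V alpha Y).
Variables (O : cstarAlgType R) (pi : A -> O) (tau : EV -> O).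
Hypothesis cov : covariant_rep pi tau.
Local Notation "x '^^' n" := (homeo_pow alpha n x) (at level 30, format "x ^^ n").
Local Notation Hom := (Hom pi tau).
Local Notation nocross := (nocross alpha).
Implicit Types (sg : int -> X -> R[i]) (B : set X).
Let pi_hom : star_hom pi := rep_hom cov.
Let lin_pi : is_linear pi. Proof. by have [] := pi_hom. Qed.

(** Finite sums of homogeneous elements whose orbit segments avoid B, together with
    their kernels: [sg n x] is the coefficient from x to alpha^n x. *)
Inductive Kel B : (int -> X -> R[i]) -> O -> Prop :=
| Kel1 n s a : Hom n s a -> (forall x, s x != 0 -> nocross B n x) ->
    Kel B (fun m x => if m == n then s x else 0) a
| KelD sg sg' a b : Kel B sg a -> Kel B sg' b -> Kel B (fun m x => sg m x + sg' m x) (a + b).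

Lemma KelE B sg sg' a b : Kel B sg a -> (forall m x, sg m x = sg' m x) -> a = b -> Kel B sg' b.
Proof.
move=> h ss <-; suff <- : sg = sg' by [].
by apply/funext => m; apply/funext => x.
Qed.

Lemma Kel_nocross B sg a : Kel B sg a -> forall m x, sg m x != 0 -> nocross B m x.
Proof.
elim => {sg a} [n s a _ h|sg sg' a b _ IH1 _ IH2] m x.
  by case: (eqVneq m n) => [->|_]; [exact: h|rewrite eqxx].
have [->|s0] := eqVneq (sg m x) 0; last by move=> _; exact: IH1.
by rewrite add0r; exact: IH2.
Qed.

Lemma Kel_sub B B' sg a : Kel B sg a -> B' `<=` B -> Kel B' sg a.
Proof.
move=> h BB; elim: h => {sg a} [n s a ha h|sg sg' a b _ IH1 _ IH2]; last exact: KelD.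
by apply: Kel1 => // x /h hx l /hx nB /BB.
Qed.

Lemma KelZ B sg a (c : R[i]) : Kel B sg a -> Kel B (fun m x => c * sg m x) (c *: a).
Proof.
elim => {sg a} [n s a ha h|sg sg' a b _ IH1 _ IH2].
  apply: (KelE (Kel1 (Hom_scale cov c ha) _)) => [x|m x|//]; last by case: eqP; rewrite ?mulr0.
  by rewrite mulf_eq0 negb_or => /andP[_]; exact: h.
by apply: (KelE (KelD IH1 IH2)) => [m x|]; rewrite ?mulrDr ?scalerDr.
Qed.

Lemma KelS B sg a : Kel B sg a -> Kel B (fun m x => conjc (sg (- m) (x^^m))) (cstar a).
Proof.
elim => {sg a} [n s a ha h|sg sg' a b _ IH1 _ IH2].
  apply: (KelE (Kel1 (Hom_star cov ha) _)) => [x sx|m x|//].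
    rewrite -[x](apowNK alpha x n); apply: nocrossN; apply: h.
    by apply: contra_neq sx => ->; rewrite cj0.
  have [->|mn] := eqVneq m (- n); first by rewrite opprK eqxx.
  by rewrite eqr_oppLR (negbTE mn) cj0.
by apply: (KelE (KelD IH1 IH2)) => [m x|]; rewrite ?cjD ?cstarD.
Qed.

Lemma Kel_mul B sg sg' a b : Kel B sg a -> Kel B sg' b -> exists om, Kel B om (cmul a b) /\
  forall z (J : finType) (p : J -> int), injective p ->
    (forall m, nocross B m z -> exists l, p l = m) -> (forall j, nocross B (p j) z) -> forall i j,
    om (p i - p j) (z^^(p j)) = \sum_l sg (p i - p l) (z^^(p l)) * sg' (p l - p j) (z^^(p j)).
Proof.
move=> ha hb; elim: ha => {sg a} [n s a ha hs|sg1 sg2 a1 a2 _ IH1 _ IH2]; last first.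
  have [o1 [k1 e1]] := IH1; have [o2 [k2 e2]] := IH2.
  exists (fun m x => o1 m x + o2 m x); split; first by rewrite cmulDl; exact: KelD.
  move=> z J p pi' pB pY i j; rewrite e1// e2// -big_split; apply: eq_bigr => l _.
  by rewrite mulrDl.
elim: hb => {sg' b} [m t b hb ht|sg1 sg2 a1 a2 _ IH1 _ IH2]; last first.
  have [o1 [k1 e1]] := IH1; have [o2 [k2 e2]] := IH2.
  exists (fun m x => o1 m x + o2 m x); split; first by rewrite cmulDr; exact: KelD.
  move=> z J p pi' pB pY i j; rewrite e1// e2// -big_split; apply: eq_bigr => l _.
  by rewrite mulrDr.
exists (fun p x => if p == n + m then s (x^^m) * t x else 0); split.
  apply: Kel1; first exact: (Hom_mul cov ha hb).
  move=> x; rewrite mulf_eq0 negb_or => /andP[sx tx].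
  by apply: nocrossD; [exact: ht|exact: hs].
move=> z J p pinj pB pY i j.
have [t0|t0] := eqVneq (t (z^^(p j))) 0.
  rewrite t0 mulr0 if_same big1// => l _; by rewrite if_same mulr0.
have [l0 l0E] : exists l, p l = m + p j by apply: pB; apply: nocrossD => //; exact: ht.
rewrite (bigD1 l0)//= big1 ?addr0 => [|l ll0].
  rewrite l0E addrK eqxx apowD; have -> : (p i - p j == n + m) = (p i - (m + p j) == n).
    by apply/eqP/eqP => h; lia.
  by case: eqP; rewrite ?mul0r.
case: (eqVneq (p l - p j) m) => h; last by rewrite mulr0.
by case/eqP: ll0; apply: pinj; rewrite l0E -h subrK.
Qed.

Section Bounded.
Variables (B : set X) (T : nat).
Hypothesis hT : forall x, exists t : nat, (t <= T)%N /\ B (x^^t).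
Hypothesis YB : Y `<=` B.

Lemma nocross_bound m x : nocross B m x -> (absz m <= T)%N.
Proof.
move=> h; rewrite leqNgt; apply/negP => mT.
have [m0|m0] := leP 0 m.
  have [t [tT Bt]] := hT (x^^1); apply: (h (t%:Z + 1)); last by rewrite apowD.
  apply/orP; left; lia.
have [t [tT Bt]] := syndetic_back hT x; apply: (h (- t%:Z)) => //.
apply/orP; right; lia.
Qed.

Definition pos (l : 'I_(T + T).+1) : int := l%:Z - T%:Z.
Definition blk z : finType := {l : 'I_(T + T).+1 | `[< nocross B (pos l) z >]}.
Definition bpos z (l : blk z) := pos (val l).
Definition kmat sg z (i j : blk z) := sg (bpos i - bpos j) (z^^(bpos j)).

Lemma pos_inj : injective pos.
Proof. by move=> i j; rewrite /pos => h; apply/ord_inj; lia. Qed.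

Lemma pos_ex m : (absz m <= T)%N -> exists l, pos l = m.
Proof.
move=> mT; have h : (absz (m + T%:Z)%R < (T + T).+1)%N by lia.
by exists (Ordinal h); rewrite /pos /=; lia.
Qed.

Lemma bpos_inj z : injective (@bpos z).
Proof. by move=> i j /pos_inj /val_inj. Qed.

Lemma bpos_ex z m : nocross B m z -> exists l : blk z, bpos l = m.
Proof.
move=> h; have [l lE] := pos_ex (nocross_bound h).
have hl : `[< nocross B (pos l) z >] by apply/asboolP; rewrite lE.
by exists (exist _ l hl).
Qed.

Lemma bpos_nocross z (l : blk z) : nocross B (bpos l) z.
Proof. by apply/asboolP; exact: (valP l). Qed.

Lemma Kel_coef sg a : Kel B sg a -> exists c : int -> O,
  (forall n, Hom n (sg n) (c n)) /\ a = \sum_l c (pos l).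
Proof.
elim => {sg a} [n s a ha hs|sg sg' a b _ [c [hc ->]] _ [c' [hc' ->]]]; last first.
  exists (fun n => c n + c' n); split; first by move=> n; exact: (Hom_add (hc n) (hc' n)).
  by rewrite big_split.
exists (fun m => if m == n then a else 0); split.
  by move=> m; case: eqP => [->|_]; [exact: ha|exact: (Hom0 cov)].
have [nT|nT] := leqP (absz n) T.
  have [l lE] := pos_ex nT; rewrite (bigD1 l)//= lE eqxx big1 ?addr0// => l' ll.
  by rewrite -lE (inj_eq pos_inj) (negbTE ll).
rewrite (_ : a = 0); first by rewrite big1// => l _; case: ifP.
apply: (Hom_zero cov ha) => x; apply: contraTeq nT => /hs h.
by rewrite -leqNgt; exact: nocross_bound h.
Qed.

Definition krep (a : O) (M : forall z, blk z -> blk z -> R[i]) :=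
  exists sg, Kel B sg a /\ forall z i j, M z i j = kmat sg i j.

Lemma krepM a b M N : krep a M -> krep b N ->
  krep (cmul a b) (fun z i j => \sum_l M z i l * N z l j).
Proof.
move=> [sg [ka aE]] [sg' [kb bE]]; have [om [ko oE]] := Kel_mul ka kb.
exists om; split=> // z i j; rewrite /kmat (oE z (blk z) (@bpos z)).
- by apply: eq_bigr => l _; rewrite aE bE.
- exact: bpos_inj.
- exact: bpos_ex.
- exact: bpos_nocross.
Qed.

Lemma krepS a M : krep a M -> krep (cstar a) (fun z i j => conjc (M z j i)).
Proof.
move=> [sg [ka aE]]; exists (fun m x => conjc (sg (- m) (x^^m))); split; first exact: KelS.
by move=> z i j; rewrite aE /kmat -apowD subrK [- (bpos i - bpos j)]opprB.
Qed.

Lemma krep_crude a M (c : R) : krep a M -> 0 <= c -> (forall z, opn (M z) <= c) ->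
  nrm a <= (T + T).+1%:R * c.
Proof.
move=> [sg [ka aE]] c0 Mc; have [d [hd ->]] := Kel_coef ka.
apply: le_trans (nrm_sum _ _ _) _.
apply: le_trans (_ : \sum_(l < (T + T).+1) c <= _); last first.
  by rewrite sumr_const card_ord -[_ *+ (T + T).+1]mulr_natl.
apply: ler_sum => l _; apply: (Hom_le cov (hd (pos l))) => // x.
have [->|sx] := eqVneq (sg (pos l) x) 0; first by rewrite nrm0.
have [i iE] := bpos_ex (Kel_nocross ka sx); have [j jE] := bpos_ex (@nocross0 _ alpha B x).
have := aE x i j; rewrite /kmat iE jE subr0 => <-.
exact: le_trans (opn_entry _ _ _) (Mc x).
Qed.

(** The norm is the supremum of the norms of the blocks: the crude bound is improved by
    taking powers. *)
Lemma krep_le a M (c : R) : krep a M -> 0 <= c -> (forall z, opn (M z) <= c) -> nrm a <= c.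
Proof.
move=> ka c0 Mc; pose b n := iter n (fun b => cmul (cstar b) b) a.
have nb n : nrm (b n) = nrm a ^+ (2 ^ n).
  elim: n => [|n IH]; first by rewrite expn0 expr1.
  by rewrite /= nrm_sq IH -exprM expnSr.
have kb n : exists N, krep (b n) N /\ forall z, opn (N z) <= c ^+ (2 ^ n).
  elim: n => [|n [N [kN oN]]]; first by exists M; rewrite expn0 expr1.
  exists (fun z i j => \sum_l conjc (N z l i) * N z l j); split.
    exact: (krepM (krepS kN) kN).
  move=> z; have -> : opn (fun i j => \sum_l conjc (N z l i) * N z l j) = opn (N z) ^+ 2.
    exact: opn_C.
  by rewrite expnSr exprM lerXn2r ?nnegrE ?opn_ge0 ?exprn_ge0.
apply: (@le_of_powers _ _ _ (T + T).+1%:R) => // [|n]; first exact: nrm_ge0.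
by have [N [kN oN]] := kb n; rewrite -nb; apply: (krep_crude kN) => //; exact: exprn_ge0.
Qed.

Hypothesis hX : hausdorff_space X.
Hypothesis clY : closed Y.
Hypotheses (minX : minimal alpha) (infX : infinite_set [set: X]).
Hypothesis piI : forall f x, nrm (cev f x) <= nrm (pi f).

(** Localization at a point z: the compression of an element to finitely many positions
    of the orbit of z, reachable from z without crossing Y, is seen by cutting down with
    local units near z. *)
Lemma localize sg a z (J : finType) (p : J -> int) : Kel B sg a -> injective p ->
  (forall j, nocross Y (p j) z) -> opn (fun i j => sg (p i - p j) (z^^(p j))) <= nrm a.
Proof.
move=> ka pinj pY.
pose P := (\sum_j absz (p j))%N.
have pP j : (absz (p j) <= P)%N by rewrite /P (bigD1 j)//= leq_addr.
have [N NP] : {N : J -> set X * (X -> R[i]) & forall j, [/\ open (N j).1, (N j).1 z, (N j).2 z = 1,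
    forall x, (N j).1 x -> nrm ((N j).2 x) = 1 & forall f : A, vanish_off (N j).1 f ->
      exists a, Hom (p j) (fun x => cev f x * (N j).2 x) a]}.
  apply: (@choice _ _ (fun j (N : set X * (X -> R[i])) => [/\ open N.1, N.1 z, N.2 z = 1,
    forall x, N.1 x -> nrm (N.2 x) = 1 & forall f : A, vanish_off N.1 f ->
      exists a, Hom (p j) (fun x => cev f x * N.2 x) a])) => j.
  by have [U [nu h]] := local_unit hX clY cov (pY j); exists (U, nu).
have [F [oF Fz fF]] := free_nbhd hX minX infX z (T + (P + P)).
have [||f0 [S [cf0 f01 f1 [clS SU] fS]]] := @bump R X cX hX [set z] (F `&` [set x | forall j, (N j).1 x]) (@closed_pt X hX z).
- by apply: openI => //; apply: open_forallI => j; have [] := NP j.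
- by move=> _ ->; split=> // j; have [] := NP j.
pose f := rC cX cf0; pose nu j := (N j).2.
have fE x : cev f x = (f0 x)%:C by [].
have fz : cev f z = 1 by rewrite fE f1.
have Sx x : cev f x != 0 -> F x /\ forall j, (N j).1 x.
  by move=> fx; apply: SU; apply: contrapT => /fS f0x; move: fx; rewrite fE f0x eqxx.
have [v vP] : {v : J -> O & forall j, Hom (p j) (fun x => cev f x * nu j x) (v j)}.
  apply: (@choice _ _ (fun j v => Hom (p j) (fun x => cev f x * nu j x) v)) => j.
  have [_ _ _ _ h] := NP j; apply: h => x nN; apply/eqP; apply: contrapT => /negP /Sx[_ hx]; exact: (nN (hx j)).
have nuz j : nu j z = 1 by have [] := NP j.
have free x m : (absz m <= T + (P + P))%N -> cev f x != 0 -> cev f (x^^m) != 0 -> m = 0.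
  by move=> mT /Sx[Fx _] /Sx[Fx' _]; exact: (fF x).
pose xi (x : J -> R[i]) := \sum_j x j *: v j.
have xi1 x : vsq x <= 1 -> nrm (xi x) <= 1.
  move=> x1; apply: (Hom_row_orth cov (fun j => Hom_scale cov (x j) (vP j))) => // [i j u w|u].
    rewrite !mulf_eq0 !negb_or => /and3P[_ fu _] /and3P[_ fw _] uw; apply: pinj; apply/eqP.
    have wE : w = u^^(p i - p j) by rewrite addrC apowD uw apowK.
    rewrite -subr_eq0; apply/eqP; apply: (free u) => //; last by rewrite -wE.
    have := pP i; have := pP j; lia.
  rewrite expr1n; apply: le_trans x1; apply: ler_sum => j _; rewrite nrmCM exprMn.
  rewrite ler_piMr ?sqr_ge0// exprn_ile1 ?nrm_ge0// nrmCM.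
  have [->|fu] := eqVneq (cev f u) 0; first by rewrite nrm0 mul0r.
  have [_ _ _ n1 _] := NP j; rewrite n1 ?mulr1; last by have [_] := Sx _ fu.
  by have /andP[h0 h1] := f01 u; rewrite fE nrmCR ger0_norm.
have [c [hc aE]] := Kel_coef ka.
(* matrix coefficients of one homogeneous part *)
have coef i j l : exists g, cmul (cstar (v i)) (cmul (c (pos l)) (v j)) = pi g /\
    cev g z = if pos l == p i - p j then sg (pos l) (z^^(p j)) else 0.
  have h := Hom_mul cov (Hom_star cov (vP i)) (Hom_mul cov (hc (pos l)) (vP j)).
  have [pE|pE] := eqVneq (pos l) (p i - p j).
    have d0 : - p i + (pos l + p j) = 0 by rewrite pE subrK addNr.
    rewrite d0 in h; have [g [gE aeq]] := Hom0E cov h; exists g; split => //.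
    rewrite -gE -apowD d0.
    by rewrite apow0 fz !nuz !mulr1 cj1 mul1r pE.
  exists 0; split; last by [].
  rewrite (is_linear0 lin_pi); apply: (Hom_zero cov h) => x.
  have [->|fx] := eqVneq (cev f x) 0; first by rewrite mul0r !mulr0.
  rewrite -apowD; have [->|fx'] := eqVneq (cev f (x^^(- p i + (pos l + p j)))) 0.
    by rewrite mul0r cj0 mul0r.
  case/eqP: pE; have := free x (- p i + (pos l + p j)) _ fx fx'.
  have := pP i; have := pP j; have := ltn_ord l; rewrite /pos => h1 h2 h3 h4.
  have : (absz (- p i + (l%:Z - T%:Z + p j))%R <= T + (P + P))%N by lia.
  by move=> /h4; lia.
have [g gP] : {g : J * J * 'I_(T + T).+1 -> A & forall q,
    cmul (cstar (v q.1.1)) (cmul (c (pos q.2)) (v q.1.2)) = pi (g q) /\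
    cev (g q) z = if pos q.2 == p q.1.1 - p q.1.2 then sg (pos q.2) (z^^(p q.1.2)) else 0}.
  apply: (@choice _ _ (fun q g => cmul (cstar (v q.1.1)) (cmul (c (pos q.2)) (v q.1.2)) = pi g /\
    cev g z = if pos q.2 == p q.1.1 - p q.1.2 then sg (pos q.2) (z^^(p q.1.2)) else 0)).
  by move=> [[i j] l]; exact: coef.
apply: opn_le => x y x1 y1.
pose G := \sum_i \sum_j \sum_l (conjc (x i) * y j) *: g (i, j, l).
have GE : cev G z = bil (fun i j => sg (p i - p j) (z^^(p j))) x y.
  rewrite /G cev_sum; apply: eq_bigr => i _; rewrite cev_sum; apply: eq_bigr => j _.
  rewrite ?cj_conj; have [sg0|sg0] := eqVneq (sg (p i - p j) (z^^(p j))) 0.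
    rewrite sg0 mulr0 mul0r cev_sum big1// => l _; have [_ gE] := gP (i, j, l).
    by rewrite cevZ gE /=; case: eqP => [->|_]; rewrite ?sg0 mulr0.
  have [l lE] := pos_ex (nocross_bound (Kel_nocross ka sg0)).
  rewrite cev_sum (bigD1 l)// big1 ?addr0 => [|l' ll]; have [_ gE] := gP (i, j, l); last first.
    have [_ gE'] := gP (i, j, l'); rewrite cevZ gE' /= -lE.
    by rewrite (inj_eq pos_inj) (negbTE (ll : l' != l)) mulr0.
  by rewrite cevZ gE /= lE eqxx; ring.
rewrite -GE; apply: le_trans (piI G z) _.
have -> : pi G = cmul (cstar (xi x)) (cmul a (xi y)).
  rewrite /G /xi cstar_sum cmul_suml (is_linear_sum _ _ _ lin_pi); apply: eq_bigr => i _.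
  rewrite (is_linear_sum _ _ _ lin_pi) !cmul_sumr; apply: eq_bigr => j _.
  rewrite (is_linear_sum _ _ _ lin_pi) aE cmul_suml cmul_sumr; apply: eq_bigr => l _.
  have [gE _] := gP (i, j, l); rewrite (is_linearZ _ _ lin_pi) -gE /=.
  by rewrite cstarZ ?cj_conj !cmulZr cmulZl scalerA mulrC.
apply: le_trans (nrm_mul _ _) _; rewrite nrm_star -[leRHS]mul1r.
apply: ler_pM; rewrite ?nrm_ge0// ?xi1//.
apply: le_trans (nrm_mul _ _) _; rewrite -[leRHS]mulr1.
by apply: ler_pM; rewrite ?nrm_ge0// ?xi1.
Qed.

End Bounded.

End Kernels.

(** * Approximation by kernels; sums of squares are squares *)

Section Approximation.
Variables (R : realType) (X : topologicalType) (cX : compact [set: X]).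
Hypothesis hX : hausdorff_space X.
Variables (V : line_bundle R X) (alpha : homeo X) (Y : set X).
Hypothesis clY : closed Y.
Local Notation A := (CX R cX).
Local Notation EV := (EY cX V alpha Y).
Variables (O : cstarAlgType R) (pi : A -> O) (tau : EV -> O).
Hypothesis cov : covariant_rep pi tau.
Hypothesis gen : cstar_generates (range pi `|` range tau).
Hypotheses (minX : minimal alpha) (infX : infinite_set [set: X]).
Hypothesis (Y0 : Y !=set0) (orbY : meets_orbits_at_most_once alpha Y).
Hypothesis piI : forall f x, nrm (cev f x) <= nrm (pi f).
Local Notation "x '^^' n" := (homeo_pow alpha n x) (at level 30, format "x ^^ n").
Local Notation Hom := (Hom pi tau).
Local Notation nocross := (nocross alpha).
Local Notation Kel := (Kel pi tau).
Let pi_hom : star_hom pi := rep_hom cov.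
Let lin_pi : is_linear pi. Proof. by have [] := pi_hom. Qed.
Local Notation e1 := (pi (CX1 R cX)).

Definition approx (a : O) := forall ep : R, 0 < ep -> exists B sg b,
  [/\ open B, Y `<=` B, Kel B sg b & nrm (a - b) <= ep].

Let approxP (F : O -> O -> O) a b (K : R) : 0 <= K -> approx a -> approx b ->
  (forall B sg sg' a' b', Kel B sg a' -> Kel B sg' b' -> exists om, Kel B om (F a' b')) ->
  (forall a' b', nrm (a - a') <= 1 -> nrm (b - b') <= 1 ->
     nrm (F a b - F a' b') <= K * (nrm (a - a') + nrm (b - b'))) -> approx (F a b).
Proof.
move=> K0 ha hb kF lF ep ep0.
pose dl := Num.min 1 (ep / (2 * (K + 1))).
have K1 : 0 < K + 1 by rewrite ltr_wpDl.
have dl0 : 0 < dl by rewrite lt_min ltr01 divr_gt0// mulr_gt0.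
have [dl1 dle] : dl <= 1 /\ dl <= ep / (2 * (K + 1)) by rewrite /dl !ge_min !lexx orbT.
have [B [sg [a' [oB YB ka da]]]] := ha _ dl0; have [B' [sg' [b' [oB' YB' kb db]]]] := hb _ dl0.
have [om kom] := kF (B `&` B') _ _ _ _ (Kel_sub ka (@subIsetl _ _ _)) (Kel_sub kb (@subIsetr _ _ _)).
exists (B `&` B'), om, (F a' b'); split => //; first exact: openI.
  by move=> y Yy; split; [exact: YB|exact: YB'].
apply: le_trans (lF _ _ (le_trans da dl1) (le_trans db dl1)) _.
apply: le_trans (_ : (K + 1) * (dl + dl) <= _); first by rewrite ler_pM ?addr_ge0 ?nrm_ge0 ?lerDl ?lerD.
move: dle; rewrite ler_pdivlMr ?mulr_gt0// => h; apply: le_trans h.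
by rewrite (_ : (K + 1) * (dl + dl) = dl * (2 * (K + 1)))//; ring.
Qed.

Lemma approx_tau xi : approx (tau xi).
Proof.
move=> ep ep0.
have ce : continuous (fun y => nrm (ecoord xi (y^^(-1)))).
  move=> y; apply: (@continuous_comp _ _ _ (homeo_pow alpha (-1)) (fun x => nrm (ecoord xi x))).
    exact: apow_cont.
  exact: (Hom_nrm_cont cov (Hom_tau cov xi)).
pose K := [set y | ep <= nrm (ecoord xi (y^^(-1)))].
have [||f [S [cf f01 fK [clS SU] fS]]] := @bump R X cX hX K (~` Y) (@closed_ge R X _ ep ce).
- exact: closed_openC.
- move=> y Ky Yy; have := Ky : ep <= nrm (ecoord xi (y^^(-1))).
  have Yy' : Y (alpha (y^^(-1))) by rewrite -apow1 apowNK.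
  by rewrite (ecoord_Y xi Yy') nrm0 leNgt ep0.
exists (~` S), (fun m x => if m == 1 then ecoord (lact (rC cX cf) xi) x else 0), (tau (lact (rC cX cf) xi)).
split; first exact: closed_openC.
- by move=> y Yy /SU.
- apply: (Kel1 (Hom_tau cov _)) => x; rewrite ecoord_lact mulf_eq0 negb_or => /andP[fx _] l hl.
  have -> : l = 1 by move: hl; lia.
  by move=> nS; move: fx; rewrite /rC mkCE fS ?eqxx.
have h := Hom_sub cov (Hom_tau cov xi) (Hom_tau cov (lact (rC cX cf) xi)).
apply: (Hom_le cov h) => [|x]; first exact: ltW.
rewrite ecoord_lact /rC mkCE.
have -> : ecoord xi x - (f (alpha x))%:C * ecoord xi x = (1 - f (alpha x))%:C * ecoord xi x.
  by rewrite rmorphB mulrBl mul1r.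
rewrite nrmCM nrmCR; have /andP[h0 h1] := f01 (alpha x); rewrite ger0_norm ?subr_ge0//.
have [le|lt] := leP ep (nrm (ecoord xi x)).
  have Kx : K (alpha x) by rewrite /K /mkset -apow1 (apowK alpha x 1).
  by rewrite fK// subrr mul0r ltW.
apply: le_trans (ltW lt); rewrite ler_piMl ?nrm_ge0//; lra.
Qed.

(** The symbol of a generator tau xi vanishes over Y, so that xi is approximated by its
    products with functions vanishing near Y; these are kernels, and kernels form a
    *-algebra. *)
Lemma Kel_dense a : approx a.
Proof.
have cl : closed approx.
  move=> x clx ep ep0; have e2 : 0 < ((ep / 2)%:C : R[i]) by rewrite ltcR divr_gt0.
  have [y [ay]] := clx _ (nbhsx_ballx x _ e2).
  rewrite -ball_normE /ball_/= nrmE ltcR => xy.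
  have [|B [sg [b [oB YB kb db]]]] := ay (ep / 2); first by rewrite divr_gt0.
  exists B, sg, b; split => //; apply: le_trans (nrm_triangle y _ _) _; lra.
have -> // : approx = setT.
apply: gen => //.
- move=> _ [[f _ <-]|[xi _ <-]]; last exact: approx_tau.
  move=> ep ep0; exists setT; eexists; exists (pi f); split; first exact: openT.
  + by [].
  + by apply: (Kel1 (Hom_pi pi tau f)) => x _; exact: nocross0.
  + by rewrite subrr nrm0 ltW.
- move=> c x y ax ay; apply: (@approxP (fun x y => c *: x + y) _ _ (nrm c + 1)) => //.
  + by rewrite addr_ge0// nrm_ge0.
  + move=> B sg sg' a' b' ka kb; eexists; exact: (KelD (KelZ cov c ka) kb).
  + move=> x' y' _ _; have -> : c *: x + y - (c *: x' + y') = c *: (x - x') + (y - y').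
      by rewrite scalerBr opprD addrACA.
    apply: le_trans (nrmD _ _) _; rewrite nrmZ mulrDr.
    by apply: lerD; [rewrite ler_wpM2r ?nrm_ge0// lerDl|rewrite ler_peMl ?nrm_ge0// lerDr nrm_ge0].
- move=> x y ax ay; apply: (@approxP cmul _ _ (nrm x + nrm y + 1)) => //.
  + by rewrite !addr_ge0// nrm_ge0.
  + by move=> B sg sg' a' b' ka kb; have [om [ko _]] := Kel_mul cov ka kb; exists om.
  + move=> x' y' dx dy; have -> : cmul x y - cmul x' y' = cmul x (y - y') + cmul (x - x') y'.
      by rewrite cmulBr cmulBl addrA subrK.
    have ny' : nrm y' <= nrm y + 1.
      rewrite -[y']subr0; apply: le_trans (nrm_triangle y _ _) _.
      by rewrite subr0 nrm_distC addrC lerD2l.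
    apply: le_trans (nrmD _ _) _; rewrite mulrDr addrC; apply: lerD; apply: le_trans (nrm_mul _ _) _.
      by rewrite mulrC ler_wpM2r ?nrm_ge0// (le_trans ny')// -addrA lerDr nrm_ge0.
    by rewrite ler_wpM2r ?nrm_ge0// -addrA lerDl addr_ge0// nrm_ge0.
- move=> x ax; apply: (@approxP (fun x _ => cstar x) x x 1) => //.
  + by move=> B sg sg' a' b' ka _; eexists; exact: KelS ka.
  + by move=> x' y' _ _; rewrite -cstarB nrm_star mul1r lerDl nrm_ge0.
- move=> ep ep0; exists setT; eexists; exists 0; split; first exact: openT.
  + by [].
  + rewrite -(is_linear0 lin_pi); apply: (Kel1 (Hom_pi pi tau 0)) => x _; exact: nocross0.
  + by rewrite subrr nrm0 ltW.
Qed.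

(** Shrinking B keeps a kernel over B, so that one neighbourhood of Y serves finitely many
    elements and can be kept away from C. *)
Lemma Kel_dense_fin (I : finType) (a : I -> O) (C : set X) (ep : R) : closed C ->
  (forall y, Y y -> ~ C y) -> 0 < ep -> exists B (sg : I -> int -> X -> R[i]) (b : I -> O),
  [/\ open B, Y `<=` B, forall x, B x -> ~ C x, forall i, Kel B (sg i) (b i) &
      forall i, nrm (a i - b i) <= ep].
Proof.
move=> clC YC ep0.
have [F FP] : {F : I -> set X * (int -> X -> R[i]) * O & forall i,
   [/\ open (F i).1.1, Y `<=` (F i).1.1, Kel (F i).1.1 (F i).1.2 (F i).2 & nrm (a i - (F i).2) <= ep]}.
  apply: (@choice _ _ (fun i (F : set X * (int -> X -> R[i]) * O) =>
   [/\ open F.1.1, Y `<=` F.1.1, Kel F.1.1 F.1.2 F.2 & nrm (a i - F.2) <= ep])) => i.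
  by have [B [sg [b h]]] := Kel_dense (a i) ep0; exists (B, sg, b).
exists ([set x | forall i, (F i).1.1 x] `&` ~` C), (fun i => (F i).1.2), (fun i => (F i).2); split.
- apply: openI; last exact: closed_openC.
  by apply: open_forallI => i; have [] := FP i.
- move=> y Yy; split; last exact: YC.
  by move=> i; have [_ h _ _] := FP i; exact: h.
- by move=> x [].
- by move=> i; have [_ _ k _] := FP i; apply: (Kel_sub k) => x [h _]; exact: h.
- by move=> i; have [_ _ _ ] := FP i.
Qed.

Lemma visits B : open B -> Y `<=` B -> exists T : nat, forall x, exists t : nat, (t <= T)%N /\ B (x^^t).
Proof. by move=> oB YB; apply: (syndetic cX minX oB); have [y Yy] := Y0; exists y; exact: YB. Qed.

(** Approximate the Z l p by kernels: in every block the sum becomes a Gram matrix, and the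
    blocks compute the norm, which bounds the powers needed for a square root. *)
Lemma positive_sums m k (Z : 'I_m -> 'I_k -> O) :
  positive_mx (fun p q => \sum_l cmul (cstar (Z l p)) (Z l q)).
Proof.
have e1l a : cmul e1 a = a by have [] := unit_O cov gen a.
have e1r a : cmul a e1 = a by have [] := unit_O cov gen a.
pose b : R := \sum_lp nrm (Z lp.1 lp.2) + 1.
have Zb l p : nrm (Z l p) + 1 <= b.
  by rewrite /b lerD2r (bigD1 (l, p))//= lerDl; apply: sumr_ge0 => lp _; exact: nrm_ge0.
have c0 : 0 < m%:R * (k%:R * b ^+ 2) + 1.
  by rewrite ltr_wpDl// mulr_ge0 ?ler0n// mulr_ge0 ?ler0n// sqr_ge0.
apply: (pbound_positive e1l e1r c0) => [p q|].
  by rewrite cstar_sum; apply: eq_bigr => l _; rewrite cstarM cstarK.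
apply: (pbound_limit c0) => ep ep0.
pose K : R := m%:R * (b + b) + 1.
have b0 : 0 <= b by rewrite /b addr_ge0// sumr_ge0// => lp _; exact: nrm_ge0.
have K0 : 0 < K by rewrite /K ltr_wpDl// mulr_ge0 ?ler0n// addr_ge0.
pose dl := Num.min 1 (ep / K).
have dl0 : 0 < dl by rewrite lt_min ltr01 divr_gt0.
have [dl1 dle] : dl <= 1 /\ dl <= ep / K by rewrite /dl !ge_min !lexx orbT.
have [B [sg [Z' [oB YB _ kZ dZ]]]] := @Kel_dense_fin ('I_m * 'I_k)%type (fun lp => Z lp.1 lp.2) set0 dl
  (@closed0 _) (fun y _ => id) dl0.
have [T hT] := visits oB YB.
have Z'b l p : nrm (Z' (l, p)) <= b.
  apply: le_trans (Zb l p); rewrite -[Z' _]subr0; apply: le_trans (nrm_triangle (Z l p) _ _) _.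
  rewrite subr0 nrm_distC addrC lerD2l; exact: le_trans (dZ (l, p)) dl1.
exists (fun p q => \sum_l cmul (cstar (Z' (l, p))) (Z' (l, q))); split.
  apply: (@gram_pbound R O e1 X (blk alpha B T) (@krep _ _ _ _ _ _ _ pi tau B T) _ _ _ _ _ _ _ m k
     (fun l p => Z' (l, p)) (fun l p z => @kmat _ _ alpha B T (sg (l, p)) z)).
  - move=> x y M N [s [ks sE]] [t [kt tE]]; exists (fun m x => s m x + t m x); split; first exact: KelD.
    by move=> z i j; rewrite sE tE.
  - move=> c x M [s [ks sE]]; exists (fun m x => c * s m x); split; first exact: KelZ.
    by move=> z i j; rewrite sE.
  - by move=> x y M N; exact: (krepM cov hT).
  - by move=> x M; exact: krepS.
  - exists (fun m x => if m == 0 then cev (CX1 R cX) x else 0); split.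
      by apply: (Kel1 (Hom_pi pi tau _)) => x _; exact: nocross0.
    move=> z i j; rewrite /kmat subr_eq0 (inj_eq (@bpos_inj _ alpha B T z)).
    by rewrite /CX1 /cstC mkCE; case: eqP.
  - by move=> x M c; exact: (krep_le cov hT).
  - move=> x M z [s [ks sE]]; rewrite (_ : M z = @kmat _ _ alpha B T s z); last first.
      by apply/funext => i; apply/funext => j.
    have nc (j : blk alpha B T z) : nocross Y (bpos j) z.
      by move=> l hl Yl; apply: (bpos_nocross hl); exact: YB.
    exact: (localize cov hT hX clY minX infX piI ks (@bpos_inj _ alpha B T z) nc).
  - by move=> l p; exists (sg (l, p)); split=> //; exact: (kZ (l, p)).
  - by move=> l p; exact: Z'b.
move=> p q; rewrite -sumrB; apply: le_trans (nrm_sum _ _ _) _.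
apply: le_trans (_ : \sum_(l < m) (b + b) * dl <= _).
  apply: ler_sum => l _; set x := Z l p; set y := Z l q; set x' := Z' (l, p); set y' := Z' (l, q).
  have -> : cmul (cstar x) y - cmul (cstar x') y' = cmul (cstar x) (y - y') + cmul (cstar (x - x')) y'.
    by rewrite cstarB cmulBr cmulBl addrA subrK.
  apply: le_trans (nrmD _ _) _; rewrite mulrDl; apply: lerD; apply: le_trans (nrm_mul _ _) _.
    rewrite nrm_star ler_pM ?nrm_ge0//; last exact: (dZ (l, q)).
    by apply: le_trans (Zb l p); rewrite lerDl.
  rewrite nrm_star mulrC ler_pM ?nrm_ge0//; last exact: (dZ (l, p)).
  exact: Z'b.
rewrite sumr_const card_ord -[_ *+ m]mulr_natl mulrA.
apply: le_trans (_ : K * dl <= _); last by rewrite mulrC -ler_pdivlMr.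
by rewrite ler_wpM2r ?(ltW dl0)// /K lerDl.
Qed.

End Approximation.

(** * Compression to finitely many orbit segments *)

Section BlockNorms.
Variable R : realType.

Lemma sum_sub (W : nmodType) (I : finType) (P : pred I) (F : I -> W) :
  \sum_(i | P i) F i = \sum_(u : {i | P i}) F (val u).
Proof.
rewrite (reindex_omap (fun u : {i | P i} => val u) insub) => [|i Pi]; last by rewrite insubT.
by apply: eq_bigl => u; rewrite valK eqxx andbT (valP u).
Qed.

Lemma sum_tag (W : nmodType) (I : finType) (J : I -> finType) (F : {i : I & J i} -> W) :
  \sum_u F u = \sum_i \sum_(j : J i) F (Tagged J j).
Proof.
have -> := @sig_big_dep W 0 +%R I J predT (fun _ => predT) (fun i j => F (Tagged J j)).
by apply: eq_bigr => -[].
Qed.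

Lemma opn_mask (I : finType) (P : pred I) (M : I -> I -> R[i]) (c : R) :
  opn (fun i j : {i | P i} => M (val i) (val j)) <= c ->
  opn (fun i j => if P i && P j then M i j else 0) <= c.
Proof.
move=> Mc; apply: opn_le => x y x1 y1; apply: le_trans Mc.
have vs (w : I -> R[i]) : vsq w <= 1 -> vsq (fun u : {i | P i} => w (val u)) <= 1.
  apply: le_trans; rewrite /vsq -(sum_sub P (fun i => nrm (w i) ^+ 2)).
  by rewrite [leRHS](bigID P)/= lerDl; apply: sumr_ge0 => i _; exact: sqr_ge0.
rewrite (_ : bil _ x y = bil (fun i j : {i | P i} => M (val i) (val j)) (fun u => x (val u)) (fun u => y (val u))).
  by apply: opn_ub; exact: vs.
rewrite /bil (bigID P)/= [X in _ + X]big1 ?addr0 => [|i /negbTE Pi]; last first.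
  by apply: big1 => j _; rewrite Pi mulr0 mul0r.
rewrite (sum_sub P); apply: eq_bigr => u _.
rewrite (bigID P)/= [X in _ + X]big1 ?addr0 => [|i /negbTE Pi]; last first.
  by rewrite Pi andbF mulr0 mul0r.
rewrite (sum_sub P); apply: eq_bigr => v _.
by rewrite (valP u) (valP v).
Qed.

Lemma opn_unmask (I : finType) (P : pred I) (M : I -> I -> R[i]) :
  opn (fun i j : {i | P i} => M (val i) (val j)) <= opn (fun i j => if P i && P j then M i j else 0).
Proof.
apply: opn_le => x y x1 y1.
pose ext (w : {i | P i} -> R[i]) i := if insub i is Some u then w u else 0.
have extE w (u : {i | P i}) : ext w (val u) = w u by rewrite /ext valK.
have ext0 w i : ~~ P i -> ext w i = 0 by move=> nP; rewrite /ext insubN.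
have vs w : vsq (ext w) = vsq w.
  rewrite /vsq (bigID P)/= [X in _ + X]big1 ?addr0 => [|i nP]; last by rewrite ext0// nrm0 expr0n.
  by rewrite (sum_sub P); apply: eq_bigr => u _; rewrite extE.
rewrite (_ : bil _ x y = bil (fun i j => if P i && P j then M i j else 0) (ext x) (ext y)).
  by apply: opn_ub; rewrite vs.
rewrite /bil [RHS](bigID P)/= [X in _ = _ + X]big1 ?addr0 => [|i nP]; last first.
  by apply: big1 => j _; rewrite (negbTE nP) mulr0 mul0r.
rewrite (sum_sub P); apply: eq_bigr => u _.
rewrite [RHS](bigID P)/= [X in _ = _ + X]big1 ?addr0 => [|i nP]; last first.
  by rewrite (negbTE nP) andbF mulr0 mul0r.
by rewrite (sum_sub P); apply: eq_bigr => v _; rewrite (valP u) (valP v) !extE.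
Qed.

Lemma opn_diag (P Q : finType) (M : P * Q -> P * Q -> R[i]) (c : R) : 0 <= c ->
  (forall i j, i.1 != j.1 -> M i j = 0) ->
  (forall t, opn (fun q q' => M (t, q) (t, q')) <= c) -> opn M <= c.
Proof.
move=> c0 M0 Mc; apply: opn_le => x y x1 y1.
pose xt (w : P * Q -> R[i]) t q := w (t, q).
have -> : bil M x y = \sum_t bil (fun q q' => M (t, q) (t, q')) (xt x t) (xt y t).
  rewrite /bil sum_pair; apply: eq_bigr => t _; apply: eq_bigr => q _.
  rewrite sum_pair (bigD1 t)//= [X in _ + X]big1 ?addr0// => t' tt; apply: big1 => q' _.
  by rewrite M0 ?mulr0 ?mul0r// eq_sym.
have vs w : \sum_t vsq (xt w t) = vsq w by rewrite /vsq sum_pair.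
apply: le_trans (nrm_sum _ _ _) _.
apply: le_trans (_ : \sum_t c * ((vsq (xt x t) + vsq (xt y t)) / 2) <= _); last first.
  by rewrite -mulr_sumr -mulr_suml big_split /= !vs ler_piMr//; lra.
apply: ler_sum => t _; apply: le_trans (bil_bound _ _ _) _.
apply: ler_pM => //; first exact: opn_ge0.
  by rewrite mulr_ge0 ?sqrtr_ge0.
have := sqr_ge0 (Num.sqrt (vsq (xt x t)) - Num.sqrt (vsq (xt y t))).
rewrite sqrrB !sqr_sqrtr ?vsq_ge0//; lra.
Qed.

Variables (I : finType) (e : blockrel I).

Lemma bmx1_block i j : ~~ e i j -> (i == j)%:R = 0 :> R[i].
Proof. by case: eqP => // ->; rewrite brel_refl. Qed.
Definition bmx1 : bmx R e := BMx bmx1_block.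

Lemma bmx1l (a : bmx R e) : cmul bmx1 a = a.
Proof.
apply: bmxP => i j; rewrite /= (bigD1 i)//= eqxx mul1r big1 ?addr0// => l /negbTE li.
by rewrite eq_sym li mul0r.
Qed.

Lemma bmx1r (a : bmx R e) : cmul a bmx1 = a.
Proof.
apply: bmxP => i j; rewrite /= (bigD1 j)//= eqxx mulr1 big1 ?addr0// => l /negbTE lj.
by rewrite lj mulr0.
Qed.

Definition bmx_rep (a : bmx R e) (M : unit -> I -> I -> R[i]) :=
  forall u i j, M u i j = a i j.

Lemma bmx_psd_pbound k (h : 'I_k -> 'I_k -> bmx R e) (c : R) : 0 < c ->
  psd_le (fun i j : 'I_k * I => h i.1 j.1 i.2 j.2) c -> pbound bmx1 c h.
Proof.
move=> c0 hc.
apply: (@psd_pbound R (bmx R e) bmx1 unit (fun=> I) bmx_rep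
   _ _ _ _ _ k h (fun p q _ i j => h p q i j) c) => //.
- by move=> a b M N aM bN u i j; rewrite aM bN.
- by move=> s a M aM u i j; rewrite aM.
- by move=> a b M N aM bN u i j /=; apply: eq_bigr => l _; rewrite aM bN.
- move=> a M s aM _ Ms; rewrite bmx_nrmE; apply: le_trans (Ms tt).
  rewrite (_ : (a : _ -> _ -> R[i]) = M tt)//.
  by apply/funext => i; apply/funext => j; rewrite aM.
Qed.

End BlockNorms.

Section Compression.
Variables (R : realType) (X : topologicalType) (cX : compact [set: X]).
Hypothesis hX : hausdorff_space X.
Variables (V : line_bundle R X) (alpha : homeo X) (Y : set X).
Hypothesis clY : closed Y.
Local Notation A := (CX R cX).
Local Notation EV := (EY cX V alpha Y).
Variables (O : cstarAlgType R) (pi : A -> O) (tau : EV -> O).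
Hypothesis cov : covariant_rep pi tau.
Hypothesis gen : cstar_generates (range pi `|` range tau).
Hypotheses (minX : minimal alpha) (infX : infinite_set [set: X]).
Hypothesis (Y0 : Y !=set0) (orbY : meets_orbits_at_most_once alpha Y).
Hypothesis piI : forall f x, nrm (cev f x) <= nrm (pi f).
Local Notation "x '^^' n" := (homeo_pow alpha n x) (at level 30, format "x ^^ n").
Local Notation Hom := (Hom pi tau).
Local Notation nocross := (nocross alpha).
Local Notation Kel := (Kel pi tau).

Variables (P : finType) (Q : nat) (z : P -> X) (r : P -> nat).
Hypothesis zY : forall t (j : 'I_Q), (j < r t)%N -> nocross Y j (z t).

(** Positions (t, j) on the orbit segment of length r t from z t. *)
Definition vpos : finType := {i : P * 'I_Q | (i.2 < r i.1)%N}.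
Definition same_seg : rel vpos := fun i j => (val i).1 == (val j).1.
Lemma same_seg_refl : reflexive same_seg. Proof. by move=> i; exact: eqxx. Qed.
Lemma same_seg_sym : symmetric same_seg. Proof. by move=> i j; exact: eq_sym. Qed.
Lemma same_seg_trans : transitive same_seg.
Proof. by move=> j i k /eqP ij /eqP jk; rewrite /same_seg ij jk. Qed.
Definition seg_block := BlockRel same_seg_refl same_seg_sym same_seg_trans.
Local Notation F := (bmx R seg_block).

Definition comp_entry (sg : int -> X -> R[i]) (i j : P * 'I_Q) : R[i] :=
  if i.1 == j.1 then sg (i.2%:Z - j.2%:Z) ((z j.1)^^(j.2%:Z)) else 0.

Lemma comp_block sg i j : ~~ seg_block i j -> comp_entry sg (val i) (val j) = 0.
Proof. by rewrite /comp_entry /= /same_seg => /negbTE ->. Qed.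

Definition comp sg : F := BMx (@comp_block sg).

Lemma compD sg sg' (c : R[i]) : comp (fun m x => c * sg m x + sg' m x) = c *: comp sg + comp sg'.
Proof. by apply: bmxP => i j; rewrite /= /comp_entry; case: ifP; rewrite ?mulr0 ?addr0. Qed.

Definition goodB B := [/\ open B, Y `<=` B & forall t (j : 'I_Q), (j < r t)%N -> nocross B j (z t)].

Lemma goodB_ex : exists C, [/\ closed C, forall y, Y y -> ~ C y &
  forall B, open B -> Y `<=` B -> (forall x, B x -> ~ C x) -> goodB B].
Proof.
pose I := (P * 'I_Q * 'I_Q)%type.
exists [set x | exists i : I, (i.1.2 < r i.1.1)%N /\ (0 < i.2 <= i.1.2)%N /\ x = (z i.1.1)^^i.2]; split.
- apply: closed_existsI => i.
  have [h|h] := pselect ((i.1.2 < r i.1.1)%N /\ (0 < i.2 <= i.1.2)%N).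
    move: (@closed_pt X hX ((z i.1.1)^^i.2)); congr closed; apply/seteqP.
    by split => x => [->|[_ []]//]; case: h.
  move: (@closed0 X); congr closed; apply/seteqP.
  by split => x // [h1 [h2 _]]; apply: h.
- by move=> y Yy [[[t j] l] /= [jr [lj yE]]]; apply: (zY jr (l := l%:Z)); [apply/orP; left; lia|by rewrite yE in Yy].
move=> B oB YB BC; split => // t j jr l hl Bl.
have [n nE] : exists n : nat, l = n%:Z by exists (absz l); lia.
subst l; have nq : (n < Q)%N by have := ltn_ord j; lia.
apply: (BC _ Bl); exists (t, j, Ordinal nq); split => //; split; last by [].
by rewrite /=; lia.
Qed.

Lemma comp_le B sg a : goodB B -> Kel B sg a -> nrm (comp sg) <= nrm a.
Proof.
move=> [oB YB Bz] ka; rewrite bmx_nrmE; have [T hT] := visits cX minX Y0 oB YB.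
apply: le_trans (opn_unmask (fun i : P * 'I_Q => (i.2 < r i.1)%N) (comp_entry sg)) _.
apply: opn_diag => [|i j|t]; first exact: nrm_ge0.
  by rewrite /comp_entry => /negbTE ->; rewrite if_same.
have := @opn_mask R 'I_Q (fun q => (q < r t)%N) (fun q q' => sg (q%:Z - q'%:Z) ((z t)^^(q'%:Z))) (nrm a).
rewrite /comp_entry /= eqxx /=; apply.
apply: (localize cov hT hX clY minX infX piI (p := fun u : {q : 'I_Q | (q < r t)%N} => (val u)%:Z) ka).
  by move=> u v h; apply: val_inj; apply: ord_inj; case: h.
by move=> u; apply: zY; exact: (valP u).
Qed.

Let lim (a : O) (l : F) := forall ep : R, 0 < ep -> exists B sg b,
  [/\ goodB B, Kel B sg b, nrm (a - b) <= ep & nrm (l - comp sg) <= ep].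

Let goodI B B' : goodB B -> goodB B' -> goodB (B `&` B').
Proof.
move=> [oB YB Bz] [oB' YB' _]; split; first exact: openI.
  by move=> y Yy; split; [exact: YB|exact: YB'].
by move=> t j jr l hl [/(Bz t j jr l hl)].
Qed.

Let lim_le a a' l l' : lim a l -> lim a' l' -> nrm (l - l') <= nrm (a - a').
Proof.
move=> la la'; apply/ler_addgt0Pr => ep ep0; have e4 : 0 < ep / 4 by rewrite divr_gt0.
have [B [sg [b [gB kb db dl]]]] := la _ e4; have [B' [sg' [b' [gB' kb' db' dl']]]] := la' _ e4.
have kk := KelD (KelZ cov (-1) (Kel_sub kb' (@subIsetr _ B B'))) (Kel_sub kb (@subIsetl _ B B')).
have := comp_le (goodI gB gB') kk; rewrite compD !scaleN1r ![- _ + _]addrC => h.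
apply: le_trans (nrm_triangle (comp sg) _ _) _.
have h1 := nrm_triangle (comp sg') (comp sg) l'; rewrite [nrm (comp sg' - l')]nrm_distC in h1.
have h2 := nrm_triangle a b b'; rewrite [nrm (b - a)]nrm_distC in h2.
have h3 := nrm_triangle a' a b'; lra.
Qed.

Let lim_ex a : exists l, lim a l.
Proof.
have [C [clC YC Cg]] := goodB_ex.
have ap n : exists B sg b, [/\ goodB B, Kel B sg b & nrm (a - b) <= n.+1%:R^-1].
  have n0 : 0 < n.+1%:R^-1 :> R by rewrite invr_gt0 ltr0n.
  have [B [sg [b [oB YB BC kb db]]]] := Kel_dense_fin hX clY cov gen (fun _ : unit => a) clC YC n0.
  by exists B, (sg tt), (b tt); split => //; exact: Cg.
have [S SP] : {S : nat -> set X * (int -> X -> R[i]) * O & forall n,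
    [/\ goodB (S n).1.1, Kel (S n).1.1 (S n).1.2 (S n).2 & nrm (a - (S n).2) <= n.+1%:R^-1]}.
  apply: (@choice _ _ (fun n (S : set X * (int -> X -> R[i]) * O) =>
    [/\ goodB S.1.1, Kel S.1.1 S.1.2 S.2 & nrm (a - S.2) <= n.+1%:R^-1])) => n.
  by have [B [sg [b h]]] := ap n; exists (B, sg, b).
have inv_small (ep : R) : 0 < ep -> exists N : nat, N.+1%:R^-1 <= ep.
  move=> ep0; exists (Num.trunc ep^-1); rewrite -[leRHS]invrK lef_pV2 ?posrE ?invr_gt0 ?ltr0n//.
  exact/ltW/Num.Theory.truncnS_gt.
have mono (N n : nat) : (N <= n)%N -> n.+1%:R^-1 <= N.+1%:R^-1 :> R.
  by move=> Nn; rewrite lef_pV2 ?posrE ?ltr0n// ler_nat.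
have [|l hl] := @seq_limit R F (fun n => comp (S n).1.2).
  move=> ep ep0; have e2 : 0 < ep / 2 by rewrite divr_gt0.
  have [N hN] := inv_small _ e2; exists N => n Nn.
  have [g1 k1 d1] := SP n; have [g2 k2 d2] := SP N.
  have kk := KelD (KelZ cov (-1) (Kel_sub k2 (@subIsetr _ (S n).1.1 (S N).1.1))) (Kel_sub k1 (@subIsetl _ _ _)).
  have := comp_le (goodI g1 g2) kk; rewrite compD !scaleN1r ![- _ + _]addrC => h.
  apply: le_trans h _; apply: le_trans (nrm_triangle a _ _) _; rewrite nrm_distC.
  by rewrite [ep]splitr; apply: lerD; [exact: le_trans d1 (le_trans (mono _ _ Nn) hN)|exact: le_trans d2 hN].
exists l => ep ep0; have [N hN] := hl ep ep0; have [M hM] := inv_small ep ep0.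
have [g k d] := SP (maxn N M); exists (S (maxn N M)).1.1, (S (maxn N M)).1.2, (S (maxn N M)).2; split => //.
  by apply: le_trans d (le_trans (mono _ _ (leq_maxr N M)) hM).
by rewrite nrm_distC; apply: hN; exact: leq_maxl.
Qed.

(** On kernels the compression is contractive by localization, so that it extends by
    density. It is completely positive because the kernel of a sum of squares is, on
    the positions of the segments, the Gram matrix of columns running over whole orbit
    blocks. *)
Lemma compression_ex : exists psi : O -> F,
  [/\ completely_positive psi, contractive_on setT psi &
      forall B sg a, goodB B -> Kel B sg a -> psi a = comp sg].
Proof.
have [psi psiP] : {psi : O -> F & forall a, lim a (psi a)}.
  by apply: (@choice _ _ (fun a l => lim a l)); exact: lim_ex.
have uniq a l : lim a l -> psi a = l.
  move=> la; apply/eqP; rewrite -subr_eq0; apply/eqP; apply: nrm_le0.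
  by have := lim_le (psiP a) la; rewrite subrr nrm0.
have limK B sg a : goodB B -> Kel B sg a -> lim a (comp sg).
  by move=> gB ka ep ep0; exists B, sg, a; split => //; rewrite subrr nrm0 ltW.
have psiS a : psi (cstar a) = cstar (psi a).
  apply: uniq => ep ep0; have [B [sg [b [gB kb db dl]]]] := psiP a _ ep0.
  exists B, (fun m x => conjc (sg (- m) (x^^m))), (cstar b); split => //.
  - exact: KelS.
  - by rewrite -cstarB nrm_star.
  rewrite (_ : comp _ = cstar (comp sg)); first by rewrite -cstarB nrm_star.
  apply: bmxP => i j; rewrite /= /comp_entry.
  rewrite ?cj_conj; have [ij|_] := eqVneq (val i).1 (val j).1; last by rewrite cj0.
  by rewrite opprB -apowD ij subrK.
have lin : is_linear psi.
  move=> c a b; apply: uniq => ep ep0.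
  have d0 : 0 < ep / (nrm c + 1) by rewrite divr_gt0// ltr_wpDl// nrm_ge0.
  have [B [sg [a' [gB ka da dl]]]] := psiP a _ d0; have [B' [sg' [b' [gB' kb db dl']]]] := psiP b _ d0.
  exists (B `&` B'), (fun m x => c * sg m x + sg' m x), (c *: a' + b'); split.
  - exact: goodI.
  - exact: (KelD (KelZ cov c (Kel_sub ka (@subIsetl _ B B'))) (Kel_sub kb (@subIsetr _ B B'))).
  - rewrite opprD addrACA -scalerBr; apply: le_trans (nrmD _ _) _; rewrite nrmZ.
    apply: le_trans (_ : nrm c * (ep / (nrm c + 1)) + ep / (nrm c + 1) <= _).
      by apply: lerD => //; rewrite ler_wpM2l ?nrm_ge0.
    by rewrite -{2}[ep / _]mul1r -mulrDl mulrC divfK// gt_eqF// ltr_wpDl// nrm_ge0.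
  rewrite compD opprD addrACA -scalerBr; apply: le_trans (nrmD _ _) _; rewrite nrmZ.
  apply: le_trans (_ : nrm c * (ep / (nrm c + 1)) + ep / (nrm c + 1) <= _).
    by apply: lerD => //; rewrite ler_wpM2l ?nrm_ge0.
  by rewrite -{2}[ep / _]mul1r -mulrDl mulrC divfK// gt_eqF// ltr_wpDl// nrm_ge0.
have contr a : nrm (psi a) <= nrm a.
  have l0 : lim 0 0.
    have -> : (0 : F) = psi 0 by rewrite (is_linear0 lin).
    exact: psiP.
  by have := lim_le (psiP a) l0; rewrite !subr0.
exists psi; split; last 2 first.
- by move=> a _; rewrite !nrmE lecR; exact: contr.
- by move=> B sg a gB ka; apply: uniq; exact: (limK B).
split=> // k a [b ab].
have aS p q : cstar (a p q) = a q p.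
  by rewrite !ab cstar_sum; apply: eq_bigr => l _; rewrite cstarM cstarK.
pose c : R := \sum_(i : 'I_k * vpos) \sum_(j : 'I_k * vpos) (nrm (psi (a i.1 j.1)) + 1) + 1.
have c0 : 0 < c.
  rewrite ltr_wpDl//; apply: sumr_ge0 => i _; apply: sumr_ge0 => j _; by rewrite addr_ge0 ?nrm_ge0.
apply: (pbound_positive (@bmx1l R _ seg_block) (@bmx1r R _ seg_block) c0) => [p q|]; first by rewrite -psiS aS.
apply: (pbound_limit c0) => ep ep0.
pose bb : R := \sum_lp nrm (b lp.1 lp.2) + 1.
have bbP l p : nrm (b l p) + 1 <= bb.
  by rewrite /bb lerD2r (bigD1 (l, p))//= lerDl; apply: sumr_ge0 => lp _; exact: nrm_ge0.
have bb0 : 0 <= bb by rewrite addr_ge0// sumr_ge0// => lp _; exact: nrm_ge0.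
pose K : R := k%:R * (bb + bb) + 1.
have K0 : 0 < K by rewrite /K ltr_wpDl// mulr_ge0 ?ler0n// addr_ge0.
pose dl := Num.min 1 (Num.min ep 1 / K).
have e10 : 0 < Num.min ep 1 by rewrite lt_min ep0 ltr01.
have dl0 : 0 < dl by rewrite lt_min ltr01 divr_gt0.
have [dl1 dle] : dl <= 1 /\ dl <= Num.min ep 1 / K by rewrite /dl !ge_min !lexx orbT.
have [C [clC YC Cg]] := goodB_ex.
have [B [sg [b' [oB YB BC kb db]]]] := Kel_dense_fin hX clY cov gen
  (fun lp : 'I_k * 'I_k => b lp.1 lp.2) clC YC dl0.
have gB := Cg _ oB YB BC; have [T hT] := visits cX minX Y0 oB YB.
pose a' p q := \sum_l cmul (cstar (b' (l, p))) (b' (l, q)).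
have aa p q : nrm (a p q - a' p q) <= Num.min ep 1.
  rewrite ab -sumrB; apply: le_trans (nrm_sum _ _ _) _.
  apply: le_trans (_ : \sum_(l < k) (bb + bb) * dl <= _).
    apply: ler_sum => l _; set x := b l p; set y := b l q; set x' := b' (l, p); set y' := b' (l, q).
    have -> : cmul (cstar x) y - cmul (cstar x') y' = cmul (cstar x) (y - y') + cmul (cstar (x - x')) y'.
      by rewrite cstarB cmulBr cmulBl addrA subrK.
    apply: le_trans (nrmD _ _) _; rewrite mulrDl; apply: lerD; apply: le_trans (nrm_mul _ _) _.
      rewrite nrm_star ler_pM ?nrm_ge0//; last exact: (db (l, q)).
      by apply: le_trans (bbP l p); rewrite lerDl.
    rewrite nrm_star mulrC ler_pM ?nrm_ge0//; last exact: (db (l, p)).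
    apply: le_trans (bbP l q); rewrite -[y']subr0; apply: le_trans (nrm_triangle y _ _) _.
    by rewrite subr0 nrm_distC addrC lerD2l; exact: le_trans (db (l, q)) dl1.
  rewrite sumr_const card_ord -[_ *+ k]mulr_natl mulrA.
  apply: le_trans (_ : K * dl <= _); last by rewrite mulrC -ler_pdivlMr.
  by rewrite ler_wpM2r ?(ltW dl0)// /K lerDl.
have rep_a' p q : @krep _ _ _ _ _ _ _ pi tau B T (a' p q) (fun x i j =>
    \sum_l \sum_r conjc (kmat (sg (l, p)) r i) * kmat (sg (l, q)) r j).
  apply: (@rep_sum R O (pi (CX1 R cX)) X (blk alpha B T)).
  - move=> x y M N [s [ks sE]] [t [kt tE]]; exists (fun m x => s m x + t m x); split; first exact: KelD.
    by move=> x' i j; rewrite sE tE.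
  - move=> s x M [s' [ks sE]]; exists (fun m x => s * s' m x); split; first exact: KelZ.
    by move=> x' i j; rewrite sE.
  - exists (fun m x => if m == 0 then cev (CX1 R cX) x else 0); split.
      by apply: (Kel1 (Hom_pi pi tau _)) => x _; exact: nocross0.
    move=> x i j; rewrite /kmat subr_eq0 (inj_eq (@bpos_inj _ alpha B T x)).
    by rewrite /CX1 /cstC mkCE; case: eqP.
  move=> l; apply: (krepM cov hT); first apply: (krepS cov).
    by exists (sg (l, p)); split=> //; exact: (kb (l, p)).
  by exists (sg (l, q)); split=> //; exact: (kb (l, q)).
have [om omP] : {om : 'I_k * 'I_k -> int -> X -> R[i] & forall pq, Kel B (om pq) (a' pq.1 pq.2) /\
   forall x i j, \sum_l \sum_r conjc (@kmat _ _ alpha B T (sg (l, pq.1)) x r i) * kmat (sg (l, pq.2)) r j =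
     kmat (om pq) i j}.
  apply: (@choice _ _ (fun pq om => Kel B om (a' pq.1 pq.2) /\
   forall x i j, \sum_l \sum_r conjc (@kmat _ _ alpha B T (sg (l, pq.1)) x r i) * kmat (sg (l, pq.2)) r j =
     kmat om i j)) => -[p q].
  by have [om h] := rep_a' p q; exists om.
exists (fun p q => psi (a' p q)); split; last first.
  move=> p q; rewrite -scaleN1r addrC -lin scaleN1r addrC.
  by apply: le_trans (contr _) (le_trans (aa p q) _); rewrite ge_min lexx.
have psia' p q : psi (a' p q) = comp (om (p, q)).
  by apply: uniq; apply: (limK B) => //; have [] := omP (p, q).
have pos_of t (j : 'I_Q) : (j < r t)%N -> exists u : blk alpha B T (z t), bpos u = j%:Z.
  by move=> jr; apply: (bpos_ex hT); have [_ _] := gB; exact.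
(* the kernel of the approximant is a Gram matrix *)
pose G (u : {t : P & ('I_k * blk alpha B T (z t))%type}) (i : 'I_k * vpos) : R[i] :=
  if tag u == (val i.2).1
  then sg ((tagged u).1, i.1) (bpos (tagged u).2 - (val i.2).2%:Z) ((z (val i.2).1)^^((val i.2).2%:Z)) else 0.
have GE : (fun i j : 'I_k * vpos => psi (a' i.1 j.1) i.2 j.2) = fun i j => \sum_u conjc (G u i) * G u j.
  apply/funext => -[p [[t i] ir]]; apply/funext => -[q [[t' j] jr]]; rewrite psia' /= /comp_entry /=.
  rewrite sum_tag; simpl in ir, jr.
  rewrite [RHS](bigD1 t)//= [X in _ = _ + X]big1 ?addr0 => [|s /negbTE st]; last first.
    by apply: big1 => lu _; rewrite /G /= st cj0 mul0r.
  have [tt|tt] := eqVneq t t'; last first.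
    by rewrite big1// => lu _; rewrite /G /= (negbTE tt) mulr0.
  subst t'.
  have [ui uiE] := pos_of t i ir; have [uj ujE] := pos_of t j jr.
  have [_ h] := omP (p, q).
  transitivity (kmat (om (p, q)) ui uj); first by rewrite /kmat uiE ujE.
  rewrite -h.
  rewrite sum_pair; apply: eq_bigr => l _; apply: eq_bigr => u _.
  by rewrite /G /= eqxx /= /kmat uiE ujE.
have GEij i j : \sum_u conjc (G u i) * G u j = psi (a' i.1 j.1) i.2 j.2 := esym (congr1 (fun F => F i j) GE).
apply: bmx_psd_pbound => //; rewrite GE; split=> [i j|w].
  rewrite [conjc _]rmorph_sum; apply: eq_bigr => t _.
  by rewrite -[LHS]/(conjc (conjc (G t j) * G t i)) cjM cjK mulrC.
rewrite bil_gram; apply/andP; split; first by apply: sumr_ge0 => t _; exact: sqr_ge0.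
have -> : \sum_t nrm (\sum_j G t j * w j) ^+ 2 = nrm (bil (fun i j => \sum_u conjc (G u i) * G u j) w w).
  by rewrite bil_gram nrmCR ger0_norm// sumr_ge0// => t _; exact: sqr_ge0.
apply: le_trans (bil_bound _ _ _) _; rewrite -expr2 sqr_sqrtr ?vsq_ge0// ler_wpM2r ?vsq_ge0//.
apply: le_trans (opn_sum _) _; rewrite /c; apply: le_trans (_ : \sum_(i : 'I_k * vpos) \sum_(j : 'I_k * vpos) (nrm (psi (a i.1 j.1)) + 1) <= _); last by rewrite lerDl.
apply: ler_sum => i _; apply: ler_sum => j _.
rewrite GEij; apply: le_trans (_ : nrm (psi (a' i.1 j.1)) <= _); first by rewrite bmx_nrmE; exact: opn_entry.
rewrite -[psi (a' _ _)]subr0; apply: le_trans (nrm_triangle (psi (a i.1 j.1)) _ _) _.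
rewrite subr0 addrC lerD2l nrm_distC -scaleN1r addrC -lin scaleN1r addrC.
by apply: le_trans (contr _) (le_trans (aa _ _) _); rewrite ge_min lexx orbT.
Qed.

End Compression.

(** * Towers: order zero maps *)

Section Towers.
Variables (R : realType) (X : topologicalType) (cX : compact [set: X]).
Variables (V : line_bundle R X) (alpha : homeo X) (Y : set X).
Local Notation A := (CX R cX).
Local Notation EV := (EY cX V alpha Y).
Variables (O : cstarAlgType R) (pi : A -> O) (tau : EV -> O).
Hypothesis cov : covariant_rep pi tau.
Local Notation "x '^^' n" := (homeo_pow alpha n x) (at level 30, format "x ^^ n").
Local Notation Hom := (Hom pi tau).
Let pi_hom : star_hom pi := rep_hom cov.
Let lin_pi : is_linear pi. Proof. by have [] := pi_hom. Qed.
Let pile : forall f, nrm (pi f) <= nrm f := pi_le pi_hom.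

Variables (P : finType) (Q : nat) (z : P -> X) (r : P -> nat) (K : P -> set X).
Variables (h : P -> X -> R) (nu : P -> nat -> X -> R[i]) (v : P -> nat -> O).
Hypotheses (vH : forall t j, (j < r t)%N -> Hom j (fun x => (h t x)%:C * nu t j x) (v t j))
  (hK : forall t x, K t x -> h t x = 1)
  (nu1 : forall t j x, (j < r t)%N -> K t x -> nrm (nu t j x) = 1)
  (rQ : forall t, (r t <= Q)%N).
Variable mu : P -> X -> R.
Hypotheses (cmu : forall t, continuous (mu t)) (mu01 : forall t x, 0 <= mu t x <= 1)
  (muK : forall t x, mu t x != 0 -> K t x)
  (disj : forall t t' j j' x x', (j < r t)%N -> (j' < r t')%N -> mu t x != 0 -> mu t' x' != 0 ->
     x^^j = x'^^j' -> t = t' /\ j = j').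

Local Notation pos := (vpos Q r).
Local Notation F := (bmx R (seg_block Q r)).
Let ty (i : pos) : P := (val i).1.
Let ix (i : pos) : nat := (val i).2.
Let w (i : pos) : O := v (ty i) (ix i).
Let D (i : pos) : set X := [set x | mu (ty i) x != 0].
Let ixr i : (ix i < r (ty i))%N. Proof. exact: (valP i). Qed.
Let wH i : Hom (ix i) (fun x => (h (ty i) x)%:C * nu (ty i) (ix i) x) (w i).
Proof. exact: vH. Qed.

Let w_orth i j f g : vanish_off (D i) f -> vanish_off (D j) g ->
  cmul (cmul (pi f) (cstar (w i))) (cmul (w j) (pi g)) = if i == j then pi (cmul f g) else 0.
Proof.
move=> fD gD.
have hH := Hom_mul cov (Hom_mul cov (Hom_pi pi tau f) (Hom_star cov (wH i))) (Hom_mul cov (wH j) (Hom_pi pi tau g)).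
have suppf x : cev f x != 0 -> mu (ty i) x != 0.
  by move=> fx; apply: contrapT => nD; case/eqP: fx; exact: fD.
have suppg x : cev g x != 0 -> mu (ty j) x != 0.
  by move=> fx; apply: contrapT => nD; case/eqP: fx; exact: gD.
have [ij|ij] := eqVneq i j.
  apply: (Hom_eq cov hH (t := cev (cmul f g))).
    by apply: (HomE (Hom_pi pi tau (cmul f g))) => //; rewrite ij addr0 add0r addNr.
  move=> x; rewrite cevM !apow0 !addr0 -ij apowK.
  have [->|gx] := eqVneq (cev g x) 0; first by rewrite !mulr0.
  have [->|fx] := eqVneq (cev f x) 0; first by rewrite !mul0r.
  have Kx := muK (suppf _ fx); rewrite hK// mul1r.
  have e1 : conjc (nu (ty i) (ix i) x) * nu (ty i) (ix i) x = 1.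
    by rewrite cj_mul_nrm nu1// expr1n.
  by rewrite -[RHS]mulr1 -e1; ring.
apply: (Hom_zero cov hH) => x; rewrite ?apow0 ?addr0.
have [->|gx] := eqVneq (cev g x) 0; first by rewrite !mulr0.
have [->|fx] := eqVneq (cev f ((x^^(ix j))^^(- (ix i)%:Z))) 0; first by rewrite !mul0r.
case/eqP: ij; have [|tt jj] := disj (ixr i) (ixr j) (suppf _ fx) (suppg _ gx).
  by rewrite apowNK.
apply: val_inj; move: tt jj; rewrite /ty /ix; case: (val i) => a b; case: (val j) => a' b' /= -> bb.
by congr pair; exact: val_inj.
Qed.

(* the weight rho is mu or its square root *)
Let wt (rho : P -> X -> R) (crho : forall t, continuous (rho t)) (m : F) (i j : pos) : A :=
  m i j *: rC cX (crho (ty i)).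

Let wt_adapted rho crho m : (forall t x, rho t x != 0 -> mu t x != 0) -> adapted D (@wt rho crho m).
Proof.
move=> rm i j.
have z0 t x : ~ mu t x != 0 -> rho t x = 0.
  by move=> n; apply: contrapT => /eqP/rm.
split=> x nD; rewrite /wt cevZ /rC mkCE; first by rewrite z0// mulr0.
have [ij|ij] := boolP (seg_block Q r i j); last by rewrite (bentP m ij) mul0r.
by rewrite (eqP ij : ty i = ty j) z0 ?mulr0.
Qed.

Definition osqrt t x := Num.sqrt (mu t x).
Lemma cont_osqrt t : continuous (osqrt t). Proof. exact: contSqrt. Qed.

Definition Smap (m : F) : O := Jmap pi w (@wt mu cmu m).
Definition Ssqrt (m : F) : O := Jmap pi w (@wt osqrt cont_osqrt m).

Let mua m : adapted D (@wt mu cmu m). Proof. exact: wt_adapted. Qed.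
Let sqa m : adapted D (@wt osqrt cont_osqrt m).
Proof. by apply: wt_adapted => t x; apply: contra_neq; rewrite /osqrt => ->; rewrite sqrtr0. Qed.

Lemma Smap_lin : is_linear Smap.
Proof.
move=> c m n; rewrite /Smap /Jmap scaler_sumr -big_split; apply: eq_bigr => i _.
rewrite scaler_sumr -big_split; apply: eq_bigr => j _ /=.
have -> : wt cmu (c *: m + n) i j = c *: wt cmu m i j + wt cmu n i j.
  by rewrite /wt /= scalerDl scalerA.
by rewrite (is_linearD _ _ lin_pi) (is_linearZ _ _ lin_pi) cmulDr cmulZr cmulDl cmulZl.
Qed.

(** With the square roots of the weights S becomes a square, whence complete positivity. *)
Lemma Smap_sqrt m n : Smap (cmul (cstar m) n) = cmul (cstar (Ssqrt m)) (Ssqrt n).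
Proof.
rewrite /Ssqrt (Jstar pi_hom) (Jmul pi_hom w_orth (adapted_mstar (sqa m)) (sqa n)).
rewrite /Smap; congr Jmap; apply/funext => i; apply/funext => j; apply: CXP => x.
rewrite /mmul cev_sum /wt cevZ /rC mkCE.
have -> : cmul (cstar m) n i j = \sum_l conjc (m l i) * n l j by [].
rewrite mulr_suml; apply: eq_bigr => l _.
rewrite cevM /mstar cevS !cevZ !mkCE /osqrt ?cj_conj cjM cj_real.
have [il|il] := boolP (seg_block Q r l i); last first.
  by rewrite (bentP m il) cj0 !mul0r.
rewrite (eqP il : ty l = ty i) -[X in _ = X](_ : conjc (m l i) * n l j * (Num.sqrt (mu (ty i) x) ^+ 2)%:C = _); last first.
  by rewrite expr2 rmorphM; ring.
by rewrite sqr_sqrtr//; have /andP[] := mu01 (ty i) x.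
Qed.

Lemma Smap_order_zero m n : cmul m n = 0 -> cmul (Smap m) (Smap n) = 0.
Proof.
move=> mn; rewrite /Smap (Jmul pi_hom w_orth (mua m) (mua n)) /Jmap big1// => i _; rewrite big1// => j _.
rewrite (_ : mmul _ _ i j = 0) ?(is_linear0 lin_pi) ?cmul0r ?cmul0l//; apply: CXP => x.
rewrite /mmul cev_sum cev0.
transitivity (\sum_l (m i l * n l j) * ((mu (ty i) x)%:C * (mu (ty i) x)%:C)).
  apply: eq_bigr => l _; rewrite cevM /wt !cevZ /rC !mkCE.
  have [il|il] := boolP (seg_block Q r i l); last by rewrite (bentP m il) !mul0r.
  by rewrite -(eqP il : ty i = ty l); ring.
have := congr1 (fun a : F => a i j) mn; rewrite /= => mn0.
by rewrite -mulr_suml mn0 mul0r.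
Qed.

Lemma Smap_le m : nrm (Smap m) <= nrm m.
Proof.
apply: (nrm_Jmap pi_hom pile w_orth (mua m)) => [|x]; first exact: nrm_ge0.
rewrite bmx_nrmE; apply: opn_le => a b a1 b1.
have -> : bil (fun i j => cev (wt cmu m i j) x) a b = bil m (fun i => (mu (ty i) x)%:C * a i) b.
  rewrite /bil; apply: eq_bigr => i _; apply: eq_bigr => j _; rewrite /wt cevZ /rC mkCE ?cj_conj cjM cj_real.
  ring.
apply: opn_ub => //; apply: le_trans a1; apply: ler_sum => i _; rewrite nrmCM exprMn ler_piMl ?sqr_ge0//.
by have /andP[h0 h1] := mu01 (ty i) x; rewrite nrmCR ger0_norm// exprn_ile1.
Qed.

Definition twt y := \sum_(i : pos) mu (ty i) (y^^(- (ix i)%:Z)).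

Lemma cont_shift (g : X -> R) n : continuous g -> continuous (fun y => g (y^^n)).
Proof.
by move=> cg y; apply: (@continuous_comp _ _ _ (homeo_pow alpha n) g); [exact: apow_cont|exact: cg].
Qed.

Lemma cont_twt : continuous twt.
Proof. by apply: contSum => i _; apply: cont_shift. Qed.

Lemma twt_at (i : pos) y : mu (ty i) (y^^(- (ix i)%:Z)) != 0 -> twt y = mu (ty i) (y^^(- (ix i)%:Z)).
Proof.
move=> m0; rewrite /twt (bigD1 i)//= big1 ?addr0// => j ji; apply: contrapT => /eqP mj.
case/eqP: ji; have [|tt jj] := disj (ixr j) (ixr i) mj m0; first by rewrite !apowNK.
apply: val_inj; move: tt jj; rewrite /ty /ix; case: (val i) => a b; case: (val j) => a' b' /= -> bb.
by congr pair; exact: val_inj.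
Qed.

Lemma twt_pos y : twt y != 0 -> exists i : pos, mu (ty i) (y^^(- (ix i)%:Z)) != 0.
Proof.
move=> t0; apply: contrapT => no; move/eqP: t0; apply; apply: big1 => i _.
by apply: contrapT => /eqP h0; apply: no; exists i.
Qed.

(** Wherever the coefficient of a does not vanish, source and target lie in one tower, and
    in the coordinates nu the coefficient is within eta of the one sampled at z t. *)
Lemma Smap_comp n s a (eta : R) : Hom n s a -> 0 <= eta ->
  (forall t x (i j : nat), mu t x != 0 -> (i < r t)%N -> (j < r t)%N -> i%:Z - j%:Z = n ->
     nrm (conjc (nu t i x) * s (x^^j) * nu t j x - s ((z t)^^j)) <= eta) ->
  (forall t x (j : nat), mu t x != 0 -> (j < r t)%N -> s (x^^j) != 0 ->
     exists i : nat, (i < r t)%N /\ i%:Z - j%:Z = n) ->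
  (forall t x (i : nat), mu t x != 0 -> (i < r t)%N -> s (x^^(i%:Z - n)) != 0 ->
     exists j : nat, (j < r t)%N /\ i%:Z - j%:Z = n) ->
  nrm (Smap (comp alpha Q z r (fun m x => if m == n then s x else 0)) - cmul (pi (rC cX cont_twt)) a) <= eta.
Proof.
move=> ha eta0 close fwd bwd; set m := comp alpha Q z r _.
pose term i j y : R[i] := ((h (ty i) (y^^(- (ix j)%:Z)))%:C * nu (ty i) (ix i) (y^^(- (ix j)%:Z)) *
  (m i j * (mu (ty i) (y^^(- (ix j)%:Z)))%:C)) *
  conjc ((h (ty j) (y^^(- (ix j)%:Z)))%:C * nu (ty j) (ix j) (y^^(- (ix j)%:Z))).
have hS : Hom n (fun y => \sum_i \sum_j term i j y) (Smap m).
  apply: (Hom_sum cov) => i _; apply: (Hom_sum cov) => j _.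
  have hij := Hom_mul cov (Hom_mul cov (wH i) (Hom_pi pi tau (wt cmu m i j))) (Hom_star cov (wH j)).
  have [ijn|ijn] := eqVneq ((ix i)%:Z - (ix j)%:Z) n.
    by apply: (HomE hij) => [|y|//]; rewrite ?addr0// /term apow0.
  have m0 : m i j = 0 by rewrite /m /= /comp_entry; case: ifP => // _; rewrite (negbTE ijn).
  rewrite /wt m0 scale0r (is_linear0 lin_pi) cmul0r cmul0l.
  by apply: (HomE (Hom0 cov n)) => // y; rewrite /term m0 mul0r mulr0 mul0r.
have hT := Hom_mul cov (Hom_pi pi tau (rC cX cont_twt)) ha; rewrite add0r in hT.
apply: (Hom_le cov (Hom_sub cov hS hT)) => // y; rewrite /rC mkCE.
have term0 i j : mu (ty j) (y^^(- (ix j)%:Z)) = 0 -> term i j y = 0.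
  move=> m0; rewrite /term; have [ij|ij] := boolP (seg_block Q r i j); last first.
    by rewrite (bentP m ij) mul0r mulr0 mul0r.
  by rewrite (eqP ij : ty i = ty j) m0 !mulr0 mul0r.
have [[j mj]|no] := pselect (exists j : pos, mu (ty j) (y^^(- (ix j)%:Z)) != 0); last first.
  rewrite big1 => [|i _]; last first.
    apply: big1 => j _; apply: term0; apply: contrapT => /eqP h0; apply: no; by exists j.
  rewrite sub0r nrmN; have [->|sy] := eqVneq (s y) 0; first by rewrite mulr0 nrm0.
  have [->|ty0] := eqVneq (twt (y^^n)) 0; first by rewrite mul0r nrm0.
  have [i mi] := twt_pos ty0; rewrite -apowD in mi.
  have [|j [jr ij]] := bwd _ _ _ mi (ixr i).
    by rewrite -apowD (_ : _ + _ = 0)//; lia.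
  have jQ : (j < Q)%N := leq_trans jr (rQ _).
  case: no; exists (exist _ (ty i, Ordinal jQ) jr : pos); rewrite /ty /ix /=.
  by move: mi; rewrite /ty (_ : - (ix i)%:Z + n = - j%:Z)//; lia.
set x := y^^(- (ix j)%:Z) in mj; have yE : y = x^^(ix j) by rewrite apowNK.
have Kx := muK mj; have other i' j' : j' != j -> term i' j' y = 0.
  move=> jj; apply: term0; apply: contrapT => /eqP m0; case/eqP: jj.
  have [|tt ii] := disj (ixr j') (ixr j) m0 mj; first by rewrite -yE apowNK.
  apply: val_inj; move: tt ii; rewrite /ty /ix; case: (val j) => a1 b; case: (val j') => a' b' /= -> bb.
  by congr pair; exact: val_inj.
rewrite exchange_big (bigD1 j)//= [X in _ + X - _]big1 ?addr0 => [|j' jj]; last first.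
  by apply: big1 => i' _; exact: other.
have termi i : term i j y = if ty i == ty j then
    (if (ix i)%:Z - (ix j)%:Z == n then nu (ty j) (ix i) x * s ((z (ty j))^^(ix j)) * (mu (ty j) x)%:C * conjc (nu (ty j) (ix j) x) else 0) else 0.
  rewrite /term -/x /m /= /comp_entry -!/(ty _) -!/(ix _).
  case: eqP => [ij|_]; last by rewrite mul0r mulr0 mul0r.
  by rewrite ij; case: eqP => _; rewrite ?mul0r ?mulr0 ?mul0r// hK// !mul1r mulrA.
have [[i0 i0r i0n]|noi] := pselect (exists2 i : nat, (i < r (ty j))%N & i%:Z - (ix j)%:Z = n); last first.
  rewrite big1 => [|i _]; last first.
    rewrite termi; case: eqP => // ij; case: eqP => // ijn; case: noi.
    by exists (ix i) => //; rewrite -ij; exact: ixr.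
  have [->|sy] := eqVneq (s y) 0; first by rewrite mulr0 subrr nrm0.
  rewrite yE in sy; have [i [ir ijn]] := fwd _ _ _ mj (ixr j) sy; case: noi; by exists i.
have i0Q : (i0 < Q)%N := leq_trans i0r (rQ _).
pose i : pos := exist _ (ty j, Ordinal i0Q) i0r.
rewrite (bigD1 i)//= big1 ?addr0 => [|i' ii]; last first.
  rewrite termi; case: eqP => // ij; case: eqP => // ijn; case/eqP: ii; apply: val_inj.
  have : ix i' = i0 by lia.
  move: ij; rewrite /ty /ix; case: (val i') => a1 b /= -> bb; congr pair; exact: val_inj.
rewrite termi /= eqxx i0n eqxx.
have yn : (y^^n)^^(- (ix i)%:Z) = x.
  rewrite -apowD {1}yE -apowD (_ : _ + _ = 0)//.
  by move: i0n; rewrite /i /ix /=; lia.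
have -> : twt (y^^n) = mu (ty j) x by rewrite (twt_at (i := i)) yn.
have := close _ _ _ _ mj i0r (ixr j) i0n; rewrite -yE => cl.
set ni := nu (ty j) i0 x in cl *; set nj := nu (ty j) (ix j) x in cl *.
set sz := s ((z (ty j))^^(ix j)) in cl *.
have ei : conjc ni * ni = 1 by rewrite cj_mul_nrm nu1// expr1n.
have ej : conjc nj * nj = 1 by rewrite cj_mul_nrm nu1// expr1n.
have -> : nu (ty j) (ix i) x * sz * (mu (ty j) x)%:C * conjc nj - (mu (ty j) x)%:C * s y =
   - ((mu (ty j) x)%:C * ni * conjc nj * (conjc ni * s y * nj - sz)).
  rewrite -[nu (ty j) (ix i) x]/ni mulrBr opprB; congr (_ - _); first by ring.
  have -> : (mu (ty j) x)%:C * ni * conjc nj * (conjc ni * s y * nj) =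
    (mu (ty j) x)%:C * s y * (conjc ni * ni) * (conjc nj * nj) by ring.
  by rewrite ei ej !mulr1.
have ni1 : nrm ni = 1 by apply: nu1.
have nj1 : nrm nj = 1 by apply: nu1 => //; exact: ixr.
rewrite nrmN 3!nrmCM nrmCJ ni1 nj1 !mulr1.
have /andP[m0 m1] := mu01 (ty j) x; rewrite nrmCR ger0_norm//.
by apply: le_trans cl; rewrite ler_piMl ?nrm_ge0.
Qed.

End Towers.

(** * Random cuts and disjoint orbit segments *)

Section Ramps.
Variables (R : realType) (e : R).
Hypothesis e0 : 0 < e.

Definition ramp (a u : R) := Num.max 0 (Num.min 1 ((u - a) / e)).

Lemma ramp01 a u : 0 <= ramp a u <= 1.
Proof. by rewrite /ramp le_max lexx /= ge_max ler01 ge_min lexx. Qed.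

Lemma ramp_lo a u : u <= a -> ramp a u = 0.
Proof.
move=> ua; rewrite /ramp max_l// ge_min; apply/orP; right.
by rewrite pmulr_lle0 ?invr_gt0// subr_le0.
Qed.

Lemma ramp_hi a u : a + e <= u -> ramp a u = 1.
Proof.
move=> ua; rewrite /ramp min_l ?max_r//.
by rewrite ler_pdivlMr// mul1r; lra.
Qed.

Lemma ramp_pos a u : ramp a u != 0 -> a < u.
Proof. by move=> h; rewrite ltNge; apply/negP => /ramp_lo h0; move: h; rewrite h0 eqxx. Qed.

Lemma cont_ramp (T : topologicalType) a (f : T -> R) : continuous f -> continuous (fun x => ramp a (f x)).
Proof.
move=> cf; apply: contMax; first exact: contCst.
apply: contMin; first exact: contCst.
apply: contM; last exact: contCst.
by apply: contB => //; exact: contCst.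
Qed.

End Ramps.

Section Cuts.
Variable R : realType.

Lemma telescope (a : nat -> R) n :
  \sum_(m < n) a m * \prod_(l < m) (1 - a l) = 1 - \prod_(l < n) (1 - a l).
Proof.
elim: n => [|n IH]; first by rewrite !big_ord0 subrr.
by rewrite !big_ord_recr /= IH; ring.
Qed.

Definition cut_weight (p : int -> R) (n : nat) (m : int) : R :=
  p m * \prod_(l < n) (1 - p (m + l.+1%:Z)) * p (m + n.+1%:Z).

(** Cut a line independently at each point m with probability p m: the point 0 lies in
    exactly one of the resulting segments. *)
Lemma cut_sum (p : int -> R) (Q : nat) :
  (forall m, exists t : nat, (t < Q)%N /\ p (m + t.+1%:Z) = 1) ->
  \sum_(n < Q) \sum_(j < Q | (j < n.+1)%N) cut_weight p n (- j%:Z) = 1.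
Proof.
move=> p1; rewrite (exchange_big_dep predT)//=.
have prod0 (a : nat -> R) n t : (t < n)%N -> a t = 1 -> \prod_(l < n) (1 - a l) = 0.
  by move=> tn at1; rewrite (bigD1 (Ordinal tn))//= at1 subrr mul0r.
transitivity (\sum_(j < Q) p (- j%:Z) * \prod_(l < j) (1 - p (- l%:Z))).
  apply: eq_bigr => j _; pose a (l : nat) := p (- j%:Z + l.+1%:Z).
  transitivity (p (- j%:Z) * \sum_(n < Q | ~~ (n < j)%N) a n * \prod_(l < n) (1 - a l)).
    rewrite mulr_sumr; apply: eq_big => [n|n _]; first by rewrite ltnS leqNgt.
    by rewrite /cut_weight mulrA mulrAC.
  congr (_ * _).
  have := telescope a Q; rewrite (bigID (fun n : 'I_Q => (n < j)%N))/=.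
  rewrite -(big_ord_widen Q (fun n => a n * \prod_(l < n) (1 - a l))) ?telescope; last exact: ltnW.
  have [t [tQ t1]] := p1 (- j%:Z); rewrite [in RHS](prod0 a Q t)// => h.
  have -> : \prod_(l < j) (1 - p (- l%:Z)) = \prod_(l < j) (1 - a l).
    rewrite (reindex_inj rev_ord_inj); apply: eq_bigr => l _; rewrite /a; congr (1 - p _).
    by rewrite /=; have := ltn_ord l; lia.
  by lra.
have := telescope (fun l => p (- l%:Z)) Q; rewrite /= => ->.
have [t [tQ t1]] := p1 (- Q%:Z); have uQ : (Q - t.+1 < Q)%N by lia.
rewrite (prod0 (fun l => p (- l%:Z)) Q _ uQ) ?subr0//.
by rewrite -t1; congr p; lia.
Qed.

Lemma cut_weight_ge0 (p : int -> R) n m : (forall l, 0 <= p l <= 1) -> 0 <= cut_weight p n m.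
Proof.
move=> p01; have p0 l : 0 <= p l by have /andP[] := p01 l.
rewrite /cut_weight !mulr_ge0// prodr_ge0// => l _; rewrite subr_ge0.
by have /andP[] := p01 (m + l.+1%:Z).
Qed.

Lemma cut_weight_pos (p : int -> R) (n : nat) m : cut_weight p n m != 0 ->
  [/\ p m != 0, p (m + n.+1%:Z) != 0 & forall l : nat, (l < n)%N -> p (m + l.+1%:Z) != 1].
Proof.
rewrite /cut_weight !mulf_eq0 !negb_or => /andP[/andP[-> h] ->]; split => // l ln.
by apply: contraNneq h => pl; rewrite (bigD1 (Ordinal ln))//= pl subrr mul0r.
Qed.

End Cuts.

Section Separated.
Variables (R : realType) (X : topologicalType).
Hypotheses (cX : compact [set: X]) (hX : hausdorff_space X).
Variable alpha : homeo X.
Hypotheses (minX : minimal alpha) (infX : infinite_set [set: X]).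
Local Notation "x '^^' n" := (homeo_pow alpha n x) (at level 30, format "x ^^ n").

Lemma distinct_orbits (I : finType) (W : I -> set X) (Q : nat) :
  (forall i, open (W i) /\ W i !=set0) -> exists y : I -> X, (forall i, W i (y i)) /\
    forall i j (m : int), (absz m <= Q)%N -> (y i)^^m = y j -> i = j /\ m = 0.
Proof.
move=> oW.
have claim (s : seq I) : uniq s -> exists y : I -> X, (forall i, i \in s -> W i (y i)) /\
    forall i j (m : int), i \in s -> j \in s -> i != j -> (absz m <= Q)%N -> (y i)^^m <> y j.
  elim: s => [_|i s IH /= /andP[nis us]].
    by exists (fun i => proj1_sig (cid (oW i).2)); split=> // i; rewrite in_nil.
  have [y [yW yd]] := IH us; have [ow w0] := oW i.
  have [x [Wx xn]] := avoid_points cX minX infX [seq (y j)^^(l%:Z - Q%:Z) | j <- s, l <- iota 0 (Q + Q).+1] ow w0.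
  have xN j (m : int) : j \in s -> (absz m <= Q)%N -> (y j)^^m <> x.
    move=> js mQ yx; move: xn => /negP; apply; apply/allpairsP.
    exists (j, absz (m + Q%:Z)); split; first exact: js.
      by change (absz (m + Q%:Z) \in iota 0 (Q + Q).+1); rewrite mem_iota; lia.
    change (x = (y j)^^((absz (m + Q%:Z))%:Z - Q%:Z)).
    by rewrite -yx; congr homeo_pow; lia.
  exists (fun j => if j == i then x else y j); split=> [j|j j' m].
    by rewrite inE; case: eqP => [->//|_ /= js]; exact: yW.
  rewrite !inE; case: eqP => [->|ji] /=; case: eqP => [->|ji'] //=.
  - by move=> _ _ /eqP[].
  - move=> _ j's _ mQ xy; apply: (xN j' (- m)) => //; first by rewrite abszN.
    by rewrite -xy apowK.
  - by move=> js _ _ mQ; exact: xN.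
  - exact: yd.
have [y [yW yd]] := claim _ (fintype.enum_uniq I); exists y; split=> [i|i j m mQ yy].
  by apply: yW; rewrite fintype.mem_enum.
have [ij|ij] := eqVneq i j; last by case: (yd i j m); rewrite ?fintype.mem_enum.
split => //; apply: contrapT => m0; subst j.
by apply: (aperiodic hX minX infX (x := y i) (n := m)) => //; exact/eqP.
Qed.

Lemma separated_nbhds (I : finType) (W : I -> set X) (Q : nat) (y : I -> X) :
  (forall i, open (W i) /\ W i (y i)) ->
  (forall i j (m : int), (absz m <= Q)%N -> (y i)^^m = y j -> i = j /\ m = 0) ->
  exists N : I -> set X, (forall i, [/\ open (N i), N i (y i) & N i `<=` W i]) /\
    forall i j (m : int) x, (absz m <= Q)%N -> N i x -> N j (x^^m) -> i = j /\ m = 0.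
Proof.
move=> oW yd; pose S := (I * I * 'I_(Q + Q).+1)%type; pose sh (t : S) := t.2%:Z - Q%:Z.
pose bad (t : S) := ~ (t.1.1 = t.1.2 /\ sh t = 0).
have [F FP] : {F : S -> set X * set X & forall t, [/\ open (F t).1, open (F t).2,
    (F t).1 (y t.1.1), (F t).2 (y t.1.2) & bad t -> forall x, (F t).1 x -> ~ (F t).2 (x^^(sh t))]}.
  apply: (@choice _ _ (fun t (F : set X * set X) => [/\ open F.1, open F.2,
    F.1 (y t.1.1), F.2 (y t.1.2) & bad t -> forall x, F.1 x -> ~ F.2 (x^^(sh t))])) => t.
  have [bt|bt] := pselect (bad t); last first.
    by exists (setT, setT); split => //; exact: openT.
  have [|A [B [oA oB Ay By AB]]] := @separate _ hX ((y t.1.1)^^(sh t)) (y t.1.2).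
    move=> h; apply: bt; apply: yd h; rewrite /sh; have := ltn_ord t.2; lia.
  exists ([set x | A (x^^(sh t))], B); split => //=; first exact: open_pre.
  by move=> _ x Ax; exact: AB.
exists (fun i x => W i x /\ forall t : S, (t.1.1 = i -> (F t).1 x) /\ (t.1.2 = i -> (F t).2 x)); split.
  move=> i; have [oWi Wy] := oW i; split=> [||x []//].
    have : open (W i `&` [set x | forall t : S, [set x | (t.1.1 = i -> (F t).1 x) /\ (t.1.2 = i -> (F t).2 x)] x]).
      apply: openI => //; apply: open_forallI => t; have [o1 o2 _ _ _] := FP t.
      have oi (P : Prop) (G : set X) : open G -> open [set x | P -> G x].
        move=> oG; have [p|np] := pselect P.
          rewrite (_ : [set x | _] = G)//; apply/seteqP; split => x /=; first exact.
          by move=> Gx _.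
        rewrite (_ : [set x | _] = setT); first exact: openT.
        by apply/seteqP; split => x // _ /np.
      exact: openI (oi _ _ o1) (oi _ _ o2).
    by congr open; apply/seteqP; split => x [].
  by split => // t; have [_ _ f1 f2 _] := FP t; split => <-.
move=> i j m x mQ [_ hi] [_ hj].
have mb : (absz (m + Q%:Z)%R < (Q + Q).+1)%N by lia.
pose t : S := (i, j, Ordinal mb); have tm : sh t = m by rewrite /sh /=; lia.
apply: contrapT => b; have [_ _ _ _ h] := FP t.
have bt : bad t by rewrite /bad tm.
by apply: (h bt x); [exact: (hi t).1|rewrite tm; exact: (hj t).2].
Qed.

End Separated.

(** * Clear blocks and random blocks *)

Lemma offset_le (j j' n n' Q : nat) : (j < n.+1)%N -> (j' < n'.+1)%N -> (n < Q)%N -> (n' < Q)%N ->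
  (absz (j%:Z - j'%:Z)%R <= Q)%N.
Proof. lia. Qed.

Lemma offset0 (j j' : nat) : j%:Z - j'%:Z = 0 -> j = j'.
Proof. lia. Qed.

Lemma offset_add (n n' : int) (T : nat) : (absz n <= T)%N -> (absz n' <= T)%N -> (absz (n - n')%R <= T + T)%N.
Proof. lia. Qed.

Section Blocks.
Variables (R : realType) (X : topologicalType) (alpha : homeo X).
Local Notation "x '^^' n" := (homeo_pow alpha n x) (at level 30, format "x ^^ n").

Lemma lt00 : (0 : R) < 0 -> False.
Proof. by rewrite ltxx. Qed.

Lemma sum_le1 (I : finType) (P : pred I) (f : I -> R) : (forall i, 0 <= f i <= 1) ->
  (forall i j, P i -> P j -> f i != 0 -> f j != 0 -> i = j) -> 0 <= \sum_(i | P i) f i <= 1.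
Proof.
move=> f01 u; have [[i /andP[Pi fi]]|no] := pselect (exists i, P i && (f i != 0)).
  by rewrite (bigD1 i)//= big1 ?addr0// => j /andP[Pj ji]; apply: contraNeq ji => fj; rewrite (u i j).
rewrite big1 ?lexx ?ler01// => i Pi; apply: contrapT => /eqP fi; apply: no; exists i; by rewrite Pi.
Qed.

Lemma same_orbit (x x' : X) (j j' : nat) : (j < j')%N -> x^^j = x'^^j' -> x = x'^^((j' - j).-1.+1).
Proof. by move=> jj xx; rewrite -[x](apowK alpha x j) xx -apowD; congr (_^^_); lia. Qed.

Lemma pred_sub_lt (j j' n : nat) : (j < j')%N -> (j' <= n)%N -> ((j' - j).-1 < n)%N.
Proof. lia. Qed.

Variables (A O1 : set X).

Definition Theta (n : nat) : set X :=
  [set x | [/\ O1 x, O1 (x^^n.+1) & forall j : 'I_n, ~ A (x^^j.+1)]].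

Lemma open_Theta n : closed A -> open O1 -> open (Theta n).
Proof.
move=> clA oO1; have : open (O1 `&` ([set x | O1 (x^^n.+1)] `&` [set x | forall j : 'I_n, [set x | ~ A (x^^j.+1)] x])).
  apply: openI => //; apply: openI; first exact: open_pre.
  by apply: open_forallI => j; apply: (@open_pre _ _ (~` A)); exact: closed_openC.
by congr open; apply/seteqP; split => x; [case=> ? []|case].
Qed.

Variables (m : nat) (q : X -> R) (g : 'I_m -> X -> R) (e : R).
Hypotheses (e0 : 0 < e) (e16 : 16 * e <= 1).

Ltac elra := move: (e0) (e16) => ? ?; lra.

Lemma small1 : 2^-1 + 4 * e < 1. Proof. by elra. Qed.
Lemma small0 : 0 < 2^-1 - 4 * e. Proof. by elra. Qed.

Lemma lvl1 : e + e <= 4 * e. Proof. by elra. Qed.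
Lemma lvl2 : 2 * e + e <= 4 * e. Proof. by elra. Qed.

Hypotheses (cq : continuous q) (cg : forall i, continuous (g i)).

Definition hi a v := ramp e (2^-1 + a) v.
Definition lo a v := ramp e a (2^-1 - v).

(** A smooth indicator of the starting points of blocks of length n.+1 whose first admissible
    type is i; it vanishes unless each signal involved is at distance more than a from 1/2. *)
Definition chi (a : R) (n : nat) (i : 'I_m) (x : X) : R :=
  hi a (q x) * hi a (q (x^^n.+1)) * (\prod_(j < n) lo a (q (x^^j.+1))) * hi a (g i x) *
  \prod_(i' < m | (i' < i)%N) lo a (g i' x).

Let mul01 (a b : R) : 0 <= a <= 1 -> 0 <= b <= 1 -> 0 <= a * b <= 1.
Proof. by move=> /andP[a0 a1] /andP[b0 b1]; rewrite mulr_ge0//= mulr_ile1. Qed.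

Lemma chi01 a n i x : 0 <= chi a n i x <= 1.
Proof.
have p01 (I : finType) (Pr : pred I) (f : I -> R) : (forall i, 0 <= f i <= 1) ->
    0 <= \prod_(i | Pr i) f i <= 1.
  by move=> f01; elim/big_ind: _ => [|a' b' ? ?|? _]; rewrite ?ler01 ?lexx//; exact: mul01.
rewrite /chi; do 4?[apply: mul01]; try exact: ramp01; apply: p01 => j; exact: ramp01.
Qed.

Lemma cont_chi a n i : continuous (chi a n i).
Proof.
have cs (f : X -> R) l : continuous f -> continuous (fun y => f (y^^l)).
  by move=> cf y; apply: (@continuous_comp _ _ _ (homeo_pow alpha l) f); [exact: apow_cont|exact: cf].
have clo (f : X -> R) : continuous f -> continuous (fun y => lo a (f y)).
  by move=> cf; apply: cont_ramp; apply: contB => //; exact: contCst.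
rewrite /chi; do 4?[apply: contM].
- exact: cont_ramp.
- by apply: (@cont_ramp R e X); exact: cs.
- by apply: contProd => j _; apply: (clo (fun y => q (y^^j.+1))); exact: cs.
- exact: cont_ramp.
- by apply: contProd => j _; exact: clo.
Qed.

Definition block (a : R) (n : nat) (i : 'I_m) (x : X) :=
  [/\ 2^-1 + a < q x, 2^-1 + a < q (x^^n.+1), forall j : nat, (j < n)%N -> q (x^^j.+1) < 2^-1 - a,
      2^-1 + a < g i x & forall i' : 'I_m, (i' < i)%N -> g i' x < 2^-1 - a].

Lemma chi_block a n i x : chi a n i x != 0 -> block a n i x.
Proof.
rewrite /chi !mulf_eq0 !negb_or => /andP[/andP[/andP[/andP[h1 h2] h3] h4] h5].
split; [exact: ramp_pos h1|exact: ramp_pos h2| |exact: ramp_pos h4|].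
  move=> j jn; have : lo a (q (x^^j.+1)) != 0.
    by apply: contraNneq h3 => h; rewrite (bigD1 (Ordinal jn))//= h mul0r.
  by move=> /(ramp_pos e0); elra.
move=> i' ii; have : lo a (g i' x) != 0.
  by apply: contraNneq h5 => h; rewrite (bigD1 i')//= h mul0r.
by move=> /(ramp_pos e0); elra.
Qed.

Lemma block_chi a b n i x : a + e <= b -> block b n i x -> chi a n i x = 1.
Proof.
move=> ab [h1 h2 h3 h4 h5]; rewrite /chi /hi !(ramp_hi e0) ?mul1r; try elra.
rewrite !big1 ?mul1r// => [j jn|j _]; apply: (ramp_hi e0).
  by have := h5 _ jn; elra.
by have := h3 _ (ltn_ord j); elra.
Qed.

(** Starting points have signal above 1/2 and inner points below, so that a block is
    determined by any of its points. *)
Lemma block_disj a b n n' i i' x x' (j j' : nat) : 0 <= a -> 0 <= b -> block a n i x -> block b n' i' x' ->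
  (j <= n)%N -> (j' <= n')%N -> x^^j = x'^^j' -> [/\ n = n', i = i', j = j' & x = x'].
Proof.
move=> a0 b0 [h1 h2 h3 h4 h5] [k1 k2 k3 k4 k5] jn jn' xx.
have jj : j = j'.
  have [lt|lt|//] := ltngtP j j'.
    have yE := same_orbit lt xx; have := k3 _ (pred_sub_lt lt jn').
    by rewrite -yE => h; exfalso; apply: lt00; elra.
  have yE := same_orbit lt (esym xx); have := h3 _ (pred_sub_lt lt jn).
  by rewrite -yE => h; exfalso; apply: lt00; elra.
subst j'; have xE : x = x' := apow_inj xx; subst x'.
have nn : n = n'.
  have [lt|lt|//] := ltngtP n n'; first by have := k3 _ lt; move=> h; exfalso; apply: lt00; elra.
  by have := h3 _ lt; move=> h; exfalso; apply: lt00; elra.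
subst n'; split => //; apply: val_inj; have [lt|lt|//] := ltngtP i i'.
  by have := k5 _ lt; move=> h; exfalso; apply: lt00; elra.
by have := h5 _ lt; move=> h; exfalso; apply: lt00; elra.
Qed.

Hypotheses (q1A : forall x, A x -> q x = 1) (q0O : forall x, ~ O1 x -> q x = 0).

Lemma block_Theta a n i x : 0 <= a -> block a n i x -> Theta n x /\ g i x != 0.
Proof.
move=> a0 [h1 h2 h3 h4 _]; split; last by apply/eqP => h; rewrite h in h4; apply: lt00; elra.
split; [by apply: contrapT => /q0O h; exfalso; apply: lt00; elra|by apply: contrapT => /q0O h; exfalso; apply: lt00; elra|].
by move=> j /q1A h; have := h3 j (ltn_ord j); rewrite h => h'; apply: lt00; elra.
Qed.

Lemma block_values n (i : 'I_m) x : q x = 1 -> q (x^^n.+1) = 1 -> (forall j, (j < n)%N -> q (x^^j.+1) = 0) ->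
  g i x = 1 -> (forall i' : 'I_m, (i' < i)%N -> g i' x = 0) -> block (4 * e) n i x.
Proof.
move=> h1 h2 h3 h4 h5; split; [by rewrite h1; exact: small1|by rewrite h2; exact: small1| |by rewrite h4; exact: small1|].
  by move=> j jn; rewrite h3//; exact: small0.
by move=> i' ii; rewrite h5//; exact: small0.
Qed.

Variable Q : nat.
Hypothesis vis : forall x, exists t : nat, (t < Q)%N /\ A (x^^t.+1).
Hypothesis big_g : forall x, exists i, 2^-1 < g i x.

Definition signal (w : 'I_Q.+1 + 'I_m) (x : X) : R :=
  match w with inl j => q (x^^j) | inr i => g i x end.
Definition unclear (c : R) : set X := [set x | exists w, `|signal w x - 2^-1| <= c].

Definition qt x := ramp e (2^-1 - e / 2) (q x).
Definition tw n x := cut_weight (fun l => qt (x^^l)) n 0.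

Lemma tw_pos n x : tw n x != 0 -> [/\ 2^-1 - e / 2 < q x, 2^-1 - e / 2 < q (x^^n.+1) &
  forall j, (j < n)%N -> q (x^^j.+1) < 2^-1 + e / 2].
Proof.
move=> /cut_weight_pos; rewrite apow0 => -[h1 h2 h3]; split.
- exact: ramp_pos h1.
- by rewrite add0r in h2; exact: ramp_pos h2.
- move=> j /h3; rewrite add0r ltNge; apply: contraNN => h; apply/eqP; apply: (ramp_hi e0); elra.
Qed.

Lemma tw_Theta n x : tw n x != 0 -> Theta n x.
Proof.
move=> /tw_pos[h1 h2 h3]; split; [by apply: contrapT => /q0O h; exfalso; apply: lt00; elra|by apply: contrapT => /q0O h; exfalso; apply: lt00; elra|].
by move=> j /q1A h; have := h3 j (ltn_ord j); rewrite h => h'; exfalso; apply: lt00; elra.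
Qed.

Lemma tw_sum y : \sum_(n < Q) \sum_(j < Q | (j < n.+1)%N) tw n (y^^(- j%:Z)) = 1.
Proof.
rewrite -[RHS](@cut_sum R (fun l => qt (y^^l)) Q) => [|l].
  apply: eq_bigr => n _; apply: eq_bigr => j _; rewrite /tw /cut_weight apow0 add0r.
  rewrite -apowD [n.+1%:Z + _]addrC; congr (_ * _ * _).
  by apply: eq_bigr => l _; rewrite add0r -apowD [l.+1%:Z + _]addrC.
have [s [sQ As]] := vis (y^^l); exists s; split => //; apply: (ramp_hi e0).
by rewrite [l + _]addrC apowD q1A//; elra.
Qed.

(** Away from the value 1/2 the random cuts are certain. *)
Lemma tw_clear (n : 'I_Q) x : tw n x != 0 -> ~ unclear (3 * e) x -> exists i, block (3 * e) n i x.
Proof.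
move=> /tw_pos[h1 h2 h3] cl.
have clear w : 3 * e < `|signal w x - 2^-1|.
  by rewrite ltNge; apply/negP => h; apply: cl; exists w.
have cq' j : (j < Q.+1)%N -> 3 * e < `|q (x^^j) - 2^-1|.
  by move=> jQ; exact: (clear (inl (Ordinal jQ))).
have up (v : R) : 3 * e < `|v - 2^-1| -> 2^-1 - e / 2 < v -> 2^-1 + 3 * e < v.
  by rewrite lter_normr => /orP[|]; elra.
have down (v : R) : 3 * e < `|v - 2^-1| -> v < 2^-1 + e / 2 -> v < 2^-1 - 3 * e.
  by rewrite lter_normr => /orP[|]; elra.
have [i0 g0x] := big_g x.
pose pr := [pred i : 'I_m | 2^-1 < g i x].
case: (@arg_minnP _ i0 pr (fun i => val i)) => [//|i gi imin]; exists i; split.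
- by apply: up => //; rewrite -[x](apow0 alpha); exact: cq'.
- by apply: up => //; apply: cq'; rewrite ltnS.
- by move=> j jn; apply: down; [apply: cq'; have := ltn_ord n; lia|exact: h3].
- by apply: up; [exact: (clear (inr i))|move: gi => /=; elra].
- move=> i' ii; apply: down; first exact: (clear (inr i')).
  have ni : ~~ pr i' by apply/negP => /imin; rewrite leqNgt ii.
  by move: ni; rewrite /= -leNgt; elra.
Qed.

(** The part of a random block that is not already covered by a clear tower. *)
Definition rest n x := tw n x * (1 - \sum_i chi (2 * e) n i x).

Let qt01 x : 0 <= qt x <= 1. Proof. exact: ramp01. Qed.
Let e2 : 0 <= 2 * e. Proof. by rewrite mulr_ge0 ?(ltW e0)//. Qed.

Lemma sum_chi01 n x : 0 <= \sum_i chi (2 * e) n i x <= 1.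
Proof.
apply: sum_le1 => [i|i i' _ _ /chi_block b /chi_block b']; first exact: chi01.
by have [] := block_disj e2 e2 b b' (leq0n _) (leq0n _) erefl.
Qed.

Lemma rest_bound n x : 0 <= rest n x <= tw n x.
Proof.
have t00 : 0 <= tw n x by apply: cut_weight_ge0 => l; exact: qt01.
have /andP[c0 c1] := sum_chi01 n x.
by rewrite /rest mulr_ge0 ?subr_ge0//= ler_piMr//; elra.
Qed.

Lemma rest_pos (n : 'I_Q) x : rest n x != 0 -> unclear (3 * e) x /\ Theta n x.
Proof.
rewrite /rest mulf_eq0 negb_or => /andP[w0 c0]; split; last exact: tw_Theta.
apply: contrapT => cl; have [i bi] := tw_clear w0 cl; move/eqP: c0; apply.
have ci : chi (2 * e) n i x = 1 by apply: (block_chi _ bi); elra.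
rewrite (bigD1 i)//= ci big1 ?addr0 ?subrr// => i' ii; apply: contrapT => /eqP ci'.
case/eqP: ii; have [] // := block_disj e2 e2 (chi_block ci') (chi_block (a := 2 * e) (n := n) (i := i) (x := x) _) (leq0n _) (leq0n _) erefl.
by rewrite ci oner_neq0.
Qed.

Lemma cont_rest n : continuous (rest n).
Proof.
have cqt l : continuous (fun x => qt (x^^l)).
  move=> y; apply: (@continuous_comp _ _ _ (homeo_pow alpha l) qt); first exact: apow_cont.
  by apply: (@cont_ramp R e X).
apply: contM; last first.
  by apply: contB; [exact: contCst|apply: contSum => i _; exact: cont_chi].
apply: contM => //; apply: contM => //; apply: contProd => l _.
by apply: contB => //; exact: contCst.
Qed.

End Blocks.

(** * Castles *)

Section Castles.
Variables (R : realType) (X : topologicalType).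
Hypotheses (cX : compact [set: X]) (hX : hausdorff_space X).
Variable alpha : homeo X.
Local Notation "x '^^' n" := (homeo_pow alpha n x) (at level 30, format "x ^^ n").
Variables (B Y : set X) (k : nat).
Variables (Ty : nat -> X -> set X -> Prop) (Sh : int -> set X -> Prop).

(** Ty r z N: the segments of length r over the base N carry coordinates comparable with
    those at z; Sh n U: there is a partial isometry moving U along the n-th power. The
    towers weighted by cchi are disjoint. Where they do not carry the whole unit, the
    pieces weighted by cw do (cE_1); csh i moves a piece to a place of a tower where ckap
    has the value (i + 1) / k and cchih is 1, distinct pieces having distinct targets
    (cinj). The function cchih lives where cchi is 1, so that the levels do not meet the
    remainder. *)
Record castle := Castle {
  cT : finType;
  cQ : nat;
  clen : cT -> nat;
  cz : cT -> X;
  cN : cT -> set X;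
  cK : cT -> set X;
  clive := fun t x => [/\ cK t x, B x & B (x^^(clen t))];
  clen_le : forall t, (clen t <= cQ)%N;
  cTy : forall t, open (cN t) /\ Ty (clen t) (cz t) (cN t);
  cz_clear : forall t (j : nat), (j < clen t)%N -> nocross alpha Y j (cz t);
  cK_closed : forall t, closed (cK t) /\ cK t `<=` cN t;
  cchi : cT -> X -> R;
  cchih : cT -> X -> R;
  cchi_cont : forall t, continuous (cchi t) /\ continuous (cchih t);
  cchi01 : forall t x, 0 <= cchi t x <= 1 /\ 0 <= cchih t x <= 1;
  cchih1 : forall t x, cchih t x != 0 -> cchi t x = 1;
  cchi_live : forall t x, cchi t x != 0 -> clive t x;
  cchi_disj : forall t t' j j' x x', (j < clen t)%N -> (j' < clen t')%N ->
    cchi t x != 0 -> cchi t' x' != 0 -> x^^j = x'^^j' -> t = t' /\ j = j';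
  ckap : X -> R;
  ckap_cont : continuous ckap;
  ckap01 : forall x, 0 <= ckap x <= 1;
  cJ : finType;
  cty : cJ -> cT;
  cw : cJ -> X -> R;
  cw_cont : forall c, continuous (cw c);
  cw_ge0 : forall c x, 0 <= cw c x;
  cw_live : forall c x, cw c x != 0 -> clive (cty c) x;
  csh : 'I_k -> cJ -> int;
  cSh : forall i c, exists U, Sh (csh i c) U /\ forall x, cw c x != 0 -> U x;
  ctarget : forall i c x, cw c x != 0 -> [/\ clive (cty c) (x^^(csh i c)),
    cchih (cty c) (x^^(csh i c)) = 1 & ckap (x^^(csh i c)) = i.+1%:R / k%:R];
  cinj : forall i i' c c' x x' j j', cw c x != 0 -> cw c' x' != 0 ->
    (j < clen (cty c))%N -> (j' < clen (cty c'))%N ->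
    (x^^(csh i c))^^j = (x'^^(csh i' c'))^^j' -> [/\ i = i', c = c' & j = j'];
  ctot := fun y => \sum_t \sum_(j < cQ | (j < clen t)%N) cchi t (y^^(- j%:Z));
  cE := fun y => \sum_c \sum_(j < cQ | (j < clen (cty c))%N) cw c (y^^(- j%:Z));
  cE_le : forall y, cE y <= 1;
  cE_1 : forall y, ctot y != 1 -> cE y = 1 }.

Section Construction.
Hypotheses (minX : minimal alpha) (infX : infinite_set [set: X]).
Variable d : nat.
Hypothesis dimX : covering_dim_le X d.
Hypotheses (clY : closed Y) (Y0 : Y !=set0) (orbY : meets_orbits_at_most_once alpha Y).
Hypotheses (oB : open B) (YB : Y `<=` B) (k0 : (0 < k)%N).
Hypothesis Ty_sub : forall r z N N', Ty r z N -> N' `<=` N -> Ty r z N'.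
Hypothesis Ty_ex : forall r z, (forall j : nat, (j < r)%N -> nocross alpha Y j z) ->
  exists N, [/\ open N, N z & Ty r z N].
Hypothesis Sh_sub : forall n U U', Sh n U -> U' `<=` U -> Sh n U'.
Hypothesis Sh_ex : forall n z, nocross alpha Y n z -> exists U, [/\ open U, U z & Sh n U].

Lemma nested_nbhds : exists A0 A O1 C1 : set X,
  [/\ open A0 /\ closed A, open O1 /\ closed C1, Y `<=` A0 /\ A0 `<=` A, A `<=` O1 /\ O1 `<=` C1 & C1 `<=` B].
Proof.
have [f [S [cf f01 fY [clS SB] fS]]] := @bump R X cX hX Y B clY oB YB.
exists [set x | 2/3 < f x], [set x | 2/3 <= f x], [set x | 1/3 < f x], S; split => //; split.
- exact: open_gt.
- exact: closed_ge.
- exact: open_gt.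
- by [].
- by move=> x /fY /= ->; lra.
- by move=> x /= /ltW.
- by move=> x /=; lra.
- by move=> x /= h; apply: contrapT => /fS f0; move: h; rewrite f0; lra.
Qed.

Lemma uniform_positive (I : finType) (e : I -> R) : (forall i, 0 < e i) ->
  exists e0, 0 < e0 /\ forall i, e0 <= e i.
Proof.
move=> e0; exists (\big[Num.min/1]_i e i); split.
  by elim/big_rec: _ => [|i x _ x0]; rewrite ?ltr01// lt_min e0.
by move=> i; rewrite (bigD1 i)//= ge_min lexx.
Qed.

Lemma uniform_nat (I : finType) (P : I -> nat -> Prop) :
  (forall i n m, (n <= m)%N -> P i n -> P i m) -> (forall i, exists n, P i n) -> exists n, forall i, P i n.
Proof.
move=> mono ex; have [f fP] := @choice _ _ (fun i n => P i n) ex.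
exists (\max_i f i) => i; apply: (mono i (f i)) => //; exact: leq_bigmax.
Qed.

(** Y meets the orbit of x at most once, so that one of the two half orbits avoids it. *)
Lemma escape (W : set X) (T : nat) (x : X) :
  (forall y, exists t : nat, (t <= T)%N /\ W (y^^t)) ->
  (forall y, exists t : nat, (t <= T)%N /\ W (y^^(- t%:Z))) ->
  exists n, [/\ (absz n <= T)%N, W (x^^n) & nocross alpha Y n x].
Proof.
move=> hT hT'.
have [[l [l0 Yl]]|no] := pselect (exists l : int, 0 < l /\ Y (x^^l)).
  have [t [tT Wt]] := hT' x; exists (- t%:Z); split => //; first by rewrite abszN.
  move=> m hm Ym; have ml : m - l != 0 by move: hm l0; lia.
  have : (homeo_pow alpha (m - l) @` Y `&` Y) (x^^m).
    by split => //; exists (x^^l) => //; rewrite -apowD subrK.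
  by rewrite orbY.
have [t [tT Wt]] := hT x; exists t%:Z; split => // m hm Ym; apply: no.
by exists m; split => //; move: hm; lia.
Qed.

Section Segments.
Variables (A0 A O1 C1 : set X) (Q : nat).
Hypotheses (oA0 : open A0) (clA : closed A) (oO1 : open O1) (clC1 : closed C1).
Hypotheses (YA0 : Y `<=` A0) (A0A : A0 `<=` A) (AO1 : A `<=` O1) (OC : O1 `<=` C1) (CB : C1 `<=` B).
Hypothesis vis : forall x, exists t : nat, (t < Q)%N /\ A0 (x^^t.+1).

Local Notation Theta := (Theta alpha A O1).

Lemma closure_Theta n x : closure (Theta n) x ->
  [/\ B x, B (x^^n.+1) & forall j : nat, (j < n.+1)%N -> nocross alpha Y j x].
Proof.
pose E : set X := C1 `&` ([set x | C1 (x^^n.+1)] `&` [set x | forall j : 'I_n, [set x | ~ A0 (x^^j.+1)] x]).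
have clE : closed E.
  apply: closedI => //; apply: closedI; first exact: closed_pre.
  by apply: closed_forall => j; apply: (@closed_pre _ _ (~` A0)); exact: open_closedC.
have TE : Theta n `<=` E.
  by move=> z [h1 h2 h3]; split; [exact: OC|split; [exact: OC|move=> j Az; apply: (h3 j); exact: A0A]].
move=> /(closure_subset TE)/clE [h1 [h2 h3]]; split; [exact: CB|exact: CB|] => j jn l hl Yl.
have ln : (absz (l - 1) < n)%N by lia.
by apply: (h3 (Ordinal ln)); apply: YA0; move: Yl; congr (Y (_^^_)); rewrite /=; lia.
Qed.

(** The neighbourhood of a point is chosen for all lengths at once: either the point may
    start a block of that length, or no point of the neighbourhood may. *)
Lemma cover_types : exists m (z : 'I_m -> X) (N : 'I_m -> set X),
  [/\ forall i, open (N i), forall x, exists i, N i x &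
      forall i (n : 'I_Q), [/\ closure (Theta n) (z i), N i (z i) & Ty n.+1 (z i) (N i)] \/
        (forall x, N i x -> ~ closure (Theta n) x)].
Proof.
pose ok (p : X * set X) := [/\ open p.2, p.2 p.1 & forall n : 'I_Q,
  (closure (Theta n) p.1 /\ Ty n.+1 p.1 p.2) \/ (forall x, p.2 x -> ~ closure (Theta n) x)].
have [x _|m [u [ou cu]]] := @fin_cover _ cX setT (X * set X) (fun p => [set x | p.2 x /\ ok p]) closedT.
  have [N NP] : {N : 'I_Q -> set X & forall n, [/\ open (N n), N n x &
      (closure (Theta n) x /\ Ty n.+1 x (N n)) \/ (forall y, N n y -> ~ closure (Theta n) y)]}.
    apply: (@choice _ _ (fun (n : 'I_Q) N => [/\ open N, N x &
      (closure (Theta n) x /\ Ty n.+1 x N) \/ (forall y, N y -> ~ closure (Theta n) y)])) => n.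
    have [cl|ncl] := pselect (closure (Theta n) x).
      have [|N [oN Nx TN]] := @Ty_ex n.+1 x; first by have [] := closure_Theta cl.
      by exists N; split => //; left.
    exists (~` closure (Theta n)); split => //; last by right.
    by apply: closed_openC; exact: closed_closure.
  pose W : set X := [set y | forall n, N n y].
  have oW : open W by apply: open_forallI => n; have [] := NP n.
  have okW : ok (x, W).
    split=> // [n|n]; first by have [] := NP n.
    have [_ _ [[cl TN]|h]] := NP n; [left; split => //; apply: Ty_sub TN _ => y; exact|right => y Wy].
    exact: h.
  exists (x, W); split; last by split => // n; have [] := NP n.
  by move: oW; congr open; apply/seteqP; split => y //= [].
exists m, (fun i => (u i).1), (fun i => [set x | (u i).2 x /\ ok (u i)]); split => //.
  by move=> x; exact: cu.
move=> i n; have [o|no] := pselect (ok (u i)); last by right => x [].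
have [o1 o2 o3] := o; have [[cl TN]|h] := o3 n; [left|by right => x [/h]].
by split => //; apply: Ty_sub TN _ => x [].
Qed.

Section Types.
Variables (m : nat) (z : 'I_m -> X) (N : 'I_m -> set X).
Hypotheses (oN : forall i, open (N i)) (coverN : forall x, exists i, N i x).
Hypothesis NP : forall i (n : 'I_Q), [/\ closure (Theta n) (z i), N i (z i) & Ty n.+1 (z i) (N i)] \/
  (forall x, N i x -> ~ closure (Theta n) x).

Definition ttype : finType :=
  {p : 'I_Q * 'I_m | `[< [/\ closure (Theta p.1) (z p.2), N p.2 (z p.2) & Ty p.1.+1 (z p.2) (N p.2)] >]}.
Definition tn (t : ttype) := (val t).1.
Definition ti (t : ttype) := (val t).2.

Lemma ttypeP t : [/\ closure (Theta (tn t)) (z (ti t)), N (ti t) (z (ti t)) & Ty (tn t).+1 (z (ti t)) (N (ti t))].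
Proof. by have /asboolP := valP t. Qed.

Lemma ttype_ex (n : 'I_Q) i x : Theta n x -> N i x -> exists t, tn t = n /\ ti t = i.
Proof.
move=> Tx Nx; have [h|h] := NP i n; last by case: (h _ Nx); exact: subset_closure.
have hb : `[< [/\ closure (Theta (n, i).1) (z (n, i).2), N (n, i).2 (z (n, i).2) & Ty (n, i).1.+1 (z (n, i).2) (N (n, i).2)] >].
  exact/asboolP.
by exists (exist _ (n, i) hb).
Qed.

Variable m0 : nat.
Definition marker := (ttype * 'I_k * 'I_m0)%type.

(** The markers are chosen before the functions that cut the orbits, so that these functions
    can be made exact on them, and the time needed to reach the markers is known before the
    length of the orbit segments on which ambiguity has to be rare. *)
Lemma markers_ex : exists (P PK : marker -> set X) (kap : X -> R),
  [/\ forall p, open (P p) /\ P p !=set0, forall p, closed (PK p) /\ P p `<=` PK p,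
      forall p x, PK p x -> Theta (tn p.1.1) x /\ N (ti p.1.1) x,
      forall p p' (l : int) x, (absz l <= Q)%N -> PK p x -> PK p' (x^^l) -> p = p' /\ l = 0 &
      [/\ continuous kap, forall x, 0 <= kap x <= 1 & forall p x, PK p x -> kap x = p.1.2.+1%:R / k%:R]].
Proof.
pose W (p : marker) := N (ti p.1.1) `&` Theta (tn p.1.1).
have oW p : open (W p) /\ W p !=set0.
  split; first by apply: openI => //; by apply: open_Theta.
  have [cl Nz _] := ttypeP p.1.1.
  have [y [Ty' Ny]] := cl _ (open_nbhs_nbhs (conj (oN _) Nz)); by exists y.
have [y [yW yd]] := distinct_orbits cX hX minX infX Q oW.
have [|V [VP Vd]] := @separated_nbhds X hX alpha marker W Q y _ yd.
  by move=> p; split; [have [] := oW p|exact: yW].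
have [f fP] : {f : marker -> X -> R & forall p, [/\ continuous (f p), forall x, 0 <= f p x <= 1,
    f p (y p) = 1 & forall x, f p x != 0 -> V p x]}.
  apply: (@choice _ _ (fun (p : marker) (f : X -> R) => [/\ continuous f, forall x, 0 <= f x <= 1,
    f (y p) = 1 & forall x, f x != 0 -> V p x])) => p.
  have [oV Vy _] := VP p.
  have [|f [S [cf f01 f1 [_ SV] fS]]] := @bump R X cX hX [set (y p)] (V p) (@closed_pt X hX _) oV.
    by move=> _ ->.
  exists f; split => //; first exact: f1.
  by move=> x fx; apply: SV; apply: contrapT => /fS f0; rewrite f0 eqxx in fx.
pose PK p : set X := [set x | 2^-1 <= f p x].
have PKV p x : PK p x -> V p x.
  by move=> h; have [_ _ _] := fP p; apply; apply/eqP => f0; move: h; rewrite /PK /= f0; lra.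
have disj p p' (l : int) x : (absz l <= Q)%N -> PK p x -> PK p' (x^^l) -> p = p' /\ l = 0.
  by move=> lQ /PKV h /PKV; exact: Vd.
pose lv (p : marker) : R := p.1.2.+1%:R / k%:R.
have kR : 0 < k%:R :> R by rewrite ltr0n.
have lv01 p : 0 <= lv p <= 1.
  by rewrite divr_ge0//= ler_pdivrMr// mul1r ler_nat.
pose kf p x := lv p * Num.min 1 (2 * f p x).
have kf01 p x : 0 <= kf p x <= 1.
  have /andP[l0 l1] := lv01 p; have [_ f01 _ _] := fP p; have /andP[f0 _] := f01 x.
  have m0' : 0 <= Num.min 1 (2 * f p x) by rewrite le_min ler01 mulr_ge0.
  by rewrite mulr_ge0//= mulr_ile1// ge_min lexx.
have kfV p x : kf p x != 0 -> V p x.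
  have [_ _ _] := fP p; move=> h k0'; apply: h; apply: contra_neq k0'.
  by rewrite /kf => ->; rewrite mulr0 min_r ?mulr0.
have kfu x p p' : kf p x != 0 -> kf p' x != 0 -> p = p'.
  move=> /kfV h /kfV h'; have [] // := Vd p p' 0 x; by rewrite ?apow0.
exists (fun p => [set x | 2^-1 < f p x]), PK, (fun x => \sum_p kf p x); split => //.
- move=> p; have [cf _ f1 _] := fP p; split; first exact: open_gt.
  by exists (y p) => /=; rewrite f1; lra.
- by move=> p; have [cf _ _ _] := fP p; split; [exact: closed_ge|move=> x /ltW].
- by move=> p x /PKV; have [_ _ VW] := VP p; move=> /VW [].
split=> [|x|p x Px].
- apply: contSum => p _; have [cf _ _ _] := fP p; apply: contM; first exact: contCst.
  by apply: contMin; [exact: contCst|apply: contM => //; exact: contCst].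
- by apply: sum_le1 => // p p' _ _; exact: kfu.
have kp : kf p x = lv p.
  by rewrite /kf min_l ?mulr1//; move: Px; rewrite /PK /=; lra.
rewrite (bigD1 p)//= big1 ?addr0// => p' pp; apply: contrapT => /eqP k'; case/eqP: pp.
apply: (kfu x) => //; rewrite kp; apply: lt0r_neq0; rewrite divr_gt0// ltr0n; by [].
Qed.

Section Levels.
Variables (P PK : marker -> set X) (kap : X -> R) (T : nat).
Hypotheses (PPK : forall p, P p `<=` PK p)
  (PKT : forall p x, PK p x -> Theta (tn p.1.1) x /\ N (ti p.1.1) x)
  (PKd : forall p p' (l : int) x, (absz l <= Q)%N -> PK p x -> PK p' (x^^l) -> p = p' /\ l = 0)
  (ckap' : continuous kap) (kap01 : forall x, 0 <= kap x <= 1)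
  (kapP : forall p x, PK p x -> kap x = p.1.2.+1%:R / k%:R).

(** Removing the markers of other types makes the type of a marker unambiguous, and leaves
    a cover because the markers are disjoint. *)
Definition region (i : 'I_m) : set X := [set x | N i x /\ forall p, ti p.1.1 != i -> ~ PK p x].

Variables (q : X -> R) (g u : 'I_m -> X -> R) (S : 'I_m -> set X) (e : R).
Hypotheses (cq : continuous q) (q1A : forall x, A x -> q x = 1) (q0O : forall x, ~ O1 x -> q x = 0)
  (q1P : forall p x, PK p x -> q x = 1 /\ q (x^^(tn p.1.1).+1) = 1)
  (q0P : forall p x j, PK p x -> (j < tn p.1.1)%N -> q (x^^j.+1) = 0).
Hypothesis uS : part_unity setT region u S.
Hypotheses (cg : forall i, continuous (g i)) (g1 : forall i x, S i x -> g i x = 1)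
  (g0 : forall i x, ~ region i x -> g i x = 0).
Hypotheses (e0 : 0 < e) (e16 : 16 * e <= 1).

Variables (E : finType) (t : E -> X -> R) (SE : E -> set X) (col : E -> 'I_m0).
Hypotheses (ct : forall i, continuous (t i)) (t0 : forall i x, 0 <= t i x)
  (tS : forall i x, ~ SE i x -> t i x = 0)
  (t1 : forall x, unclear alpha q g Q (3 * e) x -> \sum_i t i x = 1)
  (tsep : forall i i' x l, col i = col i' -> (absz l <= T + T)%N -> SE i x -> SE i' (x^^l) ->
     i = i' /\ l = 0)
  (tsh : forall i p, exists n, [/\ (absz n <= T)%N, Sh n (SE i) & forall x, SE i x -> P p (x^^n)]).

Let b1 n i x := chi alpha q g e e n i x.
Let b2 n i x := chi alpha q g e (2 * e) n i x.
Let rst := rest alpha q g e.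

Let e00 : 0 <= e. Proof. exact: ltW. Qed.
Let e2 : 0 <= 2 * e. Proof. by rewrite mulr_ge0. Qed.
Let e12 : e + e <= 2 * e. Proof. by rewrite mulr_natl mulr2n. Qed.

Let S_region i x : S i x -> region i x.
Proof. by have [_ _ h _ _] := uS; have [_] := h i; apply. Qed.

Let S_ex x : exists i, S i x.
Proof.
have [_ _ _ uz [_ us]] := uS; apply: contrapT => no.
have := us x Logic.I; rewrite big1 => [/eqP|i _]; first by rewrite eq_sym oner_eq0.
by apply: uz => Si; apply: no; exists i.
Qed.

Let big_g x : exists i, 2^-1 < g i x.
Proof.
have [i Si] := S_ex x; exists i; rewrite g1//.
by rewrite invf_lt1 ?ltr1n.
Qed.

Let b1P n i x : b1 n i x != 0 -> [/\ Theta n x, N i x & 2^-1 <= g i x].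
Proof.
move=> /(chi_block e0 e16) b; have [Tx gx] := block_Theta e0 e16 q1A q0O e00 b; split => //.
  by apply: contrapT => nN; case/eqP: gx; apply: g0 => -[].
have [_ _ _ h _] := b; apply: ltW; apply: le_lt_trans h; by rewrite lerDl.
Qed.

Let b2b1 n i x : b2 n i x != 0 -> b1 n i x = 1.
Proof. by move=> /(chi_block e0 e16); exact: (block_chi e0 e16 e12). Qed.

Let marker_b p x : PK p x -> b1 (tn p.1.1) (ti p.1.1) x = 1 /\ b2 (tn p.1.1) (ti p.1.1) x = 1.
Proof.
move=> px; have [qx qn] := q1P px.
have other i : i != ti p.1.1 -> g i x = 0.
  by move=> ip; apply: g0 => -[_ h]; apply: (h p) => //; rewrite eq_sym.
have gp : g (ti p.1.1) x = 1.
  have [i Si] := S_ex x; have [<-|ip] := eqVneq i (ti p.1.1); first exact: g1.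
  by have := g1 Si; rewrite other// => /eqP; rewrite eq_sym oner_eq0.
have b : block alpha q g (4 * e) (tn p.1.1) (ti p.1.1) x.
  apply: (block_values e0 e16) => // [j jn|i ii]; first exact: (q0P px).
  by apply: other; apply: contraTneq ii => ->; rewrite ltnn.
by split; apply: (block_chi e0 e16 _ b); [exact: lvl1|exact: lvl2].
Qed.

Let disj (s s' : ttype) (j j' : nat) x x' : (j < (tn s).+1)%N -> (j' < (tn s').+1)%N ->
  b1 (tn s) (ti s) x != 0 -> b1 (tn s') (ti s') x' != 0 -> x^^j = x'^^j' -> s = s' /\ j = j'.
Proof.
move=> jn jn' /(chi_block e0 e16) b /(chi_block e0 e16) b' xx.
have [nn ii jj _] := block_disj e0 e16 e00 e00 b b' jn jn' xx; split => //.
apply: val_inj; move: nn ii; rewrite /tn /ti; case: (val s) => a1 a2; case: (val s') => a3 a4 /= h ->.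
by congr pair; exact: val_inj.
Qed.

Let piece : finType := (E * ttype)%type.
Let pw (c : piece) x := rst (tn c.2) x * t c.1 x * u (ti c.2) x.

Let pw_pos c x : pw c x != 0 -> [/\ rst (tn c.2) x != 0, t c.1 x != 0 & u (ti c.2) x != 0].
Proof. by rewrite /pw !mulf_eq0 !negb_or => /andP[/andP[-> ->] ->]. Qed.

Let u_S i x : u i x != 0 -> S i x.
Proof. by have [_ _ _ uz _] := uS; move=> ux; apply: contrapT => /uz h; rewrite h eqxx in ux. Qed.

Let t_S i x : t i x != 0 -> SE i x.
Proof. by move=> tx; apply: contrapT => /tS h; rewrite h eqxx in tx. Qed.

Let restP (n : 'I_Q) x : rst n x != 0 -> unclear alpha q g Q (3 * e) x /\ Theta n x.
Proof. exact: (rest_pos e0 e16 q1A q0O big_g). Qed.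

Let pw_sum y : \sum_c \sum_(j < Q | (j < (tn c.2).+1)%N) pw c (y^^(- j%:Z)) =
  \sum_(n < Q) \sum_(j < Q | (j < n.+1)%N) rst n (y^^(- j%:Z)).
Proof.
pose v (p : 'I_Q * 'I_m) := \sum_(j < Q | (j < p.1.+1)%N) rst p.1 (y^^(- j%:Z)) * u p.2 (y^^(- j%:Z)).
have [_ _ _ _ [_ us]] := uS.
transitivity (\sum_(s : ttype) v (val s)).
  rewrite sum_pair exchange_big; apply: eq_bigr => s _ /=.
  rewrite exchange_big; apply: eq_bigr => j _; rewrite /pw /=; set x := y^^_.
  have [r0|rx] := eqVneq (rst (tn s) x) 0.
    by rewrite -/(tn s) r0 mul0r big1// => i _; rewrite !mul0r.
  rewrite -mulr_suml -mulr_sumr t1 ?mulr1//; exact: (restP rx).1.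
rewrite -(@sum_sub _ _ (fun p : 'I_Q * 'I_m => `[< [/\ closure (Theta p.1) (z p.2), N p.2 (z p.2) & Ty p.1.+1 (z p.2) (N p.2)] >]) v).
rewrite big_mkcond /=.
transitivity (\sum_p v p).
  apply: eq_bigr => -[n i] _; case: ifP => // /negbT nv; symmetry; apply: big1 => j _ /=.
  set x := y^^_; have [->|rx] := eqVneq (rst n x) 0; first by rewrite mul0r.
  have [->|ux] := eqVneq (u i x) 0; first by rewrite mulr0.
  have [_ Tx] := restP rx; have [Nx _] := S_region (u_S ux).
  have [s [sn si]] := ttype_ex Tx Nx; case/negP: nv; apply/asboolP.
  by have := ttypeP s; rewrite sn si.
rewrite sum_pair; apply: eq_bigr => n _; rewrite /v /= exchange_big; apply: eq_bigr => j _.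
by rewrite -mulr_sumr us ?mulr1.
Qed.

Let visA x : exists l : nat, (l < Q)%N /\ A (x^^l.+1).
Proof. by have [l [lQ Al]] := vis x; exists l; split => //; exact: A0A. Qed.

Let tot y := \sum_(s : ttype) \sum_(j < Q | (j < (tn s).+1)%N) b1 (tn s) (ti s) (y^^(- j%:Z)).

Let rest_le y : \sum_c \sum_(j < Q | (j < (tn c.2).+1)%N) pw c (y^^(- j%:Z)) <= 1.
Proof.
rewrite pw_sum -(tw_sum e0 e16 q1A visA y); apply: ler_sum => n _; apply: ler_sum => j _.
by have /andP[] := rest_bound alpha q g e0 e16 n (y^^(- j%:Z)).
Qed.

Let rest_1 y : tot y != 1 -> \sum_c \sum_(j < Q | (j < (tn c.2).+1)%N) pw c (y^^(- j%:Z)) = 1.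
Proof.
move=> ty; rewrite pw_sum -[RHS](tw_sum e0 e16 q1A visA y); apply: eq_bigr => n _; apply: eq_bigr => j jn.
rewrite /rst /rest; set x := y^^_; rewrite big1 ?subr0 ?mulr1// => i _.
apply: contrapT => /eqP bx; move/eqP: ty; apply.
have bx1 := b2b1 bx; have b10 : b1 n i x != 0 by rewrite bx1 oner_neq0.
have [Tx Nx _] := b1P b10; have [s [sn si]] := ttype_ex Tx Nx.
have js : (j < (tn s).+1)%N by rewrite sn.
have yE (l : nat) : (y^^(- l%:Z))^^l = y by rewrite apowNK.
have bs : b1 (tn s) (ti s) (y^^(- j%:Z)) != 0 by rewrite sn si.
rewrite /tot (bigD1 s)//= (bigD1 j)//= [X in _ + X + _]big1 ?addr0 => [|j' /andP[js' jj]]; last first.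
  apply: contrapT => /eqP b'; case/eqP: jj; apply: val_inj.
  by have [] := disj js' js b' bs; rewrite ?yE.
rewrite sn si -/x bx1 big1 ?addr0// => s' ss; apply: big1 => j' js'.
apply: contrapT => /eqP b'; case/eqP: ss.
by have [] := disj js' js b' bs; rewrite ?yE.
Qed.

Let shift_ex : exists n : 'I_k -> piece -> int, forall i c, [/\ (absz (n i c) <= T)%N, Sh (n i c) (SE c.1) &
  forall x, SE c.1 x -> P (c.2, i, col c.1) (x^^(n i c))].
Proof.
have [n nP] := @choice _ _ (fun (ic : 'I_k * piece) (n : int) => [/\ (absz n <= T)%N, Sh n (SE ic.2.1) &
  forall x, SE ic.2.1 x -> P (ic.2.2, ic.1, col ic.2.1) (x^^n)]) (fun ic => tsh _ _).
by exists (fun i c => n (i, c)) => i c; exact: (nP (i, c)).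
Qed.

(** Towers are the blocks on which all signals are far from 1/2. The remaining random blocks
    lie in the unclear set, where the sparse colouring cuts them into pieces; each piece
    moves to the marker of its own type, level and colour. *)
Lemma levels_castle : inhabited castle.
Proof.
have [n nP] := shift_ex.
have Theta_B s x : Theta s x -> B x /\ B (x^^s.+1) by case=> h1 h2 _; split; apply: CB; exact: OC.
have live s x : Theta (tn s) x -> 2^-1 <= g (ti s) x ->
    [/\ [set x | 2^-1 <= g (ti s) x] x, B x & B (x^^(tn s).+1)].
  by move=> /Theta_B[h1 h2] h; split.
have target i c x : pw c x != 0 -> PK (c.2, i, col c.1) (x^^(n i c)).
  by move=> /pw_pos[_ /t_S h _]; have [_ _ h'] := nP i c; apply: PPK; exact: h'.
constructor; refine (@Castle ttype Q (fun s => (tn s).+1) (fun s => z (ti s)) (fun s => N (ti s))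
  (fun s => [set x | 2^-1 <= g (ti s) x]) _ _ _ _
  (fun s => b1 (tn s) (ti s)) (fun s => b2 (tn s) (ti s)) _ _ _ _ disj kap ckap' kap01
  piece (fun c => c.2) pw _ _ _ n _ _ _ rest_le rest_1).
- by move=> s; rewrite ltn_ord.
- by move=> s; have [_ _ ty] := ttypeP s.
- by move=> s j js; have [cl _ _] := ttypeP s; have [_ _ h] := closure_Theta cl; exact: h.
- move=> s; split; first exact: closed_ge.
  move=> x /= gx; apply: contrapT => nN; move: gx; rewrite g0 => [|[]//].
  by rewrite leNgt invr_gt0 ltr0n.
- by move=> s; split; exact: cont_chi.
- by move=> s x; split; exact: chi01.
- by move=> s x; exact: b2b1.
- by move=> s x /b1P[Tx _ gx]; exact: live.
- move=> c; apply: contM; first by apply: contM => //; exact: cont_rest.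
  by have [cu _ _ _ _] := uS.
- move=> c x; have [_ u0 _ _ _] := uS; apply: mulr_ge0 => //; apply: mulr_ge0 => //.
  by have /andP[] := rest_bound alpha q g e0 e16 (tn c.2) x.
- move=> c x /pw_pos[/restP[_ Tx] _ /u_S Sx]; apply: live => //; rewrite g1//.
  by rewrite invf_le1 ?ler1n.
- by move=> i c; exists (SE c.1); have [_ h _] := nP i c; split => // x /pw_pos[_ /t_S].
- move=> i c x /(target i) px; have [h1 h2] := marker_b px; have [Tx _] := PKT px.
  split; [|exact: h2|exact: (kapP px)].
  by apply: live => //; have [] := @b1P (tn c.2) (ti c.2) (x^^(n i c)); rewrite ?h1 ?oner_neq0.
- move=> i i' c c' x x' j j' wx wx' jc jc' xx.
  have px := target i _ _ wx; have px' := target i' _ _ wx'.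
  have xE : x'^^(n i' c') = (x^^(n i c))^^(j%:Z - j'%:Z).
    by rewrite addrC apowD xx apowK.
  rewrite xE in px'; have [|[c2 ii cc] jj] := PKd _ px px'.
    exact: (offset_le jc jc' (ltn_ord _) (ltn_ord _)).
  have j_j := offset0 jj.
  subst j'; rewrite subrr apow0 in xE.
  have xx' : x' = x^^(n i c - n i' c') by rewrite addrC apowD -xE apowK.
  have [_ tx _] := pw_pos wx; have [_ tx' _] := pw_pos wx'.
  have [na _ _] := nP i c; have [na' _ _] := nP i' c'.
  have := t_S tx'; rewrite xx' => Sx'.
  have [c1 _] := tsep cc (offset_add na na') (t_S tx) Sx'.
  by split => //; move: c1 c2; case: (c) => a1 a2; case: (c') => a3 a4 /= -> ->.
Qed.

End Levels.

End Types.
End Segments.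

(** The castle is built from functions cutting the orbits near Y; their values are rarely
    near 1/2, so the ambiguous part is thin and can be distributed over the markers. *)
Lemma castle_ex : inhabited castle.
Proof.
have [A0 [A [O1 [C1 [[oA0 clA] [oO1 clC1] [YA0 A0A] [AO1 OC] CB]]]]] := nested_nbhds.
have [y0 Yy0] := Y0.
have [Q vis] : exists Q, forall x, exists t : nat, (t < Q)%N /\ A0 (x^^t.+1).
  have [T hT] := syndetic cX minX oA0 (ex_intro _ y0 (YA0 _ Yy0)).
  exists T.+1 => x; have [t [tT At]] := hT (alpha x); exists t; split => //.
  by move: At; rewrite -(apow1 alpha x) -apowD; congr (A0 (_^^_)); lia.
have [m [z [N [oN coverN NP]]]] := cover_types Q oA0 clC1 YA0 A0A OC CB.
pose D := ((Q.+1 + m) * d)%N; pose m0 := (D * (d.+1 * d.+1)).+1.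
have [P [PK [kap [PP PKc PKT PKd [ckap kap01 kapP]]]]] := markers_ex Q clA oO1 z oN m0.
have [T0 [T1 T2]] : exists T, (forall p x, exists t : nat, (t <= T)%N /\ P p (x^^t)) /\
    forall p x, exists t : nat, (t <= T)%N /\ P p (x^^(- t%:Z)).
  have [|p|T hT] := @uniform_nat _ (fun p T => forall x, exists t : nat, (t <= T)%N /\ P p (x^^t)).
  - by move=> p n n' nn h x; have [t [tn' Pt]] := h x; exists t; split => //; exact: leq_trans nn.
  - by have [oP P0] := PP p; exact: (syndetic cX minX oP P0).
  - by exists T; split => // p; apply: syndetic_back; exact: hT.
pose M := (T0 + T0)%N.
pose region' i := region PK i.
have tube_closed p (l : int) : closed [set x | PK p (x^^l)] by apply: closed_pre; have [] := PKc p.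
pose Aq : set X := [set x | A x \/ exists p, PK p x \/ PK p (x^^(- (tn p.1.1).+1%:Z))].
pose Cq : set X := [set x | ~ O1 x \/ exists pj : marker A O1 Q z N m0 * 'I_Q,
  (pj.2 < tn pj.1.1.1)%N /\ PK pj.1 (x^^(- pj.2.+1%:Z))].
have clU (F G : set X) : closed F -> closed G -> closed [set x | F x \/ G x].
  by move=> cF cG; have := closedU cF cG.
have clAq : closed Aq.
  apply: (clU _ _) => //; apply: (@closed_existsI X _ (fun p => [set x | PK p x \/ PK p (x^^(- (tn p.1.1).+1%:Z))])) => p.
  by apply: (clU _ _); [have [] := PKc p|exact: tube_closed].
have clCq : closed Cq.
  apply: (clU _ _); first exact: open_closedC.
  apply: (@closed_existsI X _ (fun pj : marker A O1 Q z N m0 * 'I_Q => [set x | (pj.2 < tn pj.1.1.1)%N /\ PK pj.1 (x^^(- pj.2.+1%:Z))])) => pj.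
  case: (ltnP pj.2 (tn pj.1.1.1)) => h.
    by move: (tube_closed pj.1 (- pj.2.+1%:Z)); congr closed; apply/seteqP; split => x => [hx|[]//].
  by move: (@closed0 X); congr closed; apply/seteqP; split => x => [//|[]//].
have ACq x : Aq x -> ~ Cq x.
  have shift_Theta p (j : 'I_Q) : (j < tn p.1.1)%N -> PK p (x^^(- j.+1%:Z)) -> ~ A x.
    move=> jn /PKT[[_ _ h] _] Ax; apply: (h (Ordinal jn)).
    by rewrite -apowD (_ : _ + _ = 0)//=; lia.
  case=> [Ax|[p hp]] [nO|[[p' j] /= [jn hj]]].
  - by apply: nO; exact: AO1.
  - by apply: (shift_Theta p' j).
  - case: hp => /PKT[[h1 h2 _] _]; first by [].
    by apply: nO; move: h2; rewrite -apowD (_ : _ + _ = 0)//; lia.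
  have nQ := ltn_ord (tn p.1.1).
  case: hp => hp.
    have [|_ e] := PKd p p' (- j.+1%:Z) x _ hp hj; first by have := ltn_ord j; lia.
    by move: e; lia.
  have hj' : PK p' ((x^^(- (tn p.1.1).+1%:Z))^^((tn p.1.1).+1%:Z - j.+1%:Z)).
    by rewrite -apowD (_ : _ + _ = - j.+1%:Z)//; lia.
  have [|pp e] := PKd p p' _ _ _ hp hj'; first by have := ltn_ord j; lia.
  by case: (offset0 e) => ej; rewrite -pp -ej ltnn in jn.
have oreg i : open (region' i).
  have : open (N i `&` [set x | forall p, [set x | ti p.1.1 != i -> ~ PK p x] x]).
    apply: openI => //; apply: open_forallI => p; case: (eqVneq (ti p.1.1) i) => [pi|pi].
      by move: (@openT X); congr open; apply/seteqP; split => x.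
    have : open (~` PK p) by apply: closed_openC; have [] := PKc p.
    by congr open; apply/seteqP; split => x => [h _|/(_ isT)].
  by congr open; apply/seteqP; split => x [].
have creg x : setT x -> exists i, region' i x.
  move=> _; have [[p px]|no] := pselect (exists p, PK p x).
    exists (ti p.1.1); split; first by have [] := PKT _ _ px.
    move=> p' pp px'; case/eqP: pp; congr (ti _.1.1).
    by have [] := PKd p' p 0 x (leq0n _) px' px.
  have [i Ni] := coverN x; exists i; split => // p _ px; apply: no; by exists p.
have [u [S uS]] := part_unity_ex R cX hX closedT oreg creg.
have [q [eq [cq eq0 qA qC qcnt]]] := rarely_half R cX hX minX infX dimX (M + M).+1 clAq clCq ACq.
have clS i : closed (S i) by have [_ _ h _ _] := uS; have [] := h i.
have Sreg i x : S i x -> ~ (~` region' i) x.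
  by have [_ _ h _ _] := uS; have [_ h'] := h i => /h' ? ?.
have [g gP] := @choice _ _ (fun i (g : (X -> R) * R) => [/\ continuous g.1, 0 < g.2,
    forall x, S i x -> g.1 x = 1, forall x, (~` region' i) x -> g.1 x = 0 &
    forall x, (cnt (fun t : 'I_(M + M).+1 => `|g.1 (x^^t) - 2^-1| <= g.2)%R <= d)%N])
  (fun i => let: ex_intro g (ex_intro e h) := rarely_half R cX hX minX infX dimX (M + M).+1 (clS i)
    (open_closedC (oreg i)) (Sreg i) in ex_intro _ (g, e) h).
have [e1 [e10 e1le]] := uniform_positive (I := option 'I_m) (e := fun o => if o is Some i then (g i).2 else eq)
  (fun o => match o with Some i => let: And5 _ h _ _ _ := gP i in h | None => eq0 end).
pose e := Num.min e1 1 / 16.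
have e1m : 0 < Num.min e1 1 by rewrite lt_min e10 ltr01.
have e0 : 0 < e by rewrite divr_gt0.
have [e16 e4] : 16 * e <= 1 /\ 4 * e <= e1.
  have h1 : Num.min e1 1 <= 1 by rewrite ge_min lexx orbT.
  have h2 : Num.min e1 1 <= e1 by rewrite ge_min lexx.
  by rewrite /e; split; lra.
pose gg i := (g i).1.
have cgg i : continuous (gg i) by have [] := gP i.
pose L := unclear alpha q gg Q (3 * e).
pose Lp : set X := [set x | exists w, `|signal alpha q gg (Q := Q) w x - 2^-1| < 4 * e].
have csig w : continuous (fun x => `|signal alpha q gg (Q := Q) w x - 2^-1|).
  apply: contAbs; apply: contB; last exact: contCst.
  case: w => [j|i] /=; last exact: cgg.
  by move=> x; apply: (@continuous_comp _ _ _ (homeo_pow alpha j) q); [exact: apow_cont|exact: cq].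
have clL : closed L by apply: closed_existsI => w; exact: closed_le.
have oLp : open Lp by apply: open_existsI => w; exact: open_lt.
have LLp : L `<=` Lp by move=> x [w hw]; exists w; apply: le_lt_trans hw _; rewrite ltr_pM2r// ltr_nat.
have LpD x : (cnt (fun j : 'I_(M + M).+1 => Lp (x^^(j%:Z - M%:Z))) <= D)%N.
  have h1 : (cnt (fun w : 'I_Q.+1 + 'I_m => True) <= Q.+1 + m)%N.
    by apply: leq_trans (max_card _) _; rewrite card_sum !card_ord.
  have h2 (w : 'I_Q.+1 + 'I_m) : True ->
     (cnt (fun j : 'I_(M + M).+1 => `|signal alpha q gg w (x^^(j%:Z - M%:Z)) - 2^-1| < 4 * e)%R <= d)%N.
    move=> _; case: w => [l|i].
      apply: leq_trans (qcnt (x^^(l%:Z - M%:Z))); apply: cnt_sub => j h.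
      apply: le_trans (e1le None); apply: ltW; apply: lt_le_trans e4.
      by move: h; rewrite /signal -!apowD; congr (`|q (_^^_) - _| < _); lia.
    have [_ _ _ _ hc] := gP i; apply: leq_trans (hc (x^^(- M%:Z))); apply: cnt_sub => j h.
    apply: le_trans (e1le (Some i)); apply: ltW; apply: lt_le_trans e4.
    by move: h; rewrite /signal -!apowD /gg.
  apply: leq_trans (cnt_ex h1 h2); apply: cnt_sub => j [w hw]; by exists w.
have Uex x : exists U : set X, [/\ open U, U x & forall p, exists n,
    [/\ (absz n <= T0)%N, Sh n U & forall y, U y -> P p (y^^n)]].
  have [W WP] := @choice _ _ (fun p (W : int * set X) => [/\ (absz W.1 <= T0)%N, Sh W.1 W.2, open W.2, W.2 x &
      forall y, W.2 y -> P p (y^^W.1)]) (fun p =>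
    let: ex_intro n (And3 h1 h2 h3) := escape x (T1 p) (T2 p) in
    let: ex_intro U (And3 k1 k2 k3) := Sh_ex h3 in
    ex_intro _ (n, U `&` [set y | P p (y^^n)]) (And5 h1 (Sh_sub k3 (@subIsetl _ _ _))
      (openI k1 (open_pre alpha n (PP p).1)) (conj k2 h2) (fun y => @proj2 _ _))).
  exists [set y | forall p, (W p).2 y]; split.
  - by apply: open_forallI => p; have [] := WP p.
  - by move=> p; have [] := WP p.
  - move=> p; have [h1 h2 _ _ h5] := WP p; exists (W p).1; split => // [|y /(_ p) /h5//].
    by apply: Sh_sub h2 _ => y; exact.
have [U UP] := @choice _ _ (fun x (U : set X) => [/\ open U, U x & forall p, exists n,
    [/\ (absz n <= T0)%N, Sh n U & forall y, U y -> P p (y^^n)]]) Uex.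
have [|nn [uu [ouu cuu]]] := @fin_cover X cX setT X U closedT.
  by move=> x _; exists x; have [] := UP x.
have [E [t [SE [col [ct t0 SEP tS [t1 tsep]]]]]] := sparse_colouring R cX hX minX infX dimX clL oLp LLp LpD
  (U := fun i => U (uu i)) ouu (fun x => cuu x Logic.I).
have tsh i p : exists n, [/\ (absz n <= T0)%N, Sh n (SE i) & forall x, SE i x -> P p (x^^n)].
  have [x Sx] : exists x, SE i `<=` U x.
    have [ne|/set0P/negP/negPn/eqP ->] := pselect (SE i !=set0); last by exists y0.
    by have [_ h] := SEP i; have [j hj] := h ne; exists (uu j).
  have [_ _ h] := UP x; have [n [h1 h2 h3]] := h p; exists n; split => //; first exact: Sh_sub h2 Sx.
  by move=> y /Sx; exact: h3.
refine (levels_castle oA0 clC1 YA0 A0A OC CB vis oN NP (P := P) (PK := PK) (kap := kap) (T := T0) (q := q)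
  (g := gg) (u := u) (S := S) (e := e) (E := E) (t := t) (SE := SE) (col := col) _ PKT PKd ckap kap01 kapP
  cq _ _ _ _ uS cgg _ _ e0 e16 ct t0 tS t1 tsep tsh).
- by move=> p; have [] := PKc p.
- by move=> x Ax; apply: qA; left.
- by move=> x nO; apply: qC; left.
- move=> p x px; split; apply: qA; right; exists p; first by left.
  by right; rewrite apowK.
- move=> p x j px jn; apply: qC; right.
  have jQ : (j < Q)%N := ltn_trans jn (ltn_ord _).
  by exists (p, Ordinal jQ); split => //; rewrite apowK.
- by move=> i x Sx; have [_ _ h _ _] := gP i; exact: h.
- by move=> i x nx; have [_ _ _ h _] := gP i; exact: h.
Qed.

End Construction.
End Castles.

(** * Moving the remainder into the towers *)

Section Rows.
Variables (R : realType) (X : topologicalType) (cX : compact [set: X]).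
Variables (V : line_bundle R X) (alpha : homeo X) (Y : set X).
Local Notation A := (CX R cX).
Local Notation EV := (EY cX V alpha Y).
Variables (O : cstarAlgType R) (pi : A -> O) (tau : EV -> O).
Hypothesis cov : covariant_rep pi tau.
Hypothesis gen : cstar_generates (range pi `|` range tau).
Local Notation "x '^^' n" := (homeo_pow alpha n x) (at level 30, format "x ^^ n").
Local Notation Hom := (Hom pi tau).
Let pi_hom : star_hom pi := rep_hom cov.
Let e1 := pi (CX1 R cX).
Let mul1O a : cmul e1 a = a := (unit_O cov gen a).1.
Let mulO1 a : cmul a e1 = a := (unit_O cov gen a).2.

Variables (k : nat) (k0 : (0 < k)%N) (I : finType).
Variables (N : 'I_k -> I -> int) (sg : 'I_k -> I -> X -> R[i]) (a : 'I_k -> I -> O) (W : I -> X -> R).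
Hypotheses (aH : forall i c, Hom (N i c) (sg i c) (a i c))
  (sgW : forall i c y, nrm (sg i c y) ^+ 2 = W c y)
  (inj : forall i i' c c' y y', sg i c y != 0 -> sg i' c' y' != 0 ->
     y^^(N i c) = y'^^(N i' c') -> i = i' /\ c = c').
Variables (r s1 : X -> R) (cr : continuous r) (cs1 : continuous s1).
Hypotheses (r01 : forall x, 0 <= r x <= 1)
  (W1 : forall y, r y != 0 -> \sum_c W c y = 1) (W_le : forall y, \sum_c W c y <= 1)
  (tgt : forall i c y, sg i c y != 0 -> r (y^^(N i c)) = 0 /\ s1 (y^^(N i c)) = i.+1%:R / k%:R)
  (s1r : forall y, r y != 0 -> s1 y = 0).

Definition row i := \sum_c a i c.
Definition rowv (i : 'I_k.+1) : O := if unlift ord0 i is Some j then row j else e1.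

Let D : set X := [set x | r x != 0].

Let offD (f : A) x : vanish_off D f -> r x = 0 -> cev f x = 0.
Proof. by move=> fD rx; apply: fD; rewrite /D /= rx eqxx. Qed.

Let cross i i' c c' : ~ (i = i' /\ c = c') -> cmul (cstar (a i c)) (a i' c') = 0.
Proof.
move=> ne; apply: (Hom_zero cov (Hom_mul cov (Hom_star cov (aH i c)) (aH i' c'))) => x.
have [->|sj] := eqVneq (sg i' c' x) 0; first by rewrite mulr0.
have [->|si] := eqVneq (sg i c ((x^^(N i' c'))^^(- N i c))) 0; first by rewrite cj0 mul0r.
by case: ne; apply: (inj si sj); rewrite apowNK.
Qed.

Let e1_star : cstar e1 = e1.
Proof.
rewrite /e1; have [_ _ <-] := pi_hom; congr pi; apply: CXP => x.
by rewrite cevS /CX1 /cstC mkCE rmorph1.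
Qed.

Let row_gram i i' : cmul (cstar (row i)) (row i') = if i == i' then \sum_c cmul (cstar (a i c)) (a i c) else 0.
Proof.
rewrite /row cstar_sum cmul_suml; have [<-|ii] := eqVneq i i'.
  apply: eq_bigr => c _; rewrite cmul_sumr (bigD1 c)//= big1 ?addr0// => c' cc.
  by apply: cross => -[_ h]; rewrite h eqxx in cc.
rewrite big1// => c _; rewrite cmul_sumr big1// => c' _.
by apply: cross => -[h _]; rewrite h eqxx in ii.
Qed.

Let gram_Hom i : Hom 0 (fun x => (\sum_c W c x)%:C) (cmul (cstar (row i)) (row i)).
Proof.
rewrite row_gram eqxx.
have h : Hom 0 (fun x => \sum_c (W c x)%:C) (\sum_c cmul (cstar (a i c)) (a i c)).
  apply: (Hom_sum cov) => c _.
  apply: (HomE (Hom_mul cov (Hom_star cov (aH i c)) (aH i c))) => [|x|//]; first by rewrite addNr.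
  by rewrite apowK cj_mul_nrm sgW.
by apply: (HomE h) => // x; rewrite rmorph_sum.
Qed.

Lemma row_le i : nrm (row i) <= 1.
Proof.
apply: (Hom_row_orth cov (aH i)) => // [c c' x x' sx sx' xx|x].
  by have [] := inj sx sx' xx.
by rewrite expr1n; under eq_bigr do rewrite sgW; exact: W_le.
Qed.

Lemma rowv_le i : nrm (rowv i) <= 1.
Proof. by rewrite /rowv; case: unliftP => [j _|_]; [exact: row_le|exact: (e1_le cov)]. Qed.

Lemma rowv0 : rowv ord0 = e1.
Proof. by rewrite /rowv unlift_none. Qed.

Let row_left i (f : A) : vanish_off D f -> cmul (pi f) (row i) = 0.
Proof.
move=> fD; rewrite /row cmul_sumr big1// => c _.
apply: (Hom_zero cov (Hom_mul cov (Hom_pi pi tau f) (aH i c))) => x.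
have [->|sx] := eqVneq (sg i c x) 0; first by rewrite mulr0.
by rewrite (offD fD) ?mul0r//; have [] := tgt sx.
Qed.

Let vanishS (f : A) : vanish_off D f -> vanish_off D (cstar f).
Proof. by move=> fD x /fD h; rewrite cevS ?cj_conj h cj0. Qed.

Lemma rowv_orth i j (f g : A) : vanish_off D f -> vanish_off D g ->
  cmul (cmul (pi f) (cstar (rowv i))) (cmul (rowv j) (pi g)) = if i == j then pi (cmul f g) else 0.
Proof.
move=> fD gD; rewrite /rowv; have [lin mulh _] := pi_hom.
case: unliftP => [i' ->|->]; case: unliftP => [j' ->|->].
- rewrite (inj_eq (@lift_inj _ _)) -cmulA [cmul (cstar _) _]cmulA row_gram.
  have [ij|_] := eqVneq i' j'; last by rewrite cmul0l cmul0r.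
  subst j'.
  have := gram_Hom i'; rewrite row_gram eqxx => h.
  apply: (Hom_eq cov (Hom_mul cov (Hom_pi pi tau f) (Hom_mul cov h (Hom_pi pi tau g)))).
    exact: (HomE (Hom_pi pi tau (cmul f g))).
  move=> x; rewrite !apow0 cevM; have [r0|rx] := eqVneq (r x) 0.
    by rewrite (offD gD r0) !mulr0.
  by rewrite W1// mul1r.
- have -> : (lift ord0 i' == ord0 :> 'I_k.+1) = false by rewrite eq_sym; apply/negbTE; exact: neq_lift.
  have [_ _ starh] := pi_hom; rewrite mul1O -cmulA.
  have -> : cmul (cstar (row i')) (pi g) = 0.
    by rewrite -[pi g]cstarK -cstarM -starh row_left ?cstar0//; exact: vanishS.
  by rewrite cmul0r.
- have -> : (ord0 == lift ord0 j' :> 'I_k.+1) = false by apply/negbTE; exact: neq_lift.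
  by rewrite e1_star mulO1 cmulA row_left// cmul0l.
- by rewrite eqxx e1_star mulO1 mul1O mulh.
Qed.

Lemma rowv_s i (f : A) : vanish_off D f ->
  cmul (pi (rC cX cs1)) (cmul (rowv i) (pi f)) = (i%:R / k%:R)%:C *: cmul (rowv i) (pi f).
Proof.
move=> fD; have [lin mulh _] := pi_hom; rewrite /rowv; case: unliftP => [j ->|->]; last first.
  rewrite mul1O mul0r scale0r -mulh -(is_linear0 lin); congr pi; apply: CXP => x.
  rewrite cevM /rC mkCE cev0; have [r0|rx] := eqVneq (r x) 0; first by rewrite (offD fD r0) mulr0.
  by rewrite s1r// mul0r.
rewrite /row cmul_suml cmul_sumr scaler_sumr; apply: eq_bigr => c _.
have h := Hom_mul cov (aH j c) (Hom_pi pi tau f).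
apply: (Hom_eq cov (Hom_mul cov (Hom_pi pi tau (rC cX cs1)) h)).
  apply: (HomE (Hom_scale cov ((lift ord0 j)%:R / k%:R)%:C h)) => //; by rewrite add0r.
move=> x; rewrite !apow0 !addr0; have [->|sx] := eqVneq (sg j c x) 0; first by rewrite !mul0r !mulr0.
by have [_ s1x] := tgt sx; rewrite /rC mkCE s1x.
Qed.

Definition rotor : O := absorb pi cr rowv.

Let r0 x : 0 <= r x. Proof. by have /andP[] := r01 x. Qed.
Let r1 x : r x <= 1. Proof. by have /andP[] := r01 x. Qed.

Lemma rot_le1 (l : R) (i j : 'I_k.+1) : 0 <= l -> l <= 1 -> `|rot k l i j| <= 1.
Proof.
move=> l0 l1; have := rot_orth l0 l1 (leq_ord j) (leq_ord j).
rewrite eqxx (bigD1 i)//= => h.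
rewrite -(@ler_pXn2r _ 2)// ?nnegrE// expr1n -normrX ger0_norm ?sqr_ge0// expr2.
have h' : 0 <= \sum_(m < k.+1 | m != i) rot k l m j * rot k l m j.
  by apply: sumr_ge0 => m _; rewrite -expr2 sqr_ge0.
by move: h h'; lra.
Qed.

(** Functions of the remainder commute with b exactly, since the remainder is constant along
    b; each of the (k+1)^2 terms of the rotor then contributes the commutators with two
    rows. *)
Lemma rotor_comm n s b (dl : R) : Hom n s b -> 0 <= dl ->
  (forall x, s x != 0 -> r (x^^n) = r x) ->
  (forall i, nrm (cmul b (row i) - cmul (row i) b) <= dl) ->
  (forall i, nrm (cmul b (cstar (row i)) - cmul (cstar (row i)) b) <= dl) ->
  nrm (cmul b rotor - cmul rotor b) <= (k.+1 * k.+1)%:R * (4 * dl).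
Proof.
move=> hb dl0 rn c1 c2; rewrite /rotor /absorb /Jmap.
have cw (i j : 'I_k.+1) : cmul b (pi (absorb_mx cX cr i j)) = cmul (pi (absorb_mx cX cr i j)) b.
  apply: (Hom_eq cov (Hom_mul cov hb (Hom_pi pi tau _))).
    by apply: (HomE (Hom_mul cov (Hom_pi pi tau (absorb_mx cX cr i j)) hb)) => //; rewrite add0r addr0.
  move=> x; rewrite apow0; have [->|sx] := eqVneq (s x) 0; first by rewrite mul0r mulr0.
  by rewrite mulrC /absorb_mx /rC !mkCE rn.
have cv i : nrm (cmul b (rowv i) - cmul (rowv i) b) <= dl.
  by rewrite /rowv; case: unliftP => [j _|_]; [exact: c1|rewrite mul1O mulO1 subrr nrm0].
have cvs i : nrm (cmul b (cstar (rowv i)) - cmul (cstar (rowv i)) b) <= dl.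
  by rewrite /rowv; case: unliftP => [j _|_]; [exact: c2|rewrite e1_star mul1O mulO1 subrr nrm0].
have wle (i j : 'I_k.+1) : nrm (pi (absorb_mx cX cr i j)) <= 2.
  apply: le_trans (pi_le pi_hom _) _; apply: nrm_CX_le => // x.
  rewrite /absorb_mx /rC mkCE nrmCR; apply: le_trans (ler_normB _ _) _.
  have := @rot_le1 (r x) i j (r0 x) (r1 x); have : `|(i == j)%:R : R| <= 1 by case: eqP => _; rewrite ?normr1 ?normr0.
  by rewrite -[(i == j :> nat)]/(val i == val j) val_eqE; lra.
rewrite cmulDr cmulDl -/e1 mul1O mulO1 opprD addrACA subrr add0r cmul_sumr cmul_suml -sumrB.
apply: le_trans (nrm_sum _ _ _) _.
apply: le_trans (_ : \sum_(i < k.+1) \sum_(j < k.+1) (4 * dl) <= _); last first.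
  rewrite sumr_const card_ord sumr_const card_ord -mulrnA -[_ *+ (k.+1 * k.+1)]mulr_natl lexx; by [].
apply: ler_sum => i _; rewrite cmul_sumr cmul_suml -sumrB; apply: le_trans (nrm_sum _ _ _) _.
apply: ler_sum => j _; set p := pi _; set v := rowv i; set w := cstar (rowv j).
have -> : cmul b (cmul (cmul v p) w) - cmul (cmul (cmul v p) w) b =
   cmul (cmul (cmul b v - cmul v b) p) w + cmul (cmul v p) (cmul b w - cmul w b).
  rewrite !cmulBl cmulBr !cmulA addrA; congr (_ - _); rewrite -[LHS]addr0 -addrA; congr (_ + _).
  rewrite -[cmul (cmul v b) p]cmulA /p cw !cmulA; by rewrite addNr.
have wn : nrm w <= 1 by rewrite /w nrm_star; exact: rowv_le.
have vn : nrm v <= 1 := rowv_le i.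
apply: le_trans (nrmD _ _) _; rewrite (_ : 4 * dl = dl * 2 * 1 + 1 * 2 * dl); last by ring.
apply: lerD; apply: le_trans (nrm_mul _ _) _; apply: ler_pM; rewrite ?nrm_ge0 ?mulr_ge0//.
- by apply: le_trans (nrm_mul _ _) _; apply: ler_pM; rewrite ?nrm_ge0//; [exact: cv|exact: wle].
- by apply: le_trans (nrm_mul _ _) _; apply: ler_pM; rewrite ?nrm_ge0//; exact: wle.
- exact: cvs.
Qed.

Lemma rotor_unitary : cmul (cstar rotor) rotor = e1 /\ cmul rotor (cstar rotor) = e1.
Proof.
split; first exact: (absorb_unitary_l pi_hom mul1O mulO1 cr r0 r1 rowv_orth).
exact: (absorb_unitary_r pi_hom mul1O mulO1 cr r0 r1 rowv_orth).
Qed.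

Lemma rotor_spec : nrm (cmul (cstar rotor) (cmul (pi (rC cX cs1)) rotor) - (pi (rC cX cs1) + pi (rC cX cr))) <= 3 / k%:R.
Proof.
apply: (absorb_spec pi_hom (pi_le pi_hom) mul1O mulO1 k0 cr r0 r1 _ rowv0 rowv_orth rowv_s).
by apply: CXP => x; rewrite cevS /rC mkCE ?cj_conj cj_real.
Qed.

End Rows.

(** * Coordinates over the bases *)

Section Coordinates.
Variables (R : realType) (X : topologicalType) (cX : compact [set: X]).
Hypothesis hX : hausdorff_space X.
Variables (V : line_bundle R X) (alpha : homeo X) (Y : set X).
Hypothesis clY : closed Y.
Local Notation A := (CX R cX).
Local Notation EV := (EY cX V alpha Y).
Variables (O : cstarAlgType R) (pi : A -> O) (tau : EV -> O).
Hypothesis cov : covariant_rep pi tau.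
Local Notation "x '^^' n" := (homeo_pow alpha n x) (at level 30, format "x ^^ n").
Local Notation Hom := (Hom pi tau).
Local Notation nocross := (nocross alpha).

Lemma Kel_terms B sg a : Kel pi tau B sg a -> exists (G : finType) (n : G -> int) (s : G -> X -> R[i]) (b : G -> O),
  [/\ forall g, Hom (n g) (s g) (b g), forall g x, s g x != 0 -> nocross B (n g) x & a = \sum_g b g].
Proof.
elim => {sg a} [n s a ha hs|sg sg' a b _ [G [n [s [c [h1 h2 ->]]]]] _ [G' [n' [s' [c' [h1' h2' ->]]]]]].
  by exists unit, (fun=> n), (fun=> s), (fun=> a); split => //; rewrite big_const card_unit /= addr0.
exists (G + G')%type, (fun u => match u with inl g => n g | inr g => n' g end),
  (fun u => match u with inl g => s g | inr g => s' g end),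
  (fun u => match u with inl g => c g | inr g => c' g end); split; [by case|by case|].
by rewrite big_sumType.
Qed.

Variables (G : finType) (n : G -> int) (s : G -> X -> R[i]) (a : G -> O) (eta : R).
Hypotheses (aH : forall g, Hom (n g) (s g) (a g)) (eta0 : 0 < eta).

(** In the coordinates nu the coefficients of the a g along segments of length r over N are
    within eta of those at z. *)
Definition good_base (r : nat) (z : X) (N : set X) := exists nu : nat -> X -> R[i],
  [/\ forall (j : nat) x, (j < r)%N -> N x -> nrm (nu j x) = 1,
      forall (j : nat) (f : A), (j < r)%N -> vanish_off N f ->
        exists b, Hom j (fun x => cev f x * nu j x) b &
      forall g (i j : nat) x, (i < r)%N -> (j < r)%N -> i%:Z - j%:Z = n g -> N x ->
        nrm (conjc (nu i x) * s g (x^^j) * nu j x - s g (z^^j)) <= eta].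

Definition good_shift (l : int) (U : set X) := exists th : X -> R[i],
  (forall x, U x -> nrm (th x) = 1) /\
  forall f : A, vanish_off U f -> exists b, Hom l (fun x => cev f x * th x) b.

Lemma good_base_sub r z N N' : good_base r z N -> N' `<=` N -> good_base r z N'.
Proof.
move=> [nu [h1 h2 h3]] NN; exists nu; split.
- by move=> j x jr /NN; exact: h1.
- by move=> j f jr fN; apply: h2 => // x nN; apply: fN => /NN.
- by move=> g i j x ir jr ij /NN; exact: h3.
Qed.

Lemma good_shift_sub l U U' : good_shift l U -> U' `<=` U -> good_shift l U'.
Proof.
move=> [th [h1 h2]] UU; exists th; split=> [x /UU|f fU]; first exact: h1.
by apply: h2 => x nU; apply: fU => /UU.
Qed.

Lemma good_shift_ex l z : nocross Y l z -> exists U, [/\ open U, U z & good_shift l U].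
Proof.
move=> /(local_unit hX clY cov)[U [th [oU Uz _ th1 h]]].
by exists U; split => //; exists th.
Qed.

Lemma good_base_ex r z : (forall j : nat, (j < r)%N -> nocross Y j z) ->
  exists N, [/\ open N, N z & good_base r z N].
Proof.
move=> hz.
have [D DP] := @choice _ _ (fun (j : 'I_r) (D : set X * (X -> R[i])) => [/\ open D.1, D.1 z, D.2 z = 1,
    forall x, D.1 x -> nrm (D.2 x) = 1 &
    forall f : A, vanish_off D.1 f -> exists b, Hom j (fun x => cev f x * D.2 x) b])
  (fun j => let: ex_intro N (ex_intro nu h) := local_unit hX clY cov (hz j (ltn_ord j)) in ex_intro _ (N, nu) h).
pose N1 : set X := [set x | forall j, (D j).1 x].
have oN1 : open N1 by apply: open_forallI => j; have [] := DP j.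
have N1z : N1 z by move=> j; have [] := DP j.
have [|W [S [oW clS zW WS SN]]] := @shrink R X cX hX [set z] N1 (@closed_pt X hX z) oN1; first by move=> _ ->.
have [f [S' [cf f01 f1 [_ S'N] fS']]] := @bump R X cX hX S N1 clS oN1 SN.
pose nu (j : nat) x := if insub j is Some o then (D (o : 'I_r)).2 x else 0.
have nuE (o : 'I_r) x : nu o x = (D o).2 x by rewrite /nu valK.
have vf : vanish_off N1 (rC cX cf) by move=> x nN; rewrite /rC mkCE fS'// => /S'N.
have nuN (j : nat) x : (j < r)%N -> N1 x -> nrm (nu j x) = 1.
  by move=> jr Nx; rewrite (nuE (Ordinal jr)); have [_ _ _ h _] := DP (Ordinal jr); exact: h.
have nuH (j : nat) (h : A) : (j < r)%N -> vanish_off N1 h -> exists b, Hom j (fun x => cev h x * nu j x) b.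
  move=> jr hN; have [_ _ _ _ hD] := DP (Ordinal jr).
  have [|b hb] := hD h; first by move=> x nD; apply: hN => /(_ (Ordinal jr)).
  by exists b; apply: (HomE hb) => // x; rewrite -(nuE (Ordinal jr)).
pose phi (t : G * 'I_r * 'I_r) x : R[i] :=
  conjc ((f x)%:C * nu t.1.2 x) * (s t.1.1 (x^^t.2) * ((f x)%:C * nu t.2 x)).
pose ok (t : G * 'I_r * 'I_r) := t.1.2%:Z - t.2%:Z == n t.1.1.
have cphi t : ok t -> exists c : A, forall x, phi t x = cev c x.
  case: t => [[g i] j] /eqP /= ij.
  have [vi hi] := nuH i _ (ltn_ord i) vf; have [vj hj] := nuH j _ (ltn_ord j) vf.
  have hh := Hom_mul cov (Hom_star cov hi) (Hom_mul cov (aH g) hj).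
  have d0 : - i%:Z + (n g + j%:Z) = 0 by rewrite -ij; lia.
  have h0 := HomE hh d0 (fun x => erefl) erefl.
  have [c [cE _]] := Hom0E cov h0; exists c => x; rewrite -cE /phi.
  have -> : (x^^(n g + j%:Z))^^(- i%:Z) = x by rewrite -apowD d0.
  by rewrite /rC mkCE.
pose close t : set X := [set x | ok t -> nrm (phi t x - phi t z) < eta].
have oc t : open (close t).
  have [o|no] := boolP (ok t); last first.
    by rewrite /close (negbTE no); move: (@openT X); congr open; apply/seteqP; split => x.
  have [c cE] := cphi t o.
  have : open [set x | nrm (cev (c - cstC cX (phi t z)) x) < eta] by apply: open_lt; exact: cont_nrm.
  congr open; apply/funext => x; apply/propext.
  have E : cev (c - cstC cX (phi t z)) x = phi t x - phi t z by rewrite cevB /cstC mkCE -cE.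
  change (nrm (cev (c - cstC cX (phi t z)) x) < eta <-> (ok t -> nrm (phi t x - phi t z) < eta)).
  by rewrite E; split => [h _ //|]; apply.
exists (W `&` [set x | forall t, close t x]); split.
- by apply: openI => //; apply: open_forallI.
- by split; [exact: zW|move=> t _; rewrite subrr nrm0].
exists nu; split.
- by move=> j x jr [Wx _]; apply: nuN => //; apply: SN; exact: WS.
- by move=> j h jr hN; apply: nuH => // x nN; apply: hN => -[Wx _]; apply: nN; apply: SN; exact: WS.
move=> g i j x ir jr ij [Wx cx].
have fW y : W y -> f y = 1 by move=> /WS; exact: f1.
have nuz (l : nat) : (l < r)%N -> nu l z = 1.
  by move=> lr; rewrite (nuE (Ordinal lr)); have [] := DP (Ordinal lr).
have okt : ok (g, Ordinal ir, Ordinal jr) by rewrite /ok /= ij.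
have := cx (g, Ordinal ir, Ordinal jr) okt.
rewrite /phi /= fW// fW; last exact: zW.
by rewrite !mul1r (nuz i ir) (nuz j jr) cj1 mul1r mulr1 mulrA => /ltW.
Qed.

Variables (B : set X) (k : nat).
Variable C : castle R alpha B Y k good_base good_shift.

Lemma castle_towers : exists (h : cT C -> X -> R) (nu : cT C -> nat -> X -> R[i]) (v : cT C -> nat -> O),
  [/\ forall t j, (j < clen t)%N -> Hom j (fun x => (h t x)%:C * nu t j x) (v t j),
      forall t x, cK t x -> h t x = 1,
      forall t (j : nat) x, (j < clen t)%N -> cK t x -> nrm (nu t j x) = 1 &
      forall t g (i j : nat) x, (i < clen t)%N -> (j < clen t)%N -> i%:Z - j%:Z = n g -> cK t x ->
        nrm (conjc (nu t i x) * s g (x^^j) * nu t j x - s g ((cz t)^^j)) <= eta].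
Proof.
have [nu nuP] := @choice _ _ (fun (t : cT C) (nu : nat -> X -> R[i]) =>
  [/\ forall (j : nat) x, (j < clen t)%N -> cN t x -> nrm (nu j x) = 1,
      forall (j : nat) (f : A), (j < clen t)%N -> vanish_off (cN t) f ->
        exists b, Hom j (fun x => cev f x * nu j x) b &
      forall g (i j : nat) x, (i < clen t)%N -> (j < clen t)%N -> i%:Z - j%:Z = n g -> cN t x ->
        nrm (conjc (nu i x) * s g (x^^j) * nu j x - s g ((cz t)^^j)) <= eta]) (fun t => (cTy t).2).
have [h hP] := @choice _ _ (fun (t : cT C) (h : X -> R) => [/\ continuous h, forall x, cK t x -> h x = 1 &
    forall x, ~ cN t x -> h x = 0])
  (fun t => let: conj clK KN := cK_closed t in let: conj oN _ := cTy t in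
    let: ex_intro h (ex_intro S0 (And5 ch _ h1 (conj _ SN) hS)) := @bump R X cX hX _ _ clK oN KN in
    ex_intro _ h (And3 ch h1 (fun x nN => hS x (fun Sx => nN (SN x Sx))))).
have ch t : continuous (h t) by have [] := hP t.
have [v vP] : {v : cT C * nat -> O & forall tj, (tj.2 < clen tj.1)%N ->
    Hom tj.2 (fun x => cev (rC cX (ch tj.1)) x * nu tj.1 tj.2 x) (v tj)}.
  apply: (@choice _ _ (fun (tj : cT C * nat) b => (tj.2 < clen tj.1)%N ->
    Hom tj.2 (fun x => cev (rC cX (ch tj.1)) x * nu tj.1 tj.2 x) b)) => -[t j] /=.
  have [lt|ge] := ltnP j (clen t); last by exists 0.
  have [_ hn _] := nuP t; have [|b hb] := hn j (rC cX (ch t)) lt; last by exists b.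
  by move=> x nN; rewrite /rC mkCE; have [_ _ ->] := hP t.
have KN t x : cK t x -> cN t x by have [_ h'] := cK_closed t; exact: h'.
exists h, nu, (fun t j => v (t, j)); split.
- move=> t j jr; apply: (HomE (vP (t, j) jr)) => // x.
- by move=> t x Kx; have [_ -> //] := hP t.
- by move=> t j x jr /KN; have [h1 _ _] := nuP t; exact: h1.
- by move=> t g i j x ir jr ij /KN; have [_ _ h1] := nuP t; exact: h1.
Qed.

Lemma castle_shifts : exists (th : 'I_k -> cJ C -> X -> R[i]) (b : 'I_k -> cJ C -> O),
  (forall i c, Hom (csh i c) (fun x => (Num.sqrt (cw c x))%:C * th i c x) (b i c)) /\
  forall i c x, cw c x != 0 -> nrm (th i c x) = 1.
Proof.
have [F FP] : {F : 'I_k * cJ C -> (X -> R[i]) * O & forall ic,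
    Hom (csh ic.1 ic.2) (fun x => (Num.sqrt (cw ic.2 x))%:C * (F ic).1 x) (F ic).2 /\
    forall x, cw ic.2 x != 0 -> nrm ((F ic).1 x) = 1}.
  apply: (@choice _ _ (fun (ic : 'I_k * cJ C) (F : (X -> R[i]) * O) =>
    Hom (csh ic.1 ic.2) (fun x => (Num.sqrt (cw ic.2 x))%:C * F.1 x) F.2 /\
    forall x, cw ic.2 x != 0 -> nrm (F.1 x) = 1)) => -[i c] /=.
  have [U [[th [th1 hth]] wU]] := cSh i c.
  have [|b hb] := hth (rC cX (contSqrt (@cw_cont _ _ _ _ _ _ _ _ C c))).
    move=> x nU; rewrite /rC mkCE (_ : cw c x = 0) ?sqrtr0//; apply: contrapT => /eqP wx.
    by apply: nU; exact: wU.
  by exists (th, b); split=> [|x /wU]; [exact: hb|exact: th1].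
exists (fun i c => (F (i, c)).1), (fun i c => (F (i, c)).2).
by split => i c; have [h1 h2] := FP (i, c).
Qed.

End Coordinates.

(** * One approximation *)

Section Approximation.
Variables (R : realType) (X : topologicalType) (cX : compact [set: X]).
Variables (V : line_bundle R X) (alpha : homeo X) (Y : set X).
Local Notation A := (CX R cX).
Local Notation EV := (EY cX V alpha Y).
Variables (O : cstarAlgType R) (pi : A -> O) (tau : EV -> O).
Hypothesis cov : covariant_rep pi tau.
Hypothesis gen : cstar_generates (range pi `|` range tau).
Local Notation "x '^^' n" := (homeo_pow alpha n x) (at level 30, format "x ^^ n").
Local Notation Hom := (Hom pi tau).
Local Notation nocross := (nocross alpha).

Variables (G : finType) (n : G -> int) (s : G -> X -> R[i]) (a : G -> O) (eta : R).
Hypotheses (aH : forall g, Hom (n g) (s g) (a g)) (eta0 : 0 < eta).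
Variables (B : set X) (k : nat).
Hypotheses (k0 : (0 < k)%N) (snc : forall g x, s g x != 0 -> nocross B (n g) x).
Hypothesis star_closed : forall g, exists g', a g' = cstar (a g).
Variable C : castle R alpha B Y k (good_base pi tau n s eta) (good_shift pi tau).
Variables (h : cT C -> X -> R) (nu : cT C -> nat -> X -> R[i]) (v : cT C -> nat -> O).
Hypotheses (vH : forall t j, (j < clen t)%N -> Hom j (fun x => (h t x)%:C * nu t j x) (v t j))
  (hK : forall t x, cK t x -> h t x = 1)
  (nu1 : forall t (j : nat) x, (j < clen t)%N -> cK t x -> nrm (nu t j x) = 1)
  (close : forall t g (i j : nat) x, (i < clen t)%N -> (j < clen t)%N -> i%:Z - j%:Z = n g -> cK t x ->
     nrm (conjc (nu t i x) * s g (x^^j) * nu t j x - s g ((cz t)^^j)) <= eta).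
Variables (th : 'I_k -> cJ C -> X -> R[i]) (b : 'I_k -> cJ C -> O).
Hypotheses (bH : forall i c, Hom (csh i c) (fun x => (Num.sqrt (cw c x))%:C * th i c x) (b i c))
  (th1 : forall i c x, cw c x != 0 -> nrm (th i c x) = 1).

Local Notation Q := (cQ C).
Local Notation chi := (@cchi _ _ _ _ _ _ _ _ C).
Local Notation chih := (@cchih _ _ _ _ _ _ _ _ C).
Local Notation kap := (@ckap _ _ _ _ _ _ _ _ C).
Local Notation live := (@clive _ _ _ _ _ _ _ _ C).

Lemma live_fwd t x g (j : nat) : live t x -> (j < clen t)%N -> s g (x^^j) != 0 ->
  exists i : nat, (i < clen t)%N /\ i%:Z - j%:Z = n g.
Proof.
move=> [_ Bx Bl] jr /snc nc.
have up : j%:Z + n g < (clen t)%:Z.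
  rewrite ltNge; apply/negP => le; apply: (nc ((clen t)%:Z - j%:Z)); first by apply/orP; left; lia.
  by rewrite -apowD subrK.
have low : 0 <= j%:Z + n g.
  rewrite leNgt; apply/negP => lt; apply: (nc (- j%:Z)); first by apply/orP; right; lia.
  by rewrite -apowD addNr apow0.
by exists (absz (j%:Z + n g)); split; lia.
Qed.

Lemma live_bwd t x g (i : nat) : live t x -> (i < clen t)%N -> s g (x^^(i%:Z - n g)) != 0 ->
  exists j : nat, (j < clen t)%N /\ i%:Z - j%:Z = n g.
Proof.
move=> [_ Bx Bl] ir /snc nc.
have up : i%:Z - n g < (clen t)%:Z.
  rewrite ltNge; apply/negP => le; apply: (nc ((clen t)%:Z - (i%:Z - n g))); first by apply/orP; right; lia.
  by rewrite -apowD subrK.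
have low : 0 <= i%:Z - n g.
  rewrite leNgt; apply/negP => lt; apply: (nc (- (i%:Z - n g))); first by apply/orP; left; lia.
  by rewrite -apowD addNr apow0.
by exists (absz (i%:Z - n g)); split; lia.
Qed.

(** The first copy takes the part of the unit that is left fixed, the second one the levels
    i / k, which absorb the remainder; the two copies are the two summands of the
    finite-dimensional algebra. *)
Definition tower2 : finType := (cT C * bool)%type.
Definition len2 (t : tower2) := clen t.1.
Definition pt2 (t : tower2) := cz t.1.
Definition frame2 (t : tower2) := v t.1.
Definition level (c : bool) (t : cT C) x :=
  if c then kap x * chih t x else chi t x - kap x * chih t x.
Definition mu2 (c : bool) (t : tower2) x := if t.2 == c then level c t.1 x else 0.

Let kc01 t x : 0 <= kap x * chih t x <= chi t x.
Proof.
have /andP[k1 k2] := ckap01 C x; have [/andP[c0 c1] /andP[d0 d1]] := cchi01 t x.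
rewrite mulr_ge0//=; have [->|hx] := eqVneq (chih t x) 0; first by rewrite mulr0.
by rewrite (cchih1 hx) mulr_ile1.
Qed.

Lemma level01 c t x : 0 <= level c t x <= 1.
Proof.
have /andP[k1 k2] := kc01 t x; have [/andP[c0 c1] _] := cchi01 t x.
by rewrite /level; case: c; apply/andP; split; lra.
Qed.

Lemma level_chi c t x : level c t x != 0 -> chi t x != 0.
Proof.
apply: contra_neq => c0; have /andP[k1 k2] := kc01 t x; rewrite c0 in k2.
by rewrite /level c0; case: c; lra.
Qed.

Lemma cont_level c t : continuous (level c t).
Proof.
have [c1 c2] := cchi_cont t; have ck := @ckap_cont _ _ _ _ _ _ _ _ C.
have ckh : continuous (fun x => kap x * chih t x) by apply: contM.
by rewrite /level; case: c => //; apply: contB.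
Qed.

Lemma cont_mu2 c t : continuous (mu2 c t).
Proof. by rewrite /mu2; case: eqP => _; [exact: cont_level|exact: contCst]. Qed.

Lemma mu201 c t x : 0 <= mu2 c t x <= 1.
Proof. by rewrite /mu2; case: ifP => _; [exact: level01|rewrite lexx ler01]. Qed.

Lemma mu2_chi c t x : mu2 c t x != 0 -> t.2 = c /\ chi t.1 x != 0.
Proof.
by rewrite /mu2; have [tc|_] := eqVneq t.2 c; [move=> /level_chi|rewrite eqxx].
Qed.

Lemma mu2_live c t x : mu2 c t x != 0 -> live t.1 x.
Proof. by move=> /mu2_chi[_]; exact: cchi_live. Qed.

Lemma mu2K c t x : mu2 c t x != 0 -> cK t.1 x.
Proof. by move=> /mu2_live[]. Qed.

Lemma mu2_disj c (t t' : tower2) (j j' : nat) x x' : (j < len2 t)%N -> (j' < len2 t')%N ->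
  mu2 c t x != 0 -> mu2 c t' x' != 0 -> x^^j = x'^^j' -> t = t' /\ j = j'.
Proof.
move=> jr jr' /mu2_chi[tc cx] /mu2_chi[tc' cx'] xx.
have [tt jj] := cchi_disj jr jr' cx cx' xx; split => //.
by move: tt tc tc'; case: (t) => t1 t2; case: (t') => t3 t4 /= -> -> ->.
Qed.

(** The part of the unit carried by each colour, and the remainder. *)
Definition share c := twt alpha Q len2 (mu2 c).
Definition remainder y := 1 - share false y - share true y.

Let ind (F : cT C -> X -> R) y := \sum_t \sum_(j < Q | (j < clen t)%N) F t (y^^(- j%:Z)).

Let shareE c y : share c y = ind (level c) y.
Proof.
pose F (p : tower2 * 'I_Q) := mu2 c p.1 (y^^(- p.2%:Z)).
rewrite /share /twt -(@sum_sub _ _ (fun p : tower2 * 'I_Q => (p.2 < len2 p.1)%N) F).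
rewrite -(pair_big_dep predT (fun (t : tower2) (j : 'I_Q) => (j < len2 t)%N) (fun t j => mu2 c t (y^^(- j%:Z))))/=.
rewrite sum_pair; apply: eq_bigr => t _; rewrite (bigD1 c)//= [X in _ + X]big1 ?addr0 => [|c' cc].
  by apply: eq_bigr => j _; rewrite /mu2 /= eqxx.
by apply: big1 => j _; rewrite /mu2 /= (negbTE cc).
Qed.

Let ctotE y : ctot C y = ind chi y. Proof. by []. Qed.

Let ind_at F t (j : nat) y : (forall t x, F t x != 0 -> chi t x != 0) -> (j < clen t)%N ->
  chi t (y^^(- j%:Z)) != 0 -> ind F y = F t (y^^(- j%:Z)).
Proof.
move=> Fc jr cy; have jQ : (j < Q)%N := leq_trans jr (clen_le t).
have z t' (j' : 'I_Q) : (j' < clen t')%N -> ~ (t' = t /\ j' = j :> nat) -> F t' (y^^(- j'%:Z)) = 0.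
  move=> jr' ne; apply: contrapT => /eqP Fy; apply: ne.
  by apply: (cchi_disj jr' jr (Fc _ _ Fy) cy); rewrite !apowNK.
rewrite /ind (bigD1 t)//= (bigD1 (Ordinal jQ))//= big1 ?addr0 => [|j' /andP[jr' jj]]; last first.
  by apply: z => // -[_ e]; case/eqP: jj; exact: val_inj.
rewrite big1 ?addr0// => t' tt; apply: big1 => j' jr'; apply: z => // -[e _].
by rewrite e eqxx in tt.
Qed.

Let ind_off F y : (forall t x, F t x != 0 -> chi t x != 0) ->
  (forall t (j : nat), (j < clen t)%N -> chi t (y^^(- j%:Z)) = 0) -> ind F y = 0.
Proof.
move=> Fc no; apply: big1 => t _; apply: big1 => j jr; apply: contrapT => /eqP /Fc.
by rewrite no// eqxx.
Qed.

Let tower_dec y : (exists t (j : nat), (j < clen t)%N /\ chi t (y^^(- j%:Z)) != 0) \/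
  (forall t (j : nat), (j < clen t)%N -> chi t (y^^(- j%:Z)) = 0).
Proof.
have [[t [j h']]|no] := pselect (exists t (j : nat), (j < clen t)%N /\ chi t (y^^(- j%:Z)) != 0).
  by left; exists t, j.
by right => t j jr; apply: contrapT => /eqP cy; apply: no; exists t, j.
Qed.

Let share_at c t (j : nat) y : (j < clen t)%N -> chi t (y^^(- j%:Z)) != 0 ->
  share c y = level c t (y^^(- j%:Z)).
Proof. by rewrite shareE; apply: ind_at; exact: level_chi. Qed.

Let share_off c y : (forall t (j : nat), (j < clen t)%N -> chi t (y^^(- j%:Z)) = 0) -> share c y = 0.
Proof. by rewrite shareE; apply: ind_off; exact: level_chi. Qed.

Lemma remainder_tot y : remainder y = 1 - ctot C y.
Proof.
rewrite /remainder; have [[t [j [jr cy]]]|no] := tower_dec y.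
  rewrite !(share_at _ jr cy) /level ctotE (ind_at (F := chi) _ jr cy)//; ring.
by rewrite !share_off// ctotE (ind_off (F := chi))// !subr0.
Qed.

Lemma remainder01 y : 0 <= remainder y <= 1.
Proof.
rewrite remainder_tot ctotE; have [[t [j [jr cy]]]|no] := tower_dec y; last first.
  by rewrite (ind_off (F := chi))// subr0 lexx ler01.
rewrite (ind_at (F := chi) _ jr cy)//; have [/andP[c0 c1] _] := cchi01 t (y^^(- j%:Z)).
by apply/andP; split; lra.
Qed.

Lemma cont_share c : continuous (share c).
Proof. by apply: cont_twt => t; exact: cont_mu2. Qed.

Lemma cont_remainder : continuous remainder.
Proof. by apply: contB; [apply: contB; [exact: contCst|exact: cont_share]|exact: cont_share]. Qed.

Lemma share_remainder y : remainder y != 0 -> share true y = 0.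
Proof.
rewrite remainder_tot ctotE; have [[t [j [jr cy]]]|no] := tower_dec y; last by rewrite share_off.
rewrite (ind_at (F := chi) _ jr cy)// (share_at _ jr cy) /level.
have [->|hx] := eqVneq (chih t (y^^(- j%:Z))) 0; first by rewrite mulr0.
by rewrite (cchih1 hx) subrr eqxx.
Qed.

Lemma remainder_invariant g y : s g y != 0 -> remainder (y^^(n g)) = remainder y.
Proof.
move=> sy; rewrite !remainder_tot !ctotE; congr (1 - _).
have [[t [j [jr cy]]]|no] := tower_dec y.
  have [|i [ir ij]] := live_fwd (cchi_live cy) jr (g := g); first by rewrite apowNK.
  have yE : (y^^(n g))^^(- i%:Z) = y^^(- j%:Z) by rewrite -apowD; congr (_^^_); lia.
  by rewrite (ind_at (F := chi) _ jr cy)// (ind_at (F := chi) (t := t) (j := i))// yE.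
rewrite (ind_off (F := chi) _ no)//; apply: ind_off => // t i ir; apply: contrapT => /eqP cy.
have [|j [jr ij]] := live_bwd (cchi_live cy) ir (g := g).
  by rewrite -!apowD (_ : _ + _ = 0)//; lia.
have yE : (y^^(n g))^^(- i%:Z) = y^^(- j%:Z) by rewrite -apowD; congr (_^^_); lia.
by rewrite yE no ?eqxx in cy.
Qed.

(** The rows: each piece is carried, level by level, along its target tower. *)
Definition slot : finType := vpos Q (fun c : cJ C => clen (cty c)).
Definition pc (p : slot) : cJ C := (val p).1.
Definition ps (p : slot) : nat := (val p).2.
Let psr p : (ps p < clen (cty (pc p)))%N. Proof. exact: (valP p). Qed.
Definition carry i p : O := cmul (cmul (v (cty (pc p)) (ps p)) (b i (pc p))) (cstar (v (cty (pc p)) (ps p))).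
Definition carry_sym i p y : R[i] :=
  ((h (cty (pc p)) ((y^^(- (ps p)%:Z))^^(csh i (pc p))))%:C *
     nu (cty (pc p)) (ps p) ((y^^(- (ps p)%:Z))^^(csh i (pc p))) *
   ((Num.sqrt (cw (pc p) (y^^(- (ps p)%:Z))))%:C * th i (pc p) (y^^(- (ps p)%:Z)))) *
  conjc ((h (cty (pc p)) (y^^(- (ps p)%:Z)))%:C * nu (cty (pc p)) (ps p) (y^^(- (ps p)%:Z))).

Lemma carry_Hom i p : Hom (csh i (pc p)) (carry_sym i p) (carry i p).
Proof.
have hv := vH (psr p).
apply: (HomE (Hom_mul cov (Hom_mul cov hv (bH i (pc p))) (Hom_star cov hv))) => //.
by rewrite addrAC subrr add0r.
Qed.

Lemma carry_w i p y : carry_sym i p y != 0 -> cw (pc p) (y^^(- (ps p)%:Z)) != 0.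
Proof. by apply: contra_neq => w0; rewrite /carry_sym w0 sqrtr0 mul0r mulr0 mul0r. Qed.

Let carry_live i p y : cw (pc p) (y^^(- (ps p)%:Z)) != 0 ->
  cK (cty (pc p)) (y^^(- (ps p)%:Z)) /\ cK (cty (pc p)) ((y^^(- (ps p)%:Z))^^(csh i (pc p))).
Proof. by move=> wx; have [Kx _ _] := cw_live wx; have [[Kx' _ _] _ _] := ctarget i wx. Qed.

Lemma carry_nrm i p y : nrm (carry_sym i p y) ^+ 2 = cw (pc p) (y^^(- (ps p)%:Z)).
Proof.
have [w0|wx] := eqVneq (cw (pc p) (y^^(- (ps p)%:Z))) 0.
  by rewrite /carry_sym w0 sqrtr0 mul0r mulr0 mul0r nrm0 expr0n.
have [K1 K2] := carry_live i wx; rewrite /carry_sym !hK// !mul1r !nrmCM nrmCJ nrmCR.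
rewrite !(nu1 (psr p))// (th1 _ wx) !mulr1 mul1r ger0_norm ?sqrtr_ge0// sqr_sqrtr//.
exact: cw_ge0.
Qed.

Let target_pos i p y : (y^^(csh i (pc p))) = ((y^^(- (ps p)%:Z))^^(csh i (pc p)))^^(ps p).
Proof. by rewrite -!apowD; congr (_^^_); lia. Qed.

Lemma carry_inj i i' p p' y y' : carry_sym i p y != 0 -> carry_sym i' p' y' != 0 ->
  y^^(csh i (pc p)) = y'^^(csh i' (pc p')) -> i = i' /\ p = p'.
Proof.
move=> /carry_w wx /carry_w wx'; rewrite (target_pos i p) (target_pos i' p') => xx.
have [ii cc jj] := cinj wx wx' (psr p) (psr p') xx; split => //.
apply: val_inj; move: cc jj; rewrite /pc /ps; case: (val p) => c1 j1; case: (val p') => c2 j2 /= -> jj.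
by congr pair; exact: val_inj.
Qed.

Lemma carry_target i p y : carry_sym i p y != 0 ->
  remainder (y^^(csh i (pc p))) = 0 /\ share true (y^^(csh i (pc p))) = i.+1%:R / k%:R.
Proof.
move=> /carry_w wx; have [lx hx kx] := ctarget i wx.
have cx1 : chi (cty (pc p)) ((y^^(- (ps p)%:Z))^^(csh i (pc p))) = 1.
  by apply: cchih1; rewrite hx oner_neq0.
rewrite target_pos; set x := (y^^_)^^_ in hx kx cx1 *.
have cx : chi (cty (pc p)) ((x^^(ps p))^^(- (ps p)%:Z)) != 0 by rewrite apowK cx1 oner_neq0.
rewrite remainder_tot ctotE (ind_at (F := chi) _ (psr p) cx)// (share_at _ (psr p) cx) apowK cx1 subrr.
by rewrite /level hx mulr1 kx.
Qed.

Lemma carry_sum y : \sum_p cw (pc p) (y^^(- (ps p)%:Z)) = cE C y.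
Proof.
pose F (p : cJ C * 'I_Q) := cw p.1 (y^^(- p.2%:Z)).
rewrite /cE -(@sum_sub _ _ (fun p : cJ C * 'I_Q => (p.2 < clen (cty p.1))%N) F).
by rewrite -(pair_big_dep predT (fun (c : cJ C) (j : 'I_Q) => (j < clen (cty c))%N) (fun c j => cw c (y^^(- j%:Z)))).
Qed.

Local Notation Row := (row carry).

(** Moving a source along a g and then into its target tower, or in the other order, ends
    at the same point, with coefficients that are both within eta of the one sampled at
    the base point of the type. Distinct sources have distinct targets, so that the errors
    are orthogonal and do not add up. *)
Lemma row_comm i g : nrm (cmul (a g) (Row i) - cmul (Row i) (a g)) <= 2 * eta.
Proof.
pose nxt (p p' : slot) := (pc p == pc p') && ((ps p')%:Z - (ps p)%:Z == n g).
have nxt_u p p' p'' : nxt p p' -> nxt p p'' -> p' = p''.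
  move=> /andP[/eqP c1 /eqP j1] /andP[/eqP c2 /eqP j2]; apply: val_inj.
  have : ps p' = ps p'' by lia.
  move: c1 c2; rewrite /pc /ps; case: (val p') => ? ?; case: (val p'') => ? ? /= <- <- jj.
  by congr pair; exact: val_inj.
have nxt_u' p p' p'' : nxt p p'' -> nxt p' p'' -> p = p'.
  move=> /andP[/eqP c1 /eqP j1] /andP[/eqP c2 /eqP j2]; apply: val_inj.
  have : ps p = ps p' by lia.
  move: c1 c2; rewrite /pc /ps; case: (val p) => ? ?; case: (val p') => ? ? /= -> -> jj.
  by congr pair; exact: val_inj.
pose T (pp : slot * slot) : O := if nxt pp.1 pp.2 then cmul (a g) (carry i pp.1) - cmul (carry i pp.2) (a g) else 0.
pose S (pp : slot * slot) y : R[i] := if nxt pp.1 pp.2 then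
  s g (y^^(csh i (pc pp.1))) * carry_sym i pp.1 y - carry_sym i pp.2 (y^^(n g)) * s g y else 0.
have TH pp : Hom (n g + csh i (pc pp.1)) (S pp) (T pp).
  rewrite /S /T; case: ifP => [/andP[/eqP cc _]|_]; last exact: (Hom0 cov).
  apply: (Hom_sub cov); first exact: (Hom_mul cov (aH g) (carry_Hom i pp.1)).
  by apply: (HomE (Hom_mul cov (carry_Hom i pp.2) (aH g))) => //; rewrite addrC cc.
have mk p (j : nat) : (j < clen (cty (pc p)))%N -> exists p', pc p' = pc p /\ ps p' = j.
  move=> jr; have jQ : (j < Q)%N := leq_trans jr (clen_le _).
  by exists (exist _ (pc p, Ordinal jQ) jr).
have leftE p : cmul (a g) (carry i p) = \sum_p' if nxt p p' then cmul (a g) (carry i p) else 0.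
  have [[p' np]|no] := pselect (exists p', nxt p p').
    rewrite (bigD1 p')//= np big1 ?addr0// => p'' pp; case: ifP => // np'.
    by rewrite (nxt_u _ _ _ np' np) eqxx in pp.
  rewrite big1 => [|p' _]; last by case: ifP => // np; case: no; exists p'.
  apply: (Hom_zero cov (Hom_mul cov (aH g) (carry_Hom i p))) => y.
  have [->|cy] := eqVneq (carry_sym i p y) 0; first by rewrite mulr0.
  have [->|sy] := eqVneq (s g (y^^(csh i (pc p)))) 0; first by rewrite mul0r.
  rewrite (target_pos i p) in sy; have [lx _ _] := ctarget i (carry_w cy).
  have [j [jr jn]] := live_fwd lx (psr p) sy; have [p' [c1 j1]] := mk p j jr.
  by case: no; exists p'; rewrite /nxt c1 eqxx j1 jn /=.
have rightE p' : cmul (carry i p') (a g) = \sum_p if nxt p p' then cmul (carry i p') (a g) else 0.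
  have [[p np]|no] := pselect (exists p, nxt p p').
    rewrite (bigD1 p)//= np big1 ?addr0// => p'' pp; case: ifP => // np'.
    by rewrite (nxt_u' _ _ _ np' np) eqxx in pp.
  rewrite big1 => [|p _]; last by case: ifP => // np; case: no; exists p.
  apply: (Hom_zero cov (Hom_mul cov (carry_Hom i p') (aH g))) => y.
  have [->|sy] := eqVneq (s g y) 0; first by rewrite mulr0.
  have [->|cy] := eqVneq (carry_sym i p' (y^^(n g))) 0; first by rewrite mul0r.
  have lx := cw_live (carry_w cy).
  have [|j [jr jn]] := live_bwd lx (psr p') (g := g).
    by rewrite -!apowD (_ : _ + _ = 0)//; lia.
  have [p [c1 j1]] := mk p' j jr; case: no; exists p.
  by rewrite /nxt c1 eqxx j1 jn /=.
have -> : cmul (a g) (Row i) - cmul (Row i) (a g) = \sum_pp T pp.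
  rewrite /row cmul_sumr cmul_suml (eq_bigr _ (fun p _ => leftE p)) (eq_bigr _ (fun p _ => rightE p)).
  rewrite [X in _ - X]exchange_big -sumrB sum_pair; apply: eq_bigr => p _; rewrite -sumrB.
  by apply: eq_bigr => p' _; rewrite /T /=; case: ifP => _; rewrite ?subrr.
have close2 p p' y : nxt p p' -> cw (pc p) (y^^(- (ps p)%:Z)) != 0 ->
    nrm (S (p, p') y) <= 2 * eta * Num.sqrt (cw (pc p) (y^^(- (ps p)%:Z))).
  move=> np wx; rewrite /S /= np; move: np => /andP[/eqP cc /eqP jn].
  have [K1 K2] := carry_live i wx; have pr' := psr p'.
  have yE : (y^^(n g))^^(- (ps p')%:Z) = y^^(- (ps p)%:Z) by rewrite -apowD; congr (_^^_); lia.
  rewrite /carry_sym yE -cc (target_pos i p); rewrite -cc in pr'.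
  have yx : y = (y^^(- (ps p)%:Z))^^(ps p) by rewrite apowNK.
  set x := y^^(- (ps p)%:Z) in K1 K2 yx *; set x' := x^^(csh i (pc p)) in K2 *.
  rewrite !hK// !mul1r; have t1 := th1 i wx; rewrite -/x in t1.
  have c1 := close pr' (psr p) jn K1; have c2 := close pr' (psr p) jn K2.
  have e1 := nu1 pr' K1; have e2 := nu1 pr' K2; have e3 := nu1 (psr p) K1; have e4 := nu1 (psr p) K2.
  set u := nu _ (ps p) x in c1 e3 *; set u' := nu _ (ps p') x in c1 e1 *.
  set w := nu _ (ps p) x' in c2 e4 *; set w' := nu _ (ps p') x' in c2 e2 *.
  have f3 : u * conjc u = 1 by rewrite mulrC cj_mul_nrm e3 expr1n.
  have f2 : w' * conjc w' = 1 by rewrite mulrC cj_mul_nrm e2 expr1n.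
  set sq := (Num.sqrt _)%:C; set t := th i (pc p) x in t1 *.
  set s1 := s g _ in c2 *; set s2 := s g _ in c1 *; set z := s g _ in c1 c2.
  have ys : s g y = s2 by rewrite /s2 [in LHS]yx.
  change (nrm (s1 * (w * (sq * t) * conjc u) - w' * (sq * t) * conjc u' * s g y) <= 2 * eta * Num.sqrt (cw (pc p) x)).
  rewrite ys.
  have -> : s1 * (w * (sq * t) * conjc u) - w' * (sq * t) * conjc u' * s2 =
     sq * (t * (w' * conjc u)) * ((conjc w' * s1 * w - z) - (conjc u' * s2 * u - z)).
    rewrite opprB addrA subrK mulrBr; congr (_ - _).
      transitivity ((w' * conjc w') * (s1 * (w * (sq * t) * conjc u))); first by rewrite f2 mul1r.
      by ring.
    transitivity ((u * conjc u) * (w' * (sq * t) * conjc u' * s2)); first by rewrite f3 mul1r.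
    by ring.
  rewrite !nrmCM nrmCJ t1 e2 e3 !mulr1 nrmCR ger0_norm ?sqrtr_ge0// mulrC ler_wpM2r ?sqrtr_ge0//.
  by apply: le_trans (nrmB _ _) _; lra.
have S0 p p' y : S (p, p') y != 0 -> nxt p p' /\ cw (pc p) (y^^(- (ps p)%:Z)) != 0.
  rewrite /S /=; case: ifP => [np|_]; last by rewrite eqxx.
  move=> sy; split => //; apply: contra_neq sy => w0; move: (np) => /andP[/eqP cc /eqP jn].
  have yE : (y^^(n g))^^(- (ps p')%:Z) = y^^(- (ps p)%:Z) by rewrite -apowD; congr (_^^_); lia.
  by rewrite /carry_sym yE -cc w0 sqrtr0 !mul0r !mulr0 !mul0r mulr0 subrr.
apply: (Hom_row_orth cov TH) => [|[p p'] [q q'] x y /S0[np wx] /S0[nq wy] /= xy|y].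
- by rewrite mulr_ge0// ltW.
- have posE (p1 p2 : slot) x1 : nxt p1 p2 -> x1^^(n g + csh i (pc p1)) = ((x1^^(- (ps p1)%:Z))^^(csh i (pc p1)))^^(ps p2).
    by move=> /andP[_ /eqP jn]; rewrite -!apowD; congr (_^^_); lia.
  rewrite (posE p p')// (posE q q')// in xy.
  have pr' := psr p'; have qr' := psr q'.
  move: (np) (nq) => /andP[/eqP cp _] /andP[/eqP cq _]; rewrite -cp in pr'; rewrite -cq in qr'.
  have [_ cc jj] := cinj wx wy pr' qr' xy.
  have pq' : p' = q'.
    have e : pc p' = pc q' by rewrite -cp cc cq.
    apply: val_inj; move: e jj; rewrite /pc /ps; case: (val p') => c1 j1; case: (val q') => c2 j2 /= -> jj.
    by congr pair; exact: val_inj.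
  by subst q'; rewrite (nxt_u' _ _ _ np nq).
rewrite sum_pair; apply: le_trans (_ : \sum_p (2 * eta) ^+ 2 * cw (pc p) (y^^(- (ps p)%:Z)) <= _).
  apply: ler_sum => p _; have w0 := cw_ge0 (pc p) (y^^(- (ps p)%:Z)).
  have bnd0 : 0 <= (2 * eta) ^+ 2 * cw (pc p) (y^^(- (ps p)%:Z)) by rewrite mulr_ge0// sqr_ge0.
  have [[p' sp]|no] := pselect (exists p', S (p, p') y != 0); last first.
    rewrite big1// => p' _; have [->|sp] := eqVneq (S (p, p') y) 0; first by rewrite nrm0 expr0n.
    by case: no; exists p'.
  have [np wx] := S0 _ _ _ sp.
  rewrite (bigD1 p')//= big1 ?addr0 => [|p'' pp]; last first.
    have [->|sp'] := eqVneq (S (p, p'') y) 0; first by rewrite nrm0 expr0n.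
    by have [np' _] := S0 _ _ _ sp'; rewrite (nxt_u _ _ _ np' np) eqxx in pp.
  rewrite -[X in _ * X]sqr_sqrtr// -exprMn; apply: lerXn2r; rewrite ?nnegrE ?nrm_ge0//.
    by rewrite !mulr_ge0 ?sqrtr_ge0// ltW.
  exact: close2.
rewrite -mulr_sumr carry_sum ler_piMr ?sqr_ge0//; exact: cE_le.
Qed.

Let pi_hom : star_hom pi := rep_hom cov.
Let mul1O x : cmul (pi (CX1 R cX)) x = x := (unit_O cov gen x).1.
Let mulO1 x : cmul x (pi (CX1 R cX)) = x := (unit_O cov gen x).2.
Let W_sum y : remainder y != 0 -> \sum_p cw (pc p) (y^^(- (ps p)%:Z)) = 1.
Proof.
by rewrite remainder_tot subr_eq0 eq_sym carry_sum; exact: cE_1.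
Qed.
Let W_le y : \sum_p cw (pc p) (y^^(- (ps p)%:Z)) <= 1.
Proof. by rewrite carry_sum; exact: cE_le. Qed.

Definition turn : O := rotor pi carry cont_remainder.

Let turn_unitary : cmul (cstar turn) turn = pi (CX1 R cX) /\ cmul turn (cstar turn) = pi (CX1 R cX).
Proof.
exact: (rotor_unitary cov gen carry_Hom carry_nrm carry_inj cont_remainder remainder01 W_sum carry_target).
Qed.

Let turn_le : nrm turn <= 1.
Proof.
rewrite -(@ler_pXn2r _ 2)// ?nnegrE ?nrm_ge0// expr1n -nrm_sq turn_unitary.1.
exact: (e1_le cov).
Qed.

Let turn_comm g : nrm (cmul (a g) turn - cmul turn (a g)) <= (k.+1 * k.+1)%:R * (4 * (2 * eta)).
Proof.
apply: (rotor_comm cov gen carry_Hom carry_nrm carry_inj cont_remainder remainder01 W_le (aH g)).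
- by rewrite mulr_ge0// ltW.
- exact: remainder_invariant.
- by move=> i; exact: row_comm.
move=> i; have [g' sg] := star_closed g; have := row_comm i g'.
rewrite -nrm_star cstarB !cstarM sg cstarK nrm_distC; exact.
Qed.

Local Notation F := (bmx R (seg_block Q len2)).
Let vH2 (t : tower2) (j : nat) : (j < len2 t)%N -> Hom j (fun x => (h t.1 x)%:C * nu t.1 j x) (frame2 t j) := @vH t.1 j.
Let hK2 (t : tower2) x : cK t.1 x -> h t.1 x = 1 := @hK t.1 x.
Let nu12 (t : tower2) (j : nat) x : (j < len2 t)%N -> cK t.1 x -> nrm (nu t.1 j x) = 1 := @nu1 t.1 j x.
Let rQ2 (t : tower2) : (len2 t <= Q)%N := clen_le t.1.

Definition piece_map c (m : F) : O := Smap pi frame2 (@cont_mu2 c) m.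
(** The second colour is conjugated by the unitary that moves the remainder into the levels. *)
Definition phi (m : F) : O := piece_map false m + cmul (cstar turn) (cmul (piece_map true m) turn).

Let piece_le c m : nrm (piece_map c m) <= nrm m :=
  Smap_le cov vH2 hK2 nu12 (@cont_mu2 c) (mu201 c) (@mu2K c) (@mu2_disj c) m.

Lemma phi_estimate g : nrm (phi (comp alpha Q pt2 len2 (fun l x => if l == n g then s g x else 0)) - a g) <=
  2 * eta + (k.+1 * k.+1)%:R * (8 * eta) + 3 / k%:R * nrm (a g).
Proof.
set m := comp _ _ _ _ _.
have est c : nrm (piece_map c m - cmul (pi (rC cX (@cont_share c))) (a g)) <= eta.
  have -> : pi (rC cX (@cont_share c)) = pi (rC cX (cont_twt (alpha := alpha) (Q := Q) (r := len2) (@cont_mu2 c))).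
    by congr pi; apply: CXP => x; rewrite /rC !mkCE.
  rewrite /piece_map /m; apply: (Smap_comp (z := pt2) cov vH2 hK2 nu12 rQ2 (@cont_mu2 c) (mu201 c) (@mu2K c) (@mu2_disj c) (aH g) (ltW eta0)).
  - by move=> t x i j mx ir jr ij; apply: close => //; exact: mu2K mx.
  - by move=> t x j mx jr sx; exact: (live_fwd (mu2_live mx) jr sx).
  - by move=> t x i mx ir sx; exact: (live_bwd (mu2_live mx) ir sx).
set p0 := pi (rC cX (@cont_share false)); set p1 := pi (rC cX (@cont_share true)).
set rr := pi (rC cX cont_remainder).
have sum1 : p0 + p1 + rr = pi (CX1 R cX).
  have [lin _ _] := pi_hom; rewrite /p0 /p1 /rr -!(is_linearD _ _ lin); congr pi; apply: CXP => x.
  rewrite !cevD /rC /CX1 /cstC !mkCE -!rmorphD -[RHS](rmorph1 (real_complex R)); congr (_%:C).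
  by rewrite /remainder; ring.
have p1le : nrm p1 <= 1.
  apply: le_trans (pi_le pi_hom _) _; apply: nrm_CX_le => // x; rewrite /rC mkCE nrmCR shareE.
  rewrite -shareE; have [[t [j [jr cy]]]|no] := tower_dec x; last by rewrite share_off// normr0.
  by rewrite (share_at _ jr cy); have /andP[l0 l1] := level01 true t (x^^(- j%:Z)); rewrite ger0_norm.
have sp := rotor_spec cov gen k0 carry_Hom carry_nrm carry_inj cont_remainder (@cont_share true) remainder01 W_sum carry_target share_remainder.
rewrite -/turn -/p1 -/rr in sp.
set S0 := piece_map false m; set S1 := piece_map true m; set U := turn.
have -> : phi m - a g = (S0 - cmul p0 (a g)) + (cmul (cstar U) (cmul (S1 - cmul p1 (a g)) U) +
   (cmul (cstar U) (cmul p1 (cmul (a g) U - cmul U (a g))) +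
    cmul (cmul (cstar U) (cmul p1 U) - (p1 + rr)) (a g))).
  rewrite [cmul (cmul (cstar U) (cmul p1 U) - (p1 + rr)) (a g)]cmulBl !cmulBl !cmulBr -!cmulA.
  set u1 := cmul (cstar U) (cmul S1 U); set u2 := cmul (cstar U) (cmul p1 (cmul (a g) U)).
  set u3 := cmul (cstar U) (cmul p1 (cmul U (a g))).
  rewrite -[u2 - u3 + _]addrA [- u3 + _]addrA addNr add0r -[u1 - u2 + _]addrA [- u2 + _]addrA addNr add0r.
  rewrite -[in LHS](mul1O (a g)) -sum1 -/S0 -/S1 /phi -/S0 -/S1 -/U -/u1 !cmulDl !opprD.
  by rewrite !addrA; congr (_ - _ - _); rewrite -!addrA [u1 + _]addrC.
have Us : nrm (cstar U) <= 1 by rewrite nrm_star.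
have tc := turn_comm g; rewrite -/U in tc.
apply: le_trans (nrmD _ _) _.
rewrite (_ : 2 * eta + _ + _ = eta + (eta + ((k.+1 * k.+1)%:R * (4 * (2 * eta)) + 3 / k%:R * nrm (a g)))); last by ring.
apply: lerD; first exact: est.
apply: le_trans (nrmD _ _) _; apply: lerD.
  apply: le_trans (nrm_mul _ _) _; rewrite -[eta]mul1r; apply: ler_pM; rewrite ?nrm_ge0//.
  apply: le_trans (nrm_mul _ _) _; rewrite -[eta]mulr1; apply: ler_pM; rewrite ?nrm_ge0//; exact: est.
apply: le_trans (nrmD _ _) _; apply: lerD.
  apply: le_trans (nrm_mul _ _) _; rewrite -[leRHS]mul1r; apply: ler_pM; rewrite ?nrm_ge0//.
  by apply: le_trans (nrm_mul _ _) _; rewrite -[leRHS]mul1r; apply: ler_pM; rewrite ?nrm_ge0.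
by apply: le_trans (nrm_mul _ _) _; apply: ler_pM; rewrite ?nrm_ge0.
Qed.

Lemma phi_cp (ps : forall m q (Z : 'I_m -> 'I_q -> O), positive_mx (fun i j => \sum_l cmul (cstar (Z l i)) (Z l j))) :
  completely_positive phi.
Proof.
have lin c : is_linear (piece_map c) := Smap_lin cov frame2 (@cont_mu2 c).
split=> [x y z|q aa [bb ab]].
  rewrite /phi !lin cmulDl cmulDr cmulZl cmulZr scalerDr addrACA; by [].
pose Sq c (m : F) := Ssqrt pi frame2 (@cont_mu2 c) m.
have sqE c x y : piece_map c (cmul (cstar x) y) = cmul (cstar (Sq c x)) (Sq c y).
  exact: (Smap_sqrt cov vH2 hK2 nu12 (@cont_mu2 c) (mu201 c) (@mu2K c) (@mu2_disj c)).
have lsum c (x : 'I_q -> F) : piece_map c (\sum_l x l) = \sum_l piece_map c (x l).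
  elim/big_rec2: _ => [|l y1 y2 _ <-]; first exact: is_linear0.
  exact: is_linearD.
pose Z (l : 'I_(q + q)) (p : 'I_q) := match fintype.split l with inl l0 => Sq false (bb l0 p) | inr l1 => cmul (Sq true (bb l1 p)) turn end.
have := ps _ _ Z; congr positive_mx; apply/funext => i; apply/funext => j.
rewrite big_split_ord ab /phi !lsum; congr (_ + _).
  by apply: eq_bigr => l _; rewrite /Z (unsplitK (inl _ l)) sqE.
rewrite cmul_suml cmul_sumr; apply: eq_bigr => l _; rewrite /Z (unsplitK (inr _ l)) sqE cstarM.
by rewrite !cmulA.
Qed.

Definition colour (p : vpos Q len2) : bool := (val p).1.2.
Definition ideal (c : bool) : set F := [set m | forall p q, colour p != c -> m p q = 0].

Let block_colour p q : seg_block Q len2 p q -> colour p = colour q.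
Proof. by rewrite /colour => /eqP ->. Qed.

Lemma ideal_two_sided c : two_sided_ideal (ideal c).
Proof.
split=> [p q _|r x y hx hy p q pc|x y hy p q pc|x y hy p q pc] /=; first by [].
- by rewrite hx// hy// mulr0 addr0.
- apply: big1 => l _; have [pl|npl] := boolP (seg_block Q len2 p l); last by rewrite bentP// mul0r.
  by rewrite hy ?mulr0// -(block_colour pl).
- by apply: big1 => l _; rewrite hy// mul0r.
Qed.

Let piece0 c c' m : c != c' -> ideal c m -> piece_map c' m = 0.
Proof.
move=> cc hm; rewrite /piece_map /Smap /Jmap big1// => i _; rewrite big1// => j _.
have -> : m i j *: rC cX (@cont_mu2 c' (val i).1) = 0.
  have [ci|ci] := eqVneq (colour i) c; last by rewrite hm// scale0r.
  apply: CXP => x; rewrite cevZ /rC mkCE cev0 /mu2 -/(colour i) ci (negbTE cc) mulr0; by [].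
by have [lin _ _] := pi_hom; rewrite (is_linear0 lin) cmul0r cmul0l.
Qed.

Let turned_le m : nrm (cmul (cstar turn) (cmul (piece_map true m) turn)) <= nrm m.
Proof.
apply: le_trans (nrm_mul _ _) _; rewrite nrm_star; apply: le_trans (ler_piMl (nrm_ge0 _) turn_le) _.
apply: le_trans (nrm_mul _ _) _; apply: le_trans (ler_piMr (nrm_ge0 _) turn_le) _; exact: piece_le.
Qed.

Lemma phi_le m : nrm (phi m) <= 2 * nrm m.
Proof.
rewrite mulr_natl mulr2n; apply: le_trans (nrmD _ _) _; apply: lerD; first exact: piece_le.
exact: turned_le.
Qed.

Lemma phi_ideal c : contractive_on (ideal c) phi /\ order_zero_on (ideal c) phi.
Proof.
have oz c' x y : cmul x y = 0 -> cmul (piece_map c' x) (piece_map c' y) = 0.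
  exact: (Smap_order_zero cov vH2 hK2 nu12 (@cont_mu2 c') (@mu2K c') (@mu2_disj c')).
case: c; split=> [m mI|x y xI yI _ _ xy].
- by rewrite !nrmE lecR /phi (piece0 _ mI)// add0r; exact: turned_le.
- rewrite /phi (piece0 _ xI)// (piece0 _ yI)// !add0r -!cmulA [cmul turn _]cmulA turn_unitary.2 mul1O.
  by rewrite [cmul (piece_map true x) _]cmulA oz// cmul0l cmul0r.
- by rewrite !nrmE lecR /phi (piece0 (c' := true) _ mI)// cmul0l cmul0r addr0; exact: piece_le.
- by rewrite /phi (piece0 (c' := true) _ xI)// (piece0 (c' := true) _ yI)// !cmul0l !cmul0r !addr0 oz.
Qed.

Lemma bool_sum c (x : bool -> F) : (forall c, ideal c (x c)) -> forall p q,
  x c p q = if colour p == c then (x false + x true) p q else 0.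
Proof.
move=> xI p q; have [pc|pc] := eqVneq (colour p) c; last exact: xI.
rewrite /=; case: c pc => pc; first by rewrite (xI false) ?add0r// pc.
by rewrite (xI true) ?addr0// pc.
Qed.

Definition index_colour (i : 'I_2) : bool := val i == 1%N.

Lemma ideal_sum : direct_sum_of (fun i => ideal (index_colour i)).
Proof.
move=> x.
have cut_block c (p q : vpos Q len2) : ~~ seg_block Q len2 p q -> (if colour p == c then x p q else 0) = 0.
  by move=> npq; rewrite bentP// if_same.
pose cut c : F := BMx (cut_block c).
have cutI c : ideal c (cut c) by move=> p q /= /negbTE ->.
have sum2 (y : 'I_2 -> F) : \sum_i y i = y ord0 + y (lift ord0 ord0) by rewrite big_ord_recl big_ord1.
exists [ffun i => cut (index_colour i)]; split.
  split=> [i|]; first by rewrite ffunE; exact: cutI.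
  rewrite sum2 !ffunE; apply: bmxP => p q /=.
  by rewrite /index_colour /=; case: (colour p); rewrite ?add0r ?addr0.
move=> y [yI xE]; apply/ffunP => i; rewrite ffunE; apply: bmxP => p q.
pose z (c : bool) := y (if c then lift ord0 ord0 else ord0).
have zI c : ideal c (z c).
  by have := yI (if c then lift ord0 ord0 else ord0); rewrite /z; case: c.
have -> : y i = z (index_colour i).
  rewrite /z /index_colour; congr (y _); apply: val_inj; case: i => -[|[|//]] /= ?; by [].
rewrite (bool_sum _ zI) /z /= {1}xE sum2; by [].
Qed.

Lemma decomposition_ex (ps : forall m q (Z : 'I_m -> 'I_q -> O), positive_mx (fun i j => \sum_l cmul (cstar (Z l i)) (Z l j))) :
  exists (f : F -> O) (I : 'I_2 -> set F),
  [/\ completely_positive f, forall i, two_sided_ideal (I i), direct_sum_of I,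
      forall i, contractive_on (I i) f /\ order_zero_on (I i) f &
      (forall m, nrm (f m) <= 2 * nrm m) /\
      forall g, nrm (f (comp alpha Q pt2 len2 (fun l x => if l == n g then s g x else 0)) - a g) <=
        2 * eta + (k.+1 * k.+1)%:R * (8 * eta) + 3 / k%:R * nrm (a g)].
Proof.
exists phi, (fun i => ideal (index_colour i)); split.
- exact: phi_cp.
- by move=> i; exact: ideal_two_sided.
- exact: ideal_sum.
- by move=> i; exact: phi_ideal.
- by split; [exact: phi_le|exact: phi_estimate].
Qed.

End Approximation.

(** * The system of approximations *)

Section System.
Variables (R : realType) (X : topologicalType) (cX : compact [set: X]).
Hypothesis hX : hausdorff_space X.
Variables (V : line_bundle R X) (alpha : homeo X) (Y : set X).
Local Notation A := (CX R cX).
Local Notation EV := (EY cX V alpha Y).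
Variables (O : cstarAlgType R) (pi : A -> O) (tau : EV -> O).
Hypothesis cov : covariant_rep pi tau.
Hypothesis gen : cstar_generates (range pi `|` range tau).
Local Notation "x '^^' n" := (homeo_pow alpha n x) (at level 30, format "x ^^ n").
Local Notation Hom := (Hom pi tau).
Local Notation nocross := (nocross alpha).
Hypotheses (minX : minimal alpha) (infX : infinite_set [set: X]).
Variable d : nat.
Hypothesis dimX : covering_dim_le X d.
Hypotheses (clY : closed Y) (Y0 : Y !=set0) (orbY : meets_orbits_at_most_once alpha Y).

Definition one_decomposable (F : cstarAlgType R) (psi : O -> F) (phi : F -> O) (I : 'I_2 -> set F) :=
  [/\ finite_dimensional F, completely_positive psi, completely_positive phi, contractive_on setT psi &
    [/\ forall i, two_sided_ideal (I i), direct_sum_of I &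
      forall i, contractive_on (I i) phi /\ order_zero_on (I i) phi]].

Section Nonzero.
Hypothesis piI : forall f x, nrm (cev f x) <= nrm (pi f).

Lemma homogeneous_approximation (G : finType) (n : G -> int) (s : G -> X -> R[i]) (a : G -> O) (B : set X) (ep : R) :
  (forall g, Hom (n g) (s g) (a g)) -> (forall g x, s g x != 0 -> nocross B (n g) x) ->
  (forall g, exists g', a g' = cstar (a g)) -> open B -> Y `<=` B -> 0 < ep ->
  exists (F : cstarAlgType R) (psi : O -> F) (phi : F -> O) (I : 'I_2 -> set F),
    [/\ one_decomposable psi phi I, forall m, nrm (phi m) <= 2 * nrm m &
        forall g, nrm (phi (psi (a g)) - a g) <= ep].
Proof.
move=> aH snc sc oB YB ep0.
pose M := \sum_g nrm (a g).
have aM g : nrm (a g) <= M.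
  by rewrite /M (bigD1 g)//= lerDl; apply: sumr_ge0 => g' _; exact: nrm_ge0.
pose k := (Num.trunc (6 * M / ep)).+1.
have kM : 6 * M / ep <= k%:R by apply: ltW; exact: Num.Theory.truncnS_gt.
have k0 : (0 < k)%N by [].
have kp : 0 < k%:R :> R by rewrite ltr0n.
pose c : R := 2 + (k.+1 * k.+1)%:R * 8.
have c0 : 0 < c by rewrite /c ltr_wpDr// mulr_ge0.
pose eta := ep / 2 / c; have eta0 : 0 < eta by rewrite !divr_gt0.
have [C] := @castle_ex R X cX hX alpha B Y k (good_base pi tau n s eta) (good_shift pi tau) minX infX d dimX
  clY Y0 orbY oB YB k0 (@good_base_sub _ _ _ _ _ _ _ pi tau _ n s eta)
  (@good_base_ex _ _ _ hX _ _ _ clY _ pi tau cov _ n s a eta aH eta0)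
  (@good_shift_sub _ _ _ _ _ _ _ pi tau) (@good_shift_ex _ _ _ hX _ _ _ clY _ pi tau cov).
have [h [nu [v [vH hK nu1 close]]]] := castle_towers hX C.
have [th [b [bH th1]]] := castle_shifts C.
have zY (t : tower2 C) (j : 'I_(cQ C)) : (j < len2 t)%N -> nocross Y j (pt2 t) by exact: cz_clear.
have [psi [psi_cp psi_c psiE]] := compression_ex hX clY cov gen minX infX Y0 piI zY.
have [f [I [f_cp I2 Isum fI [f2 fE]]]] := decomposition_ex cov gen aH eta0 k0 snc sc vH hK nu1 close bH th1
  (positive_sums hX clY cov gen minX infX Y0 piI).
have [C' [clC' YC' Cg]] := goodB_ex hX zY.
pose B' := B `&` ~` C'.
have oB' : open B' by apply: openI => //; exact: closed_openC.
have gB : goodB alpha Y (cQ C) (pt2 (C := C)) (len2 (C := C)) B'.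
  by apply: Cg => // [y Yy|x []//]; split; [exact: YB|exact: YC'].
exists (bmx R (seg_block (cQ C) (len2 (C := C)))), psi, f, I; split => //.
  by split => //; exact: bmx_finite_dimensional.
move=> g; have nc x : s g x != 0 -> nocross B' (n g) x.
  by move=> /snc h' l hl [Bl _]; exact: (h' l hl).
rewrite (psiE _ _ _ gB (Kel1 (aH g) nc)); apply: le_trans (fE g) _.
have e1 : 2 * eta + (k.+1 * k.+1)%:R * (8 * eta) = ep / 2.
  by rewrite -[RHS](@divfK _ c) ?gt_eqF// -/eta /c; ring.
rewrite e1 [leRHS]splitr lerD2l mulrAC ler_pdivrMr//.
have := aM g; rewrite ler_pdivrMr// in kM; lra.
Qed.

Lemma approximation (S : seq O) (ep : R) : 0 < ep ->
  exists (F : cstarAlgType R) (psi : O -> F) (phi : F -> O) (I : 'I_2 -> set F),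
    one_decomposable psi phi I /\ forall x, x \in S -> nrm (phi (psi x) - x) < ep.
Proof.
move=> ep0; have dl0 : 0 < ep / 8 by rewrite divr_gt0.
have [B [sg [b [oB YB _ kb db]]]] := Kel_dense_fin hX clY cov gen (fun j : 'I_(size S) => S`_j) closed0
  (fun y _ => id) dl0.
have [D DP] : {D : 'I_(size S) -> {G : finType & ((G -> int) * (G -> X -> R[i]) * (G -> O))%type} & forall j,
    [/\ forall g, Hom ((projT2 (D j)).1.1 g) ((projT2 (D j)).1.2 g) ((projT2 (D j)).2 g),
        forall g x, (projT2 (D j)).1.2 g x != 0 -> nocross B ((projT2 (D j)).1.1 g) x &
        b j = \sum_g (projT2 (D j)).2 g]}.
  apply: (@choice _ _ (fun (j : 'I_(size S)) (D : {G : finType & ((G -> int) * (G -> X -> R[i]) * (G -> O))%type}) =>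
    [/\ forall g, Hom ((projT2 D).1.1 g) ((projT2 D).1.2 g) ((projT2 D).2 g),
        forall g x, (projT2 D).1.2 g x != 0 -> nocross B ((projT2 D).1.1 g) x &
        b j = \sum_g (projT2 D).2 g])) => j.
  have [G [n [s [c [h1 h2 h3]]]]] := Kel_terms (kb j).
  by exists (existT (fun G : finType => ((G -> int) * (G -> X -> R[i]) * (G -> O))%type) G (n, s, c)).
pose G0 : finType := {j : 'I_(size S) & projT1 (D j)}.
pose n0 (g : G0) := (projT2 (D (tag g))).1.1 (tagged g).
pose s0 (g : G0) := (projT2 (D (tag g))).1.2 (tagged g).
pose a0 (g : G0) := (projT2 (D (tag g))).2 (tagged g).
have H0 g : Hom (n0 g) (s0 g) (a0 g) by have [h _ _] := DP (tag g); exact: h.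
have N0 g x : s0 g x != 0 -> nocross B (n0 g) x by have [_ h _] := DP (tag g); exact: h.
pose G : finType := (G0 * bool)%type.
pose n (g : G) := if g.2 then - n0 g.1 else n0 g.1.
pose s (g : G) := if g.2 then (fun x => conjc (s0 g.1 (x^^(- n0 g.1)))) else s0 g.1.
pose a (g : G) := if g.2 then cstar (a0 g.1) else a0 g.1.
have aH g : Hom (n g) (s g) (a g).
  by rewrite /n /s /a; case: (g.2) => //; exact: (Hom_star cov (H0 g.1)).
have snc g x : s g x != 0 -> nocross B (n g) x.
  rewrite /n /s; case: (g.2); last exact: N0.
  have [->|h] := eqVneq (s0 g.1 (x^^(- n0 g.1))) 0; first by rewrite cj0 eqxx.
  by move=> _; have := nocrossN (N0 _ _ h); rewrite apowNK.
have sc g : exists g', a g' = cstar (a g).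
  by exists (g.1, ~~ g.2); rewrite /a /=; case: (g.2); rewrite ?cstarK.
pose N : R := #|G0|%:R + 1.
have N00 : 0 < N by rewrite /N ltr_wpDl.
have dN : 0 < ep / 8 / N by rewrite divr_gt0.
have [F [psi [phi [I [od phi2 est]]]]] := homogeneous_approximation aH snc sc oB YB dN.
exists F, psi, phi, I; split => // x xS.
have [_ [psi_lin _] [phi_lin _] psi_c _] := od.
have [j xj] : exists j : 'I_(size S), x = S`_j.
  have jS : (index x S < size S)%N by rewrite index_mem.
  by exists (Ordinal jS); rewrite /= nth_index.
pose T y := phi (psi y) - y.
have TD y z : T (y + z) = T y + T z.
  by rewrite /T (is_linearD _ _ psi_lin) (is_linearD _ _ phi_lin) opprD addrACA.
have T0 : T 0 = 0 by rewrite /T (is_linear0 psi_lin) (is_linear0 phi_lin) subr0.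
have Tsum (J : finType) (f : J -> O) : T (\sum_i f i) = \sum_i T (f i) by exact: (big_morph T TD T0).
have Tle y : nrm (T y) <= 3 * nrm y.
  apply: le_trans (nrmB _ _) _; have h1 := phi2 (psi y).
  have : nrm (psi y) <= nrm y by have := psi_c y Logic.I; rewrite !nrmE lecR.
  by lra.
have Tb : nrm (T (b j)) <= ep / 8.
  have [_ _ ->] := DP j; rewrite Tsum; apply: le_trans (nrm_sum _ _ _) _.
  apply: le_trans (_ : \sum_(g : projT1 (D j)) ep / 8 / N <= _).
    by apply: ler_sum => g _; exact: (est (Tagged (fun j => projT1 (D j)) g : G0, false)).
  rewrite sumr_const (_ : _ *+ _ = ep / 8 * (#|projT1 (D j)|%:R / N)); last first.
    by rewrite -[LHS]mulr_natr -mulrA [N^-1 * _]mulrC.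
  rewrite ler_piMr ?(ltW dl0)// ler_pdivrMr// mul1r /N; apply: le_trans (_ : #|G0|%:R <= _); last by rewrite lerDl.
  rewrite ler_nat -(card_codom (f := fun g : projT1 (D j) => Tagged (fun j => projT1 (D j)) g : G0)).
    exact: max_card.
  by move=> g g' /eqP; rewrite eq_Tagged /= => /eqP.
have := db j; rewrite -xj => dx.
have -> : phi (psi x) - x = T (x - b j) + T (b j) by rewrite -TD subrK.
apply: le_lt_trans (nrmD _ _) _; have := Tle (x - b j); by lra.
Qed.

End Nonzero.

Lemma zero_approximation : (forall a : O, a = 0) ->
  one_decomposable (F := O) id id (fun=> setT).
Proof.
move=> O0; have cp : completely_positive (@id O) by split.
split => //; first by exists 0%N, (fun=> 0) => x; exists (fun=> 0); rewrite big_ord0.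
split.
- by move=> i; split.
- move=> x; exists [ffun => 0]; split; first by split => //; rewrite [LHS]O0 [RHS]O0.
  by move=> y _; apply/ffunP => i; rewrite [LHS]O0 [RHS]O0.
- by move=> i; split => // x y _ _ _ _ _; exact: O0.
Qed.

Lemma approximation_all (S : seq O) (ep : R) : 0 < ep ->
  exists (F : cstarAlgType R) (psi : O -> F) (phi : F -> O) (I : 'I_2 -> set F),
    one_decomposable psi phi I /\ forall x, x \in S -> nrm (phi (psi x) - x) < ep.
Proof.
move=> ep0; have [O0|nO] := pselect (forall a : O, a = 0).
  exists O, id, id, (fun=> setT); split; first exact: zero_approximation.
  by move=> x _; rewrite subrr nrm0.
have Oa : exists a : O, a != 0.
  by apply: contrapT => no; apply: nO => a; apply: contrapT => /eqP a0; apply: no; exists a.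
exact: (approximation (pi_isometric hX clY cov gen minX orbY Oa) S ep0).
Qed.

Theorem nuclear_dim_le1 : nuclear_dim_le O 1.
Proof.
pose AP := {F : cstarAlgType R & ((O -> F) * (F -> O) * ('I_2 -> set F))%type}.
have [D DP] : {D : seq O * nat -> AP & forall l,
    one_decomposable (projT2 (D l)).1.1 (projT2 (D l)).1.2 (projT2 (D l)).2 /\
    forall x, x \in l.1 -> nrm ((projT2 (D l)).1.2 ((projT2 (D l)).1.1 x) - x) < l.2.+1%:R^-1}.
  apply: (@choice _ _ (fun (l : seq O * nat) (D : AP) =>
    one_decomposable (projT2 D).1.1 (projT2 D).1.2 (projT2 D).2 /\
    forall x, x \in l.1 -> nrm ((projT2 D).1.2 ((projT2 D).1.1 x) - x) < l.2.+1%:R^-1)) => -[S N].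
  have N0 : 0 < N.+1%:R^-1 :> R by rewrite invr_gt0.
  have [F [psi [phi [I h]]]] := approximation_all S N0.
  by exists (existT (fun F : cstarAlgType R => ((O -> F) * (F -> O) * ('I_2 -> set F))%type) F (psi, phi, I)).
exists (seq O * nat)%type, (fun l l' => {subset l.1 <= l'.1} /\ (l.2 <= l'.2)%N), (fun l => projT1 (D l)),
  (fun l => (projT2 (D l)).1.1), (fun l => (projT2 (D l)).1.2), (fun l => (projT2 (D l)).2).
split; [split|split].
- by constructor; exact: ([::], 0%N).
- by move=> l; split.
- by move=> l1 l2 l3 [h1 h2] [h3 h4]; split => [x /h1/h3//|]; exact: leq_trans h4.
- move=> [S1 N1] [S2 N2]; exists (S1 ++ S2, maxn N1 N2); split; split => [x xS|] /=.
  + by rewrite mem_cat xS.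
  + exact: leq_maxl.
  + by rewrite mem_cat xS orbT.
  + exact: leq_maxr.
- by move=> l; have [[h1 h2 h3 h4 h5] _] := DP l.
move=> S eps eps0; exists (S, Num.trunc eps^-1) => l [Sl Nl] x /Sl xl.
have [_ h] := DP l; rewrite nrmE ltcR; apply: lt_le_trans (h x xl) _.
rewrite -[leRHS]invrK lef_pV2 ?posrE ?invr_gt0 ?ltr0n//.
apply: le_trans (ltW (Num.Theory.truncnS_gt _)) _; rewrite ler_nat ltnS; exact: Nl.
Qed.

End System.

Theorem theorem6p17 (R : realType) (X : metricType R)
  (cX : compact [set: X]) (infX : infinite_set [set: X])
  (dimX : exists d : nat, covering_dim_le X d)
  (alpha : homeo X) (alpha_minimal : minimal alpha)
  (V : line_bundle R X)
  (Y : set X) (Y_nonempty : Y !=set0) (Y_closed : closed Y)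
  (Y_orbits : meets_orbits_at_most_once alpha Y)
  (Y_trivial : forall N : nat, exists W : set X,
     [/\ open W, Y `<=` W &
         forall n : int, - (N%:Z) <= n <= N%:Z ->
           trivial_over V (homeo_pow alpha n @` W)])
  (O : cstarAlgType R) (pi : CX R cX -> O) (tau : EY cX V alpha Y -> O)
  (O_EY : is_cuntz_pimsner pi tau) :
  nuclear_dim_le O 1.
Proof.
have [d dimd] := dimX.
exact: (nuclear_dim_le1 (@metric_hausdorff R X) (cp_rep O_EY) (cp_generated O_EY) alpha_minimal infX dimd
  Y_closed Y_nonempty Y_orbits).
Qed.
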